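(* Let $(M,\Delta_M)$ be a compact Woronowicz algebra, $(N,\Delta_N)$ a right Galois co-object for $(M,\Delta_M)$, and $(P,\Delta_P)$ the reflected von Neumann bialgebra: $P\subseteq B(L^2(N))$ is the von Neumann algebra generated by $\{xy^*\mid x,y\in N\}$, with $\Delta_P(xy^* )=\Delta_N(x)\Delta_N(y)^*$ for $x,y\in N$. Let $\varphi_P,\psi_P$ be its left and right invariant nsf weights. Then: 1. If $(P,\Delta_P)$ is a compact Woronowicz algebra (that is, if $\varphi_P$ and $\psi_P$ are finite), then $n_r=\dim\mathcal H_r<\infty$ for all $r\in I_N$, i.e. all irreducible $(N,\Delta_N)$-corepresentations of $(M,\Delta_M)$ are finite-dimensional. 2. Conversely, if one of the irreducible $(N,\Delta_N)$-corepresentations of $(M,\Delta_M)$ is finite-dimensional, then they all are, and then $(P,\Delta_P)$ is a compact Woronowicz algebra. 3. If $(P,\Delta_P)$ is unimodular (that is, if $\varphi_P$ is a multiple of $\psi_P$), then there exist positive numbers $d_r$ $(r\in I_N)$ such that $A_r=d_r^2T_r^2$.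
   Context: Conventions: Hilbert spaces are separable, inner products are linear in the first variable, von Neumann algebras have separable predual; $\bar\otimes$ is the $\sigma$-weakly closed spatial tensor product; $\Sigma$ is the flip; leg numbering notation is used; nsf means normal semi-finite faithful. A von Neumann bialgebra $(M,\Delta_M)$ is a von Neumann algebra with a faithful normal unital coassociative $^*$-homomorphism $\Delta_M:M\to M\bar\otimes M$. It is a compact Woronowicz algebra if there is a normal state $\varphi_M$ with $(\varphi_M\otimes\iota)\Delta_M(x)=(\iota\otimes\varphi_M)\Delta_M(x)=\varphi_M(x)1$ for all $x\in M$ (then unique and faithful). $M$ acts on the GNS space $L^2(M)$ of $\varphi_M$ with cyclic separating vector $\xi_M$. A right Galois co-object for $(M,\Delta_M)$ consists of a Hilbert space $L^2(N)$, a $\sigma$-weakly closed linear space $N\subseteq B(L^2(M),L^2(N))$ and a normal linear map $\Delta_N:N\to N\bar\otimes N$ such that, with $N^{\mathrm{op}}=\{x^*\mid x\in N\}$: (1) $N\cdot L^2(M)$ is norm-dense in $L^2(N)$ and $N^{\mathrm{op}}\cdot L^2(N)$ is norm-dense in $L^2(M)$; (2) $NM\subseteq N$; (3) $x^*y\in M$ for $x,y\in N$; (4) $\Delta_N(xy)=\Delta_N(x)\Delta_M(y)$ for $x\in N,y\in M$; (5) $\Delta_N(x)^*\Delta_N(y)=\Delta_M(x^*y)$ for $x,y\in N$; (6) $(\Delta_N\otimes\iota)\Delta_N=(\iota\otimes\Delta_N)\Delta_N$; (7) the linear span of $\{\Delta_N(x)(y\otimes z)\mid x\in N,\ y,z\in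 M\}$ is $\sigma$-weakly dense in $N\bar\otimes N$. $(M,\Delta_M)$ is itself a right Galois co-object for $(M,\Delta_M)$. There are unitaries $\widetilde V:L^2(N)\otimes L^2(M)\to L^2(N)\otimes L^2(N)$ and $\widetilde W:L^2(N)\otimes L^2(N)\to L^2(M)\otimes L^2(N)$ determined by $\widetilde V(x\xi_M\otimes\eta)=\Delta_N(x)(\xi_M\otimes\eta)$ and $\widetilde W^*(\eta\otimes x\xi_M)=\Delta_N(x)(\eta\otimes\xi_M)$ for $x\in N,\eta\in L^2(M)$; for $N=M$ write $V,W$. $\widehat N=\{x\in B(L^2(N))\mid\widetilde V^*(x\otimes1)\widetilde V=x\otimes1\}$ is an $\ell^\infty$-direct sum $\bigoplus_{r\in I_N}B(\mathcal H_r)$ with minimal central projections $p_r$, $n_r=\dim\mathcal H_r$. For each $r$ there is a state $\phi_{N,r}=\mathrm{Tr}(T_r\,\cdot\,)$ on $B(\mathcal H_r)$, $T_r$ positive trace class and injective, with $\phi_{N,r}(x)1=(\iota\otimes\varphi_M)(\Sigma\widetilde W(1\otimes x)\widetilde W^*\Sigma)$. Let $\varphi_{\widehat N}$ be the nsf weight on $\widehat N$ given on $B(\mathcal H_r)$ by $\mathrm{Tr}(T_r^{-1}\,\cdot\,)$. For $N=M$ one obtains $\widehat M$, with comultiplication determined by $(\iota\otimes\Delta_{\widehat M})(W)=W_{13}W_{12}$. The formula $\alpha_{\widehat N}(x)=\Sigma\widetilde W(x\otimes1)\widetilde W^*\Sigma$ defines an ergodic right coaction $\widehat N\to\widehat N\bar\otimes\widehat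 M$, and there is an nsf weight $\psi_{\widehat N}$ on $\widehat N$, unique up to a positive scalar, with $\psi_{\widehat N}((\iota\otimes\omega)\alpha_{\widehat N}(x))=\psi_{\widehat N}(x)$ for all normal states $\omega$ on $\widehat M$ and $x\in\widehat N^+$. Let $\delta_{\widehat N}$ be the positive non-singular (possibly unbounded) Radon-Nikodym derivative, $\psi_{\widehat N}=\varphi_{\widehat N}(\delta_{\widehat N}^{1/2}\,\cdot\,\delta_{\widehat N}^{1/2})$, and $A_r=p_r\delta_{\widehat N}$, a positive non-singular operator on $\mathcal H_r$. A (left) $(N,\Delta_N)$-corepresentation on $\mathcal H$ is a unitary $\mathcal G\in N\bar\otimes B(\mathcal H)$ with $(\Delta_N\otimes\iota)\mathcal G=\mathcal G_{13}\mathcal G_{23}$; it is irreducible if $\mathcal H\neq0$ and the only Hilbert subspaces $\mathcal K\subseteq\mathcal H$ such that $\mathcal G$ restricts to a unitary in $N\bar\otimes B(\mathcal K)$ are $0$ and $\mathcal H$. Up to unitary equivalence the irreducible ones are indexed by $r\in I_N$, the one with index $r$ acting on the conjugate Hilbert space $\overline{\mathcal H_r}$ of dimension $n_r$. $(P,\Delta_P)$ is a von Neumann bialgebra admitting left and right invariant nsf weights, unique up to positive scalars: $\varphi_P((\omega\otimes\iota)\Delta_P(x))=\varphi_P(x)$ and $\psi_P((\iota\otimes\omega)\Delta_P(x))=\psi_P(x)$ for normal states $\omega$ on $P$ and positive $x$ integrable for $\varphi_P$, resp. $\psi_P$. *)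

(* Defs.v *)
From HB Require Import structures.
From mathcomp Require Import all_boot all_order all_algebra.
From mathcomp Require Import complex.
From mathcomp Require Import boolp classical_sets functions cardinality reals ereal.
From mathcomp Require Import topology normedtype sequences esum.

Set Implicit Arguments.
Unset Strict Implicit.
Unset Printing Implicit Defensive.

Import Order.TTheory GRing.Theory Num.Theory.
Import numFieldNormedType.Exports.

Local Open Scope classical_set_scope.
Local Open Scope ring_scope.
Local Open Scope complex_scope.

(* The topology of a [numClosedFieldType] is found on [Cx R] but not on the raw
   type [R[i]]. *)
Definition Cx (R : realType) : numClosedFieldType := R[i].

Definition cplx (R : realType) (x : R) : Cx R := x%:C.

Definition span (K : nzRingType) (V : lmodType K) (S : set V) : set V :=
  [set x | exists n (c : 'I_n -> K) (v : 'I_n -> V),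
     (forall i, S (v i)) /\ x = \sum_i c i *: v i].

(* Separable complex Hilbert spaces; [{dot _ for conjC}] is linear in the first
   variable. *)
Record hilbert (R : realType) := Hilbert {
  hsort :> completeNormedModType (Cx R);
  hdot : {dot hsort for (@Num.conj (Cx R))};
  hdot_norm : forall x, hdot x x = `|x| ^+ 2;
  hseparable : exists2 A : set hsort, countable A & dense A }.

Notation "''[' x , y ]" := (hdot _ x y) : ring_scope.

(* The Hilbert space tensor product of [H] and [K], which these conditions
   determine up to a unique unitary compatible with the elementary tensors. *)
Record htensor (R : realType) (H K : hilbert R) := HTensor {
  tspace :> hilbert R;
  tpure : {bilinear H -> K -> tspace};
  tpure_dot : forall x x' y y',
    '[tpure x y, tpure x' y'] = '[x, x'] * '[y, y'];
  tpure_total : dense (span [set z | exists x y, z = tpure x y]) }.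

(* A choice of a tensor product for every pair of Hilbert spaces. *)
Class tensor_model (R : realType) := htens (H K : hilbert R) : htensor H K.

Notation "H ⊗ K" := (htens H K) (at level 40, left associativity) : type_scope.
Notation "x ⊗v y" := (tpure (htens _ _) x y)
  (at level 40, left associativity) : ring_scope.

Definition finite_dim (R : realType) (H : hilbert R) : Prop :=
  exists n (v : 'I_n -> H), span (range v) = setT.

Section Operators.
Context {R : realType}.
Implicit Types H K L : hilbert R.

Definition bounded_op H K : set (H -> K) :=
  [set f | linear f /\ exists c : Cx R, forall x, `|f x| <= c * `|x|].

(* Operators given by a defining property are selected with [xget]; the property
   has a unique solution on the operators for which it is meant. *)
Definition adj H K (f : H -> K) : K -> H :=
  xget (fun=> 0) [set g | bounded_op g /\ forall x y, '[f x, y] = '[x, g y]].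

Definition unitary_op H K (u : H -> K) : Prop :=
  [/\ bounded_op u, adj u \o u = idfun & u \o adj u = idfun].

Definition isometry_op H K (u : H -> K) : Prop :=
  bounded_op u /\ forall x y, '[u x, u y] = '[x, y].

Definition positive_op H : set (H -> H) :=
  [set x | bounded_op x /\ forall v, 0 <= '[x v, v]].

Definition op_le H (x y : H -> H) : Prop := forall v, '[x v, v] <= '[y v, v].

Definition sqrt_op H (x : H -> H) : H -> H :=
  xget (fun=> 0) [set y | positive_op y /\ y \o y = x].

Definition square_summable H (v : nat -> H) : Prop :=
  cvg (series (fun n => `|v n| ^+ 2) @ \oo).

(* The predual of B(H, K), i.e. the sigma-weakly continuous functionals. The
   values outside [bounded_op] are irrelevant. *)
Definition predual H K : set ((H -> K) -> Cx R) :=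
  [set w | exists (v : nat -> H) (u : nat -> K),
     [/\ square_summable v, square_summable u &
       forall x, bounded_op x ->
         series (fun n => '[x (v n), u n]) @ \oo --> w x]].

Definition vector_functional H (v : H) (x : H -> H) : Cx R := '[x v, v].

Definition sw_closure H K (S : set (H -> K)) : set (H -> K) :=
  [set x | bounded_op x /\
     forall n (w : 'I_n -> (H -> K) -> Cx R) (e : Cx R),
       (forall i, predual (w i)) -> 0 < e ->
       exists2 y, S y & forall i, `|w i y - w i x| < e].

(* [S] is meant to be a sigma-weakly closed subspace, with the relative
   sigma-weak topology. *)
Definition normal_map H K H' K' (S : set (H -> K))
    (f : (H -> K) -> (H' -> K')) : Prop :=
  forall (w : (H' -> K') -> Cx R) (x : H -> K) (e : Cx R),
    predual w -> S x -> 0 < e ->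
    exists n (v : 'I_n -> (H -> K) -> Cx R) (d : Cx R),
      [/\ forall i, predual (v i), 0 < d &
        forall y, S y -> (forall i, `|v i y - v i x| < d) ->
          `|w (f y) - w (f x)| < e].

Definition subspace H K (S : set (H -> K)) : Prop :=
  S 0 /\ forall (c : Cx R) x y, S x -> S y -> S (c *: x + y).

Definition linear_on H K H' K' (S : set (H -> K))
    (f : (H -> K) -> (H' -> K')) : Prop :=
  forall (c : Cx R) x y, S x -> S y -> f (c *: x + y) = c *: f x + f y.

Definition is_vna H (Q : set (H -> H)) : Prop :=
  [/\ Q `<=` @bounded_op H H /\ Q idfun,
      subspace Q,
      forall x y, Q x -> Q y -> Q (x \o y),
      forall x, Q x -> Q (adj x) &
      sw_closure Q `<=` Q].

Definition vna_generated H (S : set (H -> H)) : set (H -> H) :=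
  [set x | forall Q, is_vna Q -> S `<=` Q -> Q x].

Definition normal_state H (Q : set (H -> H)) (w : (H -> H) -> Cx R) : Prop :=
  [/\ predual w, forall x, Q x -> positive_op x -> 0 <= w x & w idfun = 1].

(* Some orthonormal basis, padded with zero vectors in finite dimension; the
   traces below do not depend on it. *)
Definition onb H : nat -> H :=
  xget (fun=> 0) [set e : nat -> H |
    [/\ forall i j, i != j -> '[e i, e j] = 0,
        forall i, '[e i, e i] = 0 \/ '[e i, e i] = 1 &
        dense (span (range e))]].

Definition trace H (a : H -> H) : Cx R :=
  lim (series (fun n => '[a (onb H n), onb H n]) @ \oo).

Definition trace_pos H (a : H -> H) : \bar R :=
  (\sum_(0 <= n <oo) (complex.Re '[a (onb H n), onb H n])%:E)%E.

(* Partially defined operators: [uact] is only meaningful on [udom]. *)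
Record uop H := UOp { udom : set H; uact : H -> H }.

Definition positive_selfadjoint H (A : uop H) : Prop :=
  [/\ udom A 0 /\ (forall (c : Cx R) x y,
        udom A x -> udom A y -> udom A (c *: x + y)),
      forall (c : Cx R) x y, udom A x -> udom A y ->
        uact A (c *: x + y) = c *: uact A x + uact A y,
      dense (udom A),
      forall x, udom A x -> 0 <= '[uact A x, x] &
      forall y z, (forall x, udom A x -> '[uact A x, y] = '[x, z]) <->
                  (udom A y /\ uact A y = z)].

Definition nonsingular H (A : uop H) : Prop :=
  forall x, udom A x -> uact A x = 0 -> x = 0.

(* (1 + e A)^-1 and A (1 + e A)^-1, both everywhere defined and bounded when A
   is positive self-adjoint and 0 < e *)
Definition shift_inv H (A : uop H) (e : R) (y : H) : H :=
  xget 0 [set x | udom A x /\ x + cplx e *: uact A x = y].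

Definition bounded_part H (A : uop H) (e : R) : H -> H :=
  uact A \o shift_inv A e.

Definition uop_inv H (T : H -> H) : uop H :=
  {| udom := range T; uact := fun y => xget 0 [set x | T x = y] |}.

Definition affiliated H (Q : set (H -> H)) (A : uop H) : Prop :=
  forall u : H -> H, unitary_op u -> (forall x, Q x -> u \o x = x \o u) ->
    forall v, udom A v -> udom A (u v) /\ uact A (u v) = u (uact A v).

(* A weight on [Q] is only meaningful on the positive cone of [Q]. *)
Definition nsf_weight H (Q : set (H -> H)) (f : (H -> H) -> \bar R) : Prop :=
  let Qpos := Q `&` @positive_op H in
  [/\ [/\ forall x, Qpos x -> (0 <= f x)%E,
          forall x y, Qpos x -> Qpos y -> f (x + y) = (f x + f y)%E &
          forall (c : R) x, 0 <= c -> Qpos x ->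
            f (cplx c *: x) = (c%:E * f x)%E],
      (* normality, with increasing nets written as upward directed sets *)
      forall (D : set (H -> H)) (s : H -> H),
        D !=set0 -> D `<=` Qpos -> Qpos s ->
        (forall x y, D x -> D y -> exists2 z, D z & op_le x z /\ op_le y z) ->
        (forall x, D x -> op_le x s) ->
        (forall t, Qpos t -> (forall x, D x -> op_le x t) -> op_le s t) ->
        f s = ereal_sup (f @` D),
      Q `<=` sw_closure (span [set x | Qpos x /\ (f x < +oo)%E]) &
      forall x, Qpos x -> f x = 0%E -> x = 0].

Definition finite_weight H (Q : set (H -> H)) (f : (H -> H) -> \bar R) : Prop :=
  forall x, Q x -> positive_op x -> (f x < +oo)%E.

(* The Pedersen-Takesaki weight f(A^{1/2} . A^{1/2}) for a weight [f] and a
   positive self-adjoint [A] affiliated with the centralizer of [f]: the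
   (increasing) limit, as e tends to 0, of the weights
   f(A_e^{1/2} . A_e^{1/2}) with A_e = A (1 + e A)^-1. *)
Definition derived_weight H (f : (H -> H) -> \bar R) (A : uop H) (x : H -> H) :
    \bar R :=
  ereal_sup [set f (sqrt_op (bounded_part A e) \o x \o
                    sqrt_op (bounded_part A e)) | e in [set e : R | 0 < e]].

End Operators.

Section Legs.
Context {R : realType} {tens : tensor_model R}.
Implicit Types H K L : hilbert R.

Definition tensor_op H K H' K' (x : H -> K) (y : H' -> K') : H ⊗ H' -> K ⊗ K' :=
  xget (fun=> 0) [set z : H ⊗ H' -> K ⊗ K' | bounded_op z /\
    forall v w, z (v ⊗v w) = x v ⊗v y w].

Definition flip H K : H ⊗ K -> K ⊗ H :=
  xget (fun=> 0) [set z : H ⊗ K -> K ⊗ H | bounded_op z /\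
    forall v w, z (v ⊗v w) = w ⊗v v].

Definition assoc H K L : (H ⊗ K) ⊗ L -> H ⊗ (K ⊗ L) :=
  xget (fun=> 0) [set z : (H ⊗ K) ⊗ L -> H ⊗ (K ⊗ L) | bounded_op z /\
    forall u v w, z ((u ⊗v v) ⊗v w) = u ⊗v (v ⊗v w)].

Definition vn_tensor H K H' K' (S : set (H -> K)) (S' : set (H' -> K')) :
    set (H ⊗ H' -> K ⊗ K') :=
  sw_closure (span [set z | exists x y, [/\ S x, S' y & z = tensor_op x y]]).

(* (ι ⊗ ω_{v,w})(X) and (ω_{v,w} ⊗ ι)(X), where ω_{v,w}(x) = <x v, w> *)
Definition vslice2 H K H' K' (X : H ⊗ H' -> K ⊗ K') (v : H') (w : K') : H -> K :=
  adj (fun k : K => k ⊗v w : K ⊗ K') \o X \o (fun h : H => h ⊗v v : H ⊗ H').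

Definition vslice1 H K H' K' (X : H ⊗ H' -> K ⊗ K') (v : H) (w : K) : H' -> K' :=
  adj (fun k : K' => w ⊗v k : K ⊗ K') \o X \o (fun h : H' => v ⊗v h : H ⊗ H').

(* (ι ⊗ ω)(X) and (ω ⊗ ι)(X) for a normal functional ω *)
Definition slice2 H K H' K' (w : (H' -> K') -> Cx R) (X : H ⊗ H' -> K ⊗ K') :
    H -> K :=
  xget (fun=> 0) [set y : H -> K | bounded_op y /\
    forall u v, '[y u, v] = w (vslice1 X u v)].

Definition slice1 H K H' K' (w : (H -> K) -> Cx R) (X : H ⊗ H' -> K ⊗ K') :
    H' -> K' :=
  xget (fun=> 0) [set y : H' -> K' | bounded_op y /\
    forall u v, '[y u, v] = w (vslice2 X u v)].

(* (f ⊗ ι)(X) and (ι ⊗ f)(X) for a normal map f, determined by their slices *)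
Definition map1 H K H' K' L L' (f : (H -> K) -> (H' -> K'))
    (X : H ⊗ L -> K ⊗ L') : H' ⊗ L -> K' ⊗ L' :=
  xget (fun=> 0) [set Y : H' ⊗ L -> K' ⊗ L' | bounded_op Y /\
    forall u v, vslice2 Y u v = f (vslice2 X u v)].

Definition map2 H K H' K' L L' (f : (H -> K) -> (H' -> K'))
    (X : L ⊗ H -> L' ⊗ K) : L ⊗ H' -> L' ⊗ K' :=
  xget (fun=> 0) [set Y : L ⊗ H' -> L' ⊗ K' | bounded_op Y /\
    forall u v, vslice1 Y u v = f (vslice1 X u v)].

Definition leg23 L H K H' K' (X : H ⊗ H' -> K ⊗ K') :
    (L ⊗ H) ⊗ H' -> (L ⊗ K) ⊗ K' :=
  adj (@assoc L K K') \o tensor_op (idfun : L -> L) X \o @assoc L H H'.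

Definition leg13 L H K H' K' (X : H ⊗ H' -> K ⊗ K') :
    (H ⊗ L) ⊗ H' -> (K ⊗ L) ⊗ K' :=
  tensor_op (@flip L K) (idfun : K' -> K') \o leg23 (L := L) X \o
  tensor_op (@flip H L) (idfun : H' -> H').

Definition coassociative H K (N : set (H -> K))
    (D : (H -> K) -> (H ⊗ H -> K ⊗ K)) : Prop :=
  forall x, N x -> @assoc K K K \o map1 D (D x) = map2 D (D x) \o @assoc H H H.

Definition vn_bialgebra H (M : set (H -> H))
    (D : (H -> H) -> (H ⊗ H -> H ⊗ H)) : Prop :=
  [/\ is_vna M,
      [/\ forall x, M x -> vn_tensor M M (D x), linear_on M D & normal_map M D],
      [/\ forall x y, M x -> M y -> D (x \o y) = D x \o D y,
          forall x, M x -> D (adj x) = adj (D x) & D idfun = idfun],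
      forall x, M x -> D x = 0 -> x = 0 &
      coassociative M D].

Definition invariant_state H (M : set (H -> H))
    (D : (H -> H) -> (H ⊗ H -> H ⊗ H)) (w : (H -> H) -> Cx R) : Prop :=
  normal_state M w /\
  forall x, M x -> slice1 w (D x) = w x *: (idfun : H -> H) /\
                   slice2 w (D x) = w x *: (idfun : H -> H).

Definition compact_woronowicz H (M : set (H -> H))
    (D : (H -> H) -> (H ⊗ H -> H ⊗ H)) : Prop :=
  vn_bialgebra M D /\ exists w, invariant_state M D w.

(* A compact Woronowicz algebra acting on the GNS space of its invariant state,
   which is the vector state of the cyclic separating vector [xi]. *)
Definition compact_woronowicz_gns H (M : set (H -> H))
    (D : (H -> H) -> (H ⊗ H -> H ⊗ H)) (xi : H) : Prop :=
  [/\ vn_bialgebra M D, invariant_state M D (vector_functional xi),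
      dense [set v | exists2 x, M x & v = x xi] &
      forall x, M x -> x xi = 0 -> x = 0].

Definition right_galois_coobject H (M : set (H -> H))
    (DM : (H -> H) -> (H ⊗ H -> H ⊗ H)) K (N : set (H -> K))
    (DN : (H -> K) -> (H ⊗ H -> K ⊗ K)) : Prop :=
  [/\ [/\ N `<=` @bounded_op _ H K, subspace N & sw_closure N `<=` N],
      [/\ forall x, N x -> vn_tensor N N (DN x), linear_on N DN &
          normal_map N DN],
      dense (span [set v | exists x w, N x /\ v = x w]) /\
      dense (span [set v | exists x w, N x /\ v = adj x w]),
      [/\ forall x y, N x -> M y -> N (x \o y),
          forall x y, N x -> N y -> M (adj x \o y),
          forall x y, N x -> M y -> DN (x \o y) = DN x \o DM y &
          forall x y, N x -> N y -> adj (DN x) \o DN y = DM (adj x \o y)] &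
      coassociative N DN /\
      sw_closure (span [set X | exists x y z,
        [/\ N x, M y, M z & X = DN x \o tensor_op y z]]) = vn_tensor N N].

(* The unitaries V~ and W~ attached to (N, DN). *)
Definition is_mult_unitaryV H K (N : set (H -> K))
    (D : (H -> K) -> (H ⊗ H -> K ⊗ K)) (xi : H) (V : K ⊗ H -> K ⊗ K) : Prop :=
  unitary_op V /\ forall x v, N x -> V (x xi ⊗v v) = D x (xi ⊗v v).

Definition is_mult_unitaryW H K (N : set (H -> K))
    (D : (H -> K) -> (H ⊗ H -> K ⊗ K)) (xi : H) (W : K ⊗ K -> H ⊗ K) : Prop :=
  unitary_op W /\ forall x v, N x -> adj W (v ⊗v x xi) = D x (v ⊗v xi).

(* The algebra N^ (and M^ when H = K and V is the unitary of M). *)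
Definition dual_algebra H K (V : K ⊗ H -> K ⊗ K) : set (K -> K) :=
  [set x | bounded_op x /\
     adj V \o tensor_op x (idfun : K -> K) \o V = tensor_op x (idfun : H -> H)].

Definition dual_coaction H K (W : K ⊗ K -> H ⊗ K) (x : K -> K) :
    K ⊗ H -> K ⊗ H :=
  @flip H K \o W \o tensor_op x (idfun : K -> K) \o adj W \o @flip K H.

Definition adjoint_coaction H K (W : K ⊗ K -> H ⊗ K) (x : K -> K) :
    K ⊗ H -> K ⊗ H :=
  @flip H K \o W \o tensor_op (idfun : K -> K) x \o adj W \o @flip K H.

Definition corepresentation H K (N : set (H -> K))
    (D : (H -> K) -> (H ⊗ H -> K ⊗ K)) L (G : H ⊗ L -> K ⊗ L) : Prop :=
  [/\ vn_tensor N (@bounded_op _ L L) G, unitary_op G &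
      map1 D G = leg13 (L := K) G \o leg23 (L := H) G].

(* Hilbert subspaces of [L] are given as ranges of isometries [j : L' -> L]. *)
Definition irreducible_corep H K (N : set (H -> K))
    (D : (H -> K) -> (H ⊗ H -> K ⊗ K)) L (G : H ⊗ L -> K ⊗ L) : Prop :=
  [/\ corepresentation N D G, exists v : L, v != 0 &
      forall L' (j : L' -> L) (G' : H ⊗ L' -> K ⊗ L'),
        isometry_op j -> unitary_op G' ->
        vn_tensor N (@bounded_op _ L' L') G' ->
        G \o tensor_op (idfun : H -> H) j =
          tensor_op (idfun : K -> K) j \o G' ->
        range j = [set 0] \/ range j = setT].

Definition left_invariant H (P : set (H -> H))
    (D : (H -> H) -> (H ⊗ H -> H ⊗ H)) (f : (H -> H) -> \bar R) : Prop :=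
  forall w x, normal_state P w -> P x -> positive_op x -> (f x < +oo)%E ->
    f (slice1 w (D x)) = f x.

Definition right_invariant H (P : set (H -> H))
    (D : (H -> H) -> (H ⊗ H -> H ⊗ H)) (f : (H -> H) -> \bar R) : Prop :=
  forall w x, normal_state P w -> P x -> positive_op x -> (f x < +oo)%E ->
    f (slice2 w (D x)) = f x.

(* A *-isomorphism x |-> (pi r x)_r of [Q] onto the l^oo-direct sum of the
   B(Hr r), with minimal central projections [p r]. *)
Definition block_decomposition K (Q : set (K -> K)) (I : choiceType)
    (Hr : I -> hilbert R) (pi : forall r, (K -> K) -> (Hr r -> Hr r))
    (p : I -> (K -> K)) : Prop :=
  [/\ [/\ forall r, exists v : Hr r, v != 0,
          forall r, linear_on Q (pi r),
          forall r x y, Q x -> Q y -> pi r (x \o y) = pi r x \o pi r y,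
          forall r x, Q x -> pi r (adj x) = adj (pi r x) &
          forall r, pi r idfun = idfun],
      forall x, Q x -> exists c : Cx R, forall r,
        bounded_op (pi r x) /\ forall v, `|pi r x v| <= c * `|v|,
      forall x, Q x -> (forall r, pi r x = 0) -> x = 0,
      forall y : (forall r, Hr r -> Hr r),
        (exists c : Cx R, forall r,
           bounded_op (y r) /\ forall v, `|y r v| <= c * `|v|) ->
        exists2 x, Q x & forall r, pi r x = y r &
      forall r, [/\ Q (p r), pi r (p r) = idfun &
        forall s, s != r -> pi s (p r) = 0]].

(* [T r] is the density of the state of B(Hr r) determined by the averages of
   the adjoint coaction; [p r] is the unit of B(Hr r) inside [Q]. *)
Definition state_densities H K (xi : H) (W : K ⊗ K -> H ⊗ K) (Q : set (K -> K))
    (I : choiceType) (Hr : I -> hilbert R)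
    (pi : forall r, (K -> K) -> (Hr r -> Hr r)) (p : I -> (K -> K))
    (T : forall r, Hr r -> Hr r) : Prop :=
  forall r, [/\ positive_op (T r), (trace_pos (T r) < +oo)%E, injective (T r) &
    forall x, Q x -> p r \o x = x ->
      slice2 (vector_functional xi) (adjoint_coaction W x) =
        trace (T r \o pi r x) *: p r].

(* The weight given by Tr(T_r^-1 . ) on each block B(Hr r). *)
Definition dual_weight K (I : choiceType) (Hr : I -> hilbert R)
    (pi : forall r, (K -> K) -> (Hr r -> Hr r)) (T : forall r, Hr r -> Hr r)
    (x : K -> K) : \bar R :=
  (\esum_(r in [set: I])
     derived_weight (@trace_pos R (Hr r)) (uop_inv (T r)) (pi r x))%E.

Definition coaction_invariant H K (W : K ⊗ K -> H ⊗ K) (Q : set (K -> K))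
    (Mhat : set (H -> H)) (f : (K -> K) -> \bar R) : Prop :=
  forall w x, normal_state Mhat w -> Q x -> positive_op x ->
    f (slice2 w (dual_coaction W x)) = f x.

(* [delta] is the Radon-Nikodym derivative of [g] with respect to the weight
   with density T_r^-1 on the block B(Hr r). The modular group of that weight
   is Ad T_r^{-it} on B(Hr r), so its centralizer is the commutant of the T_r;
   the commutation below says that [delta] is affiliated with it. *)
Definition is_RN_derivative K (Q : set (K -> K)) (I : choiceType)
    (Hr : I -> hilbert R) (pi : forall r, (K -> K) -> (Hr r -> Hr r))
    (T : forall r, Hr r -> Hr r) (g : (K -> K) -> \bar R) (delta : uop K) :
    Prop :=
  [/\ positive_selfadjoint delta, nonsingular delta, affiliated Q delta,
      forall r, pi r (shift_inv delta 1) \o T r = T r \o pi r (shift_inv delta 1) &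
      forall x, Q x -> positive_op x ->
        g x = derived_weight (dual_weight pi T) delta x].

(* [A r] is the component p_r delta of [delta], seen as an operator on Hr r:
   the resolvents correspond under [pi r]. *)
Definition block_components K (I : choiceType) (Hr : I -> hilbert R)
    (pi : forall r, (K -> K) -> (Hr r -> Hr r)) (delta : uop K)
    (A : forall r, uop (Hr r)) : Prop :=
  forall r, [/\ positive_selfadjoint (A r), nonsingular (A r) &
    pi r (shift_inv delta 1) = shift_inv (A r) 1].

End Legs.

(* Main.v *)
(* Slices of the unitaries [Zt = Wt^*] and [Vt] are matrix coefficients lying in [N]. Invariance of
   a weight on [P] turns forms of matrix coefficients into operators commuting with the dual algebra,
   hence into scalars on its blocks: finiteness of the weight makes every [T_r] bounded below, and one
   finite block yields an invariant state. If [P] is unimodular, comparing the two invariance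
   properties through the modular theory of the Haar state gives an inequality
   [Z^* (R ⊗ 1) Z <= 1 ⊗ R], which must be an equality; hence [A_r T_r^-2] is scalar. *)
Require Import Defs.
From HB Require Import structures.
From mathcomp Require Import all_boot all_order all_algebra.
From mathcomp Require Import complex ring lra.
From mathcomp Require Import boolp classical_sets functions cardinality reals ereal.
From mathcomp Require Import topology normedtype sequences esum.

Set Implicit Arguments.
Unset Strict Implicit.
Unset Printing Implicit Defensive.

Import Order.TTheory GRing.Theory Num.Theory.
Import numFieldNormedType.Exports.

Local Open Scope classical_set_scope.
Local Open Scope ring_scope.

(** Each block splits off H_r ⊗ [Kr] in K, and a conjugate-linear map [kap] from H_r to the
    multiplicity space [Kr] has <kap g', kap g> = <T_r g, g'>. So finiteness of a weight bounds T_r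
    below, and a weight with both invariance properties equals, on matrix coefficients in an
    eigenbasis of T_r, the Haar state up to factors chi_r / (t_k t_l). For the third claim let F be
    diagonal with eigenvalues chi_r a / t^2, where t and a are eigenvalues of T_r and A_r. The
    weight psi is known exactly on special elements and bounded below termwise on others, which
    gives only Z^* (F ⊗ 1) Z <= 1 ⊗ F; the operator R = F / (1 + F) makes this bounded. Equality
    holds at vectors xi ⊗ w, because Z (xi ⊗ w) = Vt (w ⊗ xi) and Vt intertwines x ⊗ 1 for x in the
    dual algebra; the comultiplication rule spreads it to all vectors. Then Z has no coefficients
    between different eigenspaces of F, which invariance of the weight forbids within one block, so
    a = d_r^2 t^2. Unbounded operators are handled through resolvents and joint eigenbases only. *)

Local Notation bd := bounded_op.
Local Notation pos := positive_op.
Local Notation span := (@Defs.span _ _).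
Local Notation subspace := (@Defs.subspace _ _ _).

(** * Inner products, Cauchy-Schwarz, and real numbers inside the complex field *)

Section Dot.
Context {R : realType}.
Implicit Types (H K : hilbert R).
Local Notation C := (Cx R).

Lemma dotDl H (x y z : H) : '[x + y, z] = '[x, z] + '[y, z].
Proof. exact: linearDl. Qed.
Lemma dotDr H (x y z : H) : '[z, x + y] = '[z, x] + '[z, y].
Proof. exact: linearDr. Qed.
Lemma dotNl H (x z : H) : '[- x, z] = - '[x, z].
Proof. exact: linearNl. Qed.
Lemma dotNr H (x z : H) : '[z, - x] = - '[z, x].
Proof. exact: linearNr. Qed.
Lemma dotBl H (x y z : H) : '[x - y, z] = '[x, z] - '[y, z].
Proof. exact: linearBl. Qed.
Lemma dotBr H (x y z : H) : '[z, x - y] = '[z, x] - '[z, y].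
Proof. exact: linearBr. Qed.
Lemma dotZl H c (x z : H) : '[c *: x, z] = c * '[x, z] :> C.
Proof. exact: linearZl_LR. Qed.
Lemma dotZr H c (x z : H) : '[z, c *: x] = c^* * '[z, x] :> C.
Proof. exact: linearZr_LR. Qed.
Lemma dot0l H (x : H) : '[0, x] = 0. Proof. exact: linear0l. Qed.
Lemma dot0r H (x : H) : '[x, 0] = 0. Proof. exact: linear0r. Qed.
Lemma dot_suml H I r (P : pred I) (F : I -> H) z :
  '[\sum_(i <- r | P i) F i, z] = \sum_(i <- r | P i) '[F i, z].
Proof. exact: linear_sumlz. Qed.
Lemma dot_sumr H I r (P : pred I) (F : I -> H) z :
  '[z, \sum_(i <- r | P i) F i] = \sum_(i <- r | P i) '[z, F i].
Proof. exact: linear_sumr. Qed.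
Lemma dotC H (x y : H) : '[x, y] = ('[y, x] : C)^*.
Proof. by rewrite hermC /= expr0 mul1r. Qed.

Lemma dot_ge0 H (x : H) : 0 <= '[x, x] :> C.
Proof. exact: dnorm_ge0. Qed.
Lemma dot_eq0 H (x : H) : '[x, x] = 0 -> x = 0.
Proof. by move=> /eqP; rewrite dnorm_eq0 => /eqP. Qed.

Lemma dot_ext H (x y : H) : (forall z, '[x, z] = '[y, z]) -> x = y.
Proof.
move=> h; apply/eqP; rewrite -subr_eq0; apply/eqP/dot_eq0.
by rewrite dotBl h subrr.
Qed.

Lemma dot_ext0 H (x : H) : (forall z, '[x, z] = 0) -> x = 0.
Proof. by move=> h; apply: dot_ext => z; rewrite h dot0l. Qed.

Lemma zfunE H K (x : H) : (0 : H -> K) x = 0. Proof. by []. Qed.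

Lemma le_of_eq (x y : C) : x = y -> x <= y. Proof. by move->. Qed.

(** Stated for a bare quadratic expression so that inner products, positive operators and the
    sesquilinear form of a weight can share it. The minimum is at t = s / q; when q = 0, a large
    multiple of s makes the expression negative unless s = 0. *)
Lemma form_CS (p q s : C) : 0 <= p -> 0 <= q ->
  (forall t, 0 <= p - t * s^* - t^* * s + t * t^* * q) -> `|s| ^+ 2 <= p * q.
Proof.
move=> p0 q0 quad; have [q1|q1] := eqVneq q 0.
  have [->|s0] := eqVneq s 0; first by rewrite normr0 expr0n mulr_ge0.
  have n0 : 0 < `|s| ^+ 2 :> C by rewrite exprn_gt0 // normr_gt0.
  have := quad ((p + 1) / `|s| ^+ 2 * s); set k := _ / _.
  have kr : k^* = k.
    by apply/CrealP; rewrite rpredM // ?rpredV; apply: ger0_real; rewrite ?addr_ge0 ?exprn_ge0.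
  rewrite q1 mulr0 addr0 rmorphM /= kr.
  have -> : p - k * s * s^* - k * s^* * s = p - 2%:R * (k * `|s| ^+ 2) by rewrite normCK; ring.
  rewrite /k divfK ?gt_eqF // (_ : p - 2%:R * (p + 1) = - (p + 2%:R)); last by ring.
  rewrite oppr_ge0 => h; have : 0 < p + 2%:R :> C by rewrite ltr_wpDl // ltr0n.
  by move=> /lt_le_trans /(_ h); rewrite ltxx.
have qp : 0 < q by rewrite lt_neqAle eq_sym q1.
have := quad (s / q); have -> : (s / q)^* = s^* / q.
  by rewrite rmorphM fmorphV /=; congr (_ / _); apply/CrealP; exact: ger0_real.
rewrite -(pmulr_rge0 _ qp) => h; rewrite -subr_ge0; apply: le_trans h _.
by apply: le_of_eq; rewrite normCK; field.
Qed.

Lemma dot_CS2 H (x y : H) : `|'[x, y]| ^+ 2 <= '[x, x] * '[y, y] :> C.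
Proof.
apply: form_CS => [||t]; [exact: dot_ge0|exact: dot_ge0|].
have := dot_ge0 (x - t *: y); rewrite !dotBl !dotBr !dotZl !dotZr (dotC y x) => h.
by apply: le_trans h _; apply: le_of_eq; ring.
Qed.

Lemma dot_CS H (x y : H) : `|'[x, y]| <= `|x| * `|y| :> C.
Proof.
rewrite -(ler_pXn2r (n := 2)) ?nnegrE ?mulr_ge0 //.
by rewrite exprMn -!hdot_norm dot_CS2.
Qed.

Lemma norm_le_dot H (x : H) (c : C) : 0 <= c ->
  (forall y, `|'[x, y]| <= c * `|y|) -> `|x| <= c.
Proof.
move=> c0 /(_ x); rewrite hdot_norm normrX normr_id expr2.
have [->|x0] := eqVneq x 0; first by rewrite normr0.
by rewrite ler_pM2r // normr_gt0.
Qed.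

Lemma pyth H (x y : H) : '[x, y] = 0 -> `|x + y| ^+ 2 = `|x| ^+ 2 + `|y| ^+ 2 :> C.
Proof.
move=> h; rewrite -!hdot_norm dotDl !dotDr h (dotC y x) h conjC0 add0r addr0.
by [].
Qed.

Lemma Cx_real (z : C) : 0 <= z -> z = cplx (complex.Re z) /\ 0 <= complex.Re z.
Proof.
by case: z => a b; rewrite lecE /= => /andP[/eqP -> h]; split.
Qed.

Lemma cplx_le (a b : R) : (cplx a <= cplx b) = (a <= b).
Proof. exact: lecR. Qed.
Lemma cplx_lt (a b : R) : (cplx a < cplx b) = (a < b).
Proof. exact: ltcR. Qed.
Lemma cplx_ge0 (a : R) : (0 <= cplx a) = (0 <= a).
Proof. exact: (cplx_le 0). Qed.
Lemma cplx_gt0 (a : R) : (0 < cplx a) = (0 < a).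
Proof. exact: (cplx_lt 0). Qed.
Lemma Cx_gt0 (z : C) : 0 < z -> exists2 e : R, 0 < e & z = cplx e.
Proof.
move=> z0; have [e h] := Cx_real (ltW z0).
by exists (complex.Re z) => //; rewrite -cplx_gt0 -e.
Qed.
Lemma cplx_sum I r (P : pred I) (F : I -> R) :
  cplx (\sum_(i <- r | P i) F i) = \sum_(i <- r | P i) cplx (F i).
Proof. by rewrite /cplx rmorph_sum. Qed.
Lemma cplxM (a b : R) : cplx (a * b) = cplx a * cplx b.
Proof. by rewrite /cplx rmorphM. Qed.
Lemma cplxD (a b : R) : cplx (a + b) = cplx a + cplx b.
Proof. by rewrite /cplx rmorphD. Qed.
Lemma cplxB (a b : R) : cplx (a - b) = cplx a - cplx b.
Proof. by rewrite /cplx rmorphB. Qed.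
Lemma cplxV (a : R) : cplx a^-1 = (cplx a)^-1.
Proof. by rewrite /cplx fmorphV. Qed.
Lemma cplx0 : cplx (0 : R) = 0. Proof. by []. Qed.
Lemma cplx1 : cplx (1 : R) = 1. Proof. by []. Qed.
Lemma cplx_conj (a : R) : (cplx a)^* = cplx a.
Proof. by apply/CrealP; rewrite complex_real. Qed.
Lemma cplx_inj : injective (@cplx R).
Proof. by move=> a b [->]. Qed.
Lemma cplx_norm (a : R) : 0 <= a -> `|cplx a| = cplx a.
Proof. by move=> h; rewrite ger0_norm // cplx_ge0. Qed.

Definition nrm2 H (x : H) : R := complex.Re ('[x, x] : C).
Lemma nrm2E H (x : H) : cplx (nrm2 x) = '[x, x].
Proof. by rewrite /nrm2; have [<-] := Cx_real (dot_ge0 x). Qed.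
Lemma nrm2_ge0 H (x : H) : 0 <= nrm2 x.
Proof. by rewrite -cplx_ge0 nrm2E dot_ge0. Qed.

End Dot.

#[global] Hint Resolve dot_ge0 nrm2_ge0 : core.

(** * Convergence of sequences and of orthogonal series *)

Section Conv.
Context {R : realType}.
Implicit Types (H K : hilbert R).
Local Notation C := (Cx R).

Lemma cvgC_ex (V : normedModType C) (u : nat -> V) (l : V) :
  (forall e : C, 0 < e -> exists n0, forall n, (n0 <= n)%N -> `|u n - l| < e) ->
  u @ \oo --> l.
Proof.
move=> h; apply/cvgrPdist_lt => e e0; have [n0 hn] := h e e0.
by exists n0 => // n /= hle; rewrite distrC; apply: hn.
Qed.

Lemma cvgC_P (V : normedModType C) (u : nat -> V) (l : V) :
  u @ \oo --> l ->
  forall e : C, 0 < e -> exists n0, forall n, (n0 <= n)%N -> `|u n - l| < e.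
Proof.
move=> h e e0; have /cvgrPdist_lt/(_ e e0)[n0 _ hn] := h.
by exists n0 => n hle; rewrite distrC; apply: hn.
Qed.

Lemma cauchy_conv H (u : nat -> H) :
  (forall e : C, 0 < e -> exists n0, forall m n, (n0 <= m)%N -> (m <= n)%N ->
     `|u n - u m| < e) ->
  exists l : H, u @ \oo --> l.
Proof.
move=> h; have : cvg (u @ \oo).
  apply: cauchy_cvg; apply: cauchy_exP => e /h[n0 hn].
  exists (u n0), n0 => // n /= hle; rewrite -ball_normE /ball_ /= distrC.
  exact: hn.
by move=> h'; exists (lim (u @ \oo)).
Qed.

Lemma cvg_uniq (V : normedModType C) (u : nat -> V) (l l' : V) :
  u @ \oo --> l -> u @ \oo --> l' -> l = l'.
Proof. by move=> h h'; apply: (cvg_unique _ h h'). Qed.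

Lemma cvg_dotl H (u : nat -> H) l y : u @ \oo --> l ->
  (fun n => '[u n, y] : C) @ \oo --> ('[l, y] : C).
Proof.
move=> h; apply: cvgC_ex => e e0.
have y1 : 0 < `|y| + 1 :> C by rewrite ltr_wpDl.
have [n0 hn] := cvgC_P h (divr_gt0 e0 y1).
exists n0 => n /hn h'; rewrite -dotBl (le_lt_trans (dot_CS _ _)) //.
rewrite ltr_pdivlMr // in h'; apply: le_lt_trans h'.
by rewrite ler_wpM2l // lerDl.
Qed.

Lemma cvg_conj (u : nat -> C) l : u @ \oo --> l ->
  (fun n => (u n)^*) @ \oo --> l^*.
Proof.
move=> h; apply: cvgC_ex => e e0; have [n0 hn] := cvgC_P h e0.
by exists n0 => n /hn; rewrite -rmorphB norm_conjC.
Qed.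

Lemma cvg_dotr H (u : nat -> H) l y : u @ \oo --> l ->
  (fun n => '[y, u n] : C) @ \oo --> ('[y, l] : C).
Proof.
move=> h; rewrite dotC; have := cvg_conj (cvg_dotl (y := y) h).
by under eq_fun do rewrite -dotC.
Qed.

(** The order on the complex scalars is partial, so monotone convergence is run on the real
    parts. *)
Lemma bounded_series_cauchy (u : nat -> C) (c : C) : (forall n, 0 <= u n) ->
  (forall n, \sum_(i < n) u i <= c) ->
  forall e : C, 0 < e -> exists n0, forall m n, (n0 <= m)%N -> (m <= n)%N ->
    \sum_(m <= i < n) u i < e.
Proof.
move=> u0 hc e /Cx_gt0[e' e0 ->].
pose v n : R := complex.Re (u n).
have uv n : u n = cplx (v n) by have [] := Cx_real (u0 n).
have v0 n : 0 <= v n by have [] := Cx_real (u0 n).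
have c0 : 0 <= c by apply: le_trans (hc 0); rewrite big_ord0.
have [cE _] := Cx_real c0.
have inc : {homo (fun n => \sum_(i < n) v i) : n m / (n <= m)%N >-> n <= m}.
  move=> m n mn; rewrite -!(big_mkord xpredT v) (big_cat_nat _ mn) //=.
  by rewrite lerDl sumr_ge0.
have bd : has_ubound (range (fun n => \sum_(i < n) v i)).
  exists (complex.Re c) => _ [n _ <-]; rewrite -cplx_le -cE cplx_sum.
  by under eq_bigr do rewrite -uv.
have /cvgrPdist_lt /(_ (e' / 2)) := nondecreasing_cvgn inc bd.
rewrite divr_gt0 // => /(_ isT)[n0 _ hn].
exists n0 => m n hm hmn.
under eq_bigr do rewrite uv; rewrite -cplx_sum cplx_lt.
have := hn m hm; have := hn n (leq_trans hm hmn) => /=.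
rewrite -!(big_mkord xpredT v) (big_cat_nat _ hmn) //=.
set l := sup _; set a := \sum_(0 <= i < m) _; set b := \sum_(m <= i < n) _.
by rewrite !ltr_distl => /andP[h1 h2] /andP[h3 h4]; lra.
Qed.

Lemma pyth_sum H (u : nat -> H) (r : seq nat) : uniq r ->
  (forall i j, i != j -> '[u i, u j] = 0) ->
  `|\sum_(i <- r) u i| ^+ 2 = \sum_(i <- r) `|u i| ^+ 2 :> C.
Proof.
move=> ur ho; elim: r ur => [_|i r IH /= /andP[ir ur]].
  by rewrite !big_nil normr0 expr0n.
rewrite !big_cons pyth ?IH // dot_sumr big_seq big1 // => j jr.
by apply: ho; apply: contraNneq ir => ->.
Qed.

Lemma orth_series H (u : nat -> H) (c : C) :
  (forall i j, i != j -> '[u i, u j] = 0) ->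
  (forall n, \sum_(i < n) `|u i| ^+ 2 <= c) ->
  exists l : H, series u @ \oo --> l.
Proof.
move=> ho hc; apply: cauchy_conv => e e0.
have [n0 hn] := bounded_series_cauchy (fun n => exprn_ge0 2 (normr_ge0 (u n))) hc
  (exprn_gt0 2 e0).
exists n0 => m n hm hmn; rewrite sub_series_geq //.
rewrite -(ltr_pXn2r (n := 2)) ?nnegrE // ?(ltW e0) //.
rewrite pyth_sum ?iota_uniq //; exact: hn.
Qed.

End Conv.

(** * Linear spans *)

Section Span.
Context (K : nzRingType) (V : lmodType K).
Implicit Types S : set V.

Lemma span_gen S x : S x -> span S x.
Proof.
move=> Sx; exists 1%N, (fun=> 1), (fun=> x); split=> //.
by rewrite big_ord1 scale1r.
Qed.

Lemma span0 S : span S 0.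
Proof. by exists 0%N, (fun=> 0), (fun=> 0); split=> [[]//|]; rewrite big_ord0. Qed.

Lemma spanZ S c x : span S x -> span S (c *: x).
Proof.
move=> [n [a [v [h ->]]]]; exists n, (fun i => c * a i), v; split=> //.
by rewrite scaler_sumr; apply: eq_bigr => i _; rewrite scalerA.
Qed.

Lemma spanD S x y : span S x -> span S y -> span S (x + y).
Proof.
move=> [n [a [v [h ->]]]] [m [b [w [k ->]]]].
exists (n + m)%N, (fun i => match fintype.split i with inl j => a j | inr j => b j end),
  (fun i => match fintype.split i with inl j => v j | inr j => w j end); split.
  by move=> i; case: (fintype.split i).
rewrite big_split_ord /=; congr +%R; apply: eq_bigr => i _.
  by rewrite (unsplitK (inl i)).
by rewrite (unsplitK (inr i)).
Qed.

Lemma span_sum S I r (P : pred I) (F : I -> V) :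
  (forall i, P i -> span S (F i)) -> span S (\sum_(i <- r | P i) F i).
Proof. by move=> h; apply: big_ind => //; [exact: span0|exact: spanD]. Qed.


Lemma span_ind S (Q : V -> Prop) : Q 0 ->
  (forall c x y, S x -> Q y -> Q (c *: x + y)) -> forall x, span S x -> Q x.
Proof.
move=> h0 h x [n [c [v [hv ->]]]].
by elim/big_rec: _ => // i y _ Qy; apply: h.
Qed.

End Span.

(** * Gram-Schmidt, orthonormal bases padded with zeros, Parseval *)

Section Basis.
Context {R : realType}.
Implicit Types (H K : hilbert R).
Local Notation C := (Cx R).

Lemma denseP H (D : set H) : dense D <->
  forall x (e : C), 0 < e -> exists2 s, D s & `|x - s| < e.
Proof.
split=> [h x e e0|h O [x Ox] oO].
  have [|s [bs Ds]] := h (ball x e) _ (ball_open x e).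
    by exists x; exact: ballxx.
  by exists s => //; move: bs; rewrite -ball_normE.
have /nbhs_ballP[e e0 he] : nbhs x O by apply: open_nbhs_nbhs.
have [s Ds xs] := h x e e0; exists s; split=> //; apply: he.
by rewrite -ball_normE.
Qed.

Lemma dense_sub H (D E : set H) : D `<=` E -> dense D -> dense E.
Proof.
by move=> DE /denseP h; apply/denseP => x e /(h x)[s Ds xs]; exists s; auto.
Qed.

Lemma dense_orth0 H (D : set H) z : dense D -> (forall s, D s -> '[s, z] = 0) ->
  z = 0.
Proof.
move=> /denseP h ho; apply/eqP; apply: contraT => z0.
have nz : 0 < `|z| :> C by rewrite normr_gt0.
have [s /ho sz zs] := h z `|z| nz.
have : '[z, z] = '[z - s, z] by rewrite dotBl sz subr0.
move=> e; have := dot_CS (z - s) z; rewrite -e hdot_norm normrX normr_id expr2.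
by rewrite ler_pM2r // => h'; have := le_lt_trans h' zs; rewrite ltxx.
Qed.

Definition is_onb H (e : nat -> H) :=
  [/\ forall i j, i != j -> '[e i, e j] = 0,
      forall i, '[e i, e i] = 0 \/ '[e i, e i] = 1 &
      dense (span (range e))].

(** Sends 0 to 0, so Gram-Schmidt can run on linearly dependent sequences and leaves zero vectors as
    padding. *)
Definition nlz H (x : H) : H := `|x|^-1 *: x.

Lemma nlz_dot H (x : H) : '[nlz x, nlz x] = 0 \/ '[nlz x, nlz x] = 1.
Proof.
have [->|x0] := eqVneq x 0; first by left; rewrite /nlz scaler0 dot0l.
right; rewrite hdot_norm normrZ normfV normr_id mulVf ?expr1n //.
by rewrite normr_eq0.
Qed.

Lemma nlzK H (x : H) : `|x| *: nlz x = x.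
Proof.
have [->|x0] := eqVneq x 0; first by rewrite /nlz !scaler0.
by rewrite scalerA mulfV ?scale1r // normr_eq0.
Qed.

Section GramSchmidt.
Variables (H : hilbert R) (a : nat -> H).

Fixpoint gs_list n : seq H :=
  if n is m.+1 then
    rcons (gs_list m) (nlz (a m - \sum_(x <- gs_list m) '[a m, x] *: x))
  else [::].

Definition gs n : H := nlz (a n - \sum_(x <- gs_list n) '[a n, x] *: x).

Lemma gs_listE n : gs_list n = [seq gs i | i <- iota 0 n].
Proof.
elim: n => // n IH; rewrite -addn1 iotaD map_cat /= add0n -IH.
by rewrite addn1 /= cats1.
Qed.

Lemma gsE n : gs n = nlz (a n - \sum_(i < n) '[a n, gs i] *: gs i).
Proof.
rewrite {1}/gs gs_listE big_map; congr (nlz (_ - _)).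
by rewrite -(big_mkord xpredT (fun i => '[a n, gs i] *: gs i)) /index_iota subn0.
Qed.

Lemma unit_or0 (x y : H) : '[x, x] = 0 \/ '[x, x] = 1 ->
  '[y, x] * '[x, x] = '[y, x].
Proof. by case=> [/dot_eq0 ->|->]; rewrite ?dot0r ?mul0r ?mulr1. Qed.

Lemma gs_unit n : '[gs n, gs n] = 0 \/ '[gs n, gs n] = 1.
Proof. exact: nlz_dot. Qed.

Lemma gs_orth_lt n j : (j < n)%N -> '[gs n, gs j] = 0.
Proof.
elim/ltn_ind: n j => n IH j jn.
rewrite [X in '[X, _]]gsE dotZl dotBl dot_suml.
suff -> : \sum_(i < n) '['[a n, gs i] *: gs i, gs j] = '[a n, gs j] :> C.
  by rewrite subrr mulr0.
rewrite (bigD1 (Ordinal jn)) //= big1 => [|i ij].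
  by rewrite dotZl unit_or0 ?addr0 //; exact: gs_unit.
rewrite dotZl; have [lt|ge] := ltnP i j.
  by rewrite (dotC (gs i)) (IH j jn) ?conjC0 ?mulr0.
rewrite (IH i) ?mulr0 ?ltn_ord // ltn_neqAle ge andbT eq_sym.
by apply: contraNneq ij => e; apply/eqP/val_inj.
Qed.

Lemma gs_orth i j : i != j -> '[gs i, gs j] = 0.
Proof.
rewrite neq_ltn => /orP[] h; last exact: gs_orth_lt.
by rewrite dotC gs_orth_lt ?conjC0.
Qed.

Lemma gs_span n : span (range gs) (a n).
Proof.
rewrite -(subrK (\sum_(i < n) '[a n, gs i] *: gs i) (a n)).
apply: spanD; last by apply: span_sum => i _; apply: spanZ; apply: span_gen; exists i.
rewrite -[X in span _ X]nlzK -gsE; apply: spanZ; apply: span_gen; by exists n.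
Qed.

End GramSchmidt.

Lemma onb_exists H : exists e : nat -> H, is_onb e.
Proof.
have [A /countable_injP[f fi] dA] := hseparable H.
pose a n : H := xget 0 [set x | A x /\ f x = n].
have aA x : A x -> a (f x) = x.
  move=> Ax; rewrite /a; case: xgetP => [y _ [Ay e]|/(_ x)[]//].
  by apply: fi; rewrite ?inE.
exists (gs a); split; [exact: gs_orth|exact: gs_unit|].
by apply: dense_sub dA => x /aA <-; exact: gs_span.
Qed.

Lemma onbP H : is_onb (onb H).
Proof. exact: (xgetPex _ (onb_exists H)). Qed.

Section Parseval.
Variables (H : hilbert R) (e : nat -> H).
Hypotheses (eo : forall i j, i != j -> '[e i, e j] = 0)
  (eu : forall i, '[e i, e i] = 0 \/ '[e i, e i] = 1).


Lemma coef_norm i x : `|'[x, e i] *: e i| ^+ 2 = `|'[x, e i]| ^+ 2 :> C.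
Proof.
by rewrite -hdot_norm dotZl dotZr mulrCA (unit_or0 _ (eu i)) normCK mulrC.
Qed.

Lemma coef_orth x i j : i != j -> '['[x, e i] *: e i, '[x, e j] *: e j] = 0.
Proof. by move=> /eo h; rewrite dotZl dotZr h !mulr0. Qed.

Lemma proj_dot x n : let p := \sum_(i < n) '[x, e i] *: e i in
  '[p, x] = \sum_(i < n) `|'[x, e i]| ^+ 2 /\
  '[p, p] = \sum_(i < n) `|'[x, e i]| ^+ 2.
Proof.
split.
  rewrite dot_suml; apply: eq_bigr => i _.
  by rewrite dotZl (dotC (e i)) normCK.
rewrite hdot_norm -(big_mkord xpredT (fun i => '[x, e i] *: e i)) pyth_sum ?iota_uniq //.
  by rewrite big_mkord; apply: eq_bigr => i _; rewrite coef_norm.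
exact: coef_orth.
Qed.

Lemma bessel x n : \sum_(i < n) `|'[x, e i]| ^+ 2 <= `|x| ^+ 2 :> C.
Proof.
have [h1 h2] := proj_dot x n.
set p := \sum_(i < n) _ *: _ in h1 h2; set S : C := \sum_(i < n) _ in h1 h2 *.
have h3 : '[x, p] = S.
  by rewrite dotC h1 geC0_conj // /S sumr_ge0 // => i _; rewrite exprn_ge0.
have := dot_ge0 (x - p); rewrite dotBl !dotBr h1 h2 h3 subrr subr0 subr_ge0.
by rewrite -hdot_norm.
Qed.

Hypothesis ed : dense (span (range e)).

Lemma onb_ext x : (forall i, '[x, e i] = 0) -> x = 0.
Proof.
move=> h; apply: (dense_orth0 ed).
apply: (span_ind (Q := fun s => '[s, x] = 0)) => [|c y s [i _ <-] hs]; first by rewrite dot0l.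
by rewrite dotDl dotZl hs dotC h conjC0 mulr0 addr0.
Qed.

Lemma onb_cvg x : series (fun i => '[x, e i] *: e i) @ \oo --> x.
Proof.
have [l hl] : exists l : H, series (fun i => '[x, e i] *: e i) @ \oo --> l.
  apply: (orth_series (c := `|x| ^+ 2)) => [i j|n]; first exact: coef_orth.
  by under eq_bigr do rewrite coef_norm; exact: bessel.
suff xl : x = l by rewrite [X in _ --> X]xl.
apply/eqP; rewrite -subr_eq0; apply/eqP/onb_ext => j.
rewrite dotBl; apply/eqP; rewrite subr_eq0; apply/eqP.
have h := cvg_dotl (y := e j) hl.
apply: (cvg_uniq _ h); apply: cvgC_ex => d d0; exists j.+1 => n jn.
rewrite seriesEord /= dot_suml (bigD1 (Ordinal jn)) //= big1 => [|i ij].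
  by rewrite addr0 dotZl unit_or0 // subrr normr0.
by rewrite dotZl eo ?mulr0.
Qed.

Lemma parseval x y : series (fun i => '[x, e i] * '[e i, y] : C) @ \oo --> ('[x, y] : C).
Proof.
have -> : series (fun i => '[x, e i] * '[e i, y] : C) =
    (fun n => '[series (fun i => '[x, e i] *: e i) n, y] : C).
  apply: funext => n; rewrite !seriesEord /= dot_suml.
  by apply: eq_bigr => i _; rewrite dotZl.
exact: cvg_dotl (@onb_cvg x).
Qed.

End Parseval.
End Basis.

(** * Bounded operators, Riesz representation, adjoints, unitaries *)

Section Limits.
Context {R : realType}.
Implicit Types (H K L : hilbert R).
Local Notation C := (Cx R).

Lemma Cx_arch (e : C) : 0 < e ->
  exists n0, forall n, (n0 <= n)%N -> (n.+1%:R : C)^-1 < e.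
Proof.
move=> /Cx_gt0[e' e0 ->].
have [n0 _ hn] := near_infty_natSinv_lt (PosNum e0).
exists n0 => n nn; have := hn n nn => /=.
by rewrite -cplx_lt cplxV /cplx rmorph_nat.
Qed.

Lemma lim_le (V : normedModType C) (u : nat -> V) l (c : C) : 0 <= c ->
  u @ \oo --> l -> (forall n, `|u n| <= c) -> `|l| <= c.
Proof.
move=> c0 h hc; apply/ler_addgt0Pr => e e0.
have [n0 /(_ n0 (leqnn _)) hn] := cvgC_P h e0.
rewrite -[l](subrK (u n0)) (le_trans (ler_normD _ _)) // addrC lerD //.
by rewrite distrC ltW.
Qed.


Lemma bdP H K (f : H -> K) : bd f ->
  exists2 c : C, 0 <= c & forall x, `|f x| <= c * `|x|.
Proof.
move=> [_ [c h]]; exists `|c| => // x; apply: le_trans (h x) _.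
have h0 : 0 <= c * `|x| by apply: le_trans (h x).
by rewrite -(ger0_norm h0) normrM normr_id.
Qed.

Section Lin.
Variables (H K : hilbert R) (f : H -> K) (bf : bd f).
Lemma lopP c x y : f (c *: x + y) = c *: f x + f y. Proof. exact: bf.1. Qed.
Lemma lopD x y : f (x + y) = f x + f y.
Proof. by have := lopP 1 x y; rewrite !scale1r. Qed.
Lemma lop0 : f 0 = 0.
Proof. by apply: (@addrI _ (f 0)); rewrite -lopD !addr0. Qed.
Lemma lopZ c x : f (c *: x) = c *: f x.
Proof. by have := lopP c x 0; rewrite lop0 !addr0. Qed.
Lemma lopN x : f (- x) = - f x. Proof. by rewrite -scaleN1r lopZ scaleN1r. Qed.
Lemma lopB x y : f (x - y) = f x - f y. Proof. by rewrite lopD lopN. Qed.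
Lemma lop_sum I r (P : pred I) F :
  f (\sum_(i <- r | P i) F i) = \sum_(i <- r | P i) f (F i).
Proof. by apply: (big_morph f); [exact: lopD|exact: lop0]. Qed.
Lemma lop_cvg u l : u @ \oo --> l -> (fun n => f (u n)) @ \oo --> f l.
Proof.
move=> h; have [c c0 hc] := bdP bf; apply: cvgC_ex => e e0.
have c1 : 0 < c + 1 by rewrite ltr_wpDl.
have [n0 hn] := cvgC_P h (divr_gt0 e0 c1); exists n0 => n /hn h'.
rewrite -lopB (le_lt_trans (hc _)) //; rewrite ltr_pdivlMr // in h'.
by apply: le_lt_trans h'; rewrite mulrC ler_wpM2l // lerDl.
Qed.
End Lin.

Lemma bd_intro H K (f : H -> K) (c : C) :
  (forall a x y, f (a *: x + y) = a *: f x + f y) ->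
  (forall x, `|f x| <= c * `|x|) -> bd f.
Proof. by move=> h hc; split; [exact: h|exists c]. Qed.

Lemma bd_id H : bd (idfun : H -> H).
Proof. by apply: (bd_intro (c := 1)) => // x; rewrite mul1r. Qed.
Lemma bd_0 H K : bd (0 : H -> K).
Proof. by apply: (bd_intro (c := 0)) => [a x y|x] /=; rewrite ?scaler0 ?addr0 // normr0 mul0r. Qed.
Lemma bd_comp H K L (f : K -> L) (g : H -> K) :
  bd f -> bd g -> bd (f \o g).
Proof.
move=> bf bg; have [c c0 hc] := bdP bf; have [d d0 hd] := bdP bg.
apply: (bd_intro (c := c * d)) => [a x y|x] /=; first by rewrite (lopP bg) (lopP bf).
by apply: le_trans (hc _) _; rewrite -mulrA ler_wpM2l.
Qed.
Lemma bd_add H K (f g : H -> K) : bd f -> bd g -> bd (f + g).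
Proof.
move=> bf bg; have [c c0 hc] := bdP bf; have [d d0 hd] := bdP bg.
apply: (bd_intro (c := c + d)) => [a x y|x] /=.
  by rewrite !fctE (lopP bg) (lopP bf) scalerDr addrACA.
by rewrite !fctE mulrDl (le_trans (ler_normD _ _)) // lerD.
Qed.
Lemma bd_scale H K (f : H -> K) c : bd f -> bd (c *: f).
Proof.
move=> bf; have [d d0 hd] := bdP bf.
apply: (bd_intro (c := `|c| * d)) => [a x y|x] /=.
  by rewrite !fctE (lopP bf) scalerDr !scalerA (mulrC c).
by rewrite !fctE normrZ -mulrA ler_wpM2l.
Qed.
Lemma bd_opp H K (f : H -> K) : bd f -> bd (- f).
Proof.
move=> bf; have -> : - f = (-1) *: f by apply: funext => x; rewrite !fctE scaleN1r.
exact: bd_scale.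
Qed.
Lemma bd_sub H K (f g : H -> K) : bd f -> bd g -> bd (f - g).
Proof. by move=> bf bg; apply: bd_add => //; apply: bd_opp. Qed.
Lemma bd_sum H K I r (P : pred I) (F : I -> H -> K) :
  (forall i, P i -> bd (F i)) -> bd (\sum_(i <- r | P i) F i).
Proof. by move=> h; apply: big_ind => //; [exact: bd_0|exact: bd_add]. Qed.

Lemma bd_rank1 H K (k : K) (h : H) : bd (fun x : H => '[x, h] *: k).
Proof.
apply: (bd_intro (c := `|h| * `|k|)) => [a x y|x].
  by rewrite dotDl dotZl scalerDl scalerA.
by rewrite normrZ mulrAC ler_wpM2r // mulrC dot_CS.
Qed.

Lemma op_ext_dense H K (f g : H -> K) (D : set H) : bd f -> bd g ->
  dense D -> (forall x, D x -> f x = g x) -> f = g.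
Proof.
move=> bf bg /denseP dD h; apply: funext => x; apply/eqP; rewrite -subr_eq0.
have b := bd_sub bf bg; have [c c0 hc] := bdP b.
rewrite -normr_eq0 eq_le normr_ge0 andbT; apply/ler_addgt0Pr => e e0.
have c1 : 0 < c + 1 by rewrite ltr_wpDl.
have [s Ds xs] := dD x _ (divr_gt0 e0 c1).
have -> : f x - g x = (f - g) (x - s).
  by rewrite (lopB b) !fctE (h _ Ds) subrr subr0.
rewrite add0r (le_trans (hc _)) //; rewrite ltr_pdivlMr // in xs.
by apply: le_trans (ltW xs); rewrite mulrC ler_wpM2l // lerDl.
Qed.

Lemma op_ext_span H K (f g : H -> K) (S : set H) : bd f -> bd g ->
  dense (span S) -> (forall x, S x -> f x = g x) -> f = g.
Proof.
move=> bf bg dD h; apply: op_ext_dense dD _ => //.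
apply: (span_ind (Q := fun x => f x = g x)); first by rewrite !lop0.
by move=> c x y Sx e; rewrite (lopP bf) (lopP bg) h // e.
Qed.

Lemma riesz H (f : H -> C) (c : C) : 0 <= c ->
  (forall a x y, f (a *: x + y) = a * f x + f y) ->
  (forall x, `|f x| <= c * `|x|) -> exists z, forall x, f x = '[x, z].
Proof.
move=> c0 fl fc; have [eo eu ed] := onbP H; set e := onb H in eo eu ed.
have f0 : f 0 = 0 by have := fl (-1) 0 0; rewrite scaler0 addr0 mulN1r addNr.
have fZ a x : f (a *: x) = a * f x by rewrite -[a *: x]addr0 fl f0 addr0.
have fD x y : f (x + y) = f x + f y by rewrite -[x in LHS]scale1r fl mul1r.
have fS n (F : 'I_n -> H) : f (\sum_(i < n) F i) = \sum_(i < n) f (F i).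
  by apply: (big_morph f).
have fe i (z : C) : z * f (e i) * '[e i, e i] = z * f (e i).
  by have [h|->] := eu i; [move/dot_eq0: (h) ->; rewrite f0 !mulr0 mul0r|rewrite mulr1].
pose S n : C := \sum_(i < n) `|f (e i)| ^+ 2.
have S0 n : 0 <= S n by apply: sumr_ge0 => i _; rewrite exprn_ge0.
have oo i j : i != j -> '[(f (e i))^* *: e i, (f (e j))^* *: e j] = 0.
  by move=> /eo h; rewrite dotZl dotZr h !mulr0.
have nn i : `|(f (e i))^* *: e i| ^+ 2 = `|f (e i)| ^+ 2.
  by rewrite -hdot_norm dotZl dotZr conjCK mulrA fe mulrC normCK.
(* Testing f on the partial sum y gives f y = |y|^2 = S n, so S n is at most c times its own square
   root. *)
have bS n : S n <= c ^+ 2.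
  pose y := \sum_(i < n) (f (e i))^* *: e i.
  have fy : f y = S n.
    by rewrite /y fS; apply: eq_bigr => i _; rewrite fZ mulrC normCK.
  have yy : `|y| ^+ 2 = S n.
    rewrite /y -(big_mkord xpredT (fun i => (f (e i))^* *: e i)) pyth_sum ?iota_uniq //.
    by rewrite big_mkord; apply: eq_bigr => i _; rewrite nn.
  have := fc y; rewrite fy (ger0_norm (S0 n)) => h.
  have [->|Sn] := eqVneq (S n) 0; first by rewrite exprn_ge0.
  have Sn0 : 0 < S n by rewrite lt_neqAle eq_sym Sn S0.
  have : S n ^+ 2 <= c ^+ 2 * S n.
    by rewrite -{2}yy -exprMn ler_pXn2r ?nnegrE // mulr_ge0.
  by rewrite expr2 ler_pM2r.
have [z hz] : exists z : H, series (fun i => (f (e i))^* *: e i) @ \oo --> z.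
  by apply: (orth_series (c := c ^+ 2)) => // n; under eq_bigr do rewrite nn; exact: bS.
exists z => x.
have h1 := cvg_dotr (y := x) hz.
have h2 : (fun n => f (series (fun i => '[x, e i] *: e i) n)) @ \oo --> f x.
  have hx : series (fun i => '[x, e i] *: e i) @ \oo --> x by exact: onb_cvg.
  have cc : 0 < c + 1 by rewrite ltr_wpDl.
  apply: cvgC_ex => d d0; have [n0 hn] := cvgC_P hx (divr_gt0 d0 cc).
  exists n0 => n /hn h'; have -> : f (series (fun i => '[x, e i] *: e i) n) - f x =
      f (series (fun i => '[x, e i] *: e i) n - x).
    by rewrite fD -[- x]scaleN1r fZ mulN1r.
  rewrite ltr_pdivlMr // in h'; apply: le_lt_trans h'.
  by apply: le_trans (fc _) _; rewrite mulrC ler_wpM2l // lerDl.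
apply: (cvg_uniq h2).
have E : (fun n => f (series (fun i => '[x, e i] *: e i) n)) =
    (fun n => '[x, series (fun i => (f (e i))^* *: e i) n]); last first.
  rewrite E; exact: h1.
apply: funext => n; rewrite !seriesEord /= fS dot_sumr; apply: eq_bigr => i _.
by rewrite fZ dotZr conjCK mulrC.
Qed.

(** Riesz representation in the second variable. Adjoints, slices and the operator attached to the
    form of a weight all come from here. *)
Lemma lax H K (B : H -> K -> C) (c : C) : 0 <= c ->
  (forall a x y v, B (a *: x + y) v = a * B x v + B y v) ->
  (forall a x y u, B u (a *: x + y) = a^* * B u x + B u y) ->
  (forall u v, `|B u v| <= c * `|u| * `|v|) ->
  exists2 f : H -> K, bd f & forall u v, '[f u, v] = B u v.
Proof.
move=> c0 Bl Br Bc.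
have /choice[f hf] : forall u, exists z, forall v, (B u v)^* = '[v, z] :> C.
  move=> u; apply: (riesz (c := c * `|u|)); first by rewrite mulr_ge0.
    by move=> a x y; rewrite Br rmorphD rmorphM /= conjCK.
  by move=> x; rewrite norm_conjC.
have fE u v : '[f u, v] = B u v by rewrite dotC -hf conjCK.
exists f => //; apply: (bd_intro (c := c)) => [a x y|x].
  by apply: dot_ext => z; rewrite dotDl dotZl !fE Bl.
by apply: norm_le_dot => [|y]; rewrite ?mulr_ge0 // fE.
Qed.

Lemma adj_exists H K (f : H -> K) : bd f ->
  exists g, bd g /\ forall x y, '[f x, y] = '[x, g y].
Proof.
move=> bf; have [c c0 hc] := bdP bf.
have [|a x y v|a x y u|u v|g bg hg] := @lax K H (fun y x => '[y, f x]) c.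
- by [].
- by rewrite dotDl dotZl.
- by rewrite (lopP bf) dotDr dotZr.
- by apply: le_trans (dot_CS _ _) _; rewrite -mulrA mulrCA ler_wpM2l.
by exists g; split=> // x y; rewrite dotC -hg -dotC.
Qed.

Lemma adj_spec H K (f : H -> K) : bd f ->
  bd (adj f) /\ forall x y, '[f x, y] = '[x, adj f y].
Proof. by move=> bf; exact: (xgetPex _ (adj_exists bf)). Qed.

Lemma bd_adj H K (f : H -> K) : bd f -> bd (adj f).
Proof. by move=> /adj_spec[]. Qed.
Lemma adjr H K (f : H -> K) x y : bd f -> '[f x, y] = '[x, adj f y].
Proof. by move=> /adj_spec[_]; apply. Qed.
Lemma adjl H K (f : H -> K) x y : bd f -> '[adj f y, x] = '[y, f x].
Proof. by move=> bf; rewrite dotC -adjr // -dotC. Qed.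

Lemma op_ext H K (f g : H -> K) : (forall x y, '[f x, y] = '[g x, y]) -> f = g.
Proof. by move=> h; apply: funext => x; apply: dot_ext. Qed.

Lemma adj_uniq H K (f : H -> K) (g : K -> H) : bd f ->
  (forall x y, '[f x, y] = '[x, g y]) -> adj f = g.
Proof. by move=> bf h; apply: op_ext => x y; rewrite adjl // dotC h -dotC. Qed.

Lemma adjK H K (f : H -> K) : bd f -> adj (adj f) = f.
Proof. by move=> bf; apply: adj_uniq => [|x y]; [exact: bd_adj|rewrite adjl]. Qed.
Lemma adj_comp H K L (f : K -> L) (g : H -> K) : bd f -> bd g ->
  adj (f \o g) = adj g \o adj f.
Proof. by move=> bf bg; apply: adj_uniq => [|x y] /=; [exact: bd_comp|rewrite !adjr]. Qed.
Lemma adj_idfun H : adj (idfun : H -> H) = idfun.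
Proof. by apply: adj_uniq => //; exact: bd_id. Qed.
Lemma adj_add H K (f g : H -> K) : bd f -> bd g ->
  adj (f + g) = adj f + adj g.
Proof.
move=> bf bg; apply: adj_uniq => [|x y]; first exact: bd_add.
by rewrite !fctE dotDl dotDr !adjr.
Qed.
Lemma adj_scale H K (f : H -> K) c : bd f -> adj (c *: f) = c^* *: adj f.
Proof.
move=> bf; apply: adj_uniq => [|x y]; first exact: bd_scale.
by rewrite !fctE dotZl dotZr conjCK adjr.
Qed.
Lemma adj_sub H K (f g : H -> K) : bd f -> bd g ->
  adj (f - g) = adj f - adj g.
Proof.
move=> bf bg; apply: adj_uniq => [|x y]; first exact: bd_sub.
by rewrite !fctE dotBl dotBr !adjr.
Qed.
Lemma adj_rank1 H K (k : K) (h : H) :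
  adj (fun x : H => '[x, h] *: k) = (fun y : K => '[y, k] *: h).
Proof.
apply: adj_uniq => [|x y]; first exact: bd_rank1.
by rewrite dotZl dotZr -dotC mulrC.
Qed.

Section Unitary.
Variables (H K : hilbert R) (u : H -> K) (hu : unitary_op u).
Lemma un_bd : bd u. Proof. by case: hu. Qed.
Lemma unK x : adj u (u x) = x. Proof. by case: hu => _ h _; exact: (congr1 (@^~ x) h). Qed.
Lemma unVK x : u (adj u x) = x. Proof. by case: hu => _ _ h; exact: (congr1 (@^~ x) h). Qed.
Lemma un_dot x y : '[u x, u y] = '[x, y].
Proof. by rewrite adjr ?unK //; exact: un_bd. Qed.
Lemma un_dotV x y : '[adj u x, adj u y] = '[x, y].
Proof. by rewrite adjl ?unVK //; exact: un_bd. Qed.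
Lemma un_adj : unitary_op (adj u).
Proof.
have bu := un_bd; split; first exact: bd_adj; rewrite adjK //.
  by apply: funext => x /=; exact: unVK.
by apply: funext => x /=; exact: unK.
Qed.
End Unitary.

Lemma iso_adjK H K (u : H -> K) x : bd u ->
  (forall x y, '[u x, u y] = '[x, y]) -> adj u (u x) = x.
Proof. by move=> bu h; apply: dot_ext => z; rewrite adjl // h. Qed.

Lemma un_intro H K (u : H -> K) (v : K -> H) : bd u ->
  (forall x y, '[u x, u y] = '[x, y]) -> (forall y, u (v y) = y) -> unitary_op u.
Proof.
move=> bu h huv; have e x : adj u (u x) = x by exact: iso_adjK.
split; [exact: bu|by apply: funext => x; exact: e|apply: funext => x /=].
by rewrite -{1}(huv x) e huv.
Qed.

Lemma polar H (x y : H) : (4%:R : C) * '[x, y] =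
  '[x + y, x + y] - '[x - y, x - y] +
  'i * ('[x + 'i *: y, x + 'i *: y] - '[x - 'i *: y, x - 'i *: y]).
Proof.
rewrite !(dotDl, dotDr, dotNl, dotNr, dotZl, dotZr) conjCi.
have : 'i * 'i = -1 :> C by rewrite -expr2 sqrCi.
set i : C := 'i; set a : C := '[x, x]; set b : C := '[x, y]; set c : C := '[y, x].
set d : C := '[y, y] => ii.
transitivity (2%:R * (b + c) - 2%:R * (i * i) * (b - c)); last by ring.
by rewrite ii; ring.
Qed.

Lemma iso_dot H K (u : H -> K) : bd u -> (forall x, `|u x| = `|x|) ->
  forall x y, '[u x, u y] = '[x, y].
Proof.
move=> bu h x y; have four : (4%:R : C) != 0 by rewrite pnatr_eq0.
apply: (mulfI four); rewrite !polar -!(lopZ bu) -!(lopD bu) -!(lopB bu).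
by rewrite !hdot_norm !h.
Qed.

(* A map on generators that preserves inner products is the restriction of an
   isometry: the closure of the linear relation it spans is a graph. *)
Lemma iso_ext H K (I : Type) (a : I -> H) (b : I -> K) :
  (forall i j, '[a i, a j] = '[b i, b j]) -> dense (span (range a)) ->
  exists2 u : H -> K, bd u &
    (forall i, u (a i) = b i) /\ forall x y, '[u x, u y] = '[x, y].
Proof.
move=> ab /denseP dA.
pose Rl (h : H) (k : K) := exists n (c : 'I_n -> C) (i : 'I_n -> I),
  h = \sum_j c j *: a (i j) /\ k = \sum_j c j *: b (i j).
have Rnorm h k : Rl h k -> `|k| = `|h| :> C.
  move=> [n [c [i [-> ->]]]]; apply/eqP; rewrite -(eqrXn2 (n := 2)) // -!hdot_norm.
  apply/eqP; rewrite !dot_suml; apply: eq_bigr => p _; rewrite !dot_sumr.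
  by apply: eq_bigr => q _; rewrite !dotZl !dotZr ab.
have Rlin c h k h' k' : Rl h k -> Rl h' k' -> Rl (c *: h + h') (c *: k + k').
  move=> [n [d [i [-> ->]]]] [m [d' [i' [-> ->]]]].
  exists (n + m)%N, (fun j => match fintype.split j with inl j => c * d j | inr j => d' j end),
    (fun j => match fintype.split j with inl j => i j | inr j => i' j end).
  split; rewrite big_split_ord /= scaler_sumr; congr +%R; apply: eq_bigr => j _;
  by rewrite ?(unsplitK (inl j)) ?(unsplitK (inr j)) ?scalerA.
have Rspan h : span (range a) h -> exists k, Rl h k.
  move=> [n [c [v [hv ->]]]]; have /choice[i hi] : forall j, exists i, a i = v j.
    by move=> j; have [i _ e] := hv j; exists i.
  exists (\sum_j c j *: b (i j)), n, c, i; split=> //.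
  by apply: eq_bigr => j _; rewrite hi.
pose G (x : H) (y : K) := exists s : nat -> H * K, [/\ forall n, Rl (s n).1 (s n).2,
  (fun n => (s n).1) @ \oo --> x & (fun n => (s n).2) @ \oo --> y].
have Gex x : exists y, G x y.
  have /choice[s hs] : forall n, exists hk : H * K, Rl hk.1 hk.2 /\
      `|x - hk.1| < (n.+1%:R : C)^-1.
    move=> n; have n0 : 0 < (n.+1%:R : C)^-1 by rewrite invr_gt0 ltr0n.
    by have [h /Rspan[k r] xh] := dA x _ n0; exists (h, k).
  have hx : (fun n => (s n).1) @ \oo --> x.
    apply: cvgC_ex => e e0; have [n0 hn] := Cx_arch e0; exists n0 => n nn.
    by rewrite distrC; apply: lt_trans (hs n).2 _; exact: hn.
  have [y hy] : exists y : K, (fun n => (s n).2) @ \oo --> y.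
    apply: (cauchy_conv (u := fun n => (s n).2)) => e e0 /=; have e2 : 0 < e / 2 by rewrite divr_gt0 // ltr0n.
    have [n0 hn] := cvgC_P hx e2; exists n0 => m n mm mn.
    have -> : `|(s n).2 - (s m).2| = `|(s n).1 - (s m).1|.
      apply: Rnorm; have := Rlin (-1) _ _ _ _ (hs m).1 (hs n).1.
      by rewrite !scaleN1r ![- _ + _]addrC.
    rewrite -(subrKA x) (le_lt_trans (ler_normD _ _)) // [e]splitr ltrD //.
      by apply: hn; exact: leq_trans mn.
    by rewrite distrC; exact: hn.
  by exists y, s; split=> // n; exact: (hs n).1.
have Glin c x y x' y' : G x y -> G x' y' -> G (c *: x + x') (c *: y + y').
  move=> [s [s1 s2 s3]] [t [t1 t2 t3]].
  exists (fun n => (c *: (s n).1 + (t n).1, c *: (s n).2 + (t n).2)); split=> /=.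
  - by move=> n; exact: Rlin.
  - by apply: cvgD => //; apply: (lop_cvg (bd_scale c (bd_id H))).
  - by apply: cvgD => //; apply: (lop_cvg (bd_scale c (bd_id K))).
have Gnorm x y : G x y -> `|y| = `|x|.
  move=> [s [s1 s2 s3]]; apply: (cvg_uniq (V := C) (cvg_norm s3)).
  have -> : (fun n => `|(s n).2|) = (fun n => `|(s n).1|) :> (nat -> C).
    by apply: funext => n; exact: Rnorm.
  exact: (cvg_norm s2).
have Guniq x y y' : G x y -> G x y' -> y = y'.
  move=> g g'; apply/eqP; rewrite -subr_eq0 -normr_eq0.
  have := Gnorm _ _ (Glin (-1) _ _ _ _ g' g).
  by rewrite !scaleN1r addNr addrC => ->; rewrite normr0.
have /choice[u hu] := Gex.
have bu : bd u.
  apply: (bd_intro (c := 1)) => [c x y|x]; last by rewrite mul1r (Gnorm _ _ (hu x)).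
  exact: Guniq (hu _) (Glin _ _ _ _ _ (hu x) (hu y)).
exists u => //; split; last by apply: iso_dot => // x; exact: Gnorm.
move=> i; apply: Guniq (hu _) _; exists (fun=> (a i, b i)); split=> [_||] /=.
- exists 1%N, (fun=> 1), (fun=> i); by rewrite !big_ord1 !scale1r.
- exact: cvg_cst.
- exact: cvg_cst.
Qed.

End Limits.

#[global] Hint Resolve bd_id bd_0 bd_comp bd_add bd_sub bd_opp bd_scale bd_rank1 bd_adj un_bd : core.

Local Notation ampl x L := (tensor_op x (idfun : L -> L)).
Local Notation ampr L x := (tensor_op (idfun : L -> L) x).

(** * Tensor products of spaces and operators, flips, associators, legs *)

Section Tensor.
Context {R : realType} {tens : tensor_model R}.
Implicit Types (H K L : hilbert R).
Local Notation C := (Cx R).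

Lemma pure_dot H K (a a' : H) (b b' : K) :
  '[a ⊗v b, a' ⊗v b'] = '[a, a'] * '[b, b'].
Proof. exact: tpure_dot. Qed.
Lemma pureDl H K (a a' : H) (b : K) : (a + a') ⊗v b = a ⊗v b + a' ⊗v b.
Proof. exact: linearDl. Qed.
Lemma pureDr H K (a : H) (b b' : K) : a ⊗v (b + b') = a ⊗v b + a ⊗v b'.
Proof. exact: linearDr. Qed.
Lemma pureZl H K c (a : H) (b : K) : (c *: a) ⊗v b = c *: (a ⊗v b).
Proof. exact: linearZl_LR. Qed.
Lemma pureZr H K c (a : H) (b : K) : a ⊗v (c *: b) = c *: (a ⊗v b).
Proof. exact: linearZr_LR. Qed.
Lemma pure0l H K (b : K) : (0 : H) ⊗v b = 0. Proof. exact: linear0l. Qed.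
Lemma pure0r H K (a : H) : a ⊗v (0 : K) = 0. Proof. exact: linear0r. Qed.

Lemma pure_norm H K (a : H) (b : K) : `|a ⊗v b| = `|a| * `|b| :> C.
Proof.
by apply/eqP; rewrite -(eqrXn2 (n := 2)) ?mulr_ge0 // exprMn -!hdot_norm pure_dot.
Qed.

Lemma bd_pl H K (v : K) : bd (fun h : H => h ⊗v v).
Proof.
apply: (bd_intro (c := `|v|)) => [a x y|x]; first by rewrite pureDl pureZl.
by rewrite pure_norm mulrC.
Qed.
Lemma bd_pr H K (v : H) : bd (fun k : K => v ⊗v k).
Proof.
apply: (bd_intro (c := `|v|)) => [a x y|x]; first by rewrite pureDr pureZr.
by rewrite pure_norm.
Qed.
Hint Resolve bd_pl bd_pr : core.

Lemma pure_total H K : dense (span (range (fun p : H * K => p.1 ⊗v p.2))).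
Proof.
apply: dense_sub (@tpure_total _ _ _ (htens H K)) => z [n [c [v [h ->]]]].
apply: span_sum => i _; apply: spanZ; apply: span_gen.
by have [x [y ->]] := h i; exists (x, y).
Qed.

Lemma dense_span_ext0 H (S : set H) z : dense (span S) ->
  (forall s, S s -> '[s, z] = 0) -> z = 0.
Proof.
move=> dS h; apply: (dense_orth0 dS).
apply: (span_ind (Q := fun s => '[s, z] = 0)); first by rewrite dot0l.
by move=> c x y /h hx hy; rewrite dotDl dotZl hx hy mulr0 addr0.
Qed.

Lemma tdot_ext H K (x y : H ⊗ K) :
  (forall a b, '[x, a ⊗v b] = '[y, a ⊗v b]) -> x = y.
Proof.
move=> h; apply/eqP; rewrite -subr_eq0; apply/eqP.
apply: (dense_span_ext0 (@pure_total H K)) => _ [[a b] _ <-] /=.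
by rewrite dotBr dotC h -dotC subrr.
Qed.

Lemma tens_ext H K L (f g : H ⊗ K -> L) : bd f -> bd g ->
  (forall a b, f (a ⊗v b) = g (a ⊗v b)) -> f = g.
Proof.
move=> bf bg h; apply: op_ext_span (@pure_total H K) _ => // _ [[a b] _ <-] /=.
exact: h.
Qed.

Lemma top_ext H K H' K' (f g : H ⊗ H' -> K ⊗ K') : bd f -> bd g ->
  (forall a b c d, '[f (a ⊗v b), c ⊗v d] = '[g (a ⊗v b), c ⊗v d]) -> f = g.
Proof.
by move=> bf bg h; apply: tens_ext => // a b; apply: tdot_ext => c d; exact: h.
Qed.

(** The partial inner product a ⊗ b |-> <b, k> a; [lsl] is its mirror image. Expanding one leg along
    an orthonormal basis through these maps turns identities on tensor products into series. *)
Definition rsl H K (k : K) : H ⊗ K -> H := adj (fun h : H => h ⊗v k).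
Definition lsl H K (h : H) : H ⊗ K -> K := adj (fun k : K => h ⊗v k).
Lemma bd_rsl H K (k : K) : bd (rsl (H := H) k).
Proof. by rewrite /rsl; auto. Qed.
Lemma bd_lsl H K (h : H) : bd (lsl (K := K) h).
Proof. by rewrite /lsl; auto. Qed.
Hint Resolve bd_rsl bd_lsl : core.
Lemma rslE H K (k : K) (z : H ⊗ K) h : '[rsl k z, h] = '[z, h ⊗v k].
Proof. exact: adjl. Qed.
Lemma lslE H K (h : H) (z : H ⊗ K) k : '[lsl h z, k] = '[z, h ⊗v k].
Proof. exact: adjl. Qed.
Lemma rsl_pure H K (a : H) (b k : K) : rsl k (a ⊗v b) = '[b, k] *: a.
Proof. by apply: dot_ext => z; rewrite rslE pure_dot dotZl mulrC. Qed.
Lemma lsl_pure H K (a h : H) (b : K) : lsl h (a ⊗v b) = '[a, h] *: b.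
Proof. by apply: dot_ext => z; rewrite lslE pure_dot dotZl. Qed.

Lemma flip_spec H K : bd (@flip _ _ H K) /\
  forall v w, @flip _ _ H K (v ⊗v w) = w ⊗v v.
Proof.
have [|u bu [h _]] := @iso_ext _ (H ⊗ K) (K ⊗ H) (H * K)%type
  (fun p => p.1 ⊗v p.2) (fun p => p.2 ⊗v p.1) _ (@pure_total H K).
  by move=> i j; rewrite !pure_dot mulrC.
apply: (xgetPex (fun=> 0) (P := [set z : H ⊗ K -> K ⊗ H | bd z /\
    forall v w, z (v ⊗v w) = w ⊗v v])).
by exists u; split=> // v w; exact: (h (v, w)).
Qed.
Lemma bd_flip H K : bd (@flip _ _ H K). Proof. by case: (flip_spec H K). Qed.
Lemma flipE H K (v : H) (w : K) : flip (v ⊗v w) = w ⊗v v.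
Proof. by case: (flip_spec H K) => _ ->. Qed.
Hint Resolve bd_flip : core.
Lemma flipK H K (z : H ⊗ K) : flip (flip z) = z.
Proof.
have -> // : @flip _ _ K H \o @flip _ _ H K = idfun -> flip (flip z) = z.
  by move=> /(congr1 (@^~ z)).
by apply: tens_ext; auto => a b /=; rewrite !flipE.
Qed.
Lemma flip_adj H K : adj (@flip _ _ H K) = @flip _ _ K H.
Proof.
have h : adj (@flip _ _ H K) \o @flip _ _ H K \o @flip _ _ K H = @flip _ _ K H.
  apply: tens_ext; auto => a b /=; rewrite !flipE; apply: tdot_ext => c d.
  by rewrite adjl // flipE !pure_dot mulrC.
by apply: funext => z; rewrite -[in RHS]h /= flipK.
Qed.

Lemma assoc_total H K L :
  dense (span (range (fun p : H * K * L => (p.1.1 ⊗v p.1.2) ⊗v p.2))).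
Proof.
apply/denseP => x e e0; have e2 : 0 < e / 2 by rewrite divr_gt0 // ltr0n.
have [s hs xs] := (denseP _).1 (@pure_total (H ⊗ K) L) x _ e2.
suff [t ht st] : exists2 t, span (range (fun p : H * K * L => (p.1.1 ⊗v p.1.2) ⊗v p.2)) t
    & `|s - t| < e / 2.
  exists t => //; rewrite -(subrKA s) (le_lt_trans (ler_normD _ _)) //.
  by rewrite [e]splitr ltrD.
move: (e / 2) e2 => {x e e0 xs} d d0; move: s hs d d0.
apply: span_ind => [d d0|c _ y [[z l] _ <-] IH d d0 /=].
  by exists 0; [exact: span0|rewrite subr0 normr0].
have d2 : 0 < d / 2 by rewrite divr_gt0 // ltr0n.
have [t ht yt] := IH _ d2.
have c1 : 0 < `|c| * `|l| + 1 :> C by rewrite ltr_wpDl ?mulr_ge0.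
have [w hw zw] := (denseP _).1 (@pure_total H K) z _ (divr_gt0 d2 c1).
exists (c *: (w ⊗v l) + t).
  apply: spanD => //; apply: spanZ; move: w hw {zw}.
  apply: span_ind => [|b _ w [[h k] _ <-] hw]; first by rewrite pure0l; exact: span0.
  rewrite pureDl pureZl; apply: spanD => //; apply: spanZ; apply: span_gen.
  by exists (h, k, l).
have -> : c *: (z ⊗v l) + y - (c *: (w ⊗v l) + t) = c *: ((z - w) ⊗v l) + (y - t).
  by rewrite -[- w]scaleN1r pureDl pureZl scaleN1r scalerBr opprD addrACA.
rewrite (le_lt_trans (ler_normD _ _)) // [d]splitr ltrD // normrZ pure_norm.
rewrite ltr_pdivlMr // in zw; apply: le_lt_trans zw.
by rewrite mulrCA ler_wpM2l // lerDl.
Qed.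

Lemma assoc_ex H K L : exists z : (H ⊗ K) ⊗ L -> H ⊗ (K ⊗ L),
  [/\ bd z, forall u v w, z ((u ⊗v v) ⊗v w) = u ⊗v (v ⊗v w) &
  forall x y, '[z x, z y] = '[x, y]].
Proof.
have [|u bu [h hd]] := @iso_ext _ ((H ⊗ K) ⊗ L) (H ⊗ (K ⊗ L)) (H * K * L)%type
  (fun p => (p.1.1 ⊗v p.1.2) ⊗v p.2) (fun p => p.1.1 ⊗v (p.1.2 ⊗v p.2)) _
  (@assoc_total H K L).
  by move=> i j; rewrite !pure_dot mulrA.
by exists u; split=> // x v w; exact: (h (x, v, w)).
Qed.
Lemma assoc_spec H K L : bd (@assoc _ _ H K L) /\
  forall u v w, @assoc _ _ H K L ((u ⊗v v) ⊗v w) = u ⊗v (v ⊗v w).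
Proof.
apply: (xgetPex (fun=> 0) (P := [set z : (H ⊗ K) ⊗ L -> H ⊗ (K ⊗ L) | bd z /\
    forall u v w, z ((u ⊗v v) ⊗v w) = u ⊗v (v ⊗v w)])).
by have [u [b h _]] := assoc_ex H K L; exists u.
Qed.
Lemma bd_assoc H K L : bd (@assoc _ _ H K L).
Proof. by case: (assoc_spec H K L). Qed.
Hint Resolve bd_assoc : core.
Lemma assocE H K L (u : H) (v : K) (w : L) : assoc ((u ⊗v v) ⊗v w) = u ⊗v (v ⊗v w).
Proof. by case: (assoc_spec H K L) => _ ->. Qed.
Lemma assoc_ext H K L (V : hilbert R) (f g : (H ⊗ K) ⊗ L -> V) : bd f -> bd g ->
  (forall a b c, f ((a ⊗v b) ⊗v c) = g ((a ⊗v b) ⊗v c)) -> f = g.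
Proof.
move=> bf bg h; apply: op_ext_span (@assoc_total H K L) _ => // _ [[[a b] c] _ <-] /=.
exact: h.
Qed.
Lemma assoc_dot H K L x y : '[@assoc _ _ H K L x, assoc y] = '[x, y].
Proof.
have [u [b h hd]] := assoc_ex H K L.
have -> : @assoc _ _ H K L = u by apply: assoc_ext; auto => a c d; rewrite assocE h.
exact: hd.
Qed.
Lemma adj_assocE H K L (u : H) (v : K) (w : L) :
  adj (@assoc _ _ H K L) (u ⊗v (v ⊗v w)) = (u ⊗v v) ⊗v w.
Proof. by rewrite -assocE iso_adjK // => x y; rewrite assoc_dot. Qed.

Section Decomp.
Variables (H K : hilbert R) (f : nat -> K) (hf : is_onb f).

Lemma rsl_unit k (z : H ⊗ K) h : '[rsl (f k) z, h] * '[f k, f k] = '[rsl (f k) z, h].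
Proof.
have [_ /(_ k)[e|->] _] := hf; last by rewrite mulr1.
by rewrite e mulr0 rslE (dot_eq0 e) pure0r dot0r.
Qed.

Lemma rslf_norm k (z : H ⊗ K) :
  `|rsl (f k) z ⊗v f k| ^+ 2 = `|rsl (f k) z| ^+ 2 :> C.
Proof. by rewrite -!hdot_norm pure_dot rsl_unit. Qed.

Lemma pure_orth (a : nat -> H) i j : i != j -> '[a i ⊗v f i, a j ⊗v f j] = 0.
Proof. by have [h _ _] := hf; move=> /h e; rewrite pure_dot e mulr0. Qed.

Lemma tens_bessel (z : H ⊗ K) n : \sum_(i < n) `|rsl (f i) z| ^+ 2 <= `|z| ^+ 2 :> C.
Proof.
set S : C := \sum_(i < n) _.
have S0 : 0 <= S by apply: sumr_ge0 => i _; rewrite exprn_ge0.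
have [p pE] : exists p : H ⊗ K, p = \sum_(i < n) rsl (f i) z ⊗v f i.
  by exists (\sum_(i < n) rsl (f i) z ⊗v f i).
have zp : '[z, p] = S.
  by rewrite pE dot_sumr; apply: eq_bigr => i _; rewrite -rslE hdot_norm.
have pz : '[p, z] = S by rewrite dotC zp geC0_conj.
have pp : '[p, p] = S.
  rewrite hdot_norm pE -(big_mkord xpredT (fun i => rsl (f i) z ⊗v f i)) pyth_sum ?iota_uniq //.
    by rewrite big_mkord; apply: eq_bigr => i _; rewrite rslf_norm.
  by move=> i j; exact: (pure_orth (fun i => rsl (f i) z)).
have := dot_ge0 (z - p); rewrite dotBl !dotBr zp pz pp subrr subr0 subr_ge0.
by rewrite hdot_norm.
Qed.

Lemma tens_cvg (z : H ⊗ K) : series (fun k => rsl (f k) z ⊗v f k) @ \oo --> z.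
Proof.
have [l hl] : exists l : H ⊗ K, series (fun k => rsl (f k) z ⊗v f k) @ \oo --> l.
  apply: (orth_series (c := `|z| ^+ 2)) => [i j|n].
    exact: (pure_orth (fun i => rsl (f i) z)).
  under eq_bigr do rewrite rslf_norm; exact: tens_bessel.
suff zl : z = l by rewrite [X in _ --> X]zl.
have hj j a : '[z, a ⊗v f j] = '[l, a ⊗v f j].
  have h := cvg_dotl (y := a ⊗v f j) hl.
  apply: (cvg_uniq _ h); apply: cvgC_ex => d d0; exists j.+1 => n jn.
  rewrite seriesEord /= dot_suml (bigD1 (Ordinal jn)) //= big1 => [|i ij].
    by rewrite addr0 pure_dot rsl_unit rslE subrr normr0.
  by have [h' _ _] := hf; rewrite pure_dot h' ?mulr0.
apply: tdot_ext => a b; apply/eqP; rewrite -subr_eq0 -dotBl -lslE.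
have -> : lsl a (z - l) = 0; last by rewrite dot0l.
by have [e1 e2 e3] := hf; apply: (onb_ext e3) => i; rewrite lslE dotBl hj subrr.
Qed.

Lemma tens_parseval (z z' : H ⊗ K) :
  series (fun k => '[rsl (f k) z, rsl (f k) z'] : C) @ \oo --> ('[z, z'] : C).
Proof.
have -> : series (fun k => '[rsl (f k) z, rsl (f k) z'] : C) =
    (fun n => '[series (fun k => rsl (f k) z ⊗v f k) n, z']).
  apply: funext => n; rewrite !seriesEord /= dot_suml; apply: eq_bigr => i _.
  by rewrite dotC rslE -dotC.
exact: cvg_dotl (@tens_cvg z).
Qed.

(** The operator x ⊗ 1 is defined along the basis f of the right leg by z |-> Σ_k x (z_k) ⊗ f_k with
    z_k = [rsl (f k) z]. The terms are orthogonal, so the series converges with the bound of x. *)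
Lemma tens_left_ex (K0 : hilbert R) (x : H -> K0) : bd x ->
  exists2 Z : H ⊗ K -> K0 ⊗ K, bd Z & forall a b, Z (a ⊗v b) = x a ⊗v b.
Proof.
move=> bx; have [c c0 hc] := bdP bx; have [fo fu fd] := hf.
have hn k z : `|x (rsl (f k) z) ⊗v f k| ^+ 2 <= c ^+ 2 * `|rsl (f k) z| ^+ 2 :> C.
  rewrite -exprMn ler_pXn2r ?nnegrE // ?mulr_ge0 // pure_norm.
  apply: le_trans (hc _); rewrite ler_piMr // -(ler_pXn2r (n := 2)) ?nnegrE //.
  by rewrite -hdot_norm expr1n; have [->|->] := fu k.
have hS z n : \sum_(k < n) `|x (rsl (f k) z) ⊗v f k| ^+ 2 <= (c * `|z|) ^+ 2 :> C.
  apply: (le_trans (y := \sum_(k < n) c ^+ 2 * `|rsl (f k) z| ^+ 2)).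
    by apply: ler_sum => k _; exact: hn.
  by rewrite -mulr_sumr exprMn ler_wpM2l ?exprn_ge0 // tens_bessel.
have oo z i j : i != j ->
    '[x (rsl (f i) z) ⊗v f i, x (rsl (f j) z) ⊗v f j] = 0.
  by move=> /fo e; rewrite pure_dot e mulr0.
have /choice[Z hZ] : forall z, exists l : K0 ⊗ K,
    series (fun k => x (rsl (f k) z) ⊗v f k) @ \oo --> l.
  by move=> z; apply: (orth_series (c := (c * `|z|) ^+ 2)); [exact: oo|exact: hS].
have bZ : bd Z.
  apply: (bd_intro (c := c)) => [a z w|z].
    have h := cvgD (lop_cvg (bd_scale a (bd_id _)) (hZ z)) (hZ w).
    apply: (cvg_uniq (hZ _)).
    have E : series (fun k => x (rsl (f k) (a *: z + w)) ⊗v f k) =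
      (fun n => a *: series (fun k => x (rsl (f k) z) ⊗v f k) n) \+
      series (fun k => x (rsl (f k) w) ⊗v f k); last by rewrite E; exact: h.
    apply: funext => n /=; rewrite !seriesEord /= scaler_sumr -big_split /=.
    by apply: eq_bigr => i _; rewrite (lopP (bd_rsl _ _)) (lopP bx) pureDl pureZl.
  apply: (lim_le _ (hZ z)) => [|n]; first by rewrite mulr_ge0.
  rewrite -(ler_pXn2r (n := 2)) ?nnegrE ?mulr_ge0 // seriesEnat /=.
  by rewrite (pyth_sum _ (oo z)) ?iota_uniq // big_mkord; exact: hS.
exists Z => // a b; apply: (cvg_uniq (hZ _)).
have h : series (fun i => '[b, f i] *: f i) @ \oo --> b by exact: onb_cvg.
have := lop_cvg (bd_pr _ (x a)) h.
set u := (X in X @ _ --> _); set v := (X in _ -> X @ _ --> _).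
suff -> : v = u by [].
apply: funext => n; rewrite /u /v !seriesEord /= (lop_sum (bd_pr _ _)).
by apply: eq_bigr => i _; rewrite rsl_pure (lopZ bx) pureZl pureZr.
Qed.

End Decomp.

Lemma tensor_spec H K H' K' (x : H -> K) (y : H' -> K') :
  bd x -> bd y ->
  bd (tensor_op x y) /\ forall v w, tensor_op x y (v ⊗v w) = x v ⊗v y w.
Proof.
move=> bx by_; apply: (xgetPex (fun=> 0) (P := [set z : H ⊗ H' -> K ⊗ K' |
  bd z /\ forall v w, z (v ⊗v w) = x v ⊗v y w])).
have [X bX hX] := tens_left_ex (onbP H') bx.
have [Y bY hY] := tens_left_ex (onbP K) by_.
(* x ⊗ y is (1 ⊗ y)(x ⊗ 1), and 1 ⊗ y is y ⊗ 1 between two flips. *)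
exists (@flip _ _ K' K \o Y \o @flip _ _ K H' \o X); split; first by auto 8.
by move=> v w /=; rewrite hX flipE hY flipE.
Qed.
Lemma bd_tensor H K H' K' (x : H -> K) (y : H' -> K') :
  bd x -> bd y -> bd (tensor_op x y).
Proof. by move=> bx by_; case: (tensor_spec bx by_). Qed.
Hint Resolve bd_tensor : core.
Lemma tensorE H K H' K' (x : H -> K) (y : H' -> K') v w :
  bd x -> bd y -> tensor_op x y (v ⊗v w) = x v ⊗v y w.
Proof. by move=> bx by_; case: (tensor_spec bx by_) => _ ->. Qed.
Lemma tensor_comp H K L H' K' L' (x : K -> L) (x' : H -> K) (y : K' -> L') (y' : H' -> K') :
  bd x -> bd y -> bd x' -> bd y' ->
  tensor_op x y \o tensor_op x' y' = tensor_op (x \o x') (y \o y').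
Proof.
by move=> *; apply: tens_ext; auto => a b /=; rewrite !tensorE; auto.
Qed.
Lemma adj_tensor H K H' K' (x : H -> K) (y : H' -> K') :
  bd x -> bd y -> adj (tensor_op x y) = tensor_op (adj x) (adj y).
Proof.
move=> bx by_; apply: top_ext; auto => a b c d.
by rewrite adjl ?tensorE ?pure_dot ?adjl; auto.
Qed.
Lemma tensor_id H K : ampr H (idfun : K -> K) = idfun.
Proof. by apply: tens_ext; auto => a b /=; rewrite tensorE. Qed.

Lemma bd_vslice2 H K H' K' (X : H ⊗ H' -> K ⊗ K') v w :
  bd X -> bd (vslice2 X v w).
Proof. by rewrite /vslice2; auto 8. Qed.
Lemma bd_vslice1 H K H' K' (X : H ⊗ H' -> K ⊗ K') v w :
  bd X -> bd (vslice1 X v w).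
Proof. by rewrite /vslice1; auto 8. Qed.
Lemma vslice2E H K H' K' (X : H ⊗ H' -> K ⊗ K') v w a b :
  '[vslice2 X v w a, b] = '[X (a ⊗v v), b ⊗v w].
Proof. exact: rslE. Qed.
Lemma vslice1E H K H' K' (X : H ⊗ H' -> K ⊗ K') v w a b :
  '[vslice1 X v w a, b] = '[X (v ⊗v a), w ⊗v b].
Proof. exact: lslE. Qed.

Lemma bd_leg23 L H K H' K' (X : H ⊗ H' -> K ⊗ K') : bd X ->
  bd (leg23 (L := L) X).
Proof. by move=> bX; rewrite /leg23; auto 8. Qed.
Lemma bd_leg13 L H K H' K' (X : H ⊗ H' -> K ⊗ K') : bd X ->
  bd (leg13 (L := L) X).
Proof. by move=> bX; rewrite /leg13; apply: bd_comp; auto; apply: bd_comp; auto; exact: bd_leg23. Qed.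
Lemma leg23E L H K H' K' (X : H ⊗ H' -> K ⊗ K') (a : L) b c a' b' c' : bd X ->
  '[leg23 X ((a ⊗v b) ⊗v c), (a' ⊗v b') ⊗v c'] = '[a, a'] * '[X (b ⊗v c), b' ⊗v c'].
Proof.
by move=> bX; rewrite /leg23 /= adjl // !assocE tensorE // pure_dot.
Qed.
Lemma leg13E L H K H' K' (X : H ⊗ H' -> K ⊗ K') a (b : L) c a' b' c' : bd X ->
  '[leg13 X ((a ⊗v b) ⊗v c), (a' ⊗v b') ⊗v c'] = '[b, b'] * '[X (a ⊗v c), a' ⊗v c'].
Proof.
move=> bX; have bl := bd_leg23 L bX.
rewrite /leg13 /= tensorE // flipE.
have bt : bd (ampl (@flip _ _ L K) K') by auto.
by rewrite adjr // adj_tensor // flip_adj adj_idfun tensorE // flipE leg23E.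
Qed.

End Tensor.

#[global] Hint Resolve bd_pl bd_pr bd_rsl bd_lsl bd_flip bd_assoc bd_tensor
  bd_vslice1 bd_vslice2 bd_leg23 bd_leg13 : core.

(** * Normal functionals and the σ-weak closure *)

Section Predual.
Context {R : realType}.
Implicit Types (H K L : hilbert R).
Local Notation C := (Cx R).

Lemma cvg_shiftC (V : normedModType C) (u : nat -> V) (l : V) n : u @ \oo --> l ->
  (fun m => u (n + m)%N) @ \oo --> l.
Proof.
move=> h; apply: cvgC_ex => e /(cvgC_P h)[n0 hn]; exists n0 => m mn.
by apply: hn; apply: leq_trans mn (leq_addl _ _).
Qed.

Lemma lim_ge0 (u : nat -> C) (l : C) : u @ \oo --> l -> (forall n, 0 <= u n) -> 0 <= l.
Proof.
move=> h u0; have E : (fun n => `|u n|) = u by apply: funext => n; rewrite ger0_norm.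
have h' : (fun n => `|u n|) @ \oo --> `|l| by exact: cvg_norm h.
by rewrite E in h'; rewrite (cvg_uniq h h').
Qed.

Lemma lim_leC (u v : nat -> C) (l m : C) : u @ \oo --> l -> v @ \oo --> m ->
  (forall n, u n <= v n) -> l <= m.
Proof.
move=> hu hv h; rewrite -subr_ge0; apply: (lim_ge0 (cvgB hv hu)) => n /=.
by rewrite !fctE subr_ge0.
Qed.

Lemma cvg_cplx (u : nat -> R) (l : R) : u @ \oo --> l -> (fun n => cplx (u n)) @ \oo --> (cplx l : C).
Proof.
move=> /cvgrPdist_lt h; apply: cvgC_ex => e /Cx_gt0[e' e0 ->].
have [n0 _ hn] := h e' e0; exists n0 => n /hn /=.
by rewrite distrC -cplxB normc_def /= expr0n addr0 sqrtr_sqr -cplx_lt.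
Qed.

Lemma bounded_series_cvg (u : nat -> C) (c : C) : (forall n, 0 <= u n) ->
  (forall n, \sum_(i < n) u i <= c) -> exists2 l : C, series u @ \oo --> l & l <= c.
Proof.
move=> u0 hc; pose v n : R := complex.Re (u n).
have uv n : u n = cplx (v n) by have [] := Cx_real (u0 n).
have v0 n : 0 <= v n by have [] := Cx_real (u0 n).
have c0 : 0 <= c by apply: le_trans (hc 0); rewrite big_ord0.
have [cE _] := Cx_real c0.
have inc : nondecreasing_seq (series v).
  by apply: nondecreasing_series => n _ _; exact: v0.
have bd : has_ubound (range (series v)).
  exists (complex.Re c) => _ [n _ <-]; rewrite seriesEord -cplx_le -cE cplx_sum.
  by under eq_bigr do rewrite -uv.
have E : series u = fun n => cplx (series v n).
  by apply: funext => n; rewrite !seriesEord cplx_sum; apply: eq_bigr.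
have h := cvg_cplx (nondecreasing_cvgn inc bd); rewrite -E in h.
exists (cplx (sup (range (series v)))) => //.
apply: (lim_leC h (cvg_cst c)) => n; rewrite seriesEord; exact: hc.
Qed.

Lemma partial_le_lim (u : nat -> C) (l : C) n : (forall n, 0 <= u n) -> series u @ \oo --> l ->
  \sum_(i < n) u i <= l.
Proof.
move=> u0 h; apply: (lim_leC (cvg_cst _) (cvg_shiftC n h)) => m.
by rewrite seriesEord /= big_split_ord /= lerDl sumr_ge0.
Qed.

Lemma sq_sum_bounded H (v : nat -> H) : square_summable v ->
  exists2 c : C, 0 <= c & forall n, \sum_(i < n) `|v i| ^+ 2 <= c.
Proof.
move=> h; have s0 n : 0 <= `|v n| ^+ 2 :> C by rewrite exprn_ge0.
have hl n := partial_le_lim n s0 h.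
by exists (lim (series (fun n => `|v n| ^+ 2) @ \oo)) => //;
  apply: le_trans (hl 0); rewrite big_ord0.
Qed.

Lemma sq_sum_intro H (v : nat -> H) (c : C) :
  (forall n, \sum_(i < n) `|v i| ^+ 2 <= c) -> square_summable v.
Proof.
move=> h; have [|l hl _] := @bounded_series_cvg (fun n => `|v n| ^+ 2) c _ h.
  by move=> n; rewrite exprn_ge0.
by apply/cvg_ex; exists l.
Qed.

Lemma sq_sum_map H K (f : H -> K) (v : nat -> H) : bd f -> square_summable v ->
  square_summable (fun n => f (v n)).
Proof.
move=> /bdP[c c0 hc] /sq_sum_bounded[d d0 hd]; apply: (sq_sum_intro (c := c ^+ 2 * d)) => n.
apply: (le_trans (y := \sum_(i < n) c ^+ 2 * `|v i| ^+ 2)).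
  by apply: ler_sum => i _; rewrite -exprMn ler_pXn2r ?nnegrE // mulr_ge0.
by rewrite -mulr_sumr ler_wpM2l ?exprn_ge0.
Qed.

Lemma pd_conj H K H' K' (w : (H' -> K') -> C) (a : H' -> H) (b : K' -> K) :
  predual w -> bd a -> bd b ->
  predual (fun x : H -> K => w (adj b \o x \o a)).
Proof.
move=> [v [u [hv hu hw]]] ba bb; exists (fun n => a (v n)), (fun n => b (u n)).
split; [exact: sq_sum_map|exact: sq_sum_map|move=> x bx].
have -> : (fun n => '[x (a (v n)), b (u n)]) = (fun n => '[(adj b \o x \o a) (v n), u n]).
  by apply: funext => n; rewrite /= adjl.
by apply: hw; auto.
Qed.

Lemma pd_fin H K n (v : nat -> H) (u : nat -> K) :
  predual (fun x : H -> K => \sum_(i < n) '[x (v i), u i]).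
Proof.
pose t (V : hilbert R) (z : nat -> V) i := if (i < n)%N then z i else 0.
have ht (V : hilbert R) (z : nat -> V) : square_summable (t V z).
  apply: (sq_sum_intro (c := \sum_(i < n) `|z i| ^+ 2)) => m.
  rewrite (big_ord_widen (maxn n m) (fun i => `|t V z i| ^+ 2)) ?leq_maxr //.
  rewrite [X in _ <= X](big_ord_widen (maxn n m) (fun i => `|z i| ^+ 2)) ?leq_maxl //.
  rewrite big_mkcond [X in _ <= X]big_mkcond; apply: ler_sum => i _ /=; rewrite /t.
  by case: ltnP => _; case: ltnP => _; rewrite ?normr0 ?expr0n ?exprn_ge0.
exists (t H v), (t K u); split; [exact: ht|exact: ht|move=> x bx]; apply: cvgC_ex => e e0.
exists n => m nm; rewrite seriesEord /=.
rewrite [X in _ - X](big_ord_widen m (fun i => '[x (v i), u i])) //.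
rewrite [X in _ - X]big_mkcond /=.
rewrite (eq_bigr (fun i : 'I_m => if (i < n)%N then '[x (v i), u i] else 0 : C)) ?subrr ?normr0 // => i _.
by rewrite /t; case: ltnP => // _; rewrite dot0r.
Qed.

Lemma pd_ext H K (w w' : (H -> K) -> C) : predual w ->
  (forall x, bd x -> w' x = w x) -> predual w'.
Proof.
move=> [v [u [hv hu hw]]] h; exists v, u.
by split; [exact: hv|exact: hu|move=> x bx; rewrite (h x bx); exact: (hw x bx)].
Qed.

Lemma pd_vec H K (v : H) (u : K) : predual (fun x : H -> K => '[x v, u]).
Proof.
by apply: pd_ext (pd_fin 1 (fun=> v) (fun=> u)) _ => x _; rewrite big_ord1.
Qed.

Lemma pd_lin H K (w : (H -> K) -> C) : predual w -> forall c x y,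
  bd x -> bd y -> w (c *: x + y) = c * w x + w y.
Proof.
move=> [v [u [hv hu hw]]] c x y bx by_.
apply: (cvg_uniq (hw _ (bd_add (bd_scale c bx) by_))).
have h := cvgD (cvgM (cvg_cst c) (hw _ bx)) (hw _ by_).
have E : series (fun n => '[(c *: x + y) (v n), u n] : C) =
  (fun=> c) * series (fun n => '[x (v n), u n] : C) + series (fun n => '[y (v n), u n] : C).
  apply: funext => n; rewrite !fctE !seriesEord /= mulr_sumr -big_split /=.
  by apply: eq_bigr => i _; rewrite dotDl dotZl.
rewrite E; exact: h.
Qed.

Lemma pd_0 H K (w : (H -> K) -> C) : predual w -> w 0 = 0.
Proof.
move=> hw; have := pd_lin hw 1 (bd_0 H K) (bd_0 H K).
by rewrite scaler0 addr0 mul1r => /eqP; rewrite -subr_eq0 opprD addrA subrr sub0r oppr_eq0 => /eqP.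
Qed.
Lemma pd_D H K (w : (H -> K) -> C) x y : predual w -> bd x -> bd y ->
  w (x + y) = w x + w y.
Proof. by move=> hw bx by_; have := pd_lin hw 1 bx by_; rewrite scale1r mul1r. Qed.
Lemma pd_Z H K (w : (H -> K) -> C) c x : predual w -> bd x ->
  w (c *: x) = c * w x.
Proof.
by move=> hw bx; have := pd_lin hw c bx (bd_0 H K); rewrite !addr0 pd_0 // addr0.
Qed.
Lemma pd_B H K (w : (H -> K) -> C) x y : predual w -> bd x -> bd y ->
  w (x - y) = w x - w y.
Proof.
move=> hw bx by_; rewrite pd_D //; last exact: bd_opp.
have -> : - y = (-1) *: y by apply: funext => z; rewrite !fctE scaleN1r.
by rewrite pd_Z // mulN1r.
Qed.

(** The constant a + b comes from |v| |u| <= |v|^2 + |u|^2, summed over the defining series. *)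
Lemma pd_bound H K (w : (H -> K) -> C) : predual w ->
  exists2 c : C, 0 <= c & forall x (d : C), 0 <= d -> bd x ->
    (forall v, `|x v| <= d * `|v|) -> `|w x| <= c * d.
Proof.
move=> [v [u [hv hu hw]]].
have [a a0 ha] := sq_sum_bounded hv; have [b b0 hb] := sq_sum_bounded hu.
exists (a + b); first exact: addr_ge0.
move=> x d d0 bx hx; apply: (lim_le _ (hw x bx)) => [|n]; first by rewrite mulr_ge0 ?addr_ge0.
rewrite seriesEord /= (le_trans (ler_norm_sum _ _ _)) //.
apply: (le_trans (y := \sum_(i < n) (`|v i| ^+ 2 + `|u i| ^+ 2) * d)).
  apply: ler_sum => i _; apply: le_trans (dot_CS _ _) _.
  apply: (le_trans (y := d * `|v i| * `|u i|)); first by rewrite ler_wpM2r.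
  rewrite -mulrA mulrC ler_wpM2r // -subr_ge0.
  have p0 : 0 <= `|v i| :> C by []. have q0 : 0 <= `|u i| :> C by [].
  have [p1 p2] := Cx_real p0; have [q1 q2] := Cx_real q0; rewrite p1 q1.
  rewrite !expr2 -!cplxM -!cplxD -cplxB cplx_ge0.
  by move: (complex.Re _) (complex.Re _) p2 q2 => p q p2 q2; nra.
by rewrite -mulr_suml big_split /= ler_wpM2r // lerD ?ha ?hb.
Qed.

Lemma sw_bd H K (S : set (H -> K)) x : sw_closure S x -> bd x.
Proof. by case. Qed.


Lemma sw_conj H K H' K' (S : set (H -> K)) (T : set (H' -> K')) a b x :
  bd a -> bd b -> (forall s, S s -> T (adj b \o s \o a)) ->
  sw_closure S x -> sw_closure T (adj b \o x \o a).
Proof.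
move=> ba bb h [bx hx]; split=> [|n w e hw e0]; first by auto.
have [y Sy hy] := hx n (fun i x => w i (adj b \o x \o a)) e (fun i => pd_conj (hw i) ba bb) e0.
by exists (adj b \o y \o a) => //; exact: h.
Qed.

(** Finitely many normal functionals share one bound, so a norm approximation with a small enough
    tolerance controls all of them. This puts slices into N and M from their values on a dense set
    of vectors. *)
Lemma sw_norm_closed H K (S : set (H -> K)) x : S `<=` @bounded_op _ H K -> bd x ->
  (forall e : C, 0 < e -> exists2 y, S y & forall v, `|x v - y v| <= e * `|v|) ->
  sw_closure S x.
Proof.
move=> Sb bx h; split=> // n w e hw e0.
have /choice[c hc] : forall i, exists c : C, 0 <= c /\ forall x (d : C), 0 <= d ->
    bd x -> (forall v, `|x v| <= d * `|v|) -> `|w i x| <= c * d.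
  by move=> i; have [c c0 hc] := pd_bound (hw i); exists c.
have c0 : 0 <= \sum_i c i by apply: sumr_ge0 => i _; case: (hc i).
have c1 : 0 < \sum_i c i + 1 by rewrite ltr_wpDl.
have d0 := divr_gt0 e0 c1.
have [y Sy hy] := h _ d0; exists y => // i; have by_ := Sb _ Sy.
rewrite distrC -pd_B //; have [ci0 hci] := hc i.
apply: le_lt_trans (hci _ _ (ltW d0) (bd_sub bx by_) hy) _.
rewrite mulrA ltr_pdivrMr // mulrC ltr_pM2l // (bigD1 i) //= -addrA ltrDl.
by rewrite ltr_wpDl // sumr_ge0 // => j _; case: (hc j).
Qed.

End Predual.

(** * Slices, slices of σ-weakly closed tensor products, amplified maps *)

Section Slices.
Context {R : realType} {tens : tensor_model R}.
Implicit Types (H K L : hilbert R).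
Local Notation C := (Cx R).

Lemma vslice2_linl H K H' K' (X : H ⊗ H' -> K ⊗ K') c u u' v : bd X ->
  vslice2 X (c *: u + u') v = c *: vslice2 X u v + vslice2 X u' v.
Proof.
move=> bX; apply: op_ext => a b; rewrite !fctE dotDl dotZl !vslice2E.
by rewrite pureDr pureZr (lopP bX) dotDl dotZl.
Qed.
Lemma vslice2_linr H K H' K' (X : H ⊗ H' -> K ⊗ K') c u v v' : bd X ->
  vslice2 X u (c *: v + v') = c^* *: vslice2 X u v + vslice2 X u v'.
Proof.
move=> bX; apply: op_ext => a b; rewrite !fctE dotDl dotZl !vslice2E.
by rewrite pureDr pureZr dotDr dotZr.
Qed.
Lemma vslice1_linl H K H' K' (X : H ⊗ H' -> K ⊗ K') c u u' v : bd X ->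
  vslice1 X (c *: u + u') v = c *: vslice1 X u v + vslice1 X u' v.
Proof.
move=> bX; apply: op_ext => a b; rewrite !fctE dotDl dotZl !vslice1E.
by rewrite pureDl pureZl (lopP bX) dotDl dotZl.
Qed.
Lemma vslice1_linr H K H' K' (X : H ⊗ H' -> K ⊗ K') c u v v' : bd X ->
  vslice1 X u (c *: v + v') = c^* *: vslice1 X u v + vslice1 X u v'.
Proof.
move=> bX; apply: op_ext => a b; rewrite !fctE dotDl dotZl !vslice1E.
by rewrite pureDl pureZl dotDr dotZr.
Qed.

Lemma vslice2_bound H K H' K' (X : H ⊗ H' -> K ⊗ K') : bd X ->
  exists2 c : C, 0 <= c & forall u v a, `|vslice2 X u v a| <= c * `|u| * `|v| * `|a|.
Proof.
move=> /bdP[c c0 hc]; exists c => // u v a; apply: norm_le_dot => [|b].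
  by rewrite !mulr_ge0.
rewrite vslice2E; apply: le_trans (dot_CS _ _) _.
apply: (le_trans (y := c * `|a ⊗v u| * `|b ⊗v v|)); first by rewrite ler_wpM2r.
by rewrite !pure_norm; apply: le_of_eq; ring.
Qed.
Lemma vslice1_bound H K H' K' (X : H ⊗ H' -> K ⊗ K') : bd X ->
  exists2 c : C, 0 <= c & forall u v a, `|vslice1 X u v a| <= c * `|u| * `|v| * `|a|.
Proof.
move=> /bdP[c c0 hc]; exists c => // u v a; apply: norm_le_dot => [|b].
  by rewrite !mulr_ge0.
rewrite vslice1E; apply: le_trans (dot_CS _ _) _.
apply: (le_trans (y := c * `|u ⊗v a| * `|v ⊗v b|)); first by rewrite ler_wpM2r.
by rewrite !pure_norm; apply: le_of_eq; ring.
Qed.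

Lemma slice1_spec H K H' K' (w : (H -> K) -> C) (X : H ⊗ H' -> K ⊗ K') :
  predual w -> bd X -> bd (slice1 w X) /\
  forall u v, '[slice1 w X u, v] = w (vslice2 X u v).
Proof.
move=> hw bX; apply: (xgetPex (fun=> 0) (P := [set y : H' -> K' | bd y /\
    forall u v, '[y u, v] = w (vslice2 X u v)])).
have [c c0 hc] := vslice2_bound bX; have [d d0 hd] := pd_bound hw.
have [|a x y v|a x y u|u v|f bf hf] := @lax R H' K' (fun u v => w (vslice2 X u v)) (d * c).
- exact: mulr_ge0.
- by rewrite vslice2_linl // pd_lin //; auto.
- by rewrite vslice2_linr // pd_lin //; auto.
- by rewrite -!mulrA (mulrA c); apply: hd; auto; rewrite !mulr_ge0.
by exists f.
Qed.
Lemma slice2_spec H K H' K' (w : (H' -> K') -> C) (X : H ⊗ H' -> K ⊗ K') :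
  predual w -> bd X -> bd (slice2 w X) /\
  forall u v, '[slice2 w X u, v] = w (vslice1 X u v).
Proof.
move=> hw bX; apply: (xgetPex (fun=> 0) (P := [set y : H -> K | bd y /\
    forall u v, '[y u, v] = w (vslice1 X u v)])).
have [c c0 hc] := vslice1_bound bX; have [d d0 hd] := pd_bound hw.
have [|a x y v|a x y u|u v|f bf hf] := @lax R H K (fun u v => w (vslice1 X u v)) (d * c).
- exact: mulr_ge0.
- by rewrite vslice1_linl // pd_lin //; auto.
- by rewrite vslice1_linr // pd_lin //; auto.
- by rewrite -!mulrA (mulrA c); apply: hd; auto; rewrite !mulr_ge0.
by exists f.
Qed.

Lemma slice2_vec H H' K (b : H') (X : H ⊗ H' -> K ⊗ H') : bd X ->
  slice2 (vector_functional b) X = vslice2 X b b.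
Proof.
move=> bX; have [_ h] := slice2_spec (pd_vec b b) bX.
by apply: op_ext => u v; rewrite /vector_functional h vslice1E vslice2E.
Qed.
Lemma slice1_vec H H' K' (b : H) (X : H ⊗ H' -> H ⊗ K') : bd X ->
  slice1 (vector_functional b) X = vslice1 X b b.
Proof.
move=> bX; have [_ h] := slice1_spec (pd_vec b b) bX.
by apply: op_ext => u v; rewrite /vector_functional h vslice1E vslice2E.
Qed.

Lemma vec_state H (Q : set (H -> H)) (b : H) : '[b, b] = 1 ->
  normal_state Q (vector_functional b).
Proof. by move=> b1; split=> [|x _ [_ /(_ b)]|]; [exact: pd_vec| |]. Qed.

Lemma subspace_sum H K (N : set (H -> K)) n (c : 'I_n -> C) (x : 'I_n -> H -> K) :
  subspace N -> (forall i, N (x i)) -> N (\sum_i c i *: x i).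
Proof.
move=> [N0 Nl] h; suff : forall r : seq 'I_n, N (\sum_(i <- r) c i *: x i) by exact.
by elim=> [|i r IH]; rewrite ?big_nil // big_cons; exact: Nl.
Qed.

Lemma adj_sum_comp H K H' K' n (c : 'I_n -> C) (x : 'I_n -> H -> K) (a : H' -> H)
  (b : K' -> K) : bd b ->
  adj b \o (\sum_i c i *: x i) \o a = \sum_i c i *: (adj b \o x i \o a).
Proof.
move=> bb; apply: funext => v /=; rewrite !fct_sumE (lop_sum (bd_adj bb)).
by apply: eq_bigr => i _; rewrite !fctE (lopZ (bd_adj bb)).
Qed.

Lemma vslice2_tensor H K H' K' (x : H -> K) (y : H' -> K') v w : bd x ->
  bd y -> vslice2 (tensor_op x y) v w = '[y v, w] *: x.
Proof.
move=> bx by_; apply: op_ext => a b.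
by rewrite !fctE vslice2E tensorE // pure_dot dotZl mulrC.
Qed.
Lemma vslice1_tensor H K H' K' (x : H -> K) (y : H' -> K') v w : bd x ->
  bd y -> vslice1 (tensor_op x y) v w = '[x v, w] *: y.
Proof.
move=> bx by_; apply: op_ext => a b.
by rewrite !fctE vslice1E tensorE // pure_dot dotZl.
Qed.

Lemma vn_slice2 H K H' K' (N : set (H -> K)) (S' : set (H' -> K')) X v w :
  N `<=` @bounded_op _ H K -> S' `<=` @bounded_op _ H' K' -> subspace N ->
  sw_closure N `<=` N -> vn_tensor N S' X -> N (vslice2 X v w).
Proof.
move=> Nb Sb sN Ncl hX; apply: Ncl; rewrite /vslice2.
apply: sw_conj hX; auto => s [n [c [z [hz ->]]]].
rewrite adj_sum_comp //; apply: subspace_sum => // i.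
have [x [y [Nx Sy ->]]] := hz i; have bx := Nb _ Nx; have by_ := Sb _ Sy.
change (N (vslice2 (tensor_op x y) v w)).
rewrite vslice2_tensor // -[_ *: _]addr0.
by have [N0 Nl] := sN; exact: Nl.
Qed.
Lemma vn_slice1 H K H' K' (N : set (H -> K)) (S' : set (H' -> K')) X v w :
  N `<=` @bounded_op _ H K -> S' `<=` @bounded_op _ H' K' -> subspace S' ->
  sw_closure S' `<=` S' -> vn_tensor N S' X -> S' (vslice1 X v w).
Proof.
move=> Nb Sb sN Ncl hX; apply: Ncl; rewrite /vslice1.
apply: sw_conj hX; auto => s [n [c [z [hz ->]]]].
rewrite adj_sum_comp //; apply: subspace_sum => // i.
have [x [y [Nx Sy ->]]] := hz i; have bx := Nb _ Nx; have by_ := Sb _ Sy.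
change (S' (vslice1 (tensor_op x y) v w)).
rewrite vslice1_tensor // -[_ *: _]addr0.
by have [N0 Nl] := sN; exact: Nl.
Qed.

(* When [f] is implemented on [N] by a pair of unitaries, so are its
   amplifications [f ⊗ ι] and [ι ⊗ f]. *)
Section Amplify.
Variables (H K L K1 : hilbert R) (f : (H -> K) -> (H ⊗ H -> K ⊗ K)) (N : set (H -> K)).
Variables (U : K ⊗ H -> K ⊗ K) (V : H ⊗ H -> H ⊗ H).
Hypotheses (bU : bd U) (bV : bd V) (Nb : N `<=` @bounded_op _ H K).
Hypothesis fE : forall y, N y -> f y = U \o ampl y H \o adj V.

Lemma map1_spec (X : H ⊗ L -> K ⊗ K1) : bd X ->
  (forall u v, N (vslice2 X u v)) ->
  bd (map1 f X) /\ forall u v, vslice2 (map1 f X) u v = f (vslice2 X u v).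
Proof.
move=> bX hX; apply: (xgetPex (fun=> 0) (P := [set Y : (H ⊗ H) ⊗ L -> (K ⊗ K) ⊗ K1 |
  bd Y /\ forall u v, vslice2 Y u v = f (vslice2 X u v)])).
exists (ampl U K1 \o leg13 (L := H) X \o ampl (adj V) L).
split; first by auto 8.
move=> u v; rewrite fE //.
have b1 : bd (vslice2 X u v) by auto.
have b2 : bd (leg13 (L := H) X) by auto.
apply: op_ext => a b; rewrite vslice2E /= tensorE; [|auto|auto].
rewrite adjr ?adj_tensor ?adj_idfun ?tensorE; auto.
rewrite [RHS]adjr //.
move: (adj V a) (adj U b) => {a b} a b.
suff E : vslice2 (leg13 (L := H) X) u v = tensor_op (vslice2 X u v) idfun.
  by rewrite -E vslice2E.
apply: top_ext; auto => x y z t.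
by rewrite vslice2E leg13E // tensorE // pure_dot vslice2E mulrC.
Qed.

Lemma map2_spec (X : L ⊗ H -> K1 ⊗ K) : bd X ->
  (forall u v, N (vslice1 X u v)) ->
  bd (map2 f X) /\ forall u v, vslice1 (map2 f X) u v = f (vslice1 X u v).
Proof.
move=> bX hX; apply: (xgetPex (fun=> 0) (P := [set Y : L ⊗ (H ⊗ H) -> K1 ⊗ (K ⊗ K) |
  bd Y /\ forall u v, vslice1 Y u v = f (vslice1 X u v)])).
exists (ampr K1 U \o (@assoc _ _ K1 K H \o
  ampl X H \o adj (@assoc _ _ L H H)) \o ampr L (adj V)).
split; first by auto 10.
move=> u v; rewrite fE //.
have b1 : bd (vslice1 X u v) by auto.
have b2 : bd (@assoc _ _ K1 K H \o
  ampl X H \o adj (@assoc _ _ L H H)) by auto 8.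
apply: op_ext => a b; rewrite vslice1E [X in '[X, _]]/= tensorE; [|auto|auto].
rewrite adjr ?adj_tensor ?adj_idfun ?tensorE; auto.
rewrite [RHS](_ : _ = '[ampl (vslice1 X u v) H (adj V a), adj U b]);
  last by rewrite /= adjr.
move: (adj V a) (adj U b) => {a b} a b.
have E : vslice1 (@assoc _ _ K1 K H \o ampl X H \o
  adj (@assoc _ _ L H H)) u v = tensor_op (vslice1 X u v) idfun.
  apply: top_ext; auto => x y z t.
  rewrite vslice1E /= adj_assocE tensorE // -assocE assoc_dot pure_dot.
  by rewrite tensorE // pure_dot vslice1E.
by rewrite -E vslice1E.
Qed.

End Amplify.

End Slices.

#[global] Hint Resolve pd_vec : core.

(** * Norms of amplifications and extension of identities by density *)

Section TensorNorm.
Context {R : realType} {tens : tensor_model R}.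
Implicit Types (H K L : hilbert R).
Local Notation C := (Cx R).

Lemma rsl_tensor H K L (x : H -> K) (k : L) (z : H ⊗ L) : bd x ->
  rsl k (ampl x L z) = x (rsl k z).
Proof.
move=> bx; apply: dot_ext => h; rewrite rslE adjr ?adj_tensor ?adj_idfun; auto.
by rewrite tensorE; auto; rewrite -rslE -adjr.
Qed.

Lemma tensor_norm H K L (x : H -> K) (d : C) (z : H ⊗ L) : bd x -> 0 <= d ->
  (forall v, `|x v| <= d * `|v|) -> `|ampl x L z| <= d * `|z|.
Proof.
move=> bx d0 hd; rewrite -(ler_pXn2r (n := 2)) ?nnegrE ?mulr_ge0 // exprMn.
have hf := onbP L.
have h1 := tens_parseval (z := ampl x L z)
  (z' := ampl x L z) hf.
have h2 : (fun=> d ^+ 2) \* series (fun k => '[rsl (onb L k) z, rsl (onb L k) z])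
    @ \oo --> d ^+ 2 * '[z, z].
  by apply: cvgM; [exact: cvg_cst|exact: tens_parseval].
rewrite -!hdot_norm; apply: (lim_leC h1 h2) => n.
rewrite /= !seriesEord /= mulr_sumr; apply: ler_sum => i _.
by rewrite rsl_tensor // !hdot_norm -exprMn ler_pXn2r ?nnegrE ?mulr_ge0.
Qed.

Lemma lcombE (T : Type) (k : pzRingType) (E : lmodType k) (f g : T -> E) c t :
  (c *: f + g) t = c *: f t + g t.
Proof. by []. Qed.

Lemma tensor_linl H K L (x y : H -> K) c : bd x -> bd y ->
  ampl (c *: x + y) L =
  c *: ampl x L + ampl y L.
Proof.
move=> bx by_; apply: tens_ext; auto => a b.
have bl : bd (c *: x + y) by auto.
rewrite tensorE ?lcombE //; try exact: bd_id.
rewrite !tensorE; auto; by rewrite pureDl pureZl.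
Qed.

(** Bounded linear functionals. Many identities below are linear in a vector w of K and immediate
    for w = x xi with x in N; [blf_ext] extends them to all w. *)
Definition blf H (f : H -> C) := (forall a x y, f (a *: x + y) = a * f x + f y) /\
  exists2 c : C, 0 <= c & forall x, `|f x| <= c * `|x|.

Lemma blf_ext H (D : set H) (f g : H -> C) : dense D -> blf f -> blf g ->
  (forall x, D x -> f x = g x) -> f =1 g.
Proof.
move=> dD [fl [c c0 fc]] [gl [d d0 gd]] h x.
have [u hu] := riesz c0 fl fc; have [v hv] := riesz d0 gl gd.
rewrite hu hv; suff -> : u = v by [].
apply/eqP; rewrite -subr_eq0; apply/eqP/(dense_orth0 dD) => s /h.
by rewrite hu hv dotBr => ->; rewrite subrr.
Qed.

Lemma blf_dot H K (a : H -> K) z : bd a -> blf (fun w => '[a w, z]).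
Proof.
move=> ba; split=> [c x y|]; first by rewrite (lopP ba) dotDl dotZl.
have [c c0 hc] := bdP ba; exists (c * `|z|); first by rewrite mulr_ge0.
by move=> x; apply: le_trans (dot_CS _ _) _; rewrite mulrAC ler_wpM2r.
Qed.

Lemma dense_approx H (S T : set H) : dense (span S) -> T 0 ->
  (forall c x y, T x -> T y -> T (c *: x + y)) ->
  (forall s (e : C), S s -> 0 < e -> exists2 t, T t & `|s - t| < e) -> dense T.
Proof.
move=> dS T0 Tl h; apply/denseP => x e e0.
have e2 : 0 < e / 2 by rewrite divr_gt0 // ltr0n.
have [s hs xs] := (denseP _).1 dS x _ e2.
suff [t ht st] : exists2 t, T t & `|s - t| < e / 2.
  exists t => //; rewrite -(subrKA s) (le_lt_trans (ler_normD _ _)) //.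
  by rewrite [e]splitr ltrD.
move: (e / 2) e2 => {x e e0 xs} d d0; move: s hs d d0.
apply: span_ind => [d d0|c s y Ss IH d d0].
  by exists 0 => //; rewrite subr0 normr0.
have d2 : 0 < d / 2 by rewrite divr_gt0 // ltr0n.
have [t ht yt] := IH _ d2.
have c1 : 0 < `|c| + 1 :> C by rewrite ltr_wpDl.
have [w hw zw] := h s _ Ss (divr_gt0 d2 c1).
exists (c *: w + t); first exact: Tl.
have -> : c *: s + y - (c *: w + t) = c *: (s - w) + (y - t).
  by rewrite scalerBr opprD addrACA.
rewrite (le_lt_trans (ler_normD _ _)) // [d]splitr ltrD // normrZ.
rewrite ltr_pdivlMr // mulrC in zw; apply: le_lt_trans zw.
by rewrite ler_wpM2r // lerDl.
Qed.

End TensorNorm.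

(** * Weights: countable additivity and linear extension *)

Section Weights.
Context {R : realType}.
Implicit Types (H K : hilbert R).
Local Notation C := (Cx R).

Lemma quad_ext H (a b : H -> H) : bd a -> bd b ->
  (forall v, '[a v, v] = '[b v, v]) -> a = b.
Proof.
move=> ba bb h; apply: op_ext => x y.
have e (c : C) : c^* * '[a x, y] + c * '[a y, x] = c^* * '[b x, y] + c * '[b y, x].
  have := h (x + c *: y); rewrite !(lopD ba) !(lopD bb) !(lopZ ba) !(lopZ bb).
  rewrite !dotDl !dotDr !dotZl !dotZr !h -!addrA => /addrI.
  by rewrite !addrA => /addIr; rewrite addrC [RHS]addrC [in LHS]addrC [in RHS]addrC.
have := e 1; have := e 'i; rewrite conjC1 !mul1r conjCi !mulNr.
move=> h1 h2.
have h3 : 'i * ('[a y, x] - '[a x, y]) = 'i * ('[b y, x] - '[b x, y]) :> C.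
  by rewrite !mulrBr addrC h1 addrC.
have /(mulfI _) h4 := h3; have {h4} h4 := h4 (neq0Ci _).
have : 2%:R * '[a x, y] = 2%:R * '[b x, y] :> C.
  have -> : 2%:R * '[a x, y] = ('[a x, y] + '[a y, x]) - ('[a y, x] - '[a x, y]) :> C.
    by ring.
  by rewrite h2 h4; ring.
by move/(mulfI _); apply; rewrite pnatr_eq0.
Qed.

Lemma pos_bd H (x : H -> H) : pos x -> bd x. Proof. by case. Qed.
Lemma pos_id H : pos (idfun : H -> H).
Proof. by split=> [|v]; [exact: bd_id|exact: dot_ge0]. Qed.
Lemma pos_add H (x y : H -> H) : pos x -> pos y -> pos (x + y).
Proof.
by move=> [bx hx] [by_ hy]; split=> [|v]; [exact: bd_add|rewrite !fctE dotDl addr_ge0].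
Qed.
Lemma pos_scale H (c : R) (x : H -> H) : 0 <= c -> pos x ->
  pos (cplx c *: x).
Proof.
move=> c0 [bx hx]; split=> [|v]; first exact: bd_scale.
by rewrite !fctE dotZl mulr_ge0 // cplx_ge0.
Qed.
Lemma pos_sq H K (n : H -> K) : bd n -> pos (n \o adj n).
Proof. by move=> bn; split=> [|v /=]; [auto|rewrite adjr]. Qed.
Lemma pos_0 H : pos (0 : H -> H).
Proof. by split=> [|v]; [exact: bd_0|rewrite zfunE dot0l]. Qed.
Lemma pos_adj H (x : H -> H) : pos x -> adj x = x.
Proof.
move=> [bx hx]; apply: quad_ext; auto => v; rewrite adjl // dotC.
by apply: conj_Creal; rewrite realE hx.
Qed.
Lemma pos_conj H K (x : K -> K) (a : H -> K) : pos x -> bd a ->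
  pos (adj a \o x \o a).
Proof. by move=> [bx hx] ba; split=> [|v /=]; [auto|rewrite adjl]. Qed.
Lemma pos_le H (x y : H -> H) : pos x -> pos y -> op_le x y ->
  pos (y - x).
Proof.
by move=> [bx hx] [by_ hy] h; split=> [|v]; [auto|rewrite !fctE dotBl subr_ge0].
Qed.
Lemma pos_bounded H (x : H -> H) : pos x ->
  exists2 c : R, 0 <= c & op_le x (cplx c *: idfun).
Proof.
move=> [bx hx]; have [c c0 hc] := bdP bx.
have [e e0] := Cx_real c0; exists (complex.Re c) => // v.
rewrite fctE dotZl -e hdot_norm; have := hx v => h; rewrite -(ger0_norm h).
by apply: le_trans (dot_CS _ _) _; rewrite expr2 mulrA ler_wpM2r.
Qed.

Variables (H : hilbert R) (Q : set (H -> H)) (f : (H -> H) -> \bar R).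
Hypotheses (hQ : is_vna Q) (hf : nsf_weight Q f).

Definition Qp x := Q x /\ pos x.
Definition Fin x := Qp x /\ (f x < +oo)%E.
Definition F x : R := fine (f x).

Lemma Qlin c x y : Q x -> Q y -> Q (c *: x + y). Proof. by case: hQ => _ [_ h] _ _ _; exact: h. Qed.
Lemma Q0 : Q 0. Proof. by case: hQ => _ [h _] _ _ _. Qed.
Lemma Q1 : Q idfun. Proof. by case: hQ => -[]. Qed.
Lemma QD x y : Q x -> Q y -> Q (x + y).
Proof. by move=> qx qy; rewrite -[x]scale1r; exact: Qlin. Qed.
Lemma QZ c x : Q x -> Q (c *: x).
Proof. by move=> qx; rewrite -[_ *: _]addr0; apply: Qlin => //; exact: Q0. Qed.
Lemma QB x y : Q x -> Q y -> Q (x - y).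
Proof. by move=> qx qy; apply: QD => //; rewrite -scaleN1r; exact: QZ. Qed.
Lemma Qadj x : Q x -> Q (adj x). Proof. by case: hQ => _ _ _ h _; exact: h. Qed.
Lemma Qmul x y : Q x -> Q y -> Q (x \o y). Proof. by case: hQ => _ _ h _ _; exact: h. Qed.
Lemma Qb : Q `<=` @bounded_op _ H H. Proof. by case: hQ => -[]. Qed.

Lemma Qp_add x y : Qp x -> Qp y -> Qp (x + y).
Proof. by move=> [qx px] [qy py]; split; [exact: QD|exact: pos_add]. Qed.
Lemma Qp_scale (c : R) x : 0 <= c -> Qp x -> Qp (cplx c *: x).
Proof. by move=> c0 [qx px]; split; [exact: QZ|exact: pos_scale]. Qed.
Lemma Qp_0 : Qp 0. Proof. by split; [exact: Q0|exact: pos_0]. Qed.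
Lemma Qp_sub x y : Qp x -> Qp y -> op_le x y -> Qp (y - x).
Proof. by move=> [qx px] [qy py] h; split; [exact: QB|exact: pos_le]. Qed.
Lemma Qp_b x : Qp x -> bd x. Proof. by case=> _ []. Qed.

Lemma f_ge0 x : Qp x -> (0 <= f x)%E. Proof. by case: hf => -[h _ _] _ _ _; exact: h. Qed.
Lemma f_add x y : Qp x -> Qp y -> f (x + y) = (f x + f y)%E.
Proof. by case: hf => -[_ h _] _ _ _; exact: h. Qed.
Lemma f_scale (c : R) x : 0 <= c -> Qp x -> f (cplx c *: x) = (c%:E * f x)%E.
Proof. by case: hf => -[_ _ h] _ _ _; exact: h. Qed.
Lemma f_faith x : Qp x -> f x = 0%E -> x = 0.
Proof. by case: hf => _ _ _ h; exact: h. Qed.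
Lemma f_0 : f 0 = 0%E.
Proof.
by have := f_scale (lexx 0) Qp_0; rewrite scaler0 mul0e.
Qed.
Lemma f_mono x y : Qp x -> Qp y -> op_le x y -> (f x <= f y)%E.
Proof.
move=> qx qy h; have qs := Qp_sub qx qy h.
have -> : y = x + (y - x) by rewrite addrC subrK.
by rewrite f_add // leeDl // f_ge0.
Qed.

Lemma Fin_fE x : Fin x -> f x = (F x)%:E.
Proof. by move=> [qx h]; rewrite /F fineK // ge0_fin_numE // f_ge0. Qed.
Lemma F_ge0 x : Qp x -> 0 <= F x. Proof. by move=> /f_ge0; exact: fine_ge0. Qed.
Lemma Fin_Qp x : Fin x -> Qp x. Proof. by case. Qed.
Lemma Fin_b x : Fin x -> bd x. Proof. by move=> /Fin_Qp/Qp_b. Qed.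
Lemma Fin_add x y : Fin x -> Fin y -> Fin (x + y) /\ F (x + y) = F x + F y.
Proof.
move=> hx hy; have [[qx fx] [qy fy]] := (hx, hy).
have e : f (x + y) = (F x + F y)%:E by rewrite f_add // !Fin_fE.
by split; [split; [exact: Qp_add|rewrite e ltry]|rewrite {1}/F e].
Qed.
Lemma Fin_scale (c : R) x : 0 <= c -> Fin x ->
  Fin (cplx c *: x) /\ F (cplx c *: x) = c * F x.
Proof.
move=> c0 hx; have [qx fx] := hx.
have e : f (cplx c *: x) = (c * F x)%:E by rewrite f_scale // Fin_fE.
by split; [split; [exact: Qp_scale|rewrite e ltry]|rewrite {1}/F e].
Qed.
Lemma Fin_0 : Fin 0 /\ F 0 = 0.
Proof. by split; [split; [exact: Qp_0|rewrite f_0 ltry]|rewrite /F f_0]. Qed.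
Lemma Fin_le x y : Qp x -> Fin y -> op_le x y -> Fin x.
Proof. by move=> qx [qy fy] h; split=> //; apply: le_lt_trans (f_mono qx qy h) fy. Qed.
Lemma F_le x y : Qp x -> Fin y -> op_le x y -> F x <= F y.
Proof.
move=> qx fy h; rewrite -lee_fin -(Fin_fE fy) -(Fin_fE (Fin_le qx fy h)).
by apply: f_mono => //; exact: Fin_Qp.
Qed.
Lemma F_faith x : Fin x -> F x = 0 -> x = 0.
Proof. by move=> hx h; apply: f_faith; [exact: Fin_Qp|rewrite Fin_fE // h]. Qed.

(** The partial sums are an upward directed set with supremum s, so normality applies; being
    dominated by s, each term is finite. *)
Lemma F_series (x : nat -> H -> H) (s : H -> H) : (forall k, Qp (x k)) -> Fin s ->
  (forall v, series (fun k => '[x k v, v] : C) @ \oo --> ('[s v, v] : C)) ->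
  (forall k, Fin (x k)) /\ series (fun k => cplx (F (x k)) : C) @ \oo --> (cplx (F s) : C).
Proof.
move=> qx fs hs; have [qs _] := fs.
pose p n := \sum_(i < n) x i.
have qp n : Qp (p n).
  rewrite /p; elim: n => [|n IH]; first by rewrite big_ord0; exact: Qp_0.
  by rewrite big_ord_recr; exact: Qp_add.
have pE n v : '[p n v, v] = \sum_(i < n) '[x i v, v].
  by rewrite /p fct_sumE dot_suml.
have xp k v : 0 <= '[x k v, v] :> C by case: (qx k) => _ [].
have ps n : op_le (p n) s.
  by move=> v; rewrite pE; apply: partial_le_lim (hs v).
have pS n : p n.+1 = p n + x n by rewrite /p big_ord_recr.
have xs k : op_le (x k) s.
  move=> v; apply: le_trans (ps k.+1 v); rewrite pS !fctE dotDl lerDr.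
  by case: (qp k) => _ [].
have fx k : Fin (x k) by exact: Fin_le (qx k) fs (xs k).
have fp n : Fin (p n) by exact: Fin_le (qp n) fs (ps n).
split=> //.
have FpE n : F (p n) = \sum_(i < n) F (x i).
  elim: n => [|n IH]; first by rewrite /p !big_ord0; case: Fin_0.
  by rewrite pS (Fin_add (fp n) (fx n)).2 IH big_ord_recr.
have mono m n : (m <= n)%N -> op_le (p m) (p n).
  move=> /subnK <-; elim: (n - m)%N => [|k IH] v //.
  by rewrite addSn pS !fctE dotDl; apply: le_trans (IH v) _; rewrite lerDl.
have sup : f s = ereal_sup (f @` range p).
  case: hf => _ + _ _; apply=> //.
  - by exists (p 0%N); exists 0%N.
  - by move=> _ [n _ <-]; exact: qp.
  - move=> _ _ [m _ <-] [n _ <-]; exists (p (maxn m n)); first by exists (maxn m n).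
    by split; apply: mono; rewrite ?leq_maxl ?leq_maxr.
  - by move=> _ [n _ <-]; exact: ps.
  move=> t qt ht v; apply: lim_leC (hs v) (cvg_cst _) _ => n.
  by rewrite seriesEord /= -pE; apply: ht; exists n.
apply: cvgC_ex => e /Cx_gt0 [d d0 ->].
have fd : ((F s - d)%:E < f s)%E by rewrite Fin_fE // lte_fin ltrBlDr ltrDl.
move: fd; rewrite sup => /ereal_sup_gt [_ [_ [n0 _ <-] <-]] h.
exists n0 => n nn; rewrite seriesEord /= -cplx_sum -FpE distrC -cplxB cplx_norm.
  rewrite cplx_lt ltrBlDr -ltrBlDl.
  apply: lt_le_trans (F_le (qp n0) (fp n) (mono _ _ nn)).
  by rewrite -lte_fin -(Fin_fE (fp n0)).
by rewrite subr_ge0; exact: F_le.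
Qed.

Lemma Fin_dense x : Q x -> sw_closure (span [set x | Fin x]) x.
Proof. by case: hf => _ _ h _; exact: h. Qed.

(** The linear extension of the weight to the span of its finite positive elements, kept as a
    relation because the decomposition (a - b) + i (c - d) is not unique; [wgraph_fun] shows that
    the value is. *)
Definition wgraph (z : H -> H) (l : C) := exists a b c d,
  [/\ Fin a, Fin b, Fin c & Fin d] /\
  z = (a - b) + 'i *: (c - d) /\ l = cplx (F a - F b) + 'i * cplx (F c - F d).

Lemma sa_split (h k h' k' : H -> H) : bd h -> bd k ->
  bd h' -> bd k' -> adj h = h -> adj k = k -> adj h' = h' -> adj k' = k' ->
  h + 'i *: k = h' + 'i *: k' -> h = h' /\ k = k'.
Proof.
move=> bh bk bh' bk' ah ak ah' ak' e.
have := congr1 (@adj _ _ _) e; rewrite !adj_add ?adj_scale ?ah ?ak ?ah' ?ak' ?conjCi; auto.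
rewrite !scaleNr => e2.
have e1 : h = h'.
  have : h + h = h' + h'.
    have -> : h + h = (h + 'i *: k) + (h - 'i *: k) by rewrite addrACA subrr addr0.
    by rewrite e e2 addrACA subrr addr0.
  move=> e3; have {}e3 : (2%:R : C) *: h = (2%:R : C) *: h' by rewrite !scaler_nat !mulr2n.
  have n2 : (2%:R : C) != 0 by rewrite pnatr_eq0.
  exact: (scalerI n2 e3).
split=> //; move: e; rewrite e1 => /addrI e.
exact: (scalerI (neq0Ci (Cx R)) e).
Qed.

Lemma wgraph_fun z l l' : wgraph z l -> wgraph z l' -> l = l'.
Proof.
move=> [a [b [c [d [[fa fb fc fd] [-> ->]]]]]] [a' [b' [c' [d' [[fa' fb' fc' fd'] [e ->]]]]]].
have B x : Fin x -> bd x := @Fin_b x.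
have A x : Fin x -> adj x = x by move=> [[_ px] _]; exact: pos_adj.
have D x y : Fin x -> Fin y -> F (x + y) = F x + F y by move=> hx hy; case: (Fin_add hx hy).
have [] := sa_split _ _ _ _ _ _ _ _ e; rewrite ?adj_sub ?A; auto.
move=> h1 h2.
have e1 : F (a + b') = F (a' + b).
  by congr F; rewrite -[a](subrK b) h1 addrAC subrK.
have e2 : F (c + d') = F (c' + d).
  by congr F; rewrite -[c](subrK d) h2 addrAC subrK.
rewrite !D // in e1 e2.
have -> : F a - F b = F a' - F b' by apply/eqP; rewrite subr_eq addrAC -e1 addrK.
by have -> : F c - F d = F c' - F d' by apply/eqP; rewrite subr_eq addrAC -e2 addrK.
Qed.

Lemma wgraph_fin x : Fin x -> wgraph x (cplx (F x)).
Proof.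
move=> fx; have [f0 F00] := Fin_0; exists x, 0, 0, 0.
by split=> //; split; rewrite ?F00 ?subr0 ?scaler0 ?addr0 ?mulr0 ?addr0.
Qed.
Lemma wgraph_add z z' l l' : wgraph z l -> wgraph z' l' -> wgraph (z + z') (l + l').
Proof.
move=> [a [b [c [d [[fa fb fc fd] [-> ->]]]]]] [a' [b' [c' [d' [[fa' fb' fc' fd'] [-> ->]]]]]].
have [h1 e1] := Fin_add fa fa'; have [h2 e2] := Fin_add fb fb'.
have [h3 e3] := Fin_add fc fc'; have [h4 e4] := Fin_add fd fd'.
exists (a + a'), (b + b'), (c + c'), (d + d'); split=> //; split.
  by rewrite !opprD addrACA -scalerDr; congr (_ + 'i *: _); rewrite addrACA.
by rewrite e1 e2 e3 e4 !cplxB !cplxD; ring.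
Qed.
Lemma wgraph_real (r : R) z l : 0 <= r -> wgraph z l -> wgraph (cplx r *: z) (cplx r * l).
Proof.
move=> r0 [a [b [c [d [[fa fb fc fd] [-> ->]]]]]].
have [h1 e1] := Fin_scale r0 fa; have [h2 e2] := Fin_scale r0 fb.
have [h3 e3] := Fin_scale r0 fc; have [h4 e4] := Fin_scale r0 fd.
exists (cplx r *: a), (cplx r *: b), (cplx r *: c), (cplx r *: d); split=> //; split.
  by rewrite scalerDr scalerBr scalerA [_ * 'i]mulrC -scalerA scalerBr.
by rewrite e1 e2 e3 e4 !cplxB !cplxM; ring.
Qed.
Lemma wgraph_i z l : wgraph z l -> wgraph ('i *: z) ('i * l).
Proof.
move=> [a [b [c [d [[fa fb fc fd] [-> ->]]]]]]; exists d, c, a, b; split=> //; split.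
  by rewrite scalerDr scalerA -expr2 sqrCi scaleN1r opprB addrC.
by rewrite mulrDr mulrA -expr2 sqrCi !cplxB; ring.
Qed.
Lemma wgraph_N z l : wgraph z l -> wgraph (- z) (- l).
Proof.
move=> /wgraph_i/wgraph_i; rewrite scalerA mulrA -expr2 sqrCi scaleN1r mulN1r.
by [].
Qed.
Lemma wgraph_rl (r : R) z l : wgraph z l -> wgraph (cplx r *: z) (cplx r * l).
Proof.
move=> h; case: (lerP 0 r) => [r0|/ltW r0]; first exact: wgraph_real.
have := wgraph_N (wgraph_real _ h); rewrite -oppr_ge0 in r0 => /(_ _ r0).
by rewrite -scaleNr -mulNr (_ : - cplx (- r) = cplx r) // -[- cplx _]sub0r -cplx0 -cplxB sub0r opprK.
Qed.
Lemma wgraph_Z (c : C) z l : wgraph z l -> wgraph (c *: z) (c * l).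
Proof.
move=> h; have -> : c = cplx (complex.Re c) + 'i * cplx (complex.Im c).
  by rewrite [LHS]complexE.
rewrite scalerDl mulrDl -scalerA -mulrA; apply: wgraph_add; first exact: wgraph_rl.
by apply: wgraph_i; exact: wgraph_rl.
Qed.

Definition wdom z := exists l, wgraph z l.
Definition wext z : C := xget 0 (wgraph z).
Lemma wextE z l : wgraph z l -> wext z = l.
Proof. by move=> h; apply: xget_subset1 => // a b; exact: wgraph_fun. Qed.
Lemma wdomP z : wdom z -> wgraph z (wext z).
Proof. by move=> [l h]; rewrite (wextE h). Qed.
Lemma wdom_lin c x y : wdom x -> wdom y -> wdom (c *: x + y).
Proof.
move=> /wdomP hx /wdomP hy; exists (c * wext x + wext y).
by apply: wgraph_add => //; exact: wgraph_Z.
Qed.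
Lemma wext_lin c x y : wdom x -> wdom y -> wext (c *: x + y) = c * wext x + wext y.
Proof.
move=> /wdomP hx /wdomP hy; apply: wextE; apply: wgraph_add => //; exact: wgraph_Z.
Qed.
Lemma wdom_fin x : Fin x -> wdom x. Proof. by move/wgraph_fin; exists (cplx (F x)). Qed.
Lemma wext_fin x : Fin x -> wext x = cplx (F x). Proof. by move/wgraph_fin/wextE. Qed.

End Weights.

(** * Operators on tensor products determined at product vectors *)

Section PureForm.
Context {R : realType} {tens : tensor_model R}.
Local Notation C := (Cx R).

Lemma left_parseval (H1 H2 : hilbert R) (z z' : H1 ⊗ H2) :
  series (fun k => '[lsl (onb H1 k) z, lsl (onb H1 k) z'] : C) @ \oo --> ('[z, z'] : C).
Proof.
have e t k : lsl (onb H1 k) t = rsl (onb H1 k) (flip t) :> H2.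
  by apply: dot_ext => a; rewrite lslE rslE (adjr _ _ (bd_flip _ _)) flip_adj flipE.
have -> : '[z, z'] = '[flip z, flip z'] by rewrite (adjr _ _ (bd_flip _ _)) flip_adj flipK.
have -> : (fun k => '[lsl (onb H1 k) z, lsl (onb H1 k) z'] : C) =
  (fun k => '[rsl (onb H1 k) (flip z), rsl (onb H1 k) (flip z')]).
  by apply: funext => k; rewrite !e.
exact: (tens_parseval (z := _) (z' := _) (onbP _)).
Qed.

Lemma rsl_flip (L1 L2 : hilbert R) (a : L2) (z : L1 ⊗ L2) : rsl a z = lsl a (flip z).
Proof. by apply: dot_ext => h; rewrite lslE rslE -flip_adj adjl // flipE. Qed.

Lemma lsl_tensor (H K L : hilbert R) (x : H -> K) (k : L) (z : L ⊗ H) : bd x ->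
  lsl k (ampr L x z) = x (lsl k z).
Proof.
move=> bx; apply: dot_ext => h; rewrite lslE adjr ?adj_tensor ?adj_idfun; auto.
by rewrite tensorE; auto; rewrite -lslE -adjr.
Qed.

(** Complex polarization, one leg at a time: first the diagonal slices in one leg vanish, then all
    slices in the other. *)
Lemma pure_quad0 (H K : hilbert R) (A : H ⊗ K -> H ⊗ K) : bd A ->
  (forall b w, '[A (b ⊗v w), b ⊗v w] = 0) -> A = 0.
Proof.
move=> bA h.
have h1 b : vslice1 A b b = 0.
  apply: quad_ext; [by auto|exact: bd_0|] => w.
  by rewrite vslice1E h zfunE dot0l.
have h2 w w' : vslice2 A w w' = 0.
  apply: quad_ext; [by auto|exact: bd_0|] => b.
  rewrite vslice2E -vslice1E h1 zfunE dot0l.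
  by rewrite dot0l.
apply: tens_ext; [by []|exact: bd_0|] => a b; apply: tdot_ext => c d.
rewrite -vslice2E h2 zfunE zfunE.
by rewrite !dot0l.
Qed.

Lemma pure_quad_ext (H K : hilbert R) (A B : H ⊗ K -> H ⊗ K) : bd A -> bd B ->
  (forall b w, '[A (b ⊗v w), b ⊗v w] = '[B (b ⊗v w), b ⊗v w]) -> A = B.
Proof.
move=> bA bB h; apply/eqP; rewrite -subr_eq0; apply/eqP; apply: pure_quad0; first by auto.
move=> b w; rewrite (_ : (A - B) (b ⊗v w) = A (b ⊗v w) - B (b ⊗v w)) //.
by rewrite dotBl h subrr.
Qed.

Lemma sqr_le (x y : C) : 0 <= x -> 0 <= y -> x ^+ 2 <= y ^+ 2 -> x <= y.
Proof. by move=> x0 y0; rewrite ler_pXn2r. Qed.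

Lemma pure_norm_ext (H : hilbert R) (q1 q2 : H -> C) :
  (forall c b, q1 (c *: b) = `|c| ^+ 2 * q1 b) -> (forall c b, q2 (c *: b) = `|c| ^+ 2 * q2 b) ->
  (forall b, '[b, b] = 1 -> q1 b = q2 b) -> q1 =1 q2.
Proof.
move=> h1 h2 h b; rewrite -(nlzK b) h1 h2.
by case: (nlz_dot b) => [/dot_eq0 e|/h -> //]; rewrite e -(scale0r 0) h1 h2 normr0 expr0n !mul0r.
Qed.

Definition rk (H1 H2 : hilbert R) (g : H2) (h : H1) : H1 -> H2 := fun x => '[x, h] *: g.
Lemma bd_rk (H1 H2 : hilbert R) (g : H2) (h : H1) : bd (rk g h).
Proof. exact: bd_rank1. Qed.

End PureForm.

#[global] Hint Resolve bd_rk : core.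

(** * Criteria for finite dimension *)

Section FinBasis.
Context {R : realType}.
Implicit Types (H : hilbert R).
Local Notation C := (Cx R).

Definition fin_basis H := exists d (g : 'I_d -> H),
  (forall i j, '[g i, g j] = (i == j)%:R :> C) /\ forall x, x = \sum_i '[x, g i] *: g i.

Lemma fin_basis_onb H (e : nat -> H) n0 : is_onb e ->
  (forall n, (n0 <= n)%N -> e n = 0) -> fin_basis H.
Proof.
move=> [eo eu ed] h; pose s := [seq i <- iota 0 n0 | e i != 0].
have es k : (k < size s)%N -> '[e (nth 0%N s k), e (nth 0%N s k)] = 1.
  move=> ks; have := mem_nth 0%N ks; rewrite mem_filter => /andP[h1 _].
  by case: (eu (nth 0%N s k)) => // /dot_eq0 e0; rewrite e0 eqxx in h1.
exists (size s), (fun k => e (nth 0%N s k)); split=> [i j|x].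
  have [->|ij] := eqVneq i j; first by rewrite es.
  by rewrite eo // nth_uniq // filter_uniq ?iota_uniq.
apply/eqP; rewrite -subr_eq0; apply/eqP; apply: (onb_ext ed) => i.
rewrite dotBl dot_suml.
have [e0|e0] := eqVneq (e i) 0.
  by rewrite e0 !dot0r sub0r; apply/eqP; rewrite oppr_eq0; apply/eqP; apply: big1 => k _; rewrite dot0r.
have is_ : i \in s.
  by rewrite mem_filter e0 mem_iota /= add0n ltnNge; apply/negP => /h /eqP; exact/negP.
have ks : (index i s < size s)%N by rewrite index_mem.
rewrite (bigD1 (Ordinal ks)) //= nth_index // big1 ?addr0.
  by rewrite dotZl; case: (eu i) => [/dot_eq0 z|->]; [rewrite z eqxx in e0|rewrite mulr1 subrr].
move=> k ki; rewrite dotZl eo ?mulr0 //; apply: contraNneq ki => ki.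
by apply/eqP/val_inj => /=; rewrite -ki index_uniq ?filter_uniq ?iota_uniq.
Qed.

Lemma finite_dim_basis H : finite_dim H -> fin_basis H.
Proof.
move=> [n [v hv]].
pose a m := if insub m is Some i then v i else 0 : H.
apply: (fin_basis_onb (e := gs a) (n0 := n)).
  split; [exact: gs_orth|exact: gs_unit|].
  apply/denseP => x e e0; exists x; last by rewrite subrr normr0.
  have : [set: H] x by []; rewrite -hv => -[m [c [w [hw ->]]]].
  apply: span_sum => i _; apply: spanZ; have [j _ <-] := hw i.
  by have := gs_span a j; rewrite /a valK.
move=> m nm; rewrite gsE /a insubF ?ltnNge ?nm //= /nlz big1 ?subr0 ?scaler0 //.
by move=> i _; rewrite dot0l scale0r.
Qed.

Lemma fin_basis_dim H : fin_basis H -> finite_dim H.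
Proof.
move=> [d [g [_ h]]]; exists d, g; apply/seteqP; split=> // x _.
exists d, (fun i => '[x, g i]), g; split=> // i; by exists i.
Qed.

(** The sum of the <e_i, e_i> is at most c Tr T, so some tail of it is below 1; a basis vector in
    that tail has norm 0 or 1 and is therefore 0. *)
Lemma trace_fin_basis H (T : H -> H) (c : C) : 0 <= c -> pos T ->
  (trace_pos T < +oo)%E -> (forall v, '[v, v] <= c * '[T v, v]) -> fin_basis H.
Proof.
move=> c0 [bT pT] tT h; have [eo eu ed] := onbP H.
have pe n : (0%:E <= (complex.Re ('[T (onb H n), onb H n] : C))%:E :> \bar R)%E.
  by rewrite lee_fin; have [] := Cx_real (pT (onb H n)).
have tfin : trace_pos T \is a fin_num.
  by rewrite ge0_fin_numE // /trace_pos; apply: nneseries_ge0.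
have sumle n : \sum_(i < n) '[onb H i, onb H i] <= c * cplx (fine (trace_pos T)).
  apply: (@le_trans _ _ (\sum_(i < n) c * '[T (onb H i), onb H i])); first by apply: ler_sum => i _.
  rewrite -mulr_sumr ler_wpM2l //.
  have -> : \sum_(i < n) '[T (onb H i), onb H i] =
     cplx (\sum_(i < n) complex.Re ('[T (onb H i), onb H i] : C)).
    by rewrite cplx_sum; apply: eq_bigr => i _; have [] := Cx_real (pT (onb H i)).
  rewrite cplx_le -lee_fin fineK // -sumEFin.
  have := @nneseries_lim_ge R (fun i => (complex.Re ('[T (onb H i), onb H i] : C))%:E) xpredT 0 n.
  by rewrite big_mkord; apply=> i _ _; exact: pe.
have [n0 hn] := bounded_series_cauchy (fun n => dot_ge0 (onb H n)) sumle (ltr01 : 0 < 1 :> C).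
apply: (fin_basis_onb (onbP H) (n0 := n0)) => n nn.
have := hn n n.+1 nn (leqnSn n); rewrite big_nat1 => h1.
by apply: dot_eq0; case: (eu n) => // h2; rewrite h2 ltxx in h1.
Qed.

Lemma adj_bound (H K : hilbert R) (x : H -> K) (d : C) : bd x -> 0 <= d ->
  (forall v, `|x v| <= d * `|v|) -> forall v, `|adj x v| <= d * `|v|.
Proof.
move=> bx d0 h v; apply: norm_le_dot => [|y]; first by rewrite mulr_ge0.
rewrite adjl //; apply: le_trans (dot_CS _ _) _.
by rewrite mulrAC [d * `|y| * _]mulrC ler_wpM2l // mulrC.
Qed.

End FinBasis.

Lemma scombE (T : Type) (k : pzRingType) (E : lmodType k) (f : T -> E) c t :
  (c *: f) t = c *: f t.
Proof. by []. Qed.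

Section PredualSum.
Context {R : realType} {tens : tensor_model R}.
Local Notation C := (Cx R).

Lemma pd_finT (H K : hilbert R) (I : finType) (v : I -> H) (u : I -> K) :
  predual (fun x : H -> K => \sum_i '[x (v i), u i]).
Proof.
case E: (enum I) => [|t0 l].
  apply: (pd_ext (pd_fin 0%N (fun=> 0) (fun=> 0))) => x _.
  by rewrite big_ord0 -big_enum E big_nil.
apply: (pd_ext (pd_fin (size (enum I)) (fun i => v (nth t0 (enum I) i))
  (fun i => u (nth t0 (enum I) i)))) => x _.
by rewrite -big_enum (big_nth t0) big_mkord.
Qed.

Lemma pure_sumr (H K : hilbert R) I r (P : pred I) (F : I -> K) (a : H) :
  a ⊗v (\sum_(i <- r | P i) F i) = \sum_(i <- r | P i) a ⊗v F i.
Proof. by elim/big_rec2: _ => [|i x y _ <-]; [exact: pure0r|exact: pureDr]. Qed.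

Lemma pure_suml (H K : hilbert R) I r (P : pred I) (F : I -> H) (b : K) :
  (\sum_(i <- r | P i) F i) ⊗v b = \sum_(i <- r | P i) F i ⊗v b.
Proof. by elim/big_rec2: _ => [|i x y _ <-]; [exact: pure0l|exact: pureDl]. Qed.

Lemma tensor_pos (H K : hilbert R) (x : H -> H) (t : H ⊗ K) : pos x ->
  0 <= '[ampl x K t, t] :> C.
Proof.
move=> [bx px]; have h := tens_parseval (z := ampl x K t) (z' := t) (onbP K).
apply: (lim_ge0 h) => n; rewrite seriesEord /=; apply: sumr_ge0 => k _.
by rewrite rsl_tensor.
Qed.
End PredualSum.

(** * Joint eigenbases of a trace class operator and a commuting one, by power iteration *)

Section Eigen.
Context {R : realType}.
Implicit Types (H L : hilbert R).
Local Notation C := (Cx R).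

Lemma lim_op H L (F : nat -> H -> L) (c : C) : 0 <= c ->
  (forall n a x y, F n (a *: x + y) = a *: F n x + F n y) ->
  (forall n x, `|F n x| <= c * `|x|) -> (forall x, exists l : L, (fun n => F n x) @ \oo --> l) ->
  exists2 p : H -> L, bd p & forall x, (fun n => F n x) @ \oo --> p x.
Proof.
move=> c0 Fl Fc Fx; have [p hp] := choice Fx; exists p => //.
apply: (bd_intro (c := c)) => [a x y|x]; last first.
  apply: (lim_le _ (hp x)) => [|n]; [by rewrite mulr_ge0|exact: Fc].
apply: (cvg_uniq (hp _)).
have -> : (fun n => F n (a *: x + y)) = (fun n => a *: F n x + F n y) by apply: funext => n; rewrite Fl.
by apply: cvgD; [apply: cvgZr; exact: hp|exact: hp].
Qed.

Lemma sqr_lt (x y : C) : 0 <= x -> 0 <= y -> x ^+ 2 < y ^+ 2 -> x < y.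
Proof. by move=> x0 y0; rewrite ltr_pXn2r. Qed.

Lemma cplx_sqrt (r : R) : 0 <= r -> cplx (Num.sqrt r) ^+ 2 = cplx r.
Proof. by move=> r0; rewrite expr2 -cplxM -expr2 sqr_sqrtr. Qed.

Lemma pos_sa H (T : H -> H) x y : pos T -> '[T x, y] = '[x, T y].
Proof. by move=> pT; rewrite adjr ?(pos_adj pT) //; case: pT. Qed.

Section Iter.
Variables (H : hilbert R) (T : H -> H).
Hypotheses (pT : pos T) (T1 : op_le T idfun).
Let bT : bd T. Proof. by case: pT. Qed.
Let A n : H -> H := iter n T.

Lemma it_lin n a x y : A n (a *: x + y) = a *: A n x + A n y.
Proof. by elim: n => //= n ->; rewrite (lopP bT). Qed.
Lemma it_sa n x y : '[A n x, y] = '[x, A n y].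
Proof. by elim: n x y => //= n IH x y; rewrite (pos_sa _ _ pT) IH -[T (A n y)]iterS iterSr. Qed.
Let m n x : C := '[A n x, x].
Lemma it_m i j x : '[A i x, A j x] = m (i + j) x.
Proof. by rewrite -it_sa /A -iterD addnC. Qed.
(** The difference is <T (x - T x), x - T x> plus <(1 - T) T x, T x>, both nonnegative. *)
Lemma T_TT x : '[T x, T x] <= '[T x, x] :> C.
Proof.
have [_ h] := pT; have := h (x - T x); have := T1 (T x).
rewrite -subr_ge0 => h1 h2; rewrite -subr_ge0; have := addr_ge0 h1 h2.
rewrite (lopB bT) !dotBl !dotBr (pos_sa (T x) x pT).
by congr (is_true (0 <= _)); ring.
Qed.
Lemma m_ge0 n x : 0 <= m n x.
Proof.
rewrite -(odd_double_half n) -addnn addnA -it_m; case: (odd n) => //=.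
by case: pT.
Qed.
Lemma m_dec n x : m n.+1 x <= m n x.
Proof.
rewrite -(odd_double_half n) -addnn addnA; set k := n./2.
case: (odd n); last by rewrite -addSn -!it_m; exact: T1.
have -> : (true + k + k).+1 = (k.+1 + k.+1)%N by rewrite add1n addSn addnS.
by have -> : (true + k + k = k.+1 + k)%N by []; rewrite -!it_m; exact: T_TT.
Qed.
Lemma m_mono n k x : (n <= k)%N -> m k x <= m n x.
Proof.
move=> /subnK <-; elim: (k - n)%N => [|j IH] //; exact: le_trans (m_dec _ _) IH.
Qed.
Lemma it_norm n x : `|A n x| <= 1 * `|x|.
Proof.
apply: sqr_le; rewrite ?mulr_ge0 // mul1r -!hdot_norm it_m.
by have := m_mono x (leq0n (n + n)).
Qed.
(** |A j x - A i x|^2 = m (2j) - 2 m (i + j) + m (2i), and the numbers m n = <A n x, x> decrease to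
    a limit. *)
Lemma it_cvg x : exists l : H, (fun n => A n x) @ \oo --> l.
Proof.
pose r n := complex.Re (m n x); have mr n : m n x = cplx (r n) by have [] := Cx_real (m_ge0 n x).
have rb : has_lbound (range r).
  by exists 0 => _ [n _ <-]; have [] := Cx_real (m_ge0 n x).
have rd : nonincreasing_seq r.
  by move=> i j ij; rewrite -cplx_le -!mr; exact: m_mono.
have rc := nonincreasing_cvgn rd rb; set q := inf _ in rc.
have qr n : q <= r n by apply: ge_inf => //; exists n.
apply: cauchy_conv => e e0; have [d d0 ed] := Cx_gt0 e0.
have d2 : 0 < d ^+ 2 / 2 by rewrite divr_gt0 ?exprn_gt0.
have [n0 hn] : exists n0, forall n, (n0 <= n)%N -> r n < q + d ^+ 2 / 2.
  have := cvgC_P (cvg_cplx rc) (e := cplx (d ^+ 2 / 2)); rewrite cplx_gt0 => /(_ d2) [n0 h].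
  exists n0 => n /h; rewrite -cplxB cplx_norm ?subr_ge0 // cplx_lt; lra.
exists n0 => i j i0 ij; have j0 : (n0 <= j)%N by exact: leq_trans ij.
apply: sqr_lt; [exact: normr_ge0|exact: ltW|]; rewrite -hdot_norm dotBl !dotBr !it_m !mr.
rewrite ed -!cplxB expr2 -cplxM cplx_lt.
have k1 := hn (j + j)%N (leq_trans j0 (leq_addr _ _)).
have k2 := hn (i + i)%N (leq_trans i0 (leq_addr _ _)).
have k3 := qr (j + i)%N; have k4 := qr (i + j)%N; rewrite -expr2; lra.
Qed.

Lemma it_proj : exists p : H -> H, [/\ bd p, forall x, (fun n => A n x) @ \oo --> p x,
  forall x, T (p x) = p x & forall x, '[p x, x] <= '[T x, x] :> C].
Proof.
have [p bp hp] := lim_op ler01 it_lin it_norm it_cvg; exists p; split=> // x.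
  apply: (cvg_uniq (lop_cvg bT (hp x))).
  by have := cvg_shiftC 1 (hp x).
have h1 : (fun k => '[A (1 + k) x, x] : C) @ \oo --> ('[p x, x] : C).
  exact: cvg_dotl (cvg_shiftC 1 (hp x)).
apply: (lim_leC h1 (cvg_cst ('[T x, x] : C))) => n.
exact: (m_mono x (leq_addr n 1)).
Qed.

Lemma sqrt_step (B : H -> H) (r : R) : 0 <= r -> (forall x y, '[B x, y] = '[x, B y]) ->
  (forall x, `|B (B x)| <= cplx r * `|x|) -> forall x, `|B x| <= cplx (Num.sqrt r) * `|x|.
Proof.
move=> r0 Bs h x; apply: sqr_le; rewrite ?mulr_ge0 ?cplx_ge0 ?sqrtr_ge0 //.
rewrite exprMn cplx_sqrt // -hdot_norm Bs.
have : 0 <= '[x, B (B x)] :> C by rewrite -Bs.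
move=> /ger0_norm <-; apply: le_trans (dot_CS _ _) _.
by rewrite mulrC expr2 mulrA ler_wpM2r.
Qed.

(** For symmetric B the norm of B is the square root of that of B^2, so a bound below 1 on the power
    2^j descends to T by j square roots. *)
Lemma it_gap j (r : R) : 0 <= r -> r < 1 -> (forall x, `|A (2 ^ j) x| <= cplx r * `|x|) ->
  exists2 s : R, 0 <= s < 1 & forall x, `|T x| <= cplx s * `|x|.
Proof.
elim: j r => [|j IH] r r0 r1 h; first by exists r; rewrite ?r0.
apply: (IH (Num.sqrt r)); rewrite ?sqrtr_ge0 //.
  by rewrite -(sqrtr1 R) ltr_sqrt.
apply: sqrt_step => // [x y|x]; first exact: it_sa.
by rewrite /A -iterD addnn -mul2n -expnS; exact: h.
Qed.

(** If the powers tended to 0, so would their traces: the tail of Σ <T e_i, e_i> is small uniformly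
    in the power, and the head goes to 0 termwise. A power of trace at most 1/2 bounds the
    Hilbert-Schmidt norm of its square root and so yields a gap, against the last hypothesis, which
    says that the form of T comes arbitrarily close to 1. *)
Lemma it_nonzero (e : nat -> H) (c : C) (p : H -> H) : is_onb e ->
  (forall x, (fun n => A n x) @ \oo --> p x) ->
  (forall n, \sum_(i < n) '[T (e i), e i] <= c) ->
  (forall s : R, 0 <= s < 1 -> exists x, cplx s * '[x, x] < '[T x, x]) -> p <> 0.
Proof.
move=> he hp tc hs p0; have [eo eu ed] := he.
have m0 (x : H) : (fun n => m n x) @ \oo --> (0 : C).
  move: (cvg_dotl (y := x) (hp x)); rewrite p0 zfunE dot0l => h; exact: h.
have q4 : 0 < 4%:R^-1 :> C by rewrite invr_gt0 ltr0n.
have [n0 hn0] := bounded_series_cauchy (fun i => (pT.2 (e i))) tc q4.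
have head N d : 0 < d -> exists k, forall n, (k <= n)%N -> \sum_(i < N) m n (e i) < d.
  elim: N d => [|N IH] d d0; first by exists 0%N => n _; rewrite big_ord0.
  have d2 : 0 < d / 2%:R by rewrite divr_gt0 // ltr0n.
  have [k1 h1] := IH _ d2; have [k2 h2] := cvgC_P (m0 (e N)) d2.
  exists (maxn k1 k2) => n; rewrite geq_max => /andP[/h1 n1 /h2].
  rewrite subr0 (ger0_norm (m_ge0 _ _)) => n2.
  by rewrite big_ord_recr /= [d]splitr; exact: (ltrD n1 n2).
have [k hk] := head n0 _ q4; pose j := k.
have kj : (k <= 2 ^ j + 2 ^ j)%N by rewrite (leq_trans (ltnW (ltn_expl k (ltnSn 1)))) ?leq_addr.
pose q := (2 ^ j + 2 ^ j)%N.
have q1 : (1 <= q)%N by rewrite addn_gt0 expn_gt0.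
have tr N : \sum_(i < N) m q (e i) <= 2%:R^-1.
  have h1 : \sum_(0 <= i < N) m q (e i) <= \sum_(0 <= i < n0 + N) m q (e i).
    rewrite [leRHS](big_cat_nat (n := N)) ?leq_addl //= lerDl.
    by apply: sumr_ge0 => i _; exact: m_ge0.
  rewrite -(big_mkord xpredT (fun i => m q (e i))); apply: le_trans h1 _.
  rewrite (big_cat_nat (n := n0)) ?leq_addr //=.
  have -> : 2%:R^-1 = 4%:R^-1 + 4%:R^-1 :> C by field.
  apply: lerD; first by rewrite big_mkord; apply: ltW; exact: hk.
  apply: le_trans (ltW (hn0 n0 (n0 + N)%N (leqnn _) (leq_addr _ _))).
  by apply: ler_sum => i _; exact: (m_mono (e i) q1).
have h2 : 0 <= 2%:R^-1 :> R by rewrite invr_ge0 ler0n.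
have c2 : cplx (2%:R^-1 : R) = 2%:R^-1 :> C by rewrite cplxV /cplx rmorph_nat.
have r1 : Num.sqrt (2%:R^-1 : R) < 1.
  by rewrite -[ltRHS]sqrtr1 ltr_sqrt ?ltr01 // invf_lt1 ?ltr0n // ltr1n.
have [s s01 hs'] : exists2 s : R, 0 <= s < 1 & forall x, `|T x| <= cplx s * `|x|.
  apply: (it_gap (j := j) (sqrtr_ge0 (2%:R^-1)) r1) => x.
  apply: sqr_le; rewrite ?mulr_ge0 ?cplx_ge0 ?sqrtr_ge0 //.
  rewrite exprMn cplx_sqrt // c2 -hdot_norm.
  apply: (lim_leC (parseval (x := A (2 ^ j) x) (y := A (2 ^ j) x) eo eu ed)
    (cvg_cst (2%:R^-1 * `|x| ^+ 2))) => N.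
  rewrite seriesEord /=; apply: (@le_trans _ _ (\sum_(i < N) `|x| ^+ 2 * m q (e i))).
    apply: ler_sum => i _; have -> : '[A (2 ^ j) x, e i] * '[e i, A (2 ^ j) x] = `|'[x, A (2 ^ j) (e i)]| ^+ 2.
      by rewrite normCK -(it_sa (2 ^ j) x (e i)) -dotC.
    apply: le_trans (dot_CS2 _ _) _; by rewrite it_m hdot_norm.
  by rewrite -mulr_sumr mulrC ler_wpM2r ?exprn_ge0.
have [x] := hs s s01; apply/negP; rewrite -real_leNgt ?ger0_real //; last first.
- by rewrite mulr_ge0 // cplx_ge0; case/andP: s01.
- by case: pT.
rewrite -(ger0_norm (pT.2 x)); apply: le_trans (dot_CS _ _) _.
by rewrite hdot_norm expr2 mulrA ler_wpM2r.
Qed.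

End Iter.

Lemma it_comm H (T B : H -> H) n x : (forall x, B (T x) = T (B x)) ->
  B (iter n T x) = iter n T (B x).
Proof. by move=> h; elim: n => //= n IH; rewrite h IH. Qed.

(** Divided by l, the supremum of its form on unit vectors, T can be iterated; the limit p is the
    spectral projection of the largest eigenvalue l. *)
Lemma eig_top H (T : H -> H) (e : nat -> H) (c : C) : pos T -> T <> 0 -> is_onb e ->
  (forall n, \sum_(i < n) '[T (e i), e i] <= c) ->
  exists (l : R) (p : H -> H), [/\ 0 < l, pos p /\ p <> 0,
    forall x, T (p x) = cplx l *: p x,
    forall B : H -> H, bd B -> (forall x, B (T x) = T (B x)) -> forall x, B (p x) = p (B x) &
    (forall x, T x = cplx l *: x -> p x = x) /\ forall x, cplx l * '[p x, x] <= '[T x, x]].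
Proof.
move=> pT T0 he tc; have [bT posT] := pT.
pose E : set R := [set r | exists2 x : H, '[x, x] = 1 & r = complex.Re ('[T x, x] : C)].
have TE x : '[T x, x] = cplx (complex.Re ('[T x, x] : C)) by have [] := Cx_real (posT x).
have [x0 x0E] : exists x : H, '[T x, x] != 0.
  apply: contrapT => h; apply: T0; apply: quad_ext; [exact: bT|exact: bd_0|] => v.
  rewrite dot0l; apply: contrapT => /eqP hv; by apply: h; exists v.
have nT x : '[T x, x] = '[x, x] * '[T (nlz x), nlz x].
  rewrite -{1 2}(nlzK x) (lopZ bT) dotZl dotZr mulrA -normCK normr_id -hdot_norm.
  by [].
have x01 : '[nlz x0, nlz x0] = 1.
  case: (nlz_dot x0) => // /dot_eq0 h; case/eqP: x0E; rewrite nT h.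
  by rewrite dot0r mulr0.
have E0 : E (complex.Re ('[T (nlz x0), nlz x0] : C)) by exists (nlz x0).
have [c0 c00 hc0] := pos_bounded pT.
have Eub : has_ubound E.
  exists c0 => _ [x x1 ->]; rewrite -cplx_le -TE; apply: le_trans (hc0 x) _.
  by rewrite (_ : (cplx c0 *: idfun) x = cplx c0 *: x) // dotZl x1 mulr1.
have Es : has_sup E by split=> //; eexists; exact: E0.
pose l := sup E.
have lub r : E r -> r <= l by move=> h; exact: ub_le_sup.
have l0 : 0 < l.
  apply: lt_le_trans (lub _ E0); rewrite -cplx_lt -TE lt_neqAle posT andbT eq_sym.
  by apply: contraNneq x0E => h; rewrite nT h mulr0.
have Tl x : '[T x, x] <= cplx l * '[x, x].
  case: (nlz_dot x) => [/dot_eq0 h|h]; first by rewrite nT h dot0r mulr0 mulr_ge0 // cplx_ge0 ltW.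
  rewrite nT mulrC ler_wpM2r // TE cplx_le; apply: lub; by exists (nlz x).
have lV : 0 <= l^-1 by rewrite invr_ge0 ltW.
have lc : cplx l != 0 by rewrite gt_eqF // cplx_gt0.
pose T' := cplx l^-1 *: T; have pT' : pos T' := pos_scale lV pT.
have T'E x : T' x = cplx l^-1 *: T x by [].
have T'1 : op_le T' idfun.
  by move=> x; rewrite T'E dotZl cplxV ler_pdivrMl ?cplx_gt0.
have [p [bp hp Tp pT'x]] := it_proj pT' T'1.
have TpE x : T (p x) = cplx l *: p x by rewrite -[in RHS]Tp T'E scalerA cplxV divff // scale1r.
have cp (B : H -> H) : bd B -> (forall x, B (T x) = T (B x)) -> forall x, B (p x) = p (B x).
  move=> bB hB x; have h1 := lop_cvg bB (hp x); apply: (cvg_uniq h1).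
  have -> : (fun n => B (iter n T' x)) = (fun n => iter n T' (B x)).
    by apply: funext => n; apply: it_comm => y; rewrite !T'E (lopZ bB) hB.
  exact: hp.
exists l, p; split; [exact: l0| |exact: TpE|exact: cp|].
- split; first split; [exact: bp|move=> x|].
    apply: (lim_ge0 (cvg_dotl (y := x) (hp x))) => n; exact: m_ge0.
  apply: (it_nonzero pT' T'1 (c := cplx l^-1 * c) he hp) => [n|s /andP[s0 s1]].
    have -> : \sum_(i < n) '[T' (e i), e i] = cplx l^-1 * \sum_(i < n) '[T (e i), e i].
      by rewrite mulr_sumr; apply: eq_bigr => i _; rewrite T'E dotZl.
    by rewrite ler_wpM2l ?cplx_ge0.
  have d0 : 0 < l * (1 - s) by rewrite mulr_gt0 // subr_gt0.
  have [_ [x x1 ->] hx] := sup_adherent d0 Es.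
  exists x; rewrite x1 mulr1 T'E dotZl cplxV ltr_pdivlMl ?cplx_gt0 // TE -cplxM cplx_lt.
  by apply: le_lt_trans hx; rewrite -/l; lra.
split=> x.
  move=> h; have e1 n : iter n T' x = x.
    by elim: n => //= n ->; rewrite T'E h scalerA cplxV mulVf // scale1r.
  apply: (cvg_uniq (hp x)).
  have -> : (fun n => iter n T' x) = (fun=> x) by apply: funext.
  exact: cvg_cst.
by have := pT'x x; rewrite T'E dotZl cplxV ler_pdivlMl ?cplx_gt0.
Qed.

(** B commutes with the top eigenprojection p of T. Either B p = 0, and every vector in the range of
    p serves with b = 0; or B p has finite trace because l p <= T, and its top eigenvectors lie in
    the range of p. *)
Lemma joint_eig H (T B : H -> H) (e : nat -> H) (c : C) : pos T -> T <> 0 -> is_onb e ->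
  (forall n, \sum_(i < n) '[T (e i), e i] <= c) -> pos B ->
  (forall x, B (T x) = T (B x)) ->
  exists (l b : R) (y : H), [/\ 0 < l, y <> 0, T y = cplx l *: y & B y = cplx b *: y].
Proof.
move=> pT T0 he tc pB hB; have [bB posB] := pB.
have [l [p [l0 [pp p0] Tp cp [fixp lep]]]] := eig_top pT T0 he tc.
have [bp posp] := pp.
have ppE x : p (p x) = p x by apply: fixp; exact: Tp.
have Bp x : B (p x) = p (B x) by exact: cp.
have [Bp0|Bp0] := pselect (B \o p = 0).
  have [x px] : exists x, p x <> 0.
    apply: contrapT => h; apply: p0; apply: funext => x; apply: contrapT => px.
    by apply: h; exists x.
  exists l, 0, (p x); split=> //; rewrite scale0r; exact: (congr1 (@^~ x) Bp0).
have [b0 b00 hb0] := pos_bounded pB.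
have sp x y : '[p x, y] = '[x, p y] := pos_sa x y pp.
have form x : '[(B \o p) x, x] = '[B (p x), p x] by rewrite /= Bp; transitivity ('[p (p (B x)), x] : C); [rewrite ppE|rewrite sp].
have pBp : pos (B \o p) by split=> [|x]; [auto|rewrite form].
have [|b [q [b1 [pq q0] Cq _ _]]] := eig_top pBp Bp0 he (c := cplx b0 * (cplx l^-1 * c)).
  move=> n; apply: (@le_trans _ _ (\sum_(i < n) cplx b0 * (cplx l^-1 * '[T (e i), e i]))).
    apply: ler_sum => i _; rewrite form; apply: le_trans (hb0 _) _.
    rewrite (_ : (cplx b0 *: idfun) (p (e i)) = cplx b0 *: p (e i)) // dotZl.
    rewrite ler_wpM2l ?cplx_ge0 // cplxV ler_pdivlMl ?cplx_gt0 //.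
    by rewrite -sp ppE; exact: lep.
  by rewrite -!mulr_sumr ler_wpM2l ?cplx_ge0 // ler_wpM2l // cplx_ge0 invr_ge0 ltW.
have [x qx] : exists x, q x <> 0.
  apply: contrapT => h; apply: q0; apply: funext => x; apply: contrapT => qx.
  by apply: h; exists x.
have bc : cplx b != 0 by rewrite gt_eqF // cplx_gt0.
have py : p (q x) = q x.
  have e1 : q x = (cplx b)^-1 *: p (B (q x)).
    by rewrite -Bp -[B (p _)]/((B \o p) _) Cq scalerA mulVf // scale1r.
  by rewrite [in LHS]e1 (lopZ bp) ppE -e1.
exists l, b, (q x); split=> //; first by rewrite -[in LHS]py Tp py.
by rewrite -[in LHS]py -[B (p _)]/((B \o p) _) Cq.
Qed.

Lemma onb_complete H (e : nat -> H) : (forall i j, i != j -> '[e i, e j] = 0) ->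
  (forall i, '[e i, e i] = 0 \/ '[e i, e i] = 1) ->
  exists2 P : H -> H, bd P & [/\ forall x, series (fun i => '[x, e i] *: e i) @ \oo --> P x,
    forall x i, '[P x, e i] = '[x, e i], forall x, `|P x| <= 1 * `|x| &
    (forall x, P x = x) -> dense (span (range e))].
Proof.
move=> eo eu.
have bes x n : `|series (fun i => '[x, e i] *: e i) n| <= 1 * `|x| :> C.
  rewrite seriesEord /=; have [_ h] := proj_dot eo eu x n.
  apply: sqr_le; rewrite ?mulr_ge0 // -hdot_norm h mul1r; exact: bessel.
have ex x : exists l : H, series (fun i => '[x, e i] *: e i) @ \oo --> l.
  apply: (orth_series (c := `|x| ^+ 2)) => [i j ij|n]; first exact: coef_orth.
  by rewrite (eq_bigr (fun i : 'I_n => `|'[x, e i]| ^+ 2)) ?bessel // => i _; exact: coef_norm.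
have [|P bP hP] := lim_op (F := fun n x => series (fun i => '[x, e i] *: e i) n) ler01 _ (fun n x => bes x n) ex.
  move=> n a x y; rewrite !seriesEord /= scaler_sumr -big_split; apply: eq_bigr => i _ /=.
  by rewrite dotDl dotZl scalerDl scalerA.
exists P; first exact: bP.
split; first exact: hP.
- move=> x i; apply: (cvg_uniq (cvg_dotl (y := e i) (hP x))).
  apply: cvgC_ex => d d0; exists i.+1 => n ni; rewrite seriesEord /= dot_suml.
  rewrite (bigD1 (Ordinal ni)) //= dotZl (unit_or0 _ (eu i)) big1 ?addr0 ?subrr ?normr0 //.
  by move=> k ki; rewrite dotZl eo ?mulr0.
- move=> x; apply: (lim_le _ (hP x)) => [|n]; [by rewrite mulr_ge0|exact: bes].
move=> hx; apply/denseP => x d d0; have := cvgC_P (hP x) d0 => -[n /(_ n (leqnn n))].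
rewrite hx distrC => hn; exists (series (fun i => '[x, e i] *: e i) n) => //.
by rewrite seriesEord /=; apply: span_sum => i _; apply: spanZ; apply: span_gen; exists i.
Qed.

(** Joint eigenvectors with different eigenvalues are orthogonal, so Gram-Schmidt on a dense
    sequence of joint eigenvectors returns joint eigenvectors. Were the result incomplete, T
    compressed to the orthogonal complement would have a joint eigenvector there, orthogonal to the
    dense sequence. *)
Lemma eigenbasis H (T B : H -> H) (c : C) : pos T -> injective T ->
  (forall n, \sum_(i < n) '[T (onb H i), onb H i] <= c) -> pos B ->
  (forall x, B (T x) = T (B x)) ->
  exists g : nat -> H, is_onb g /\ exists t b : nat -> R, forall n,
    T (g n) = cplx (t n) *: g n /\ B (g n) = cplx (b n) *: g n.
Proof.
move=> pT Ti tc pB hB; have [bT posT] := pT; have [bB posB] := pB.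
pose E l b y := T y = cplx l *: y /\ B y = cplx b *: y.
pose EE y := exists l b, E l b y.
have E0 l b : E l b 0 by split; rewrite ?(lop0 bT) ?(lop0 bB) scaler0.
have El l b k x y : E l b x -> E l b y -> E l b (k *: x + y).
  move=> [h1 h2] [h3 h4]; split; rewrite ?(lopP bT) ?(lopP bB) ?h1 ?h2 ?h3 ?h4;
  by rewrite scalerDr !scalerA mulrC.
have [A /countable_injP[f fi] dA] := hseparable H.
pose d n : H := xget 0 [set x | A x /\ f x = n].
have dE x : A x -> d (f x) = x.
  move=> Ax; rewrite /d; case: xgetP => [y _ [Ay e]|/(_ x)[]//].
  by apply: fi; rewrite ?inE.
(* For each point [d n] of a dense sequence and each k, a joint eigenvector within 1 / (k + 1) of it
   if there is one, and 0 otherwise. *)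
pose a m : H := if unpickle m is Some (n, k) then
  xget 0 [set y | EE y /\ `|d n - y| < (k.+1%:R)^-1] else 0.
have aE m : EE (a m).
  have z : EE 0 by exists 0, 0.
  rewrite /a; case: unpickle => [[n k]|] //; case: xgetP => [y _ [] //|//].
have ad y (e : C) : EE y -> 0 < e -> exists m, `|y - a m| < e.
  move=> Ey e0; have e2 : 0 < e / 2 by rewrite divr_gt0 // ltr0n.
  have [k /(_ k (leqnn k)) hk] := Cx_arch e2.
  have k0 : 0 < (k.+1%:R : C)^-1 by rewrite invr_gt0 ltr0n.
  have [x Ax hx] := (denseP _).1 dA y _ k0.
  exists (pickle (f x, k)); rewrite /a pickleK dE //.
  case: xgetP => [z _ [_ hz]|/(_ y)]; last by case; split=> //; rewrite distrC.
  rewrite -(subrKA x) (le_lt_trans (ler_normD _ _)) // [e]splitr.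
  by apply: ltrD; apply: lt_trans hk.
have [go gu] : (forall i j, i != j -> '[gs a i, gs a j] = 0) /\
  (forall i, '[gs a i, gs a i] = 0 \/ '[gs a i, gs a i] = 1).
  by split; [exact: gs_orth|exact: gs_unit].
have orth l b l' b' x y : E l b x -> E l' b' y -> E l b ('[x, y] *: y).
  move=> [h1 h2] [h3 h4]; rewrite /E !(lopZ bT) !(lopZ bB) h3 h4 !scalerA.
  have k1 : cplx l * '[x, y] = '[x, y] * cplx l'.
    by rewrite -dotZl -h1 (pos_sa _ _ pT) h3 dotZr cplx_conj mulrC.
  have k2 : cplx b * '[x, y] = '[x, y] * cplx b'.
    by rewrite -dotZl -h2 (pos_sa _ _ pB) h4 dotZr cplx_conj mulrC.
  by rewrite k1 k2.
have gE n : EE (gs a n).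
  elim/ltn_ind: n => n IH; have [l [b hl]] := aE n; exists l, b.
  rewrite gsE /nlz -[_ *: _]addr0; apply: (El) => //.
  rewrite addrC -scaleN1r; apply: (El) => //.
  apply: (big_ind (fun y => E l b y)) => // [x y hx hy|i _].
    by rewrite -[x]scale1r; exact: El.
  by have [l' [b' h']] := IH i (ltn_ord i); exact: orth hl h'.
have [P bP [hP Pc Pn Pd]] := onb_complete go gu.
exists (gs a); split; last first.
  have [t ht] := choice gE; have [b hb] := choice ht; exists t, b => n; exact: hb.
split=> //; apply: Pd.
have PP x : P (P x) = P x.
  apply: (cvg_uniq (hP (P x))); rewrite (_ : (fun i => _) = (fun i => '[x, gs a i] *: gs a i)).
    exact: hP.
  by apply: funext => i; rewrite Pc.
pose Q x := x - P x.
have bQ : bd Q by have := bd_sub (bd_id H) bP.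
have Qg x i : '[Q x, gs a i] = 0 by rewrite /Q dotBl Pc subrr.
have PQ x y : '[P x, Q y] = 0.
  have h := cvg_dotl (y := Q y) (hP x); apply: (cvg_uniq h).
  rewrite (_ : (fun n => _) = fun=> 0 : C); first exact: cvg_cst.
  apply: funext => n; rewrite seriesEord /= dot_suml big1 // => i _.
  by rewrite dotZl (dotC (gs a i)) Qg conjC0 mulr0.
have QQ x : Q (Q x) = Q x by rewrite /Q (lopB bP) PP subrr subr0.
have comm (U : H -> H) : pos U -> (forall n, exists l, U (gs a n) = cplx l *: gs a n) ->
    forall x, U (P x) = P (U x).
  move=> pU hU x; have [bU _] := pU; apply: (cvg_uniq (lop_cvg bU (hP x))).
  rewrite (_ : (fun n => _) = series (fun i => '[U x, gs a i] *: gs a i)); first exact: hP.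
  apply: funext => n; rewrite !seriesEord /= (lop_sum bU); apply: eq_bigr => i _.
  have [l hl] := hU i; have e1 : '[U x, gs a i] = cplx l * '[x, gs a i].
    by rewrite (pos_sa _ _ pU) hl dotZr cplx_conj.
  by rewrite (lopZ bU) hl e1 scalerA mulrC.
have cT x : T (Q x) = Q (T x).
  rewrite /Q (lopB bT) comm // => n; have [l [b [h _]]] := gE n; by exists l.
have cB x : B (Q x) = Q (B x).
  rewrite /Q (lopB bB) comm // => n; have [l [b [_ h]]] := gE n; by exists b.
have PE x : x = P x + Q x by rewrite /Q addrC subrK.
have QP x y : '[Q x, P y] = 0 by rewrite dotC PQ conjC0.
have TQ x : '[T (Q x), x] = '[T (Q x), Q x].
  by rewrite [in X in '[_, X]](PE x) dotDr cT QP add0r.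
have [TQ0|TQ0] := pselect (T \o Q = 0).
  move=> x; have h : Q x = 0.
    apply: (Ti); rewrite (lop0 bT); exact: (congr1 (@^~ x) TQ0).
  by rewrite [RHS]PE h addr0.
have pTQ : pos (T \o Q) by split=> [|x]; [auto|rewrite /= TQ].
have [||l [b [y [l0 y0 Ty By]]]] := joint_eig pTQ TQ0 (onbP H) (c := c) _ pB.
- move=> n; apply: le_trans (tc n); apply: ler_sum => i _ /=; rewrite TQ.
  move: (onb H i) => x; have -> : '[T x, x] = '[T (P x), P x] + '[T (Q x), Q x].
    have e1 : '[T (P x), Q x] = 0 by rewrite (pos_sa _ _ pT) cT PQ.
    have e2 : '[T (Q x), P x] = 0 by rewrite cT QP.
    have e3 : '[T (P x + Q x), P x + Q x] = '[T x, x] by rewrite -PE.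
    rewrite -e3 (lopD bT) (dotDl (T (P x))) !(dotDr (P x) (Q x)).
    by rewrite e1 e2 addr0 add0r.
  by rewrite lerDr; exact: posT.
- by move=> x /=; rewrite hB cB.
have lc : cplx l != 0 by rewrite gt_eqF // cplx_gt0.
have Qy : Q y = y.
  have e : y = (cplx l)^-1 *: Q (T y).
    by rewrite -cT -[T (Q y)]/((T \o Q) y) Ty scalerA mulVf // scale1r.
  by rewrite [in LHS]e (lopZ bQ) QQ -e.
have Ey : EE y by exists l, b; split=> //; rewrite -[in LHS]Qy -[T _]/((T \o Q) y).
have ya m : '[y, a m] = 0.
  have := gs_span a m; move: (a m); apply: span_ind; first exact: dot0r.
  by move=> k x z [i _ <-] hz; rewrite dotDr dotZr -{1}Qy Qg mulr0 add0r.
have yn : 0 < `|y| by rewrite normr_gt0; exact/eqP.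
have [m hm] := ad y _ Ey yn.
have e : '[y, y] = '[y, y - a m] by rewrite dotBr ya subr0.
have : `|'[y, y]| < `|y| ^+ 2.
  by rewrite e; apply: le_lt_trans (dot_CS _ _) _; rewrite expr2 ltr_pM2l.
by rewrite hdot_norm ger0_norm ?exprn_ge0 // ltxx.
Qed.

End Eigen.

(** * Orthonormal subfamilies, dense sequences in subspaces, orthogonal projections *)

Section Subfamily.
Context {R : realType}.
Local Notation C := (Cx R).

Lemma nonzero_subfamily (H : hilbert R) (e : nat -> H) n0 :
  (forall i j, i != j -> '[e i, e j] = 0) ->
  (forall i, '[e i, e i] = 0 \/ '[e i, e i] = 1) ->
  (forall n, (n0 <= n)%N -> e n = 0) ->
  exists d (g : 'I_d -> H), [/\ forall i j, '[g i, g j] = (i == j)%:R :> C,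
    forall i, exists n, g i = e n &
    forall x, (forall i, '[x, g i] = 0) -> forall n, '[x, e n] = 0].
Proof.
move=> eo eu h; pose s := [seq i <- iota 0 n0 | e i != 0].
have es k : (k < size s)%N -> '[e (nth 0%N s k), e (nth 0%N s k)] = 1.
  move=> ks; have := mem_nth 0%N ks; rewrite mem_filter => /andP[h1 _].
  by case: (eu (nth 0%N s k)) => // /dot_eq0 e0; rewrite e0 eqxx in h1.
exists (size s), (fun k => e (nth 0%N s k)); split=> [i j|i|x hx n].
- have [->|ij] := eqVneq i j; first by rewrite es.
  by rewrite eo // nth_uniq // filter_uniq ?iota_uniq.
- by exists (nth 0%N s i).
have [e0|e0] := eqVneq (e n) 0; first by rewrite e0 dot0r.
have ns : n \in s.
  by rewrite mem_filter e0 mem_iota /= add0n ltnNge; apply/negP => /h /eqP; exact/negP.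
have ks : (index n s < size s)%N by rewrite index_mem.
by have := hx (Ordinal ks); rewrite /= nth_index.
Qed.

Lemma orthonormal_sum (H : hilbert R) d (g : 'I_d -> H) x i :
  (forall i j, '[g i, g j] = (i == j)%:R :> C) -> '[\sum_k '[x, g k] *: g k, g i] = '[x, g i].
Proof.
move=> go; rewrite dot_suml (bigD1 i) //= dotZl go eqxx mulr1 big1 ?addr0 // => k /negPf ki.
by rewrite dotZl go ki mulr0.
Qed.
Implicit Types (H L : hilbert R).

Lemma dense_sequence H : exists a : nat -> H, forall x (e : C), 0 < e ->
  exists n, `|x - a n| < e.
Proof.
have [A /countable_injP[f fi] dA] := hseparable H.
pose a n : H := xget 0 [set x | A x /\ f x = n].
have aA x : A x -> a (f x) = x.
  move=> Ax; rewrite /a; case: xgetP => [y _ [Ay e]|/(_ x)[]//].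
  by apply: fi; rewrite ?inE.
exists a => x e e0; have [s As h] := (denseP A).1 dA x e e0.
by exists (f s); rewrite aA.
Qed.

Definition lin_closed H (S : set H) := S 0 /\ forall (c : C) x y, S x -> S y -> S (c *: x + y).

Lemma lin_closed_sum H (S : set H) I r (Q : pred I) (F : I -> H) : lin_closed S ->
  (forall i, Q i -> S (F i)) -> S (\sum_(i <- r | Q i) F i).
Proof.
move=> [S0 SL] h; apply: (big_ind S) => // x y Sx Sy.
by rewrite -[x]scale1r; exact: SL.
Qed.

(** The approximating sequence has to lie in S itself: for each point of a dense sequence of H and
    each precision, a point of S that close is picked when one exists. *)
Lemma subspace_sequence H (S : set H) : lin_closed S -> exists s : nat -> H,
  (forall n, S (s n)) /\ forall x (e : C), S x -> 0 < e -> exists n, `|x - s n| < e.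
Proof.
move=> [S0 _]; have [a ha] := dense_sequence H.
have /choice[s hs] : forall n : nat, exists v, S v /\ forall m k, unpickle n = Some (m, k) ->
    (exists2 w, S w & `|a m - w| < (k.+1%:R : C)^-1) -> `|a m - v| < (k.+1%:R : C)^-1.
  move=> n; case e: (unpickle n) => [[m k]|]; last by exists 0; split.
  have [[w Sw hw]|h] := pselect (exists2 w, S w & `|a m - w| < (k.+1%:R : C)^-1).
    by exists w; split=> // m' k' [<- <-].
  by exists 0; split=> // m' k' [<- <-] /h.
exists s; split=> [n|x e Sx e0]; first by have [] := hs n.
have e2 : 0 < e / 2%:R by rewrite divr_gt0 // ltr0n.
have [k hk] := Cx_arch e2; have k0 : 0 < (k.+1%:R : C)^-1 by rewrite invr_gt0 ltr0n.
have [m hm] := ha x _ k0; exists (pickle (m, k)).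
have [_ /(_ m k (pickleK _))] := hs (pickle (m, k)) => h.
have h1 : `|a m - s (pickle (m, k))| < (k.+1%:R : C)^-1.
  by apply: h; exists x => //; rewrite distrC.
rewrite (_ : x - _ = (x - a m) + (a m - s (pickle (m, k)))); last by rewrite addrA subrK.
apply: le_lt_trans (ler_normD _ _) _; rewrite [e]splitr.
by apply: ltrD; apply: lt_trans (hk _ (leqnn _)).
Qed.

(** S need not be topologically closed, so p is described through S and its orthogonal complement;
    it comes from Gram-Schmidt on a sequence dense in S. *)
Lemma projection H (S : set H) : lin_closed S -> exists2 p : H -> H, bd p &
  [/\ forall s, S s -> p s = s, forall x s, S s -> '[p x, s] = '[x, s],
   forall x z, (forall s, S s -> '[s, z] = 0) -> '[p x, z] = 0 &
   (forall x, p x = x) -> dense S].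
Proof.
move=> hS; have [S0 SL] := hS; have [s [sS sd]] := subspace_sequence hS.
have [e [eo eu es eS]] : exists e : nat -> H, [/\ forall i j, i != j -> '[e i, e j] = 0,
    forall i, '[e i, e i] = 0 \/ '[e i, e i] = 1, forall n, span (range e) (s n) &
    forall n, S (e n)].
  exists (gs s); split; [exact: gs_orth|exact: gs_unit|exact: gs_span|move=> n].
  elim/ltn_ind: n => n IH; rewrite gsE.
  have SZ c x : S x -> S (c *: x) by move=> Sx; rewrite -[c *: x]addr0; exact: SL.
  apply: (SZ); rewrite addrC -scaleN1r; apply: SL; last exact: sS.
  by apply: lin_closed_sum; [exact: hS|move=> i _; apply: SZ; exact: IH].
have [p bp [pc pe _ pd]] := onb_complete eo eu; exists p => //.
have so x t : S t -> '[p x, t] = '[x, t].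
  move=> St; apply/eqP; rewrite -subr_eq0 -dotBl; apply/eqP; set y := _ - _.
  have ys : forall n, '[y, s n] = 0.
    move=> n; apply: (span_ind (Q := fun v => '[y, v] = 0) _ _ (es n)) => [|c a b [i _ <-] h].
      by rewrite dot0r.
    by rewrite dotDr dotZr h addr0 /y dotBl pe subrr mulr0.
  apply: contrapT => /eqP y0; have c0 : 0 < `|'[y, t] : C| by rewrite normr_gt0.
  have e0 : 0 < `|'[y, t] : C| / (`|y| + 1) by rewrite divr_gt0 // ltr_wpDl.
  have [n hn] := sd t _ St e0; have : `|'[y, t] : C| < `|'[y, t] : C|; last by rewrite ltxx.
  have h1 : '[y, t] = '[y, t - s n] by rewrite dotBr ys subr0.
  rewrite {1}h1; apply: le_lt_trans (dot_CS _ _) _.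
  apply: (@le_lt_trans _ _ ((`|y| + 1) * `|t - s n|)); first by rewrite ler_wpM2r // lerDl.
  by rewrite mulrC -ltr_pdivlMr // ltr_wpDl.
have oz x z : (forall s, S s -> '[s, z] = 0) -> '[p x, z] = 0.
  move=> hz; apply: (cvg_uniq (cvg_dotl (y := z) (pc x))); apply: cvgC_ex => d d0; exists 0%N => n _.
  rewrite seriesEord /= dot_suml big1 ?subrr ?normr0 // => i _.
  by rewrite dotZl hz ?mulr0.
split=> //.
- move=> t St; apply/eqP; rewrite eq_sym -subr_eq0; apply/eqP; apply: dot_eq0; set y := _ - _.
  have hy u : S u -> '[u, y] = 0.
    by move=> Su; rewrite dotC /y dotBl so // subrr conjC0.
  by rewrite {1}/y dotBl hy // oz // subrr.
- move=> /pd d; apply: dense_sub d => x; apply: span_ind => [//|c a b [i _ <-] h]; exact: SL.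
Qed.

Lemma dense_of_orth H (S : set H) : lin_closed S ->
  (forall z, (forall s, S s -> '[s, z] = 0) -> z = 0) -> dense S.
Proof.
move=> hS h; have [p bp [_ po _ pd]] := projection hS; apply: pd => x.
apply/eqP; rewrite -subr_eq0; apply/eqP; apply: h => s Ss.
by rewrite dotC dotBl po // subrr conjC0.
Qed.

End Subfamily.

(** * Resolvents and bounded parts of a positive self-adjoint operator *)

Section Resolvent.
Context {R : realType} (H : hilbert R) (A : uop H).
Local Notation C := (Cx R).
Hypothesis hA : positive_selfadjoint A.

Let sym x y : udom A x -> udom A y -> '[uact A x, y] = '[x, uact A y].
Proof. by move=> hx hy; have [_ _ _ _ sa] := hA; have [_ /(_ (conj hy erefl))] := sa y (uact A y); apply. Qed.

Variable e : R.
Hypothesis e0 : 0 < e.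
Let ce : 0 < cplx e. Proof. by rewrite cplx_gt0. Qed.

Lemma shift_norm x : udom A x -> `|x| <= `|x + cplx e *: uact A x| :> C.
Proof.
move=> hx; have [_ _ _ pA _] := hA; have p1 := pA _ hx.
have p2 : 0 <= '[x, uact A x] :> C by rewrite -sym.
have p3 : 0 <= cplx e :> C by exact: ltW.
apply: sqr_le => //; rewrite -!hdot_norm dotDl !dotDr -addrA lerDl.
apply: addr_ge0; first by rewrite dotZr cplx_conj; apply: mulr_ge0.
apply: addr_ge0; last exact: dot_ge0.
by rewrite dotZl; apply: mulr_ge0.
Qed.

Lemma shift_inj x y : udom A x -> udom A y ->
  x + cplx e *: uact A x = y + cplx e *: uact A y -> x = y.
Proof.
move=> hx hy E; have [[d0 dL] aL _ _ _] := hA.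
have hd : udom A ((-1) *: y + x) by exact: dL.
have h : (-1) *: y + x + cplx e *: uact A ((-1) *: y + x) = 0.
  rewrite aL // !scaleN1r scalerDr scalerN addrACA E addrACA.
  by rewrite [- y + y]addNr [- _ + _]addNr addr0.
have := shift_norm hd; rewrite h normr0 => h1.
have : (-1) *: y + x == 0 by rewrite -normr_le0.
by rewrite scaleN1r addrC subr_eq0 => /eqP.
Qed.

(** The range of 1 + e A is dense, since a vector orthogonal to it would satisfy A z = - z / e, and
    it is closed, since [shift_norm] makes the preimages of a convergent sequence Cauchy. Both
    halves use self-adjointness in the form of the last clause of [positive_selfadjoint]. *)
Lemma shift_surj y : exists2 x, udom A x & x + cplx e *: uact A x = y.
Proof.
have [[d0 dL] aL dd pA sa] := hA.
pose S := [set y | exists2 x, udom A x & x + cplx e *: uact A x = y].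
have a0 : uact A 0 = 0.
  by have := aL 1 0 0 d0 d0; rewrite !scale1r addr0 => /eqP; rewrite -subr_eq0 opprD addrA subrr sub0r oppr_eq0 => /eqP.
have SS : lin_closed S.
  split; first by exists 0; rewrite // a0 scaler0 addr0.
  move=> c _ _ [x hx <-] [x' hx' <-]; exists (c *: x + x'); first exact: dL.
  by rewrite aL // !scalerDr !scalerA [cplx e * c]mulrC addrACA.
have Sd : dense S.
  apply: dense_of_orth SS _ => z hz.
  have [zd za] : udom A z /\ uact A z = - (cplx e)^-1 *: z.
    apply/sa => x hx; have := hz _ (ex_intro2 _ _ x hx erefl).
    rewrite dotDl dotZl dotZr => /eqP; rewrite addrC addr_eq0 => /eqP h.
    rewrite rmorphN fmorphV /= cplx_conj mulNr -mulrN -h mulrA mulVf ?mul1r //.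
    by rewrite gt_eqF.
  have := pA _ zd; rewrite za dotZl mulNr oppr_ge0 => h.
  apply: dot_eq0; apply: le_anti; rewrite dot_ge0 andbT.
  by move: h; rewrite pmulr_rle0 // invr_gt0.
have /choice[x hx] : forall n : nat, exists x, udom A x /\
    `|y - (x + cplx e *: uact A x)| < (n.+1%:R : C)^-1.
  move=> n; have n0 : 0 < (n.+1%:R : C)^-1 by rewrite invr_gt0 ltr0n.
  by have [s [x xd <-] h] := (denseP S).1 Sd y _ n0; exists x.
pose Y n := x n + cplx e *: uact A (x n).
have YC : Y @ \oo --> y.
  apply: cvgC_ex => d d0'; have [n0 h] := Cx_arch d0'; exists n0 => n nn.
  by rewrite distrC; apply: lt_trans (hx n).2 (h n nn).
have dif m n : `|x n - x m| <= `|Y n - Y m| :> C.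
  have hd : udom A ((-1) *: x m + x n) by apply: dL; [exact: (hx m).1|exact: (hx n).1].
  have := shift_norm hd; rewrite aL; [|exact: (hx m).1|exact: (hx n).1].
  rewrite !scaleN1r scalerDr scalerN addrACA -opprD [- x m + _]addrC.
  by rewrite [- _ + (x n + _)]addrC.
have [l xl] : exists l : H, x @ \oo --> l.
  apply: cauchy_conv => d d0'; have d2 : 0 < d / 2%:R by rewrite divr_gt0 // ltr0n.
  have [n0 h] := cvgC_P YC d2; exists n0 => m n hm hn; apply: le_lt_trans (dif m n) _.
  rewrite (_ : Y n - Y m = (Y n - y) + (y - Y m)); last by rewrite addrA subrK.
  apply: le_lt_trans (ler_normD _ _) _; rewrite [d]splitr [`|y - _|]distrC.
  by apply: ltrD; apply: h => //; exact: leq_trans hm hn.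
have [ld la] : udom A l /\ uact A l = (cplx e)^-1 *: (y - l).
  apply/sa => u hu.
  apply: (cvg_uniq (cvg_dotr (y := uact A u) xl)).
  rewrite (_ : (fun n => '[uact A u, x n] : C) = fun n => (cplx e)^-1 * ('[u, Y n] - '[u, x n])).
    rewrite dotZr fmorphV /= cplx_conj dotBr; apply: cvgMr; apply: cvgB; exact: cvg_dotr.
  apply: funext => n; rewrite sym //; last exact: (hx n).1.
  rewrite -dotBr /Y addrC addKr dotZr cplx_conj mulrA mulVf ?mul1r //.
  by rewrite gt_eqF.
exists l => //; rewrite la scalerA mulfV ?scale1r ?gt_eqF //.
by rewrite addrC subrK.
Qed.

Lemma shift_invP y : udom A (shift_inv A e y) /\
  shift_inv A e y + cplx e *: uact A (shift_inv A e y) = y.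
Proof.
by rewrite /shift_inv; case: xgetP => [x -> //|h]; have [x a b] := shift_surj y; case: (h x).
Qed.

Lemma shift_invK x : udom A x -> shift_inv A e (x + cplx e *: uact A x) = x.
Proof. by move=> hx; have [a b] := shift_invP (x + cplx e *: uact A x); exact: shift_inj. Qed.

Lemma bd_shift_inv : bd (shift_inv A e).
Proof.
have [[d0 dL] aL _ _ _] := hA.
apply: (@bd_intro _ _ _ _ 1) => [a x y|x].
  have [[dx ex] [dy ey]] := (shift_invP x, shift_invP y).
  rewrite -[in LHS]ex -[in LHS]ey -[RHS]shift_invK; last exact: dL.
  by congr shift_inv; rewrite aL // !scalerDr !scalerA [cplx e * a]mulrC addrACA.
by have [dx ex] := shift_invP x; rewrite mul1r -[X in _ <= `|X|]ex; exact: shift_norm.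
Qed.

Lemma pos_shift_inv : pos (shift_inv A e).
Proof.
split=> [|y]; first exact: bd_shift_inv.
have [dx ex] := shift_invP y; rewrite -[X in '[_, X]]ex dotDr dotZr cplx_conj.
have [_ _ _ pA _] := hA; apply: addr_ge0; first exact: dot_ge0.
apply: mulr_ge0; first exact: ltW.
by rewrite -sym //; exact: pA.
Qed.

Lemma bounded_partE y : cplx e *: bounded_part A e y = y - shift_inv A e y.
Proof. by have [_ E] := shift_invP y; rewrite /bounded_part /= -[X in _ = X - _]E addrC addKr. Qed.

Lemma pos_bounded_part : pos (bounded_part A e).
Proof.
have ne : cplx e != 0 by rewrite gt_eqF.
have E : bounded_part A e = (cplx e)^-1 *: (idfun - shift_inv A e).
  apply: funext => y; rewrite scombE -[LHS]scale1r -(mulVf ne) -scalerA bounded_partE.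
  by [].
split=> [|y]; first by rewrite E; apply: bd_scale; apply: bd_sub; [exact: bd_id|exact: bd_shift_inv].
have [dx ex] := shift_invP y; rewrite /bounded_part /= -[X in '[_, X]]ex dotDr dotZr cplx_conj.
have [_ _ _ pA _] := hA; apply: addr_ge0; first exact: pA.
by apply: mulr_ge0; [exact: ltW|exact: dot_ge0].
Qed.

End Resolvent.

(** * Diagonal operators, square roots, traces in an arbitrary basis, polarization *)

Section Diagonal.
Context {R : realType}.
Implicit Types (H L : hilbert R).
Local Notation C := (Cx R).

Lemma diag_op H (g : nat -> H) (d : nat -> R) (c : R) : is_onb g -> (forall n, 0 <= d n <= c) ->
  exists2 x : H -> H, pos x &
    (forall n, x (g n) = cplx (d n) *: g n) /\ forall v, `|x v| <= cplx c * `|v|.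
Proof.
move=> [go gu gd] hd.
have c0 : 0 <= c by have /andP[a b] := hd 0%N; exact: le_trans a b.
have t0 i : 0 <= '[g i, g i] :> C by exact: dot_ge0.
pose u v i := cplx (d i) *: ('[v, g i] *: g i).
have uo v i j : i != j -> '[u v i, u v j] = 0 by move=> ij; rewrite /u !dotZl !dotZr go // !mulr0.
have un v i : `|u v i| ^+ 2 <= cplx c ^+ 2 * `|'[v, g i]| ^+ 2 :> C.
  have /andP[a b] := hd i.
  rewrite normrZ exprMn coef_norm // ler_wpM2r ?exprn_ge0 //.
  by rewrite cplx_norm // lerXn2r ?nnegrE ?cplx_ge0 ?cplx_le.
have ub v n : \sum_(i < n) `|u v i| ^+ 2 <= cplx c ^+ 2 * `|v| ^+ 2.
  apply: (@le_trans _ _ (\sum_(i < n) cplx c ^+ 2 * `|'[v, g i]| ^+ 2)).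
    by apply: ler_sum => i _; exact: un.
  by rewrite -mulr_sumr ler_wpM2l ?exprn_ge0 ?cplx_ge0 //; exact: bessel.
have us v n : `|series (u v) n| <= cplx c * `|v| :> C.
  apply: sqr_le; rewrite ?mulr_ge0 ?cplx_ge0 //.
  rewrite seriesEord /= -(big_mkord xpredT (u v)) (pyth_sum (iota_uniq _ _) (uo v)) big_mkord exprMn.
  exact: ub.
have ex v : exists l : H, series (u v) @ \oo --> l.
  by apply: (orth_series (c := cplx c ^+ 2 * `|v| ^+ 2)) => [i j /uo|n]; [apply|exact: ub].
have cc0 : 0 <= cplx c :> C by rewrite cplx_ge0.
have [|x bx hx] := lim_op (F := fun n v => series (u v) n) cc0 _ (fun n v => us v n) ex.
  move=> n a v w; rewrite !seriesEord /= scaler_sumr -big_split; apply: eq_bigr => i _ /=.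
  by rewrite /u dotDl dotZl !scalerA mulrDr scalerDl !mulrA [a * _]mulrC.
exists x; last split.
- split=> // v; apply: (lim_ge0 (cvg_dotl (y := v) (hx v))) => n.
  rewrite seriesEord /= dot_suml; apply: sumr_ge0 => i _.
  have /andP[a b] := hd i.
  by rewrite !dotZl mulr_ge0 ?cplx_ge0 // [X in _ * X]dotC mul_conjC_ge0.
- move=> n; apply: (cvg_uniq (hx (g n))); apply: cvgC_ex => e e0; exists n.+1 => m nm.
  rewrite seriesEord /= (bigD1 (Ordinal nm)) //= big1 ?addr0; last first.
    by move=> i ni; rewrite /u go ?scale0r ?scaler0 // eq_sym.
  rewrite /u (_ : '[g n, g n] *: g n = g n) ?subrr ?normr0 //.
  case: (gu n) => h; first by rewrite (dot_eq0 h) scaler0.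
  by rewrite h scale1r.
- by move=> v; apply: (lim_le _ (hx v)) => [|n]; [rewrite mulr_ge0|exact: us].
Qed.

(** (b + r)(b - r) x = 0, and b + r is injective when r > 0. On eigenvectors this pins down the
    square root that [sqrt_op] selects. *)
Lemma sqrt_eigen H (b : H -> H) (r : R) x : pos b -> 0 <= r ->
  b (b x) = cplx (r ^+ 2) *: x -> b x = cplx r *: x.
Proof.
move=> pb r0 E; have [bb posb] := pb.
have [r00|r00] := eqVneq r 0.
  rewrite r00 cplx0 scale0r; apply: dot_eq0; rewrite (pos_sa _ _ pb) E r00 expr0n /= cplx0.
  by rewrite scale0r dot0r.
pose v := b x - cplx r *: x; apply/eqP; rewrite -subr_eq0 -/v; apply/eqP.
have bv : b v = - (cplx r *: v).
  rewrite /v (lopB bb) (lopZ bb) E scalerBr scalerA -cplxM -expr2 opprB.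
  by [].
have := posb v; rewrite bv dotNl dotZl oppr_ge0 => h.
apply: dot_eq0; apply: le_anti; rewrite dot_ge0 andbT.
by move: h; rewrite pmulr_rle0 // cplx_gt0 lt_neqAle eq_sym r00.
Qed.

Lemma sqrt_op_diag H (g : nat -> H) (a : nat -> R) (c : R) (b : H -> H) : is_onb g ->
  bd b -> (forall n, 0 <= a n <= c) -> (forall n, b (g n) = cplx (a n) *: g n) ->
  pos (sqrt_op b) /\ forall n, sqrt_op b (g n) = cplx (Num.sqrt (a n)) *: g n.
Proof.
move=> hg bb ha hb; have [go gu gd] := hg.
have hd n : 0 <= Num.sqrt (a n) <= Num.sqrt c.
  by have /andP[h1 h2] := ha n; rewrite sqrtr_ge0 /= ler_wsqrtr.
have [x px [xg _]] := diag_op hg hd.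
have [pS SS] : pos (sqrt_op b) /\ sqrt_op b \o sqrt_op b = b.
  rewrite /sqrt_op; case: xgetP => [y -> //|/(_ x)[]]; split=> //.
  have bx := pos_bd px; apply: (op_ext_span (bd_comp bx bx) bb gd) => _ [n _ <-] /=.
  rewrite xg (lopZ bx) xg scalerA hb -cplxM -expr2 sqr_sqrtr //.
  by have /andP[] := ha n.
split=> // n; apply: (sqrt_eigen pS); first exact: sqrtr_ge0.
rewrite -[sqrt_op b _]/((sqrt_op b \o sqrt_op b) _) SS hb sqr_sqrtr //.
by have /andP[] := ha n.
Qed.

Lemma trace_pos_partial H (a : H -> H) n : pos a ->
  ((\sum_(i < n) complex.Re ('[a (onb H i), onb H i] : C))%:E <= trace_pos a)%E.
Proof.
move=> [_ pa]; rewrite -sumEFin.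
have pe m : (0%:E <= (complex.Re ('[a (onb H m), onb H m] : C))%:E :> \bar R)%E.
  by rewrite lee_fin; have [] := Cx_real (pa (onb H m)).
have := @nneseries_lim_ge R (fun i => (complex.Re ('[a (onb H i), onb H i] : C))%:E) xpredT 0 n.
by rewrite big_mkord; apply=> i _ _; exact: pe.
Qed.

Lemma trace_pos_le H (a : H -> H) (c : R) : pos a ->
  (forall n, \sum_(i < n) '[a (onb H i), onb H i] <= cplx c :> C) -> (trace_pos a <= c%:E)%E.
Proof.
move=> [_ pa] h; apply: lime_le.
  apply: is_cvg_nneseries => m _ _; rewrite lee_fin; by have [] := Cx_real (pa (onb H m)).
apply: nearW => n; rewrite big_mkord sumEFin lee_fin -cplx_le cplx_sum.
rewrite (eq_bigr (fun i : 'I_n => '[a (onb H i), onb H i] : C)) ?h // => i _.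
by have [] := Cx_real (pa (onb H i)).
Qed.

Lemma trace_pos_ge H (a : H -> H) (c : R) n : pos a ->
  cplx c <= \sum_(i < n) '[a (onb H i), onb H i] :> C -> (c%:E <= trace_pos a)%E.
Proof.
move=> pa h; apply: le_trans (trace_pos_partial n pa); rewrite lee_fin -cplx_le cplx_sum.
rewrite (eq_bigr (fun i : 'I_n => '[a (onb H i), onb H i] : C)) ?h // => i _.
by have [] := Cx_real (pa.2 (onb H i)).
Qed.

Lemma hs_adj H L (c : H -> L) (e : nat -> H) (f : nat -> L) (s : C) : bd c -> is_onb e ->
  (forall i j, i != j -> '[f i, f j] = 0) -> (forall i, '[f i, f i] = 0 \/ '[f i, f i] = 1) ->
  (forall n, \sum_(i < n) `|c (e i)| ^+ 2 <= s) -> forall m, \sum_(j < m) `|adj c (f j)| ^+ 2 <= s.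
Proof.
move=> bc [eo eu ed] fo fu h m.
have cv j := parseval (x := adj c (f j)) (y := adj c (f j)) eo eu ed.
pose u n := \sum_(j < m) series (fun i => '[adj c (f j), e i] * '[e i, adj c (f j)] : C) n.
have uc : u @ \oo --> \sum_(j < m) '[adj c (f j), adj c (f j)].
  rewrite /u; elim: (m) => [|k IH].
    by rewrite big_ord0; apply: cvgC_ex => d d0; exists 0%N => n _; rewrite big_ord0 subrr normr0.
  rewrite big_ord_recr /=; under eq_fun do rewrite big_ord_recr /=.
  exact: (cvgD IH (cv k)).
rewrite (eq_bigr (fun j : 'I_m => '[adj c (f j), adj c (f j)])); last by move=> j _; rewrite hdot_norm.
have sc : (fun _ : nat => s) @ \oo --> s by apply: cvgC_ex => d d0; exists 0%N => n _; rewrite subrr normr0.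
apply: (lim_leC uc sc) => n; apply: le_trans (h n); rewrite /u.
under eq_bigr do rewrite seriesEord /=.
rewrite exchange_big /=; apply: ler_sum => i _.
apply: le_trans (bessel fo fu (c (e i)) m); apply: ler_sum => j _.
have -> : '[e i, adj c (f j)] = '[c (e i), f j] by rewrite (adjr _ _ bc).
have -> : '[adj c (f j), e i] = '[f j, c (e i)] by rewrite adjl.
by rewrite (dotC (f j)) normCK mulrC.
Qed.

(** [trace_pos] is defined through the fixed basis [onb]. Passing twice to the adjoint, through
    Hilbert-Schmidt sums, compares it with any other orthonormal family. *)
Lemma trace_pos_family H L (c : H -> L) (g : nat -> H) (m : nat) (s : R) : bd c ->
  (forall i j, i != j -> '[g i, g j] = 0) -> (forall i, '[g i, g i] = 0 \/ '[g i, g i] = 1) ->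
  (trace_pos (adj c \o c) <= s%:E)%E -> \sum_(j < m) '[c (g j), c (g j)] <= cplx s :> C.
Proof.
move=> bc go gu h; have ba := bd_adj bc.
have pa : pos (adj c \o c) by split=> [|v]; [exact: bd_comp|rewrite /= adjl].
have h1 n : \sum_(i < n) `|c (onb H i)| ^+ 2 <= cplx s :> C.
  have := le_trans (trace_pos_partial n pa) h; rewrite lee_fin -cplx_le cplx_sum.
  rewrite (eq_bigr (fun i : 'I_n => `|c (onb H i)| ^+ 2 : C)) // => i _.
  have [<- _] := Cx_real (pa.2 (onb H i)).
  by rewrite /= adjl // hdot_norm.
have [fo fu fd] := onbP L.
have h2 := hs_adj bc (onbP H) fo fu h1.
have := hs_adj ba (onbP L) go gu h2 m; rewrite adjK //.
by rewrite (eq_bigr (fun j : 'I_m => '[c (g j), c (g j)])) // => j _; rewrite hdot_norm.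
Qed.

Section Sesquilinear.
Variables (U : lmodType C) (D : set U).
Hypothesis DL : forall (c : C) x y, D x -> D y -> D (c *: x + y).

Definition sesq_on (B : U -> U -> C) :=
  (forall c x y z, D x -> D y -> D z -> B (c *: x + y) z = c * B x z + B y z) /\
  (forall c x y z, D x -> D y -> D z -> B z (c *: x + y) = c^* * B z x + B z y).

Lemma polar_sesq B x y : sesq_on B -> D x -> D y ->
  let q c := B (c *: y + x) (c *: y + x) in
  B x y = 4%:R^-1 * ((q 1 - q (-1)) + 'i * (q 'i - q (- 'i))).
Proof.
move=> [Bl Br] Dx Dy q.
have i2 : ('i : C) * 'i = -1 by rewrite -expr2 sqrCi.
have qE c : q c = c * (c^* * B y y + B y x) + (c^* * B x y + B x x).
  by rewrite /q Bl ?Br //; exact: DL.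
have e1 : (-1)^* = -1 :> C by rewrite rmorphN /= conjC1.
have e2 : (- 'i)^* = 'i :> C by rewrite rmorphN /= conjCi opprK.
rewrite !qE conjC1 e1 e2 conjCi.
have f4 : (4%:R : C) != 0 by rewrite pnatr_eq0.
apply: (mulfI f4); rewrite mulrA mulfV // mul1r.
by ring: i2.
Qed.


(** Invariance of a weight is known on squares only; this carries it to the associated sesquilinear
    form. *)
Lemma polar_series (Bk : nat -> U -> U -> C) B : (forall k, sesq_on (Bk k)) -> sesq_on B ->
  (forall x, D x -> series (fun k => Bk k x x) @ \oo --> B x x) ->
  forall x y, D x -> D y -> series (fun k => Bk k x y) @ \oo --> B x y.
Proof.
move=> hk hB h x y Dx Dy.
have hc c : series (fun k => Bk k (c *: y + x) (c *: y + x)) @ \oo --> B (c *: y + x) (c *: y + x).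
  by apply: h; exact: DL.
rewrite (polar_sesq hB Dx Dy) /=.
rewrite (_ : series _ = fun n => 4%:R^-1 * (
  (series (fun k => Bk k (1 *: y + x) (1 *: y + x)) n - series (fun k => Bk k ((-1) *: y + x) ((-1) *: y + x)) n)
  + 'i * (series (fun k => Bk k ('i *: y + x) ('i *: y + x)) n - series (fun k => Bk k ((- 'i) *: y + x) ((- 'i) *: y + x)) n))).
  apply: cvgMr; apply: cvgD; first by apply: cvgB; exact: hc.
  by apply: cvgMr; apply: cvgB; exact: hc.
apply: funext => n; rewrite !seriesEord /= -!sumrB !mulr_sumr -big_split mulr_sumr /=.
by apply: eq_bigr => k _; exact: (polar_sesq (hk k) Dx Dy).
Qed.
End Sesquilinear.

End Diagonal.

(** * From commutation with unitaries to commutation with a self-adjoint operator *)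

Section UnitarySpan.
Context {R : realType} (H : hilbert R).
Local Notation C := (Cx R).

Lemma square_uop (a : H -> H) : bd a -> adj a = a ->
  positive_selfadjoint (UOp setT (a \o a)).
Proof.
move=> ba sa; have s x y : '[a x, y] = '[x, a y] by rewrite (adjr _ _ ba) sa.
split=> //=; first by move=> c x y _ _; rewrite !(lopP ba).
- by apply/denseP => x e e0; exists x; rewrite // subrr normr0.
- by move=> x _; rewrite s.
- move=> y z; split=> [h|[_ <-] x _]; last by rewrite !s.
  by split=> //; apply: dot_ext => x; rewrite dotC [RHS]dotC -h // -!s.
Qed.

(* The Cayley-type unitaries [1 - 2B -/+ 2i aB], with [B = (1 + a^2)^-1], have [B] and [aB] as
   linear combinations. *)
Lemma commute_of_unitaries (a X : H -> H) : bd a -> adj a = a -> bd X ->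
  (forall u, unitary_op u ->
     (forall y, bd y -> (forall v, y (a v) = a (y v)) -> forall v, y (u v) = u (y v)) ->
     forall v, X (u v) = u (X v)) ->
  forall v, X (a v) = a (X v).
Proof.
move=> ba sa bX hX; have s x y : '[a x, y] = '[x, a y] by rewrite (adjr _ _ ba) sa.
have pA := square_uop ba sa; pose A := UOp setT (a \o a).
have [B [bB pB BE BK]] : exists B : H -> H, [/\ bd B, pos B,
    forall y, B y + a (a (B y)) = y & forall x, B (x + a (a x)) = x].
  exists (shift_inv A 1); split.
  - exact: bd_shift_inv.
  - exact: pos_shift_inv.
  - by move=> y; have [_] := shift_invP pA ltr01 y; rewrite cplx1 scale1r.
  - by move=> x; have := shift_invK pA ltr01 (x := x) I; rewrite cplx1 scale1r.
have Bc y : bd y -> (forall v, y (a v) = a (y v)) -> forall v, y (B v) = B (y v).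
  by move=> by_ yc v; rewrite -[in RHS](BE v) (lopD by_) !yc BK.
have Ba v : B (a v) = a (B v) by rewrite (Bc a ba).
have sB x y : '[B x, y] = '[x, B y] by exact: pos_sa.
pose U (k : C) v := v - 2%:R *: B v - k *: a (B v).
have bU k : bd (U k).
  rewrite (_ : U k = idfun - 2%:R *: B - k *: (a \o B)) //.
  by apply: bd_sub; [apply: bd_sub; [exact: bd_id|exact: bd_scale]|apply: bd_scale; exact: bd_comp].
have UE k v z : '[U k v, z] = '[v, z] - 2%:R * '[B v, z] - k * '[a (B v), z] :> C.
  by rewrite /U !dotBl !dotZl.
have i2 : ('i : C) * 'i = -1 by rewrite -expr2 sqrCi.
have UU k v : k = 2%:R * 'i \/ k = - (2%:R * 'i) -> U k (U (- k) v) = v.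
  move=> hk; have k2 : k * k = - 4%:R by case: hk => ->; ring: i2.
  have e1 : B (U (- k) v) = B v - 2%:R *: B (B v) + k *: a (B (B v)).
    by rewrite /U (lopB bB) (lopB bB) !(lopZ bB) Ba scaleNr opprK.
  have e2 : a (B (U (- k) v)) = a (B v) - 2%:R *: a (B (B v)) + k *: (B v - B (B v)).
    have e3 : a (a (B (B v))) = B v - B (B v) by apply/eqP; rewrite eq_sym subr_eq addrC BE.
    by rewrite e1 (lopD ba) (lopB ba) !(lopZ ba) e3.
  apply: dot_ext => z; rewrite UE e2 e1 UE !dotDl !dotNl !dotZl !dotDl !dotNl.
  set t1 := '[v, z]; set t2 := '[B v, z]; set t3 := '[a (B v), z]; set t4 := '[B (B v), z].
  set t5 := '[a (B (B v)), z].
  transitivity (t1 - 4%:R * t2 + 4%:R * t4 - (k * k) * (t2 - t4)); first by ring.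
  by rewrite k2; ring.
have cU k v : k^* = - k -> adj (U k) v = U (- k) v.
  move=> hk; congr (_ v); apply: (adj_uniq (bU k)) => x y.
  rewrite UE [RHS]dotC UE !rmorphB /= !rmorphM /= rmorphN /= hk opprK rmorph_nat.
  by rewrite -(dotC x y) -(dotC x (B y)) -(dotC x (a (B y))) -s -!sB Ba.
have k0 : (2%:R * 'i : C)^* = - (2%:R * 'i) by rewrite rmorphM /= rmorph_nat conjCi mulrN.
have k1 : (- (2%:R * 'i) : C)^* = - (- (2%:R * 'i)) by rewrite rmorphN /= k0.
have unU k : k = 2%:R * 'i \/ k = - (2%:R * 'i) -> unitary_op (U k).
  move=> hk; have hk' : k^* = - k by case: hk => ->.
  have hk2 : - k = 2%:R * 'i \/ - k = - (2%:R * 'i) by case: hk => ->; [right|left; rewrite opprK].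
  split; first exact: bU.
    by apply: funext => v; rewrite /= cU // -[X in U _ (U X _)]opprK UU.
  by apply: funext => v; rewrite /= cU // UU.
have XU k v : k = 2%:R * 'i \/ k = - (2%:R * 'i) -> X (U k v) = U k (X v).
  move=> hk; apply: hX; first exact: unU.
  by move=> y by_ yc w; rewrite /U !(lopB by_) !(lopZ by_) yc (Bc y by_ yc).
have XUd k v z : k = 2%:R * 'i \/ k = - (2%:R * 'i) ->
    '[X v, z] - 2%:R * '[X (B v), z] - k * '[X (a (B v)), z] =
    '[X v, z] - 2%:R * '[B (X v), z] - k * '[a (B (X v)), z] :> C.
  by move=> /XU E; rewrite -UE -E /U !(lopB bX) !(lopZ bX) !dotBl !dotZl.
have f4 : (4%:R : C) != 0 by rewrite pnatr_eq0.
have XB v : X (B v) = B (X v).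
  apply: dot_ext => z; apply: (mulfI f4).
  have h1 := XUd _ v z (or_introl erefl); have h2 := XUd _ v z (or_intror erefl).
  set E1 := (X in X = _) in h1; set E2 := (X in X = _) in h2.
  transitivity (2%:R * '[X v, z] - (E1 + E2)); first by rewrite /E1 /E2; ring.
  by rewrite h1 h2; ring.
have XaB v : X (a (B v)) = a (B (X v)).
  have f4i : (4%:R * 'i : C) != 0 by rewrite mulf_neq0 // neq0Ci.
  apply: dot_ext => z; apply: (mulfI f4i).
  have h1 := XUd _ v z (or_introl erefl); have h2 := XUd _ v z (or_intror erefl).
  set E1 := (X in X = _) in h1; set E2 := (X in X = _) in h2.
  transitivity (E2 - E1); first by rewrite /E1 /E2; ring.
  by rewrite h1 h2; ring.
by move=> v; rewrite -[in LHS](BK v) XaB -XB BK.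
Qed.

End UnitarySpan.

(** * Traces of rank one operators and Cauchy-Schwarz for positive operators *)

Section TraceRank.
Context {R : realType} (H : hilbert R).
Local Notation C := (Cx R).

Lemma pos_rk (v : H) : pos (rk v v).
Proof. by split=> [|w]; [exact: bd_rk|rewrite /rk dotZl [X in _ * X]dotC mul_conjC_ge0]. Qed.

Lemma trace_pos_rk (v : H) : trace_pos (rk v v) = (nrm2 v)%:E.
Proof.
have pv := pos_rk v; have [eo eu ed] := onbP H.
have E n : '[rk v v (onb H n), onb H n] = `|'[v, onb H n]| ^+ 2.
  by rewrite /rk dotZl normCK mulrC -dotC.
apply: le_anti; apply/andP; split.
  apply: trace_pos_le => // n; under eq_bigr do rewrite E.
  by rewrite nrm2E hdot_norm; exact: bessel.
apply/lee_addgt0Pr => e e0; have ce : 0 < cplx e :> C by rewrite cplx_gt0.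
have [n /(_ n (leqnn n))] := cvgC_P (parseval (x := v) (y := v) eo eu ed) ce.
rewrite seriesEord /= distrC -nrm2E => h.
rewrite -leeBlDr //.
apply: (trace_pos_ge (n := n)) => //; under eq_bigr do rewrite E.
have -> : \sum_(i < n) `|'[v, onb H i]| ^+ 2 = \sum_(i < n) '[v, onb H i] * '[onb H i, v] :> C.
  by apply: eq_bigr => i _; rewrite normCK [in RHS](dotC (onb H i)).
move: h; set S := \sum_(i < n) _; move=> h.
have S0 : 0 <= S by apply: sumr_ge0 => i _; rewrite [X in _ * X]dotC mul_conjC_ge0.
have [SE Sr] := Cx_real S0; rewrite SE; move: h; rewrite SE -cplxB.
rewrite cplx_le => h; have h2 : `|cplx (nrm2 v - complex.Re S)| < cplx e := h.
have h3 : nrm2 v - complex.Re S < e.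
  rewrite -cplx_lt; apply: le_lt_trans h2.
  by rewrite real_ler_norm // realE -(@cplx0 R) !cplx_le le_total.
by rewrite lerBlDr -lerBlDl ltW.
Qed.

End TraceRank.

Section PositiveCS.
Context {R : realType} (H : hilbert R).
Local Notation C := (Cx R).

Lemma pos_CS (A : H -> H) x y : pos A -> `|'[A x, y]| ^+ 2 <= '[A x, x] * '[A y, y] :> C.
Proof.
move=> pA; have [bA posA] := pA; apply: form_CS => // t.
have e : '[A y, x] = '[A x, y]^* by rewrite (pos_sa _ _ pA) -dotC.
have := posA (x - t *: y); rewrite (lopB bA) (lopZ bA) !dotBl !dotBr !dotZl !dotZr e => h.
by apply: le_trans h _; apply: le_of_eq; ring.
Qed.

End PositiveCS.

Lemma le_sqr_succ (R : realType) (x : Cx R) : 0 <= x -> x <= (x + 1) ^+ 2.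
Proof.
move=> x0; have -> : (x + 1) ^+ 2 = x + (x * x + x + 1) by ring.
by rewrite lerDl !addr_ge0 ?mulr_ge0.
Qed.

(** * Comparison of vectors through conjugate coefficients *)

Section ConjPair.
Context {R : realType} {tens : tensor_model R}.
Local Notation C := (Cx R).

Lemma conj_parseval (H : hilbert R) (g : nat -> H) (x x' y y' : H) (c c' : C) : is_onb g ->
  (forall k, '[x, g k] = c * ('[y, g k])^*) -> (forall k, '[x', g k] = c' * ('[y', g k])^*) ->
  '[x, x'] = c * c'^* * ('[y, y'])^*.
Proof.
move=> [go gu gd] h h'; apply: (cvg_uniq (parseval (x := x) (y := x') go gu gd)).
rewrite (_ : series _ = fun n => c * c'^* * (series (fun k => '[y, g k] * '[g k, y'] : C) n)^*).
  by apply: cvgMr; apply: cvg_conj; exact: parseval.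
apply: funext => n; rewrite !seriesEord /= rmorph_sum mulr_sumr; apply: eq_bigr => k _.
rewrite h (dotC (g k) x') h' !rmorphM /= conjCK (dotC (g k) y') conjCK.
by ring.
Qed.

(* Expansions along two orthonormal bases identify, up to conjugation and exchange of the legs. *)
Lemma conj_pair (H1 H2 : hilbert R) (g1 : nat -> H1) (g2 : nat -> H2) (x x' : H1 ⊗ H2)
  (y y' : H2 ⊗ H1) (c c' : C) : is_onb g1 -> is_onb g2 ->
  (forall k i, '[x, g1 k ⊗v g2 i] = c * ('[y, g2 i ⊗v g1 k])^*) ->
  (forall k i, '[x', g1 k ⊗v g2 i] = c' * ('[y', g2 i ⊗v g1 k])^*) ->
  '[x, x'] = c * c'^* * ('[y, y'])^*.
Proof.
move=> h1 h2 hx hx'.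
have e i : '[rsl (g2 i) x, rsl (g2 i) x'] = c * c'^* * ('[rsl (g2 i) (flip y), rsl (g2 i) (flip y')])^*.
  have fl z : rsl (g2 i) (flip z) = lsl (g2 i) z :> H1 by rewrite rsl_flip flipK.
  by apply: (conj_parseval h1) => k; rewrite fl rslE lslE.
have fy : '[flip y, flip y'] = '[y, y'] by rewrite -flip_adj adjl // flip_adj flipK.
rewrite -fy; apply: (cvg_uniq (tens_parseval h2 (z := x) (z' := x'))).
rewrite (_ : series _ = fun n => c * c'^* *
  (series (fun k => '[rsl (g2 k) (flip y), rsl (g2 k) (flip y')] : C) n)^*).
  by apply: cvgMr; apply: cvg_conj; exact: (tens_parseval h2 (z := flip y) (z' := flip y')).
by apply: funext => n; rewrite !seriesEord /= rmorph_sum mulr_sumr; apply: eq_bigr => k _; rewrite e.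
Qed.

(* The linear extension of a weight on sums and on positive elements *)
End ConjPair.

Section WeightGraph.
Context {R : realType} (H : hilbert R) (Q : set (H -> H)) (f : (H -> H) -> \bar R).
Local Notation C := (Cx R).
Hypotheses (hQ : is_vna Q) (hf : nsf_weight Q f).

Lemma wgraph_0 : wgraph Q f 0 0.
Proof. by have [h e] := Fin_0 hQ hf; have := wgraph_fin hQ hf h; rewrite e cplx0. Qed.

Lemma wgraph_sum I r (P : pred I) (z : I -> H -> H) (l : I -> C) :
  (forall i, P i -> wgraph Q f (z i) (l i)) ->
  wgraph Q f (\sum_(i <- r | P i) z i) (\sum_(i <- r | P i) l i).
Proof.
move=> h; elim/big_ind2: _ => //; first exact: wgraph_0.
by move=> z1 l1 z2 l2; exact: wgraph_add.
Qed.

Lemma wgraph_polar (za zb zc zd : H -> H) (a b c d : C) : wgraph Q f za a -> wgraph Q f zb b ->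
  wgraph Q f zc c -> wgraph Q f zd d ->
  wgraph Q f (4%:R^-1 *: ((za - zb) + 'i *: (zc - zd))) (4%:R^-1 * ((a - b) + 'i * (c - d))).
Proof.
move=> ha hb hc hd; apply: (wgraph_Z hQ hf); apply: (wgraph_add hQ hf).
  by apply: (wgraph_add hQ hf) => //; exact: wgraph_N.
by apply: (wgraph_Z hQ hf); apply: (wgraph_add hQ hf) => //; exact: wgraph_N.
Qed.

(** The graph presents z as (a - b) + i (c - d). Positivity forces z = a - b, hence z <= a, and z is
    finite. *)
Lemma wgraph_pos z l : Qp Q z -> wgraph Q f z l -> Fin Q f z /\ l = cplx (F f z).
Proof.
move=> qz hz; have fz : Fin Q f z.
  have [a [b [c [d [[fa fb fc fd] [e _]]]]]] := hz.
  apply: (Fin_le hQ hf qz fa) => v; rewrite e.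
  have rl x : Fin Q f x -> exists k : R, 0 <= k /\ '[x v, v] = cplx k.
    by move=> [[_ [_ px]] _]; have [E p] := Cx_real (px v); exists (complex.Re ('[x v, v] : C)).
  have [ka [_ ea]] := rl a fa; have [kb [b0 eb]] := rl b fb.
  have [kc [_ ec]] := rl c fc; have [kd [_ ed]] := rl d fd.
  have [kz [_ ez]] : exists k : R, 0 <= k /\ '[z v, v] = cplx k.
    by have [_ [_ px]] := qz; have [E p] := Cx_real (px v); exists (complex.Re ('[z v, v] : C)).
  have e2 : '[z v, v] = (cplx ka - cplx kb) + 'i * (cplx kc - cplx kd) :> C.
    rewrite e -[(_ + _) v]/((a v - b v) + 'i *: (c v - d v)).
    by rewrite dotDl dotZl !dotBl ea eb ec ed.
  rewrite -e ez ea cplx_le.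
  have : cplx kz + cplx kz = (cplx ka - cplx kb) + (cplx ka - cplx kb) :> C.
    have e3 : cplx kz = (cplx ka - cplx kb) - 'i * (cplx kc - cplx kd) :> C.
      rewrite -(cplx_conj kz) -ez e2 rmorphD rmorphM /= conjCi !rmorphB /= !cplx_conj.
      by rewrite mulNr.
    by rewrite {1}e3 -ez e2 addrACA addNr addr0.
  rewrite -!cplxB -!cplxD => /cplx_inj h; have {}h : kz = ka - kb by lra.
  by rewrite h lerBlDr lerDl.
by split=> //; rewrite -(wextE hQ hf hz) (wext_fin hQ hf fz).
Qed.

End WeightGraph.

(** * Density arguments for quadratic forms and amplified positive operators *)

Section Density.
Context {R : realType} {tens : tensor_model R}.
Local Notation C := (Cx R).

(* Positive operators agreeing with [A] at vectors approximating [z] have almost as large a form at [z]. *)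
Lemma form_le_approx (L : hilbert R) (A : L -> L) (D : set L) (z : L) (B : C) : pos A ->
  dense D -> (forall x, D x -> exists A' : L -> L, [/\ pos A', A' x = A x & '[A' z, z] <= B]) ->
  '[A z, z] <= B.
Proof.
move=> pA dD h; have bA := pos_bd pA; have [c c0 hc] := bdP bA.
have key x : D x -> '[A z, z] <= B + c * `|z - x| ^+ 2.
  move=> Dx; have [A' [pA' eA le]] := h x Dx; have bA' := pos_bd pA'.
  have sA := pos_adj pA; have sA' := pos_adj pA'.
  have E : '[A z, z] = '[A' z, z] + ('[A (z - x), z - x] - '[A' (z - x), z - x]).
    rewrite !(lopB bA) !(lopB bA') eA !dotBl !dotBr.
    have e1 : '[A z, x] = '[A' z, x] by rewrite (adjr _ _ bA) (adjr _ _ bA') sA sA' eA.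
    have e2 : '[A x, x] = '[A' x, x] by rewrite eA.
    by rewrite e1; ring.
  have le1 : '[A (z - x), z - x] <= c * `|z - x| ^+ 2.
    have ge : 0 <= '[A (z - x), z - x] by exact: pA.2.
    rewrite -(ger0_norm ge) (le_trans (dot_CS _ _)) // expr2 mulrA ler_wpM2r //.
  rewrite E lerD // (le_trans _ le1) // gerBl; exact: pA'.2.
have BR : B \is Num.real.
  have [x Dx _] : exists2 s, D s & `|z - s| < 1 by apply: (denseP D).1.
  have [A' [pA' _ le]] := h x Dx.
  by rewrite -(ler_real le) ger0_real //; exact: pA'.2.
have lr : '[A z, z] \is Num.real by rewrite ger0_real //; exact: pA.2.
rewrite real_leNgt //; apply/negP => lt; have e0 : 0 < '[A z, z] - B by rewrite subr_gt0.
have [e1 [e10 e1h]] : exists e1 : C, 0 < e1 /\ c * e1 ^+ 2 < '[A z, z] - B.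
  have [d d0 dE] := Cx_gt0 e0; have [cE c0R] := Cx_real c0; rewrite dE cE.
  set cr := complex.Re c; exists (cplx (Num.min 1 (d / (cr + 1) / 2))).
  have p1 : 0 < cr + 1 by rewrite ltr_wpDl.
  have p : 0 < Num.min 1 (d / (cr + 1) / 2) by rewrite lt_min ltr01 !divr_gt0.
  split; first by rewrite cplx_gt0.
  rewrite expr2 -!cplxM cplx_lt.
  have l1 : Num.min 1 (d / (cr + 1) / 2) <= 1 by rewrite ge_min lexx.
  have l2 : Num.min 1 (d / (cr + 1) / 2) <= d / (cr + 1) / 2 by rewrite ge_min lexx orbT.
  have l3 : cr * (d / (cr + 1) / 2) < d.
    rewrite !mulrA ltr_pdivrMr // ltr_pdivrMr //; nra.
  apply: le_lt_trans l3; rewrite ler_wpM2l //; nra.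
have [x Dx lx] := (denseP D).1 dD z e1 e10.
have le2 : c * `|z - x| ^+ 2 <= c * e1 ^+ 2.
  by rewrite ler_wpM2l // ler_pXn2r ?nnegrE // ltW.
have l3 : B + c * `|z - x| ^+ 2 < '[A z, z] by rewrite -ltrBrDl; exact: le_lt_trans e1h.
by have := le_lt_trans (key x Dx) l3; rewrite ltxx.
Qed.

Lemma form_ge0_dense (L : hilbert R) (B : L -> L) (D : set L) : bd B -> dense D ->
  (forall x, D x -> 0 <= '[B x, x] :> C) -> forall x, 0 <= '[B x, x] :> C.
Proof.
move=> bB dD h x; have [c c0 hc] := bdP bB.
have hu n : exists y, D y /\ `|y - x| < (n.+1%:R : C)^-1.
  have e0 : 0 < (n.+1%:R : C)^-1 by rewrite invr_gt0 ltr0n.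
  by have [s Ds ls] := (denseP D).1 dD x _ e0; exists s; rewrite distrC.
have [u hu'] := choice hu; pose k := c * (2%:R * `|x| + 1).
have k0 : 0 <= k by rewrite mulr_ge0 // addr_ge0 // mulr_ge0.
have bnd n : `|'[B (u n), u n] - '[B x, x]| <= k * `|u n - x|.
  have [_ lt] := hu' n; have d1 : `|u n - x| <= 1.
    by rewrite (le_trans (ltW lt)) // invf_le1 ?ler1n ?ltr0n.
  have un : `|u n| <= `|x| + 1 by rewrite -[u n](subrK x) addrC (le_trans (ler_normD _ _)) // lerD2l.
  have -> : '[B (u n), u n] - '[B x, x] = '[B (u n - x), u n] + '[B x, u n - x].
    by rewrite (lopB bB) dotBl dotBr; ring.
  rewrite (le_trans (ler_normD _ _)) //.
  have l1 : `|'[B (u n - x), u n]| <= c * `|u n - x| * (`|x| + 1).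
    by rewrite (le_trans (dot_CS _ _)) // ler_pM.
  have l2 : `|'[B x, u n - x]| <= c * `|x| * `|u n - x|.
    by rewrite (le_trans (dot_CS _ _)) // ler_wpM2r.
  rewrite (le_trans (lerD l1 l2)) // /k; apply: le_of_eq; ring.
have cvg : (fun n => '[B (u n), u n] : C) @ \oo --> ('[B x, x] : C).
  apply: cvgC_ex => e e0; have k1 : 0 < k + 1 by rewrite ltr_wpDl.
  have [n0 hn] := Cx_arch (divr_gt0 e0 k1); exists n0 => n le.
  have [_ l] := hu' n; apply: le_lt_trans (bnd n) _.
  apply: le_lt_trans (_ : _ <= (k + 1) * `|u n - x|) _; first by rewrite ler_wpM2r // lerDl.
  by rewrite -ltr_pdivlMl // mulrC (lt_trans l) // hn.
by apply: (lim_ge0 cvg) => n; apply: h; have [] := hu' n.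
Qed.

Lemma tensorZl (H1 H2 L : hilbert R) (x : H1 -> H2) (c : C) : bd x ->
  ampl (c *: x) L = c *: ampl x L.
Proof.
move=> bx; have bcx : bd (c *: x) by exact: bd_scale.
have bt : bd (ampl x L) by exact: bd_tensor.
apply: tens_ext => [||a b]; [exact: bd_tensor|exact: bd_scale|].
by rewrite (_ : (c *: ampl x L) (a ⊗v b) = c *: ampl x L (a ⊗v b)) // !tensorE // -pureZl.
Qed.

Lemma dense_pure (H1 H2 : hilbert R) (S1 : set H1) (S2 : set H2) :
  (forall z, (forall x, S1 x -> '[x, z] = 0) -> z = 0) ->
  (forall z, (forall x, S2 x -> '[x, z] = 0) -> z = 0) ->
  dense (span [set z | exists x y, [/\ S1 x, S2 y & z = x ⊗v y]]).
Proof.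
move=> h1 h2; apply: dense_of_orth => [|z hz].
  by split; [exact: span0|move=> c x y hx hy; apply: spanD => //; exact: spanZ].
apply: tdot_ext => b k; rewrite dot0l -rslE.
have -> : rsl k z = 0; last by rewrite dot0l.
apply: h1 => x Sx; rewrite dotC rslE -lslE.
have -> : lsl x z = 0; last by rewrite dot0l conjC0.
apply: h2 => y Sy; rewrite dotC lslE -dotC; apply: hz; apply: span_gen; by exists x, y.
Qed.


Lemma pos_zero (L : hilbert R) (A : L -> L) z : pos A -> '[A z, z] = 0 -> A z = 0.
Proof.
move=> pA h; have := pos_CS z (A z) pA; rewrite h mul0r => le.
apply: dot_eq0; apply/eqP; have := le_anti (introT andP (conj le (exprn_ge0 2 (normr_ge0 _)))).
by move/eqP; rewrite expf_eq0 /= normr_eq0.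
Qed.

Lemma pos_amp_l (L1 L2 : hilbert R) (A : L2 -> L2) : pos A ->
  pos (ampr L1 A).
Proof.
move=> pA; have bA := pos_bd pA; split=> [|z]; first exact: bd_tensor.
apply: (lim_ge0 (@left_parseval _ tens L1 L2 (ampr L1 A z) z)) => n; rewrite seriesEord /=; apply: sumr_ge0 => k _.
by rewrite lsl_tensor //; exact: pA.2.
Qed.

Lemma pos_amp_r (L1 L2 : hilbert R) (A : L1 -> L1) : pos A ->
  pos (ampl A L2).
Proof.
move=> pA; have bA := pos_bd pA; split=> [|z]; first exact: bd_tensor.
apply: (lim_ge0 (@tens_parseval _ tens L1 L2 _ (onbP L2) (ampl A L2 z) z)) => n; rewrite seriesEord /=; apply: sumr_ge0 => k _.
by rewrite rsl_tensor //; exact: pA.2.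
Qed.

Lemma tensor_subl (L1 L2 L3 : hilbert R) (A B : L1 -> L2) z : bd A -> bd B ->
  ampl (A - B) L3 z =
  ampl A L3 z - ampl B L3 z.
Proof.
move=> bA bB; have -> : A - B = (-1) *: B + A by rewrite scaleN1r addrC.
by rewrite tensor_linl // lcombE scaleN1r addrC.
Qed.

Lemma tensor_subr (L1 L2 L3 : hilbert R) (A B : L1 -> L2) z : bd A -> bd B ->
  ampr L3 (A - B) z =
  ampr L3 A z - ampr L3 B z.
Proof.
move=> bA bB; have bAB : bd (A - B) by exact: bd_sub.
apply: tdot_ext => a b; rewrite dotBl -!lslE !lsl_tensor //; exact: dotBl.
Qed.

Lemma form_conj_l (L1 L2 L3 : hilbert R) (S : L1 -> L2) (A : L2 -> L2) (z : L1 ⊗ L3) :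
  bd S -> bd A ->
  '[ampl (adj S \o (A \o S)) L3 z, z] =
  '[ampl A L3 (ampl S L3 z), ampl S L3 z] :> C.
Proof.
move=> bS bA; have baS := bd_adj bS; have bAS : bd (A \o S) by exact: bd_comp.
have -> : ampl (adj S \o (A \o S)) L3 = ampl (adj S) L3 \o
    (ampl A L3 \o ampl S L3).
  by rewrite tensor_comp // tensor_comp.
have e : ampl (adj S) L3 = adj (ampl S L3).
  by rewrite adj_tensor // adj_idfun.
by rewrite e; apply: (adjl _ _ (bd_tensor bS (bd_id L3))).
Qed.

Lemma form_conj_r (L1 L2 L3 : hilbert R) (S : L1 -> L2) (A : L2 -> L2) (z : L3 ⊗ L1) :
  bd S -> bd A ->
  '[ampr L3 (adj S \o (A \o S)) z, z] =
  '[ampr L3 A (ampr L3 S z), ampr L3 S z] :> C.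
Proof.
move=> bS bA; have baS := bd_adj bS; have bAS : bd (A \o S) by exact: bd_comp.
have -> : ampr L3 (adj S \o (A \o S)) = ampr L3 (adj S) \o
    (ampr L3 A \o ampr L3 S).
  by rewrite tensor_comp // tensor_comp.
have e : ampr L3 (adj S) = adj (ampr L3 S).
  by rewrite adj_tensor // adj_idfun.
by rewrite e; apply: (adjl _ _ (bd_tensor (bd_id L3) bS)).
Qed.

Lemma assocK (H1 H2 H3 : hilbert R) x : @assoc _ _ H1 H2 H3 (adj (@assoc _ _ H1 H2 H3) x) = x.
Proof.
have b : bd (@assoc _ _ H1 H2 H3) by exact: bd_assoc.
have ba := bd_adj b.
have E : @assoc _ _ H1 H2 H3 \o adj (@assoc _ _ H1 H2 H3) = (fun z => z).
  apply: tens_ext => [||a d]; [exact: bd_comp|exact: bd_id|].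
  have E2 : @assoc _ _ H1 H2 H3 \o adj (@assoc _ _ H1 H2 H3) \o (fun d : H2 ⊗ H3 => a ⊗v d) =
      (fun d : H2 ⊗ H3 => a ⊗v d).
    apply: tens_ext => [||c e]; [|exact: bd_pr|by rewrite /= adj_assocE assocE].
    by apply: bd_comp; [exact: bd_comp|exact: bd_pr].
  exact: (congr1 (@^~ d) E2).
exact: (congr1 (@^~ x) E).
Qed.

Lemma adj_assoc_dot (H1 H2 H3 : hilbert R) x y :
  '[adj (@assoc _ _ H1 H2 H3) x, adj (@assoc _ _ H1 H2 H3) y] = '[x, y].
Proof. by rewrite (adjl _ _ (bd_assoc H1 H2 H3)) assocK. Qed.

Lemma assoc_mid (H1 H2 H3 : hilbert R) (x : H2 -> H2) z : bd x ->
  ampl (ampr H1 x) H3 (adj (@assoc _ _ H1 H2 H3) z) =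
  adj (@assoc _ _ H1 H2 H3) (ampr H1 (ampl x H3) z).
Proof.
move=> bx; have bl : bd (ampr H1 x) by exact: bd_tensor.
have br : bd (ampl x H3) by exact: bd_tensor.
have E : @assoc _ _ H1 H2 H3 \o ampl (ampr H1 x) H3 =
    ampr H1 (ampl x H3) \o @assoc _ _ H1 H2 H3.
  apply: assoc_ext => [||a b c]; [by apply: bd_comp => //; exact: bd_tensor|by apply: bd_comp => //; exact: bd_tensor|].
  by rewrite /= tensorE // tensorE // !assocE tensorE // tensorE.
have e1 := congr1 (@^~ (adj (@assoc _ _ H1 H2 H3) z)) E.
rewrite /= assocK in e1; rewrite -e1; apply: dot_ext => u.
by rewrite (adjl _ _ (bd_assoc H1 H2 H3)) assoc_dot.
Qed.

End Density.

(** * The standing hypotheses on (M, DM), (N, DN), (P, DP) and the blocks *)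

Section GaloisData.
Context {R : realType} {tens : tensor_model R}.

(** The weights on P, the weight psi, its derivative delta and the A_r are left out of the bundle;
    they enter as variables of the sections that use them. *)
Record galois_data := GaloisData {
  gH : hilbert R; gM : set (gH -> gH);
  gDM : (gH -> gH) -> (gH ⊗ gH -> gH ⊗ gH); gxi : gH;
  ghM : compact_woronowicz_gns gM gDM gxi;
  gK : hilbert R; gN : set (gH -> gK);
  gDN : (gH -> gK) -> (gH ⊗ gH -> gK ⊗ gK);
  ghN : right_galois_coobject gM gDM gN gDN;
  gP : set (gK -> gK); gDP : (gK -> gK) -> (gK ⊗ gK -> gK ⊗ gK);
  ghP : gP = vna_generated [set z | exists x y, [/\ gN x, gN y & z = x \o adj y]];
  ghDP : vn_bialgebra gP gDP;
  ghDPN : forall x y, gN x -> gN y -> gDP (x \o adj y) = gDN x \o adj (gDN y);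
  gV : gH ⊗ gH -> gH ⊗ gH; ghV : is_mult_unitaryV gM gDM gxi gV;
  gVt : gK ⊗ gH -> gK ⊗ gK; ghVt : is_mult_unitaryV gN gDN gxi gVt;
  gWt : gK ⊗ gK -> gH ⊗ gK; ghWt : is_mult_unitaryW gN gDN gxi gWt;
  gI : choiceType; gHr : gI -> hilbert R;
  gpi : forall r, (gK -> gK) -> (gHr r -> gHr r); gp : gI -> (gK -> gK);
  ghpi : block_decomposition (dual_algebra gVt) gpi gp;
  gT : forall r, gHr r -> gHr r;
  ghT : state_densities gxi gWt (dual_algebra gVt) gpi gp gT }.

End GaloisData.
Arguments gpi {R tens g} r _ _.
Arguments gT {R tens g} r _.

Section Galois.
Context {R : realType} {tens : tensor_model R}.
Local Notation C := (Cx R).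
Variable G : galois_data.
Local Notation H := (gH G).
Local Notation K := (gK G).
Local Notation M := (gM (g := G)).
Local Notation DM := (gDM (g := G)).
Local Notation xi := (gxi G).
Local Notation N := (gN (g := G)).
Local Notation DN := (gDN (g := G)).
Local Notation P := (gP (g := G)).
Local Notation DP := (gDP (g := G)).
Local Notation V := (gV (g := G)).
Local Notation Vt := (gVt (g := G)).
Local Notation Wt := (gWt (g := G)).
Local Notation hM := (ghM G).
Local Notation hN := (ghN G).
Local Notation hV := (ghV G).
Local Notation hVt := (ghVt G).
Local Notation hWt := (ghWt G).
Local Notation Nhat := (dual_algebra Vt).
Local Notation Hr := (gHr (g := G)).
Local Notation pi := (@gpi _ _ G).
Local Notation gp := (@gp _ _ G).
Local Notation T := (@gT _ _ G).

(** * Slices of Z and Vt, and the dual algebra as a commutant *)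

Section Basics.

Definition Mb : M `<=` @bounded_op _ H H. Proof. by case: hM => -[[[? _] _ _ _ _] _ _ _ _]. Qed.
Definition Msub : subspace M. Proof. by case: hM => -[[_ ? _ _ _] _ _ _ _]. Qed.
Definition Mmul x y : M x -> M y -> M (x \o y).
Proof. by case: hM => -[[_ _ h _ _] _ _ _ _] _ _ _; exact: h. Qed.
Definition Madj x : M x -> M (adj x).
Proof. by case: hM => -[[_ _ _ h _] _ _ _ _] _ _ _; exact: h. Qed.
Definition DM_b x : M x -> bd (DM x).
Proof. by case: hM => -[_ [h _ _] _ _ _] _ _ _ Mx; have [] := h x Mx. Qed.
Definition DM_mul x y : M x -> M y -> DM (x \o y) = DM x \o DM y.
Proof. by case: hM => -[_ _ [h _ _] _ _] _ _ _; exact: h. Qed.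
Definition xi1 : '[xi, xi] = 1.
Proof. by case: hM => _ [[_ _ h] _] _ _; exact: h. Qed.
Definition Mxi_dense : dense [set v | exists2 x, M x & v = x xi].
Proof. by case: hM. Qed.
Definition Msep x : M x -> x xi = 0 -> x = 0.
Proof. by case: hM => _ _ _ h; exact: h. Qed.
Lemma M_inv x a b : M x -> '[DM x (xi ⊗v a), xi ⊗v b] = '[x xi, xi] * '[a, b].
Proof.
move=> Mx; case: hM => _ [_ /(_ x Mx)[h _]] _ _.
by rewrite -vslice1E -slice1_vec ?h ?fctE ?dotZl //; exact: DM_b.
Qed.
Lemma M_inv2 x a b : M x -> '[DM x (a ⊗v xi), b ⊗v xi] = '[x xi, xi] * '[a, b].
Proof.
move=> Mx; case: hM => _ [_ /(_ x Mx)[_ h]] _ _.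
by rewrite -vslice2E -slice2_vec ?h ?fctE ?dotZl //; exact: DM_b.
Qed.

Definition Nb : N `<=` @bounded_op _ H K. Proof. by case: hN => -[]. Qed.
Definition Nsub : subspace N. Proof. by case: hN => -[]. Qed.
Definition Ncl : sw_closure N `<=` N. Proof. by case: hN => -[]. Qed.
Definition DN_t x : N x -> vn_tensor N N (DN x).
Proof. by case: hN => _ [h _ _] _ _ _; exact: h. Qed.
Definition DN_b x : N x -> bd (DN x).
Proof. by move=> /DN_t []. Qed.
Definition DN_lin : linear_on N DN. Proof. by case: hN => _ []. Qed.
Definition NM x y : N x -> M y -> N (x \o y).
Proof. by case: hN => _ _ _ [h _ _ _] _; exact: h. Qed.
Definition NNM x y : N x -> N y -> M (adj x \o y).
Proof. by case: hN => _ _ _ [_ h _ _] _; exact: h. Qed.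
Definition DNM x y : N x -> M y -> DN (x \o y) = DN x \o DM y.
Proof. by case: hN => _ _ _ [_ _ h _] _; exact: h. Qed.
Definition DNN x y : N x -> N y -> adj (DN x) \o DN y = DM (adj x \o y).
Proof. by case: hN => _ _ _ [_ _ _ h] _; exact: h. Qed.
Hint Resolve Nb Mb DN_b DM_b : core.

Lemma Nlin c x y : N x -> N y -> N (c *: x + y). Proof. by case: Nsub => _ h; exact: h. Qed.
Lemma N0 : N 0. Proof. by case: Nsub. Qed.
Lemma NZ c x : N x -> N (c *: x).
Proof. by move=> Nx; rewrite -[_ *: _]addr0; apply: Nlin => //; exact: N0. Qed.
Lemma ND x y : N x -> N y -> N (x + y).
Proof. by move=> Nx Ny; rewrite -[x]scale1r; exact: Nlin. Qed.

Lemma Nsep x : N x -> x xi = 0 -> x = 0.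
Proof.
move=> Nx x0; have bx := Nb Nx; have h : adj x \o x = 0.
  by apply: Msep; [exact: NNM|rewrite /= x0 (lop0 (bd_adj bx))].
apply: funext => v; apply: dot_eq0; rewrite adjr //.
by move/(congr1 (@^~ v)): h => /= ->; rewrite dot0r.
Qed.

Lemma Nxi_dense : dense [set v | exists2 x, N x & v = x xi].
Proof.
case: hN => _ _ [dS _] _ _; apply: (dense_approx dS).
- by exists 0 => //; exact: N0.
- move=> c _ _ [x Nx ->] [y Ny ->]; exists (c *: x + y) => //; exact: Nlin.
- move=> _ e [x [w [Nx ->]]] e0; have bx := Nb Nx; have [c c0 hc] := bdP bx.
  have c1 : 0 < c + 1 by rewrite ltr_wpDl.
  have [_ [m Mm ->] hm] := (denseP _).1 Mxi_dense w _ (divr_gt0 e0 c1).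
  exists (x (m xi)); first by exists (x \o m) => //; exact: NM.
  rewrite -(lopB bx) (le_lt_trans (hc _)) //; rewrite ltr_pdivlMr // mulrC in hm.
  by apply: le_lt_trans hm; rewrite ler_wpM2r // lerDl.
Qed.

Definition Zt := adj Wt.
Definition unZ : unitary_op Zt. Proof. by case: hWt => h _; exact: un_adj. Qed.
Definition bZ : bd Zt := un_bd unZ.
Definition unVt : unitary_op Vt. Proof. by case: hVt. Qed.
Definition bVt : bd Vt := un_bd unVt.
Definition unV : unitary_op V. Proof. by case: hV. Qed.
Definition bV : bd V := un_bd unV.
Hint Resolve bZ bVt bV : core.
Lemma ZE x v : N x -> Zt (v ⊗v x xi) = DN x (v ⊗v xi).
Proof. by case: hWt => _ h; exact: h. Qed.
Lemma VtE x v : N x -> Vt (x xi ⊗v v) = DN x (xi ⊗v v).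
Proof. by case: hVt => _ h; exact: h. Qed.
Lemma VE x v : M x -> V (x xi ⊗v v) = DM x (xi ⊗v v).
Proof. by case: hV => _ h; exact: h. Qed.

(** After composition with V both sides agree at m xi ⊗ b. Being unitarily implemented, DN is norm
    continuous and has amplifications. *)
Lemma DNV y : N y -> DN y = Vt \o ampl y H \o adj V.
Proof.
move=> Ny; have by_ := Nb Ny; have bD := DN_b Ny.
suff h : DN y \o V = Vt \o ampl y H.
  by apply: funext => z; rewrite -[in LHS](unVK unV z) -/((DN y \o V) _) h.
apply: tens_ext; auto => a b.
have e : (DN y \o V) \o (fun a : H => a ⊗v b) =
   (Vt \o ampl y H) \o (fun a : H => a ⊗v b).
  apply: (op_ext_dense _ _ Mxi_dense); [by auto|by auto|] => _ [m Mm ->] /=.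
  rewrite VE // tensorE // -[y (m xi)]/((y \o m) xi) VtE; last exact: NM.
  by rewrite DNM.
exact: (congr1 (@^~ a) e).
Qed.

(** At w = x xi both sides are DN x (xi ⊗ xi). This is the link between the two unitaries. *)
Lemma ZVxi w : Zt (xi ⊗v w) = Vt (w ⊗v xi).
Proof.
have e : Zt \o (fun w : K => xi ⊗v w) = Vt \o (fun w : K => w ⊗v xi).
  apply: (op_ext_dense _ _ Nxi_dense); [by auto|by auto|] => _ [x Nx ->] /=.
  by rewrite ZE // VtE.
exact: (congr1 (@^~ w) e).
Qed.

Lemma DN_slice2 x v w : N x -> N (vslice2 (DN x) v w).
Proof. by move=> Nx; apply: (vn_slice2 v w Nb Nb Nsub Ncl); exact: DN_t. Qed.
Lemma DN_slice1 x v w : N x -> N (vslice1 (DN x) v w).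
Proof. by move=> Nx; apply: (vn_slice1 v w Nb Nb Nsub Ncl); exact: DN_t. Qed.

(** Coassociativity in matrix entries, which keeps the associator out of what follows. *)
Lemma COASS x a b c a' b' c' : N x ->
  '[DN (vslice2 (DN x) c c') (a ⊗v b), a' ⊗v b'] =
  '[DN (vslice1 (DN x) a a') (b ⊗v c), b' ⊗v c'] :> C.
Proof.
move=> Nx; have bD := DN_b Nx.
have [b1 h1] := map1_spec bVt bV Nb DNV bD (fun u v => DN_slice2 u v Nx).
have [b2 h2] := map2_spec bVt bV Nb DNV bD (fun u v => DN_slice1 u v Nx).
rewrite -h1 -h2 vslice2E vslice1E -assoc_dot assocE -[in RHS]assocE.
case: hN => _ _ _ _ [/(_ x Nx) e _].
by have := congr1 (@^~ ((a ⊗v b) ⊗v c)) e => /= ->.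
Qed.

(** Slices in either leg of the two unitaries: [nn] and [qq] are the coefficients of Z and Vt in N,
    [ss] are slices of Z in the dual algebra, and [sg] are the slices of Vt whose commutant is the
    dual algebra. *)
Definition nn (w' w : K) : H -> K := vslice2 Zt w w'.
Definition ss (f : H) (b : K) : K -> K := vslice1 Zt f b.
Definition qq (v w : K) : H -> K := vslice1 Vt w v.
Definition sg (f : H) (b : K) : K -> K := vslice2 Vt f b.
Lemma bd_nn w' w : bd (nn w' w). Proof. exact: bd_vslice2. Qed.
Lemma bd_ss w' w : bd (ss w' w). Proof. exact: bd_vslice1. Qed.
Lemma bd_qq w' w : bd (qq w' w). Proof. exact: bd_vslice1. Qed.
Lemma bd_sg w' w : bd (sg w' w). Proof. exact: bd_vslice2. Qed.
Hint Resolve bd_nn bd_ss bd_qq bd_sg : core.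
Lemma nnE w' w a b : '[nn w' w a, b] = '[Zt (a ⊗v w), b ⊗v w'].
Proof. exact: vslice2E. Qed.
Lemma ssE f b w w' : '[ss f b w, w'] = '[Zt (f ⊗v w), b ⊗v w'].
Proof. exact: vslice1E. Qed.
Lemma qqE v w a b : '[qq v w a, b] = '[Vt (w ⊗v a), v ⊗v b].
Proof. exact: vslice1E. Qed.
Lemma sgE f b w w' : '[sg f b w, w'] = '[Vt (w ⊗v f), w' ⊗v b].
Proof. exact: vslice2E. Qed.
Lemma nn_ss w' w a b : '[nn w' w a, b] = '[ss a b w, w'].
Proof. by rewrite nnE ssE. Qed.
Lemma qq_sg v w a b : '[qq v w a, b] = '[sg a b w, v].
Proof. by rewrite qqE sgE. Qed.

Lemma Ncl_dense (F : K -> H -> K) (c : C) : 0 <= c ->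
  (forall w w' v, F w v - F w' v = F (w - w') v) -> (forall w, bd (F w)) ->
  (forall w v, `|F w v| <= c * `|w| * `|v|) ->
  (forall x, N x -> N (F (x xi))) -> forall w, N (F w).
Proof.
move=> c0 Fs Fb Fc FN w; apply: Ncl; apply: (sw_norm_closed Nb) => // e e0.
have c1 : 0 < c + 1 by rewrite ltr_wpDl.
have [_ [x Nx ->] hx] := (denseP _).1 Nxi_dense w _ (divr_gt0 e0 c1).
exists (F (x xi)) => [|v]; first exact: FN.
rewrite Fs; apply: le_trans (Fc _ _) _; rewrite ler_wpM2r //.
rewrite ltr_pdivlMr // mulrC in hx; apply: le_trans (ltW hx).
by rewrite ler_wpM2r // lerDl.
Qed.

Lemma nn_lin w' c x y v : nn w' (c *: x + y) v = c *: nn w' x v + nn w' y v.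
Proof. by rewrite /nn vslice2_linl. Qed.
Lemma qq_lin w' c x y v : qq w' (c *: x + y) v = c *: qq w' x v + qq w' y v.
Proof. by rewrite /qq vslice1_linl. Qed.

Lemma nn_bound w' : exists2 c : C, 0 <= c & forall w v, `|nn w' w v| <= c * `|w| * `|v|.
Proof.
have [c c0 hc] := vslice2_bound bZ; exists (c * `|w'|); first by rewrite mulr_ge0.
by move=> w v; apply: le_trans (hc w w' v) _; rewrite (mulrAC c).
Qed.
Lemma qq_bound w' : exists2 c : C, 0 <= c & forall w v, `|qq w' w v| <= c * `|w| * `|v|.
Proof.
have [c c0 hc] := vslice1_bound bVt; exists (c * `|w'|); first by rewrite mulr_ge0.
by move=> w v; apply: le_trans (hc w w' v) _; rewrite (mulrAC c).
Qed.

Lemma nn_xi w' x : N x -> nn w' (x xi) = vslice2 (DN x) xi w'.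
Proof. by move=> Nx; apply: op_ext => a b; rewrite nnE vslice2E ZE. Qed.
Lemma qq_xi v x : N x -> qq v (x xi) = vslice1 (DN x) xi v.
Proof. by move=> Nx; apply: op_ext => a b; rewrite qqE vslice1E VtE. Qed.

Lemma N_nn w' w : N (nn w' w).
Proof.
have [c c0 hc] := nn_bound w'; apply: (Ncl_dense c0 _ _ hc) => //.
  by move=> x y v; rewrite addrC -scaleN1r -nn_lin scaleN1r addrC.
by move=> x Nx; rewrite nn_xi //; exact: DN_slice2.
Qed.
Lemma N_qq w' w : N (qq w' w).
Proof.
have [c c0 hc] := qq_bound w'; apply: (Ncl_dense c0 _ _ hc) => //.
  by move=> x y v; rewrite addrC -scaleN1r -qq_lin scaleN1r addrC.
by move=> x Nx; rewrite qq_xi //; exact: DN_slice1.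
Qed.
Hint Resolve N_nn N_qq : core.

(* [DN (F w)] depends continuously on [w], because [DN] is implemented by
   unitaries on [N]. *)
Lemma blf_DN (F : K -> H -> K) (c : C) z z' : 0 <= c ->
  (forall a x y v, F (a *: x + y) v = a *: F x v + F y v) -> (forall w, N (F w)) ->
  (forall w v, `|F w v| <= c * `|w| * `|v|) -> blf (fun w => '[DN (F w) z, z']).
Proof.
move=> c0 Fl FN Fc; split=> [a x y|].
  have -> : F (a *: x + y) = a *: F x + F y by apply: funext => v; rewrite Fl.
  by rewrite DN_lin // !fctE dotDl dotZl.
exists (c * `|adj V z| * `|adj Vt z'|); first by rewrite !mulr_ge0.
move=> w; rewrite DNV //= adjr //; apply: le_trans (dot_CS _ _) _.
rewrite mulrAC ler_wpM2r // mulrAC; apply: tensor_norm; auto.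
by rewrite mulr_ge0.
Qed.

Lemma ss_xi f b x : N x -> ss f b (x xi) = vslice1 (DN x) f b xi.
Proof. by move=> Nx; apply: dot_ext => w'; rewrite ssE vslice1E ZE. Qed.
Lemma sg_xi f b x : N x -> sg f b (x xi) = vslice2 (DN x) f b xi.
Proof. by move=> Nx; apply: dot_ext => w'; rewrite sgE vslice2E VtE. Qed.

(** Coassociativity at w = x xi, then density. Comultiplying a coefficient of Z composes the slices
    [ss]; for Vt and [sg], in [DN_qq], the order of composition is the opposite one. *)
Lemma DN_nn w' w f1 f2 b1 b2 :
  '[DN (nn w' w) (f1 ⊗v f2), b1 ⊗v b2] = '[ss f2 b2 (ss f1 b1 w), w'].
Proof.
move: w; apply: (blf_ext Nxi_dense).
- have [c c0 hc] := nn_bound w'; apply: (blf_DN _ _ c0 _ _ hc) => //.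
  by move=> *; exact: nn_lin.
- apply: (blf_dot (a := ss f2 b2 \o ss f1 b1)); auto.
move=> _ [x Nx ->]; rewrite nn_xi // COASS // -ZE; last exact: DN_slice1.
by rewrite -ssE (ss_xi _ _ Nx).
Qed.

Lemma DN_qq v w f1 f2 b1 b2 :
  '[DN (qq v w) (f1 ⊗v f2), b1 ⊗v b2] = '[sg f1 b1 (sg f2 b2 w), v].
Proof.
move: w; apply: (blf_ext Nxi_dense).
- have [c c0 hc] := qq_bound v; apply: (blf_DN _ _ c0 _ _ hc) => //.
  by move=> *; exact: qq_lin.
- apply: (blf_dot (a := sg f1 b1 \o sg f2 b2)); auto.
move=> _ [x Nx ->]; rewrite qq_xi // -COASS // -VtE; last exact: DN_slice2.
by rewrite -sgE (sg_xi _ _ Nx).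
Qed.

Lemma ss_sg f b a c w : ss f b (sg a c w) = sg a c (ss f b w).
Proof.
have e : ss f b \o sg a c = sg a c \o ss f b.
  apply: (op_ext_dense _ _ Nxi_dense); [by auto|by auto|] => _ [x Nx ->] /=.
  apply: dot_ext => v; rewrite (sg_xi _ _ Nx) (ss_xi _ _ Nx) ssE sgE.
  rewrite ZE; last exact: DN_slice2. rewrite VtE; last exact: DN_slice1.
  exact: COASS.
exact: (congr1 (@^~ w) e).
Qed.

(** Comes from testing the defining relation on elementary tensors; membership in the dual algebra
    is checked as a commutation from here on. *)
Lemma NhatP x : Nhat x <-> bd x /\ forall a c w, x (sg a c w) = sg a c (x w).
Proof.
split=> [[bx h]|[bx h]]; split=> //.
  move=> a c w; apply: dot_ext => v; rewrite adjr // !sgE.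
  move/(congr1 (fun t => Vt (t (w ⊗v a)))): h => /=.
  rewrite (unVK unVt) tensorE // => <-.
  by rewrite [RHS]adjr ?adj_tensor ?adj_idfun ?tensorE; auto.
suff e : ampl x K \o Vt = Vt \o ampl x H.
  by apply: funext => z; rewrite -compA e /= (unK unVt).
apply: top_ext; auto => w a v c /=; rewrite tensorE // -sgE -h.
by rewrite adjr ?adj_tensor ?adj_idfun ?tensorE; auto; rewrite -sgE -adjr.
Qed.

Lemma Nhat_b x : Nhat x -> bd x. Proof. by case. Qed.
Lemma Nhat_Vt x : Nhat x -> forall z,
  ampl x K (Vt z) = Vt (ampl x H z).
Proof.
move=> [bx h] z; move/(congr1 (fun t => Vt (t z))): h => /=.
by rewrite (unVK unVt).
Qed.
Lemma Nhat_adj x : Nhat x -> Nhat (adj x).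
Proof.
move=> Nx; have [bx _] := Nx; split; first by auto.
have e1 (L : hilbert R) : ampl (adj x) L = adj (ampl x L).
  by rewrite adj_tensor ?adj_idfun; auto.
apply: funext => z; apply: dot_ext => y /=.
by rewrite !e1 !adjl ?(Nhat_Vt Nx) ?(un_dot unVt); auto.
Qed.
Lemma Nhat_comp x y : Nhat x -> Nhat y -> Nhat (x \o y).
Proof.
move=> /NhatP[bx hx] /NhatP[by_ hy]; apply/NhatP; split=> [|a c w /=]; first by auto.
by rewrite hy hx.
Qed.
Lemma Nhat_lin c x y : Nhat x -> Nhat y -> Nhat (c *: x + y).
Proof.
move=> /NhatP[bx hx] /NhatP[by_ hy]; apply/NhatP; split=> [|a d w /=]; first by auto.
by rewrite !fctE hx hy (lopP (bd_sg _ _)).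
Qed.
Lemma Nhat_0 : Nhat 0.
Proof. by apply/NhatP; split=> [|a c w]; rewrite ?fctE ?(lop0 (bd_sg _ _)) //; exact: bd_0. Qed.
Lemma Nhat_1 : Nhat idfun. Proof. by apply/NhatP; split. Qed.
Lemma Nhat_ss f b : Nhat (ss f b).
Proof. by apply/NhatP; split=> // a c w; exact: ss_sg. Qed.

Lemma ss_xi_qq v w : ss xi v w = qq v w xi.
Proof. by apply: dot_ext => w'; rewrite ssE qqE ZVxi. Qed.

(** This is [DN_nn] with xi as first vector, read through Vt. It is the bridge between right
    invariance, which is adapted to [nn], and left invariance, which is adapted to [qq]. *)
Lemma nn_ss_qq w' w v : nn w' (ss xi v w) = qq v (nn w' w xi).
Proof.
apply: op_ext => a b; rewrite nn_ss -DN_nn -VtE // qqE.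
by [].
Qed.

End Basics.

Local Notation Z := Zt.
Hint Resolve Nhat_ss Nhat_1 : core.

Hint Resolve bd_nn bd_ss bd_qq bd_sg : core.

(** * The reflected bialgebra and its weights seen on N *)

Section GaloisP.

Lemma Pvna : is_vna P. Proof. by case: (ghDP G). Qed.
Lemma DP_b z : P z -> bd (DP z).
Proof. by case: (ghDP G) => _ [h _ _] _ _ _ Pz; have [] := h z Pz. Qed.
Lemma DP_lin : linear_on P DP. Proof. by case: (ghDP G) => _ []. Qed.
Lemma DP_normal : normal_map P DP. Proof. by case: (ghDP G) => _ []. Qed.
Lemma DP_mul x y : P x -> P y -> DP (x \o y) = DP x \o DP y.
Proof. by case: (ghDP G) => _ _ [h _ _] _ _; exact: h. Qed.
Lemma DP_adj x : P x -> DP (adj x) = adj (DP x).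
Proof. by case: (ghDP G) => _ _ [_ h _] _ _; exact: h. Qed.
Lemma DP_1 : DP idfun = idfun. Proof. by case: (ghDP G) => _ _ [_ _ h] _ _. Qed.
Lemma P_b : P `<=` @bounded_op _ K K. Proof. exact: (Qb Pvna). Qed.
Hint Resolve P_b DP_b : core.

Lemma P_NN x y : N x -> N y -> P (x \o adj y).
Proof. by move=> Nx Ny; rewrite (ghP G) => Q _; apply; exists x, y. Qed.

Lemma lin_on0 (H1 H2 H3 H4 : hilbert R) (S : set (H1 -> H2)) (f : (H1 -> H2) -> (H3 -> H4)) :
  linear_on S f -> S 0 -> f 0 = 0.
Proof.
move=> h S0; have := h 1 0 0 S0 S0; rewrite !scale1r addr0 => e.
by apply: (addrI (f 0)); rewrite addr0.
Qed.

Lemma sw_adj (H1 H2 : hilbert R) (S : set (H1 -> H2)) (T : set (H2 -> H1)) x :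
  S `<=` @bounded_op _ H1 H2 ->
  (forall s, S s -> T (adj s)) -> sw_closure S x -> sw_closure T (adj x).
Proof.
move=> bS h [bx hx]; split=> [|n w e pw e0]; first exact: bd_adj.
have pw' i : predual (fun y : H1 -> H2 => (w i (adj y))^*).
  have [v [u [sv su hw]]] := pw i; exists u, v; split; [exact: su|exact: sv|] => y by_.
  have e1 : series (fun n => '[y (u n), v n] : C) =
            (fun m => (series (fun n => '[adj y (v n), u n]) m : C)^*).
    apply: funext => m; rewrite !seriesEord /= rmorph_sum /=.
    by apply: eq_bigr => k _; rewrite adjl // -dotC.
  rewrite e1; exact: cvg_conj (hw (adj y) (bd_adj by_)).
have [y Sy hy] := hx n _ e pw' e0; exists (adj y) => [|i]; first exact: h.
by have := hy i; rewrite -rmorphB norm_conjC.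
Qed.

Lemma sw_close_two (H1 H2 : hilbert R) (S : set (H1 -> H2)) x n (w : 'I_n -> (H1 -> H2) -> C) w0 e :
  sw_closure S x -> (forall i, predual (w i)) -> predual w0 -> 0 < e ->
  exists y, [/\ S y, forall i, `|w i y - w i x| < e & `|w0 y - w0 x| < e].
Proof.
move=> [bx hx] pw p0 e0.
have [|y Sy hy] := hx n.+1 (fun i => if unlift ord0 i is Some j then w j else w0) e _ e0.
  by move=> i; case: unliftP => [j _|_]; [exact: pw|exact: p0].
exists y; split; [exact: Sy| |].
  by move=> i; move: (hy (lift ord0 i)); rewrite liftK => h; exact: h.
by move: (hy ord0); rewrite unlift_none => h; exact: h.
Qed.

(** The operators z for which both z and its adjoint map N into N on the left form a von Neumann
    algebra. It contains the generators of P, because N^* N lies in M and N M in N. *)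
Lemma PN z y : P z -> N y -> N (z \o y).
Proof.
have Nb := @Nb.
pose Q := [set z : K -> K | bd z /\ forall y, N y -> N (z \o y) /\ N (adj z \o y)].
suff h : is_vna Q.
  move=> + Ny; rewrite (ghP G) => /(_ Q h) [].
    move=> _ [a [b [Na Nb' ->]]]; split; first by auto.
    move=> c Nc; rewrite adj_comp ?adjK; auto.
    by split; rewrite -compA; apply: NM => //; exact: NNM.
  by move=> _ /(_ y Ny)[].
split; first split.
- by move=> ? [].
- by split=> [|c Nc]; rewrite ?adj_idfun.
- split.
    split=> [|c Nc]; first by auto.
    have -> : adj (0 : K -> K) = 0.
      by apply: adj_uniq => [|a b]; rewrite ?dot0r ?dot0l.
    by have -> : (0 : K -> K) \o c = 0 by []; split; exact: N0.
  move=> c a b [ba ha] [bb hb]; split=> [|d Nd]; first by auto.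
  rewrite adj_add ?adj_scale; auto.
  have [a1 a2] := ha d Nd; have [b1 b2] := hb d Nd.
  by split; [exact: (Nlin c a1 b1)|exact: (Nlin _ a2 b2)].
- move=> a b [ba ha] [bb hb]; split=> [|d Nd]; first by auto.
  rewrite (adj_comp ba bb); have [d1 d2] := hb d Nd; have [a1 a2] := ha d Nd.
  split; [exact: (ha _ d1).1|exact: (hb _ a2).2].
- move=> a [ba ha]; split=> [|d Nd]; first by auto.
  by have [] := ha d Nd; rewrite adjK.
move=> a ca; have ba := sw_bd ca; split=> // d Nd.
have cl (S : set (K -> K)) b : (forall s, S s -> N (s \o d)) -> sw_closure S b -> N (b \o d).
  move=> hS cb; apply: Ncl; have -> : b \o d = adj (idfun : K -> K) \o b \o d by rewrite adj_idfun.
  apply: (sw_conj (S := S) (a := d) (b := idfun) (T := N)) cb; [exact: Nb|exact: bd_id|].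
  by move=> s Ss; rewrite adj_idfun; exact: hS.
split; first by apply: cl ca => s [_ /(_ d Nd)[]].
apply: (cl (fun s => exists2 t, Q t & s = adj t)) => [_ [t [_ /(_ d Nd)[_ ?]] ->] //|].
by apply: sw_adj ca => [s []//|s Qs]; exists s.
Qed.

Lemma adj_comp3 (H1 H2 H3 H4 : hilbert R) (f : H3 -> H4) (g : H2 -> H3) (h : H1 -> H2) :
  bd f -> bd g -> bd h ->
  adj (f \o g \o h) = adj h \o adj g \o adj f.
Proof. by move=> bf bg bh; rewrite (adj_comp (bd_comp bf bg) bh) (adj_comp bf bg). Qed.

(** The z satisfying the formula form a von Neumann algebra containing the generators. Closedness
    uses normality of DP on one side and an explicit normal functional on the other; [sw_close_two]
    finds one approximant good for both. *)
Lemma DPV z : P z -> DP z = Vt \o ampl z H \o adj Vt.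
Proof.
pose E z := Vt \o ampl z H \o adj Vt.
have [bV0 uV] := (bVt, unVt).
have bE a : bd a -> bd (E a).
  by move=> ba; exact: bd_comp (bd_comp bV0 (bd_tensor ba (bd_id H))) (bd_adj bV0).
pose Q := [set z : K -> K | P z /\ DP z = E z].
suff h : is_vna Q.
  rewrite (ghP G) => /(_ Q h) [] //.
  move=> _ [a [b [Na Nb' ->]]]; split; first exact: P_NN.
  have [ba bb] := (Nb Na, Nb Nb').
  rewrite (ghDPN Na Nb') (DNV Na) (DNV Nb').
  rewrite (adj_comp3 bV0 (bd_tensor bb (bd_id H)) (bd_adj bV)) (adjK bV).
  rewrite (adj_tensor bb (bd_id H)) adj_idfun /E.
  rewrite (_ : ampl (a \o adj b) H =
     ampl a H \o ampl (adj b) H).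
    2: by rewrite tensor_comp; auto.
  apply: funext => t /=; by rewrite (unK unV).
have Eadj a : bd a -> adj (E a) = E (adj a).
  move=> ba; rewrite /E (adj_comp3 bV0 (bd_tensor ba (bd_id H)) (bd_adj bV0)) (adjK bV0).
  by rewrite (adj_tensor ba (bd_id H)) adj_idfun.
have Emul a b : bd a -> bd b -> E a \o E b = E (a \o b).
  move=> ba bb; rewrite /E (_ : ampl (a \o b) H = ampl a H \o ampl b H); last by rewrite tensor_comp; auto.
  by apply: funext => t /=; rewrite (unK uV).
have Elin c a b : bd a -> bd b -> E (c *: a + b) = c *: E a + E b.
  move=> ba bb; rewrite /E tensor_linl //; apply: funext => t /=.
  by rewrite !lcombE /= (lopP bV0).
split; first split.
- by move=> ? [/P_b].
- by split; [exact: Q1 Pvna|rewrite DP_1 /E tensor_id; apply: funext => t /=; rewrite (unVK uV)].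
- split.
    split; first exact: Q0 Pvna.
    have E0 : linear_on (@bounded_op _ K K) E by move=> c a b; exact: Elin.
    by rewrite (lin_on0 DP_lin (Q0 Pvna)) (lin_on0 E0 (bd_0 K K)).
  move=> c a b [Pa ha] [Pb hb]; split; first exact: (Qlin Pvna).
  by rewrite DP_lin // ha hb Elin; auto.
- move=> a b [Pa ha] [Pb hb]; split; first exact: (Qmul Pvna).
  by rewrite DP_mul // ha hb Emul; auto.
- move=> a [Pa ha]; split; first exact: (Qadj Pvna).
  by rewrite DP_adj // ha Eadj; auto.
move=> a ca; have ba := sw_bd ca.
have Pa : P a.
  by case: Pvna => _ _ _ _; apply; case: ca => _ h; split=> // n w e pw e0;
    have [y [Py _] hy] := h n w e pw e0; exists y.
split=> //; apply: op_ext => s t; apply/eqP; rewrite -subr_eq0 -normr_le0.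
apply/ler_addgt0Pr => e e0; rewrite add0r.
have e2 : 0 < e / 2 by rewrite divr_gt0 // ltr0n.
have [n [v [d [pv d0 hv]]]] := DP_normal (pd_vec s t) Pa e2.
have pE : predual (fun x : K -> K => '[E x s, t]).
  exists (fun k => rsl (onb H k) (adj Vt s)), (fun k => rsl (onb H k) (adj Vt t)).
  have sq u : square_summable (fun k => rsl (onb H k) u : K).
    by apply: (sq_sum_intro (c := `|u| ^+ 2)) => m; exact: tens_bessel (onbP H) u m.
  split; [exact: sq|exact: sq|] => x bx; have -> : '[E x s, t] = '[ampl x H (adj Vt s), adj Vt t].
    by rewrite /E /= adjr.
  have := tens_parseval (z := ampl x H (adj Vt s)) (z' := adj Vt t) (onbP H).
  have -> : (fun k => '[rsl (onb H k) (ampl x H (adj Vt s)),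
      rsl (onb H k) (adj Vt t)] : C) =
    (fun k => '[x (rsl (onb H k) (adj Vt s)), rsl (onb H k) (adj Vt t)]).
    by apply: funext => k; rewrite rsl_tensor.
  exact.
have [e1 e10 ee] := Cx_gt0 e2; have [d1 d10 dd] := Cx_gt0 d0.
have m0 : 0 < cplx (Num.min d1 e1) :> C by rewrite cplx_gt0 lt_min d10.
have [y [[Py hy] h1 h2]] := sw_close_two ca pv pE m0.
have : `|'[DP y s, t] - '[DP a s, t]| < e / 2 :> C.
  by apply: hv => // i; apply: lt_le_trans (h1 i) _; rewrite dd cplx_le ge_min lexx.
have : `|'[E y s, t] - '[E a s, t]| < e / 2 :> C.
  by apply: lt_le_trans h2 _; rewrite ee cplx_le ge_min lexx orbT.
rewrite hy distrC => k1 k2; rewrite -(subrKA '[E y s, t]) (le_trans (ler_normD _ _)) //.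
by rewrite [e]splitr addrC ltW // ltrD // distrC.
Qed.

Lemma DP_DN z y : P z -> N y -> DP z \o DN y = DN (z \o y).
Proof.
move=> Pz Ny; have [bz by_] := (P_b Pz, Nb Ny).
rewrite DPV // !DNV //; last exact: PN.
have -> : ampl (z \o y) H =
     ampl z H \o ampl y H.
  by rewrite tensor_comp; auto.
by apply: funext => t /=; rewrite (unK unVt).
Qed.

Lemma DN_DP_DN x z y : N x -> P z -> N y ->
  adj (DN x) \o DP z \o DN y = DM (adj x \o (z \o y)).
Proof.
by move=> Nx Pz Ny; rewrite -compA DP_DN // DNN //; exact: PN.
Qed.

Definition sq (H1 H2 : hilbert R) (n : H1 -> H2) : H2 -> H2 := n \o adj n.
Lemma sq_form (H1 H2 : hilbert R) (n : H1 -> H2) v : bd n -> '[sq n v, v] = '[adj n v, adj n v].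
Proof. by move=> bn; rewrite /sq /= adjr. Qed.

Lemma polar_op (H1 H2 : hilbert R) (x y : H1 -> H2) : bd x -> bd y ->
  x \o adj y = (4%:R : C)^-1 *: ((sq (x + y) - sq (x - y)) +
    'i *: (sq (x + 'i *: y) - sq (x - 'i *: y))).
Proof.
move=> bx by_; have biy : bd ('i *: y) by exact: bd_scale.
apply: op_ext => a b; rewrite -[LHS](mulKf (x := 4%:R : C)) ?pnatr_eq0 //.
have h1 c : adj (x + y) c = adj x c + adj y c by rewrite adj_add.
have h2 c : adj (x - y) c = adj x c - adj y c by rewrite adj_sub.
have h3 c : adj (x + 'i *: y) c = adj x c - 'i *: adj y c.
  by rewrite adj_add ?adj_scale // conjCi -scaleNr.
have h4 c : adj (x - 'i *: y) c = adj x c + 'i *: adj y c.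
  by rewrite adj_sub ?adj_scale // conjCi scaleNr opprK.
have e (k : C) (f1 f2 f3 f4 : H2 -> H2) :
  (k *: ((f1 - f2) + 'i *: (f3 - f4))) a = k *: ((f1 a - f2 a) + 'i *: (f3 a - f4 a)) by [].
rewrite e dotZl; congr (_ * _).
rewrite dotDl dotBl dotZl dotBl.
have qf n : bd n -> '[sq n a, b] = '[adj n a, adj n b].
  by move=> bn; rewrite /sq /= adjr.
rewrite !qf; auto.
rewrite !h1 !h2 !h3 !h4 /= adjr //.
rewrite !dotDl !dotDr !dotNl !dotNr !dotZl !dotZr !conjCi.
have i2 : 'i * 'i = -1 :> C by rewrite -expr2 sqrCi.
set p := '[adj x a, adj y b]; set q := '[adj y a, adj x b].
set p1 := '[adj x a, adj x b]; set q1 := '[adj y a, adj y b].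
transitivity (2%:R * p + 2%:R * q + 2%:R * ('i * 'i) * p - 2%:R * ('i * 'i) * q : C).
  by rewrite i2; ring.
by ring.
Qed.

Section Form.
Variables (f : (K -> K) -> \bar R) (hf : nsf_weight P f).
Local Notation Fn := (@Fin _ _ P f).
Local Notation FF := (@F _ _ f).
Local Notation S x y := (@wext _ _ P f (x \o adj y)).
(** On these elements S x y, the value of f at x composed with the adjoint of y, is a positive
    sesquilinear form, the inner product of a GNS construction. *)
Definition Nf (x : H -> K) := N x /\ Fn (sq x).
Lemma Nf_N x : Nf x -> N x. Proof. by case. Qed.
Lemma Qp_sq x : N x -> Qp P (sq x).
Proof. by move=> Nx; split; [exact: P_NN|apply: pos_sq; exact: Nb]. Qed.
Lemma Nf_add x y : Nf x -> Nf y -> Nf (x + y).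
Proof.
move=> [Nx fx] [Ny fy]; have Nxy := ND Nx Ny; split=> //.
have [bx by_] := (Nb Nx, Nb Ny).
have two0 : 0 <= 2%:R :> R by rewrite ler0n.
have [h1 _] := Fin_scale Pvna hf two0 fx; have [h2 _] := Fin_scale Pvna hf two0 fy.
have [h3 _] := Fin_add Pvna hf h1 h2.
apply: (Fin_le Pvna hf (Qp_sq Nxy) h3) => v.
have e2 : cplx (2%:R : R) = 2%:R :> C by rewrite /cplx rmorph_nat.
rewrite sq_form ?adj_add; auto; rewrite !fctE !dotDl !dotZl !sq_form // e2.
set a := adj x v; set b := adj y v.
have := dot_ge0 (a - b); rewrite dotBl !dotBr => h.
rewrite -subr_ge0; apply: le_trans h _; rewrite !dotDr.
by rewrite -subr_ge0 (_ : _ - _ = 0) //; ring.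
Qed.
Lemma Nf_scale c x : Nf x -> Nf (c *: x).
Proof.
move=> [Nx fx]; split; first exact: NZ.
have bx := Nb Nx.
have c0 : 0 <= complex.Re (`|c| ^+ 2 : C) by have [] := Cx_real (exprn_ge0 2 (normr_ge0 c)).
have [h _] := Fin_scale Pvna hf c0 fx.
suff -> : sq (c *: x) = cplx (complex.Re (`|c| ^+ 2 : C)) *: sq x by [].
have [<- _] := Cx_real (exprn_ge0 2 (normr_ge0 c)).
apply: funext => v; rewrite /sq adj_scale //= !fctE (lopZ bx) scalerA.
by rewrite normCK.
Qed.
Lemma Nf_lin c x y : Nf x -> Nf y -> Nf (c *: x + y).
Proof. by move=> hx hy; apply: Nf_add => //; exact: Nf_scale. Qed.
Lemma Nf_wdom x y : Nf x -> Nf y -> wdom P f (x \o adj y).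
Proof.
move=> hx hy; have [Nx Ny] := (Nf_N hx, Nf_N hy).
have hi := Nf_scale 'i hy.
have hs a b : Nf a -> Nf b -> Nf (a - b).
  by move=> ha hb; apply: Nf_add => //; rewrite -scaleN1r; exact: Nf_scale.
have D n : Nf n -> wdom P f (sq n) by move=> [_ h]; exact: (wdom_fin Pvna hf).
have D0 : wdom P f 0 by apply: (wdom_fin Pvna hf); have [] := Fin_0 Pvna hf.
have Dl c a b : wdom P f a -> wdom P f b -> wdom P f (c *: a + b).
  exact: (wdom_lin Pvna hf).
have Db a b : Nf a -> Nf b -> wdom P f (sq a - sq b).
  by move=> ha hb; rewrite addrC -scaleN1r; apply: Dl; exact: D.
rewrite (polar_op (Nb Nx) (Nb Ny)).
rewrite -[_ *: _]addr0; apply: (Dl) D0; rewrite addrC; apply: (Dl); apply: Db; auto.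
- exact: Nf_add.
- exact: Nf_add.
Qed.
Lemma S_linl c x y z : Nf x -> Nf y -> Nf z -> S (c *: x + y) z = c * S x z + S y z.
Proof.
move=> hx hy hz; rewrite -(wext_lin Pvna hf); [|exact: Nf_wdom|exact: Nf_wdom].
by [].
Qed.
Lemma S_linr c x y z : Nf x -> Nf y -> Nf z -> S z (c *: x + y) = c^* * S z x + S z y.
Proof.
move=> hx hy hz; rewrite -(wext_lin Pvna hf); [|exact: Nf_wdom|exact: Nf_wdom].
have [bx by_] := (Nb (Nf_N hx), Nb (Nf_N hy)); have bz := Nb (Nf_N hz).
congr (wext _ _ _); apply: funext => v.
by rewrite adj_add ?adj_scale; auto; rewrite /= !fctE (lopP bz).
Qed.
Lemma S_sq x : Nf x -> S x x = cplx (FF (sq x)).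
Proof. by move=> [_ h]; exact: (wext_fin Pvna hf). Qed.

(** Right invariance tested on vector states. The weight of the unimodular case is left invariant by
    hypothesis and inherits this form of right invariance from its multiple
    ([vector_invariant_multiple]). *)
Definition vector_invariant := forall b x, '[b, b] = 1 -> P x -> pos x ->
  (f x < +oo)%E -> f (vslice2 (DP x) b b) = f x.

Lemma right_vector_invariant : right_invariant P DP f -> vector_invariant.
Proof.
move=> hr b x b1 Px px fx; have := hr _ _ (vec_state P b1) Px px fx.
by rewrite (slice2_vec _ (DP_b Px)).
Qed.

(** The slice of DP (n n^* ) at b is the sum of the m_k m_k^* over an orthonormal basis, so
    invariance becomes a Parseval identity for S. *)
Lemma right_inv_series n b : vector_invariant -> Nf n -> '[b, b] = 1 ->
  let m k := vslice2 (DN n) (onb H k) b in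
  (forall k, Nf (m k)) /\ series (fun k => cplx (FF (sq (m k))) : C) @ \oo --> (cplx (FF (sq n)) : C).
Proof.
move=> hr [Nn fn] b1 m; have bD := DN_b Nn.
have Nm k : N (m k) by exact: DN_slice2.
have Pn := P_NN Nn Nn.
have fe := hr _ _ b1 Pn (Fin_Qp fn).2 fn.2.
have Qs : Qp P (vslice2 (DP (sq n)) b b).
  split; last first.
    rewrite /vslice2 -compA; apply: pos_conj; last exact: bd_pl.
    by rewrite ghDPN //; exact: pos_sq.
  case: (ghDP G) => _ [h _ _] _ _ _.
  by apply: (vn_slice2 b b (Qb Pvna) (Qb Pvna)); [case: Pvna|case: Pvna|exact: h].
have fs : Fn (vslice2 (DP (sq n)) b b) by split=> //; rewrite fe; case: fn.
have FE : FF (vslice2 (DP (sq n)) b b) = FF (sq n) by rewrite /F fe.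
have [|h1 h2] := F_series Pvna hf (fun k => Qp_sq (Nm k)) fs.
  move=> v; have -> : '[vslice2 (DP (sq n)) b b v, v] =
    '[adj (DN n) (v ⊗v b), adj (DN n) (v ⊗v b)] :> C.
    by rewrite vslice2E ghDPN //= adjr.
  have -> : (fun k => '[sq (m k) v, v] : C) = (fun k =>
    '[rsl (onb H k) (adj (DN n) (v ⊗v b)), rsl (onb H k) (adj (DN n) (v ⊗v b))]).
    apply: funext => k; rewrite sq_form; last exact: Nb.
    have -> // : rsl (onb H k) (adj (DN n) (v ⊗v b)) = adj (m k) v.
    apply: dot_ext => a; rewrite rslE adjl // adjl; last exact: Nb.
    by rewrite dotC [RHS]dotC vslice2E.
  exact: (tens_parseval (z := _) (z' := _) (onbP _)).
by split=> [k|]; [split|rewrite -FE].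
Qed.

Lemma left_inv_series n b : left_invariant P DP f -> Nf n -> '[b, b] = 1 ->
  let m k := vslice1 (DN n) (onb H k) b in
  (forall k, Nf (m k)) /\ series (fun k => cplx (FF (sq (m k))) : C) @ \oo --> (cplx (FF (sq n)) : C).
Proof.
move=> hr [Nn fn] b1 m; have bD := DN_b Nn.
have Nm k : N (m k) by exact: DN_slice1.
have Pn := P_NN Nn Nn.
have e : slice1 (vector_functional b) (DP (sq n)) = vslice1 (DP (sq n)) b b.
  by apply: slice1_vec; exact: DP_b.
have fe := hr _ _ (vec_state P b1) Pn (Fin_Qp fn).2 fn.2.
rewrite e in fe.
have Qs : Qp P (vslice1 (DP (sq n)) b b).
  split; last first.
    rewrite /vslice1 -compA; apply: pos_conj; last exact: bd_pr.
    by rewrite ghDPN //; exact: pos_sq.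
  case: (ghDP G) => _ [h _ _] _ _ _.
  by apply: (vn_slice1 b b (Qb Pvna) (Qb Pvna)); [case: Pvna|case: Pvna|exact: h].
have fs : Fn (vslice1 (DP (sq n)) b b) by split=> //; rewrite fe; case: fn.
have FE : FF (vslice1 (DP (sq n)) b b) = FF (sq n) by rewrite /F fe.
have [|h1 h2] := F_series Pvna hf (fun k => Qp_sq (Nm k)) fs.
  move=> v; have -> : '[vslice1 (DP (sq n)) b b v, v] =
    '[adj (DN n) (b ⊗v v), adj (DN n) (b ⊗v v)] :> C.
    by rewrite vslice1E ghDPN //= adjr.
  have -> : (fun k => '[sq (m k) v, v] : C) = (fun k =>
    '[lsl (onb H k) (adj (DN n) (b ⊗v v)), lsl (onb H k) (adj (DN n) (b ⊗v v))]).
    apply: funext => k; rewrite sq_form; last exact: Nb.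
    have -> // : lsl (onb H k) (adj (DN n) (b ⊗v v)) = adj (m k) v.
    apply: dot_ext => a; rewrite lslE adjl // adjl; last exact: Nb.
    by rewrite dotC [RHS]dotC vslice1E.
  exact: left_parseval.
by split=> [k|]; [split|rewrite -FE].
Qed.

End Form.
End GaloisP.

(** * Operators attached to forms of matrix coefficients *)

Section Forms.

Lemma nn_slice2 w' w a b : vslice2 (DN (nn w' w)) a b = nn (adj (ss a b) w') w.
Proof.
apply: op_ext => x y; rewrite vslice2E DN_nn nn_ss [LHS]adjr //; exact: bd_ss.
Qed.
Lemma nn_slice1 w' w a b : vslice1 (DN (nn w' w)) a b = nn w' (ss a b w).
Proof. by apply: op_ext => x y; rewrite vslice1E DN_nn nn_ss. Qed.
Lemma qq_slice1 v w a b : vslice1 (DN (qq v w)) a b = qq (adj (sg a b) v) w.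
Proof.
apply: op_ext => x y; rewrite vslice1E DN_qq qq_sg [LHS]adjr //; exact: bd_sg.
Qed.
Lemma qq_slice2 v w a b : vslice2 (DN (qq v w)) a b = qq v (sg a b w).
Proof. by apply: op_ext => x y; rewrite vslice2E DN_qq qq_sg. Qed.

Lemma nn_linl w c x y : nn (c *: x + y) w = c^* *: nn x w + nn y w.
Proof. by apply: vslice2_linr; exact: bZ. Qed.
Lemma qq_linl w c x y : qq (c *: x + y) w = c^* *: qq x w + qq y w.
Proof. by apply: vslice1_linr; exact: bVt. Qed.

Lemma qq_norm v w a : `|qq v w a| <= `|v| * `|w| * `|a|.
Proof.
apply: norm_le_dot => [|b]; first by rewrite !mulr_ge0.
rewrite qqE; apply: le_trans (dot_CS _ _) _.
have -> : `|Vt (w ⊗v a)| = `|w ⊗v a| :> C.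
  by apply/eqP; rewrite -(eqrXn2 (n := 2)) // -!hdot_norm (un_dot unVt).
by rewrite !pure_norm (_ : _ * _ * (_ * _) = `|v| * `|w| * `|a| * `|b|) //; ring.
Qed.
Lemma nn_norm v w a : `|nn v w a| <= `|v| * `|w| * `|a|.
Proof.
apply: norm_le_dot => [|b]; first by rewrite !mulr_ge0.
rewrite nnE; apply: le_trans (dot_CS _ _) _.
have -> : `|Z (a ⊗v w)| = `|a ⊗v w| :> C.
  by apply/eqP; rewrite -(eqrXn2 (n := 2)) // -!hdot_norm (un_dot unZ).
by rewrite !pure_norm (_ : _ * _ * (_ * _) = `|v| * `|w| * `|a| * `|b|) //; ring.
Qed.

Lemma ss_adj_lsl a b w : adj (ss a b) w = lsl a (adj Z (b ⊗v w)).
Proof.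
apply: dot_ext => x; rewrite lslE.
rewrite adjl; last exact: bd_ss.
rewrite adjl; last exact: bZ.
by rewrite dotC ssE -dotC.
Qed.
Lemma sg_adj_rsl a b w : adj (sg a b) w = rsl a (adj Vt (w ⊗v b)).
Proof.
apply: dot_ext => x; rewrite rslE.
rewrite adjl; last exact: bd_sg.
rewrite adjl; last exact: bVt.
by rewrite dotC sgE -dotC.
Qed.

Section Weight.
Variables (f : (K -> K) -> \bar R) (hf : nsf_weight P f).
Local Notation Fn := (@Fin _ _ P f).
Local Notation FF := (@F _ _ f).
Local Notation S x y := (@wext _ _ P f (x \o adj y)).
Local Notation Nf := (Nf f).

Lemma wext_adj z : wdom P f z -> wext P f (adj z) = (wext P f z)^*.
Proof.
move=> /(wdomP Pvna hf) [a [b [c [d [[fa fb fc fd] [e1 e2]]]]]].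
apply: (wextE Pvna hf); exists a, b, d, c; split=> //.
have [ba bb bc bd] := And4 (Fin_b fa) (Fin_b fb) (Fin_b fc) (Fin_b fd).
have A x : Fn x -> adj x = x by move=> [[_ px] _]; exact: pos_adj.
split.
  rewrite e1 adj_add ?adj_scale ?adj_sub ?A; auto.
  by rewrite conjCi scaleNr -scalerN opprB.
rewrite e2 rmorphD rmorphM /= !conjCi !cplx_conj mulNr -mulrN.
by rewrite !cplxB opprB.
Qed.
Lemma S_conj x y : Nf x -> Nf y -> S y x = (S x y)^*.
Proof.
move=> hx hy; rewrite -wext_adj; last exact: Nf_wdom.
have [bx by_] := (Nb (Nf_N hx), Nb (Nf_N hy)).
by rewrite (adj_comp bx (bd_adj by_)) (adjK by_).
Qed.
Lemma Nf_0 : Nf 0.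
Proof.
split; first exact: N0.
have -> : sq (0 : H -> K) = 0 by apply: funext.
by have [] := Fin_0 Pvna hf.
Qed.
Lemma S_eq0 x : Nf x -> FF (sq x) = 0 -> x = 0.
Proof.
move=> hx h; have bx := Nb (Nf_N hx).
have e : sq x = 0 := F_faith hf hx.2 h.
rewrite -[x]adjK //; have -> : adj x = 0.
  apply: funext => v; apply: dot_eq0; rewrite -sq_form // e.
  by rewrite zfunE dot0l.
by apply: adj_uniq => [|a b]; [exact: bd_0|rewrite dot0r zfunE dot0l].
Qed.
Lemma S_ge0 x : Nf x -> 0 <= S x x :> C.
Proof.
by move=> hx; rewrite (S_sq hf hx) cplx_ge0; apply: (F_ge0 hf); exact: Qp_sq (Nf_N hx).
Qed.
Lemma S_CS x y : Nf x -> Nf y -> `|S x y| ^+ 2 <= S x x * S y y.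
Proof.
move=> hx hy; apply: form_CS => [||t]; [exact: S_ge0|exact: S_ge0|].
have hxy : Nf ((- t) *: y + x) by exact: Nf_lin.
have := S_ge0 hxy; rewrite (S_linl hf) // !(S_linr hf) // (S_conj hx hy) rmorphN => h.
by apply: le_trans h _; apply: le_of_eq; ring.
Qed.

Lemma form_op (n : K -> (H -> K)) (c : R) : 0 <= c ->
  (forall a x y, n (a *: x + y) = a^* *: n x + n y) ->
  (forall w, Nf (n w) /\ FF (sq (n w)) <= c * nrm2 w) ->
  exists2 Y : K -> K, bd Y & forall w w', '[Y w, w'] = S (n w') (n w).
Proof.
move=> c0 nl hn; have hN w : Nf (n w) by have [] := hn w.
apply: (lax (c := cplx c)) => [|a x y v|a x y u|u v].
- by rewrite cplx_ge0.
- by rewrite nl (S_linr hf) // conjCK.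
- by rewrite nl (S_linl hf).
apply: sqr_le; [exact: normr_ge0|by rewrite !mulr_ge0 ?cplx_ge0|].
apply: le_trans (S_CS (hN v) (hN u)) _; rewrite !(S_sq hf) // !exprMn.
have h w : cplx (FF (sq (n w))) <= cplx c * `|w| ^+ 2.
  by rewrite -hdot_norm -nrm2E -cplxM cplx_le; have [] := hn w.
have p w : 0 <= cplx (FF (sq (n w))) :> C.
  by rewrite cplx_ge0; apply: (F_ge0 hf); exact: Qp_sq (Nf_N (hN w)).
apply: le_trans (ler_pM (p v) (p u) (h v) (h u)) _.
by apply: le_of_eq; ring.
Qed.

Local Notation t1 Y := (ampr H Y).
Local Notation t2 Y := (ampr K Y).
Local Notation t3 Y := (ampl Y H).
Local Notation t4 Y := (ampl Y K).

(** Slicing DN (nn w' w0) moves w' by the adjoint of a slice [ss]. Hence, at b' ⊗ w', the forms of Z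
    (1 ⊗ Y) Z^* and of 1 ⊗ Y are the two sides of [right_inv_series]; the operators coincide, and Y
    commutes with every slice of Z. *)
Lemma right_form w0 (c : R) : vector_invariant f -> 0 <= c ->
  (forall w, Nf (nn w w0) /\ FF (sq (nn w w0)) <= c * nrm2 w) ->
  exists2 Y : K -> K, bd Y & (forall w w', '[Y w, w'] = S (nn w' w0) (nn w w0)) /\
    forall a b w, Y (ss a b w) = ss a b (Y w).
Proof.
move=> hr c0 hn; have hN w : Nf (nn w w0) by have [] := hn w.
have [Y bY hY] := form_op c0 (nn_linl w0) hn; exists Y => //; split=> // a b w.
have [uZ b_Z] := (unZ, bZ).
have bY1 : bd (t1 Y) by exact: bd_tensor (bd_id _) bY.
have bY2 : bd (t2 Y) by exact: bd_tensor (bd_id _) bY.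
suff h : Z \o (t1 Y) \o adj Z = (t2 Y).
  apply: dot_ext => t; rewrite ssE -(tensorE _ _ (bd_id H) bY) .
  have -> : Z ((t1 Y) (a ⊗v w)) = (t2 Y) (Z (a ⊗v w)) by rewrite -h /= (unK uZ).
  rewrite (adjr _ _ bY) ssE [RHS](adjr _ _ bY2) (adj_tensor (bd_id _) bY) adj_idfun.
  by rewrite (tensorE _ _ (bd_id _) (bd_adj bY)).
apply: pure_quad_ext => [||b' w']; [by auto|by []|].
have -> : '[(Z \o (t1 Y) \o adj Z) (b' ⊗v w'), b' ⊗v w'] =
  '[(t1 Y) (adj Z (b' ⊗v w')), adj Z (b' ⊗v w')] :> C by rewrite /= adjr.
rewrite [in RHS](tensorE _ _ (bd_id _) bY).
move: b'; apply: pure_norm_ext => [k b'|k b'|b' b1].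
- by rewrite pureZl (lopZ (bd_adj b_Z)) (lopZ bY1) dotZl dotZr mulrA normCK.
- by rewrite !pureZl dotZl dotZr mulrA normCK.
have [h1 h2] := right_inv_series hf hr (hN w') b1.
apply: (cvg_uniq (left_parseval (z := (t1 Y) (adj Z (b' ⊗v w'))) (z' := adj Z (b' ⊗v w')))).
rewrite pure_dot b1 mul1r hY (S_sq hf (hN w')).
have -> : series (fun k => '[lsl (onb H k) ((t1 Y) (adj Z (b' ⊗v w'))), lsl (onb H k) (adj Z (b' ⊗v w'))] : C) =
  series (fun k => cplx (FF (sq (vslice2 (DN (nn w' w0)) (onb H k) b')))).
  congr series; apply: funext => k.
  rewrite lsl_tensor // -ss_adj_lsl hY nn_slice2; exact: (S_sq hf (hN _)).
exact: h2.
Qed.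


End Weight.
End Forms.

(** * The blocks B(H_r), their multiplicity spaces, and the role of T_r *)

Section Blocks.

Lemma Hr_neq0 r : exists v : Hr r, v != 0. Proof. by case: (ghpi G) => -[]. Qed.
Lemma pi_lin r c x y : Nhat x -> Nhat y -> pi r (c *: x + y) = c *: pi r x + pi r y.
Proof. by case: (ghpi G) => -[_ h _ _ _] _ _ _ _; exact: h. Qed.
Lemma pir_mul r x y : Nhat x -> Nhat y -> pi r (x \o y) = pi r x \o pi r y.
Proof. by case: (ghpi G) => -[_ _ h _ _] _ _ _ _; exact: h. Qed.
Lemma pi_adj r x : Nhat x -> pi r (adj x) = adj (pi r x).
Proof. by case: (ghpi G) => -[_ _ _ h _] _ _ _ _; exact: h. Qed.
Lemma pi_1 r : pi r idfun = idfun. Proof. by case: (ghpi G) => -[_ _ _ _ h] _ _ _ _; exact: h. Qed.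
Lemma pi_b r x : Nhat x -> bd (pi r x).
Proof. by case: (ghpi G) => _ h _ _ _ Nx; have [c /(_ r)[]] := h x Nx. Qed.
Lemma pi_inj x y : Nhat x -> Nhat y -> (forall r, pi r x = pi r y) -> x = y.
Proof.
move=> Nx Ny e; have [_ _ h _ _] := ghpi G.
apply/eqP; rewrite -subr_eq0; apply/eqP; rewrite -[x - y]addrC -scaleN1r.
apply: h => [|r]; first exact: Nhat_lin.
by rewrite pi_lin // e scaleN1r addNr.
Qed.
Lemma pi_0 r : pi r 0 = 0.
Proof.
have N0 := Nhat_0; have := pi_lin r (-1) N0 N0.
by rewrite !scaleN1r addNr => ->; rewrite addNr.
Qed.
Lemma pZ r : [/\ Nhat (gp r), pi r (gp r) = idfun & forall s, s != r -> pi s (gp r) = 0].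
Proof. by have [_ _ _ _ h] := ghpi G; exact: h. Qed.

Variable r : gI G.
Local Notation T := (gT (g := G) r).

Lemma rho_ex (y : Hr r -> Hr r) : bd y ->
  exists x, [/\ Nhat x, pi r x = y & forall s, s != r -> pi s x = 0].
Proof.
move=> by_; have [_ _ _ hs _] := ghpi G; have [c c0 hc] := bdP by_.
(* The family with y in position r and 0 elsewhere; [eq_rect] transports y along r = s. *)
pose yy s : Hr s -> Hr s := if pselect (r = s) is left e then eq_rect r (fun s => Hr s -> Hr s) y s e else 0.
have hyy s : bd (yy s) /\ forall v, `|yy s v| <= c * `|v|.
  rewrite /yy; case: pselect => [e|_]; first by case: s / e.
  by split=> [|v]; [exact: bd_0|rewrite normr0 mulr_ge0].
have [x Nx hx] := hs yy (ex_intro _ c hyy).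
have [Np p1 p0] := pZ r.
exists (x \o gp r); split=> [||s sr]; first exact: Nhat_comp.
  rewrite pir_mul // p1 hx /yy; case: pselect => [e|] //.
  by rewrite (Prop_irrelevance e erefl).
rewrite pir_mul // p0 //; apply: funext => v; exact: lop0 (pi_b s Nx).
Qed.

(** The inclusion of B(H_r) as a direct summand of the dual algebra. *)
Definition rho (y : Hr r -> Hr r) : K -> K :=
  xget 0 [set x | [/\ Nhat x, pi r x = y & forall s, s != r -> pi s x = 0]].
Lemma rhoP y : bd y ->
  [/\ Nhat (rho y), pi r (rho y) = y & forall s, s != r -> pi s (rho y) = 0].
Proof. by move=> /rho_ex[x hx]; rewrite /rho; case: xgetP => [a _ //|/(_ x)]. Qed.
Lemma rho_N y : bd y -> Nhat (rho y). Proof. by case/rhoP. Qed.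
Lemma rho_pi y : bd y -> pi r (rho y) = y. Proof. by case/rhoP. Qed.
Lemma rho_b y : bd y -> bd (rho y). Proof. by move/rho_N/Nhat_b. Qed.
Lemma rho_uniq x : Nhat x -> (forall s, s != r -> pi s x = 0) -> x = rho (pi r x).
Proof.
move=> Nx h; have [N1 p1 p0] := rhoP (pi_b r Nx).
apply: pi_inj => // s; have [->|sr] := eqVneq s r; first by rewrite p1.
by rewrite h // p0.
Qed.
Lemma x_rho x y : Nhat x -> bd y -> x \o rho y = rho (pi r x \o y).
Proof.
move=> Nx by_; have [Ny p1 p0] := rhoP by_; have bx := pi_b r Nx.
rewrite [LHS]rho_uniq; first by rewrite pir_mul // p1.
  exact: Nhat_comp.
move=> s sr; rewrite pir_mul // p0 //; apply: funext => v; exact: lop0 (pi_b s Nx).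
Qed.
Lemma rho_mul y z : bd y -> bd z -> rho y \o rho z = rho (y \o z).
Proof. by move=> by_ bz; rewrite x_rho ?rho_pi //; exact: rho_N. Qed.
Lemma rho_adj y : bd y -> adj (rho y) = rho (adj y).
Proof.
move=> by_; have [Ny p1 p0] := rhoP by_.
rewrite [LHS]rho_uniq; first by rewrite pi_adj // p1.
  exact: Nhat_adj.
move=> s sr; rewrite pi_adj // p0 //.
by apply: adj_uniq => [|a b]; [exact: bd_0|rewrite dot0l dot0r].
Qed.
Lemma rho_lin c y z : bd y -> bd z -> rho (c *: y + z) = c *: rho y + rho z.
Proof.
move=> by_ bz; have [Ny p1 p0] := rhoP by_; have [Nz q1 q0] := rhoP bz.
rewrite [RHS]rho_uniq; first by rewrite pi_lin // p1 q1.
  exact: Nhat_lin.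
by move=> s sr; rewrite pi_lin // p0 // q0 // scaler0 addr0.
Qed.

Definition eps : Hr r := xget 0 [set v : Hr r | '[v, v] = 1].
Lemma eps1 : '[eps, eps] = 1.
Proof.
rewrite /eps; case: xgetP => [v _ //|h].
have [v v0] := Hr_neq0 r; case: (nlz_dot v) => [/dot_eq0 e|/h []].
by case/eqP: v0; rewrite -[v]nlzK e scaler0.
Qed.
(** A matrix unit with second index [eps]. The part of K under block r is H_r ⊗ [Kr], with h ⊗ u
    realised as [th h u], and [ee] projects onto the copy eps ⊗ [Kr] of the multiplicity space. *)
Definition th (h : Hr r) : K -> K := rho (rk h eps).
Definition ee : K -> K := th eps.
Lemma th_N h : Nhat (th h). Proof. exact: rho_N. Qed.
Lemma th_b h : bd (th h). Proof. exact: rho_b. Qed.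
Hint Resolve th_N th_b : core.
Lemma th_pi h : pi r (th h) = rk h eps. Proof. exact: rho_pi. Qed.
Lemma x_th x h w : Nhat x -> x (th h w) = th (pi r x h) w.
Proof.
move=> Nx; have := x_rho Nx (bd_rk h eps) => /(congr1 (@^~ w)) /= ->.
congr (rho _ w); apply: funext => v; rewrite /rk /= lopZ //; exact: pi_b.
Qed.
Lemma adj_th_th g h w : adj (th g) (th h w) = '[h, g] *: ee w.
Proof.
have e : adj (th g) \o th h = '[h, g] *: ee.
  rewrite /th rho_adj // rho_mul; auto.
  have -> : adj (rk g eps) \o rk h eps = '[h, g] *: rk eps eps + 0.
    rewrite addr0 /rk adj_rank1; apply: funext => v /=.
    by rewrite dotZl /= !fctE scalerA mulrC.
  rewrite rho_lin //.
  rewrite [rho 0](_ : _ = 0) ?addr0 //; apply/esym.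
  rewrite -(pi_0 r); apply: rho_uniq; first exact: Nhat_0.
  by move=> s _; exact: pi_0.
exact: (congr1 (@^~ w) e).
Qed.
Lemma th_lin c g h w : th (c *: g + h) w = c *: th g w + th h w.
Proof.
have -> : th (c *: g + h) = c *: th g + th h; last by [].
rewrite -rho_lin //; congr rho; apply: funext => v.
by rewrite /rk !fctE scalerDr !scalerA mulrC.
Qed.
Lemma ee_adj : adj ee = ee. Proof. by rewrite /ee /th rho_adj // /rk adj_rank1. Qed.
Lemma th_ee h w : th h (ee w) = th h w.
Proof.
rewrite /ee x_th // th_pi /rk; congr (th _ w); by rewrite eps1 scale1r.
Qed.
Lemma ee_ee w : ee (ee w) = ee w. Proof. exact: th_ee. Qed.
Lemma adj_th_ee h w : ee (adj (th h) w) = adj (th h) w.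
Proof.
apply: dot_ext => v; rewrite -{1}ee_adj adjl; last exact: th_b.
by rewrite adjl // [RHS]adjl // th_ee.
Qed.
Definition Kr u := ee u = u.
Lemma th_dot g h u v : Kr u -> '[th g u, th h v] = '[g, h] * '[u, v].
Proof.
by move=> ku; rewrite -(adjl _ _ (th_b h)) adj_th_th dotZl ku.
Qed.
Lemma Kr_lin c u v : Kr u -> Kr v -> Kr (c *: u + v).
Proof. by move=> ku kv; rewrite /Kr (lopP (f := ee) (th_b _)) ku kv. Qed.
Lemma uu_ex : exists u, Kr u /\ '[u, u] = 1.
Proof.
have [w w0] : exists w, ee w != 0.
  apply: contrapT => h; have e : ee = 0.
    by apply: funext => w; apply: contrapT => /eqP hw; apply: h; exists w.
  have := th_pi eps; rewrite -/ee e pi_0 => /(congr1 (@^~ eps)).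
  rewrite /rk eps1 scale1r => e0; have := eps1.
  by rewrite -e0 dot0l => /eqP; rewrite eq_sym oner_eq0.
have kw : Kr (ee w) by exact: ee_ee.
case: (nlz_dot (ee w)) => [/dot_eq0 e|h].
  by case/eqP: w0; rewrite -[LHS]nlzK e scaler0.
exists (nlz (ee w)); split=> //; rewrite /nlz -[_ *: _]addr0; apply: Kr_lin => //.
by rewrite /Kr (lop0 (f := ee) (th_b _)).
Qed.
Definition uu : K := xget 0 [set u | Kr u /\ '[u, u] = 1].
Lemma uuP : Kr uu /\ '[uu, uu] = 1.
Proof. by have [u hu] := uu_ex; rewrite /uu; case: xgetP => [v _ //|/(_ u)]. Qed.
Lemma Kr_uu : Kr uu. Proof. by case: uuP. Qed.
Lemma ee_uu : ee uu = uu. Proof. exact: Kr_uu. Qed.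
Lemma uu1 : '[uu, uu] = 1. Proof. by case: uuP. Qed.
Lemma th_eps u : Kr u -> th eps u = u. Proof. by []. Qed.

Lemma nn_th g h u v a b : Kr u ->
  '[nn (th g v) (th h u) a, b] = '[pi r (ss a b) h, g] * '[u, v].
Proof. by move=> ku; rewrite nn_ss x_th // th_dot. Qed.

Lemma x_nn_xi x w' w : Nhat x -> x (nn w' w xi) = nn w' (x w) xi.
Proof.
move=> Nx; have bx := Nhat_b Nx; apply: dot_ext => b.
rewrite adjr // !nnE !ZVxi.
rewrite -(tensorE _ _ bx (bd_id H)) -(Nhat_Vt Nx).
by rewrite [RHS]adjr ?adj_tensor ?adj_idfun ?tensorE; auto.
Qed.

(** [kap] is conjugate linear from H_r to the multiplicity space and [cc] goes back, transposed to
    it by [kap_cc]. By [kap_dot], the composite of [cc] after [kap] is T_r, so [kap] serves as a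
    conjugate-linear square root of T_r. *)
Definition kap (g : Hr r) : K := nn (th g uu) uu xi.
Definition cc (v : K) : Hr r := pi r (ss xi v) eps.
Lemma kap_Kr g : Kr (kap g).
Proof. by rewrite /Kr /ee /kap (x_nn_xi _ _ (th_N eps)) -/ee ee_uu. Qed.
Lemma th_kap g h : th h (kap g) = nn (th g uu) (th h uu) xi.
Proof. exact: x_nn_xi. Qed.
Lemma kap_cc g v : '[kap g, v] = '[cc v, g].
Proof. by rewrite /kap -{2}(th_eps Kr_uu) (nn_th _ _ _ _ _ Kr_uu) uu1 mulr1. Qed.
(** If cc v = 0, the coefficients qq v u vanish for u in [Kr], so the range of Vt has no component
    along v in its first leg; as Vt is unitary, v ⊗ v = 0. *)
Lemma cc_inj v : Kr v -> cc v = 0 -> v = 0.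
Proof.
move=> kv c0.
have h u : Kr u -> qq v u = 0.
  move=> ku; apply: Nsep; first exact: N_qq.
  rewrite -ss_xi_qq -(th_eps ku) x_th // -/(cc v) c0.
  have := th_lin 1 0 0 u; rewrite scaler0 addr0 scale1r => e.
  by apply: (addrI (th 0 u)); rewrite -e addr0.
have h2 : forall w a b, '[Vt (w ⊗v a), v ⊗v b] = 0.
  move=> w a b; have be : bd ee := th_b eps.
  have bt : bd (ampl ee K) by auto.
  have -> : '[Vt (w ⊗v a), v ⊗v b] = '[ampl ee K (Vt (w ⊗v a)), v ⊗v b].
    rewrite (adjr _ _ bt) (adj_tensor be (bd_id K)) adj_idfun ee_adj.
    by rewrite (tensorE _ _ be (bd_id K)) kv.
  rewrite (Nhat_Vt (th_N eps)) (tensorE _ _ be (bd_id H)) -qqE h; last exact: ee_ee.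
  by rewrite zfunE dot0l.
apply: dot_eq0.
have e : v ⊗v v = 0.
  rewrite -(unVK unVt (v ⊗v v)); rewrite (_ : adj Vt (v ⊗v v) = 0) ?(lop0 bVt) //.
  apply: tdot_ext => x y; rewrite dot0l adjl; last exact: bVt.
  by rewrite dotC h2 conjC0.
have e2 : '[v ⊗v v, v ⊗v v] = '[v, v] * '[v, v] by exact: pure_dot.
move: e2; rewrite [in LHS]e dot0l => /esym/eqP; by rewrite mulf_eq0 orbb => /eqP.
Qed.
(** Slices of Z at xi have rank one in H_r. These are the operators against which a commuting Y is
    tested in [Y_scalar]. *)
Lemma pi_ss_th h1 u1 h : Kr u1 -> pi r (ss xi (th h1 u1)) h = '[h, h1] *: cc u1.
Proof.
move=> ku; apply: dot_ext => g.
have := nn_th g h uu xi (th h1 u1) Kr_uu; rewrite uu1 mulr1 => <-.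
by rewrite -th_kap (th_dot _ _ _ (kap_Kr g)) kap_cc dotZl.
Qed.

Lemma T_pos : pos (T). Proof. by have [] := ghT r. Qed.
Lemma T_b : bd (T). Proof. by case: T_pos. Qed.
Lemma T_inj : injective (T). Proof. by have [] := ghT r. Qed.
Lemma T_form x w w' : Nhat x -> gp r \o x = x ->
  '[ampr K x (Z (xi ⊗v w)), Z (xi ⊗v w')] =
  trace (T \o pi r x) * '[gp r w, w'] :> C.
Proof.
move=> Nx px; have [_ _ _ /(_ x Nx px)] := ghT r.
have bx := Nhat_b Nx; have bt : bd (ampr K x) by auto.
have bW : bd Wt by have [] := ghWt G => /un_bd.
have bA : bd (adjoint_coaction Wt x).
  exact: bd_comp (bd_comp (bd_comp (bd_comp (bd_flip _ _) bW) bt) (bd_adj bW)) (bd_flip _ _).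
rewrite slice2_vec // => /(congr1 (fun f : K -> K => '[f w, w'] : C)).
rewrite vslice2E /adjoint_coaction /= !flipE.
rewrite (_ : (trace (T \o pi r x) *: gp r) w = trace (T \o pi r x) *: gp r w) //.
rewrite dotZl => <-.
rewrite (adjr _ _ (bd_flip _ _)) flip_adj flipE [RHS](adjr _ _ bW).
by [].
Qed.

Lemma trace_T_rk g g' : trace (T \o rk g g') = '[T g, g'] :> C.
Proof.
have [eo eu ed] := onbP (Hr r).
have h := parseval (x := T g) (y := g') eo eu ed.
rewrite /trace; apply: cvg_lim; first exact: norm_hausdorff.
have -> // : (fun n => '[(T \o rk g g') (onb (Hr r) n), onb (Hr r) n] : C) =
  (fun n => '[T g, onb (Hr r) n] * '[onb (Hr r) n, g']).
apply: funext => n; by rewrite /= /rk (lopZ T_b) dotZl mulrC.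
Qed.

(** Evaluate [T_form] at x = th g (th g')^* and at the vector uu. The matrix unit x has trace <T g,
    g'> against T, and slicing Z (xi ⊗ uu) by the adjoint of th h gives kap h ⊗ uu. *)
Lemma kap_dot g g' : '[kap g', kap g] = '[T g, g'].
Proof.
have zE h : ampr K (adj (th h)) (Z (xi ⊗v uu)) = kap h ⊗v uu.
  have bt : bd (ampr K (adj (th h))) by auto.
  apply: tdot_ext => b w; rewrite adjr // adj_tensor ?adjK ?adj_idfun ?tensorE; auto.
  rewrite -nnE -[X in nn _ X](th_eps Kr_uu) (nn_th _ _ _ _ _ Kr_uu).
  by rewrite -/(cc b) -kap_cc pure_dot.
have Nx : Nhat (th g \o adj (th g')) by apply: Nhat_comp => //; exact: Nhat_adj.
have [Np p1 p0] := pZ r.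
have px : gp r \o (th g \o adj (th g')) = th g \o adj (th g').
  have e : gp r \o th g = th g by rewrite x_rho // p1.
  by apply: funext => v /=; rewrite -[gp r _]/((gp r \o th g) _) e.
have := T_form uu uu Nx px.
have -> : '[gp r uu, uu] = 1.
  by rewrite -(th_eps Kr_uu) x_th // p1 th_eps; [exact: uu1|exact: Kr_uu].
rewrite mulr1.
have -> : pi r (th g \o adj (th g')) = rk g g'.
  rewrite pir_mul ?pi_adj ?th_pi //; last exact: Nhat_adj.
  rewrite /rk adj_rank1; apply: funext => v /=.
  by rewrite dotZl eps1 mulr1.
rewrite trace_T_rk => <-.
have -> : ampr K (th g \o adj (th g')) =
  ampr K (th g) \o ampr K (adj (th g')).
  by rewrite tensor_comp; auto.
rewrite /= [RHS]adjr; last by auto.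
rewrite adj_tensor ?adj_idfun; auto.
by rewrite !zE !pure_dot uu1 !mulr1.
Qed.

End Blocks.

Hint Resolve th_N th_b : core.

(** * Finite weights, and finite dimension of the blocks *)

Section Finite.

Lemma finite_of_unit f : nsf_weight P f -> (f idfun < +oo)%E -> finite_weight P f.
Proof.
move=> hf h1 x Px px; have [c c0 hc] := pos_bounded px.
have Q1 : Qp P idfun by split; [exact: Q1 Pvna|exact: pos_id].
have f1 : Fin P f idfun by [].
have [fc _] := Fin_scale Pvna hf c0 f1.
by have [] := Fin_le Pvna hf (conj Px px) fc hc.
Qed.

(** Finite elements span a σ-weakly dense subspace and w is normal with value 1 at the identity, so
    some finite x has w x <> 0; then the weight of the identity is f x / w x. *)
Lemma state_finite f (w : (K -> K) -> C) : nsf_weight P f -> normal_state P w ->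
  (forall x, P x -> pos x -> (f x < +oo)%E -> f (w x *: (idfun : K -> K)) = f x) ->
  finite_weight P f.
Proof.
move=> hf [pw w0 w1] h; apply: finite_of_unit => //.
have Q1 : Qp P idfun by split; [exact: Q1 Pvna|exact: pos_id].
have [x [fx wx]] : exists x, Fin P f x /\ w x != 0.
  apply: contrapT => hn.
  have z x : Fin P f x -> w x = 0.
    by move=> fx; apply: contrapT => /eqP wx; apply: hn; exists x.
  have [_ hcl] := Fin_dense hf Q1.1.
  have [y sy] := hcl 1%N (fun=> w) 1 (fun=> pw) ltr01; move/(_ ord0).
  have [_ ->] : bd y /\ w y = 0.
    move: y sy; apply: span_ind; first by split; [exact: bd_0|exact: pd_0 pw].
    move=> c x y fx [by_ wy]; have bx := Fin_b fx; split; first by auto.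
    by rewrite (pd_lin pw) // wy z // mulr0 addr0.
  by rewrite w1 sub0r normrN normr1 ltxx.
have [[Px px] fx'] := fx; have := h x Px px fx'.
have wp : 0 < w x by rewrite lt_neqAle eq_sym wx w0.
have [a a0 ea] := Cx_gt0 wp; rewrite ea (f_scale hf (ltW a0) Q1) => e.
move: fx'; rewrite -e; have := f_ge0 hf Q1.
by case: (f idfun) => [r _ _| |] //=; rewrite ?ltry // gt0_muley // lte_fin.
Qed.

Lemma compact_finite_right f : nsf_weight P f -> right_invariant P DP f ->
  compact_woronowicz P DP -> finite_weight P f.
Proof.
move=> hf hr [_ [w [nw hw]]]; apply: (state_finite hf nw) => x Px px fx.
by have [_ <-] := hw x Px; exact: hr.
Qed.
Lemma compact_finite_left f : nsf_weight P f -> left_invariant P DP f ->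
  compact_woronowicz P DP -> finite_weight P f.
Proof.
move=> hf hr [_ [w [nw hw]]]; apply: (state_finite hf nw) => x Px px fx.
by have [<- _] := hw x Px; exact: hr.
Qed.

Lemma thZ r a (h : Hr r) w : th (a *: h) w = a *: th h w.
Proof.
have t0 : th (0 : Hr r) w = 0.
  have := th_lin 1 (0 : Hr r) 0 w; rewrite scaler0 addr0 scale1r => e.
  by apply: (addrI (th (0 : Hr r) w)); rewrite -e addr0.
by have := th_lin a h 0 w; rewrite addr0 t0 addr0.
Qed.

(** Y commutes with s = ss xi (th h u), which acts on H_r as g |-> <g, h> c. Computing <Y s (th h
    u), th c u> with s on either side of Y compares the forms of Y at h and at c. *)
Lemma Y_scalar r (Y : K -> K) : bd Y ->
  (forall a b w, Y (ss a b w) = ss a b (Y w)) ->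
  exists x : C, forall g : Hr r, '[Y (th g (uu r)), th g (uu r)] = x * '[g, g].
Proof.
move=> bY hY; set u := uu r; have ku : Kr r u := Kr_uu r.
pose c := cc r u; have c0 : '[c, c] != 0 :> C.
  apply/eqP => /dot_eq0 /(cc_inj ku) u0; have := uu1 r; rewrite -/u u0 dot0l.
  by move/eqP; rewrite eq_sym oner_eq0.
exists ('[Y (th c u), th c u] / '[c, c]) => h.
rewrite mulrAC; apply: (canRL (mulfK c0)).
pose s := ss xi (th h u); have Ns : Nhat s by exact: Nhat_ss.
have bs := Nhat_b Ns.
have sE g : pi r s g = '[g, h] *: c by exact: pi_ss_th.
have e1 : '[Y (s (th h u)), th c u] = '[h, h] * '[Y (th c u), th c u].
  by rewrite x_th // sE thZ (lopZ bY) dotZl.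
have e2 : '[s (Y (th h u)), th c u] = '[c, c] * '[Y (th h u), th h u].
  rewrite (adjr _ _ bs) (x_th _ _ (Nhat_adj Ns)).
  have -> : pi r (adj s) c = '[c, c] *: h.
    rewrite pi_adj //; apply: dot_ext => g; rewrite adjl; last exact: pi_b.
    by rewrite sE dotZr dotZl -dotC mulrC.
  by rewrite thZ dotZr -dotC.
by rewrite mulrC -e2 /s -hY -/s e1 mulrC.
Qed.

Lemma adj_form_le (x : H -> K) (d : R) : bd x -> 0 <= d ->
  (forall v, `|x v| <= cplx d * `|v|) -> op_le (sq x) (cplx (d ^+ 2) *: idfun).
Proof.
move=> bx d0 h v; rewrite sq_form // (_ : (cplx (d ^+ 2) *: idfun) v = cplx (d ^+ 2) *: v) //.
have d0' : 0 <= cplx d by rewrite cplx_ge0.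
have -> : cplx (d ^+ 2) = cplx d ^+ 2 by rewrite !expr2 cplxM.
rewrite dotZl !hdot_norm -exprMn lerXn2r ?nnegrE ?mulr_ge0 //.
exact: (adj_bound bx d0' h v).
Qed.

Lemma Fin_sq_bound f (x : H -> K) (d : R) : nsf_weight P f -> finite_weight P f -> N x -> 0 <= d ->
  (forall v, `|x v| <= cplx d * `|v|) -> Nf f x /\ F f (sq x) <= d ^+ 2 * F f idfun.
Proof.
move=> hf ff Nx d0 h; have bx := Nb Nx.
have Q1 : Qp P idfun by split; [exact: Q1 Pvna|exact: pos_id].
have f1 : Fin P f idfun by split=> //; apply: ff; case: Q1.
have d2 : 0 <= d ^+ 2 by rewrite exprn_ge0.
have [fc Fc] := Fin_scale Pvna hf d2 f1.
have hle := adj_form_le bx d0 h.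
have Qx := Qp_sq Nx; have fx : Fin P f (sq x) by apply: (Fin_le Pvna hf Qx fc); exact: hle.
split; first by split.
rewrite -Fc; apply: (F_le Pvna hf Qx fc); exact: hle.
Qed.

Lemma norm_real (L : hilbert R) (v : L) : exists2 d : R, 0 <= d & `|v| = cplx d /\ nrm2 v = d ^+ 2.
Proof.
have [e d0] := Cx_real (normr_ge0 v); exists (complex.Re `|v|) => //; split=> //.
by apply: cplx_inj; rewrite nrm2E hdot_norm e expr2 -cplxM expr2.
Qed.

(** The form of nn (th g u) w0 is x <g, g> by [Y_scalar]. The same element is qq u (kap g), of norm
    at most |kap g|, so x <g, g> <= f(1) <T g, g>. As x > 0, T is bounded below, and its finite
    trace makes H_r finite-dimensional. *)
Lemma finite_blocks f r : nsf_weight P f -> right_invariant P DP f -> finite_weight P f ->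
  fin_basis (Hr r).
Proof.
move=> hf hr ff; set u := uu r; have ku : Kr r u := Kr_uu r.
pose c := cc r u; have c0 : '[c, c] != 0 :> C.
  apply/eqP => /dot_eq0 /(cc_inj ku) u0; have := uu1 r; rewrite -/u u0 dot0l.
  by move/eqP; rewrite eq_sym oner_eq0.
pose w0 := th c u.
have nE (g : Hr r) : nn (th g u) w0 = qq u (kap g).
  have -> : w0 = ss xi u u by rewrite /w0 /c /cc -(x_th _ _ (Nhat_ss _ _)) (th_eps ku).
  by rewrite nn_ss_qq.
have F1 : 0 <= F f idfun.
  by apply: (F_ge0 hf); split; [exact: Q1 Pvna|exact: pos_id].
have hn w : Nf f (nn w w0) /\ F f (sq (nn w w0)) <= nrm2 w0 * F f idfun * nrm2 w.
  have [d d0 [ed e2]] := norm_real w; have [d' d0' [ed' e2']] := norm_real w0.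
  have [|h1 h2] := Fin_sq_bound hf ff (N_nn w w0) (mulr_ge0 d0 d0').
    by move=> v; rewrite cplxM -ed -ed'; exact: nn_norm.
  split=> //; apply: le_trans h2 _; rewrite e2 e2' le_eqVlt; apply/orP; left; apply/eqP; ring.
have [Y bY [hY1 hY2]] := right_form hf (right_vector_invariant hr) (mulr_ge0 (nrm2_ge0 w0) F1) hn.
have [x hx] := Y_scalar r bY hY2.
have xE (g : Hr r) : x * '[g, g] = cplx (F f (sq (qq u (kap g)))).
  rewrite -hx hY1 nE; apply: (S_sq hf); rewrite -nE; by have [] := hn (th g u).
have NE (g : Hr r) : Nf f (qq u (kap g)) by rewrite -nE; have [] := hn (th g u).
have x0 : 0 < x.
  have xe : x = cplx (F f (sq (qq u (kap (eps r))))) by rewrite -xE eps1 mulr1.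
  rewrite lt_neqAle; apply/andP; split; last first.
    by rewrite xe cplx_ge0; apply: (F_ge0 hf); exact: Qp_sq (Nf_N (NE _)).
  apply/eqP => x0; have q0 (g : Hr r) : qq u (kap g) = 0.
    by apply: (S_eq0 hf (NE g)); apply: cplx_inj; rewrite -xE -x0 mul0r.
  have : '[nn (th c u) (th c u) xi, th c u] = 0.
    by rewrite nE q0 zfunE dot0l.
  rewrite (nn_th _ _ _ _ _ ku) uu1 mulr1 pi_ss_th // dotZl => /eqP.
  by rewrite mulf_eq0 (negPf c0).
have [_ tT _ _] := ghT r; have pT := T_pos r.
have x1 : 0 <= cplx (F f idfun) / x by rewrite divr_ge0 ?cplx_ge0 // ltW.
apply: (trace_fin_basis x1 pT tT) => g.
rewrite mulrAC ler_pdivlMr // mulrC xE -kap_dot hdot_norm.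
have [d d0 [ed e2]] := norm_real (kap g).
have [|h1 h2] := Fin_sq_bound hf ff (N_qq u (kap g)) d0.
  move=> v; apply: le_trans (qq_norm _ _ _) _.
  have -> : `|u| = 1 :> C.
    have := uu1 r; rewrite -/u hdot_norm => /eqP; by rewrite sqrp_eq1 // => /eqP.
  by rewrite mul1r ed.
by rewrite ed (_ : cplx (F f idfun) * cplx d ^+ 2 = cplx (d ^+ 2 * F f idfun)) ?cplx_le // !expr2 !cplxM mulrC.
Qed.

End Finite.

(** * A finite unitary matrix of coefficients yields an invariant state on P *)

Section MatrixCompact.

Variables (f g : (K -> K) -> \bar R).
Hypotheses (hf : nsf_weight P f) (hfl : left_invariant P DP f).
Hypotheses (hg : nsf_weight P g) (hgr : right_invariant P DP g).
Variables (d : nat) (n : 'I_d -> 'I_d -> (H -> K)) (c : 'I_d).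
Hypothesis nN : forall i j, N (n i j).
Hypothesis nU1 : forall l l' a, \sum_k adj (n k l) (n k l' a) = (l == l')%:R *: a.
Hypothesis nU2 : forall l l' b, \sum_k n l k (adj (n l' k) b) = (l == l')%:R *: b.
Hypothesis nD : forall k l a b, DN (n k l) (a ⊗v b) = \sum_m n k m a ⊗v n m l b.
Let bn i j : bd (n i j) := Nb (nN i j).

(** By unitarity of the matrix n, [mE] of the identity operator is the identity matrix, and the
    diagonal entry [mO] is a normal state. *)
Definition mE (z : K -> K) b b' : C := \sum_k '[z (n k b' xi), n k b xi].
Definition mO (z : K -> K) : C := \sum_k '[z (n k c xi), n k c xi].

Lemma mO_state : normal_state P mO.
Proof.
split=> [|x _ [bx px]|]; first exact: pd_finT.
  by apply: sumr_ge0 => k _.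
transitivity ('[\sum_k adj (n k c) (n k c xi), xi] : C).
  by rewrite dot_suml; apply: eq_bigr => k _; rewrite adjl.
by rewrite nU1 eqxx scale1r xi1.
Qed.

(** Unitarity rewrites n_kc xi ⊗ a as the sum over b of DN n_kb applied to xi ⊗ n_cb^* a. Then DN^*
    DP(z) DN becomes DM, and invariance of the Haar state evaluates every term. *)
Lemma mE_slice z a a' : P z -> '[slice1 mO (DP z) a, a'] =
  \sum_b \sum_b' mE z b b' * '[adj (n c b') a, adj (n c b) a'] :> C.
Proof.
move=> Pz; have [pw _ _] := mO_state; have bz := P_b Pz; have bD := DP_b Pz.
have [_ ->] := slice1_spec pw bD.
have nx k v : n k c xi ⊗v v = \sum_b DN (n k b) (xi ⊗v adj (n c b) v).
  under eq_bigr do rewrite nD.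
  rewrite exchange_big /= (eq_bigr (fun m => n k m xi ⊗v ((m == c)%:R *: v))).
    rewrite (bigD1 c) //= eqxx scale1r big1 ?addr0 // => m /negPf ->.
    by rewrite scale0r pure0r.
  move=> m _; rewrite -nU2.
  by rewrite pure_sumr.
have key k b b' : '[DP z (DN (n k b') (xi ⊗v adj (n c b') a)), DN (n k b) (xi ⊗v adj (n c b) a')] =
   '[z (n k b' xi), n k b xi] * '[adj (n c b') a, adj (n c b) a'] :> C.
  have bd := DN_b (nN k b).
  rewrite -adjl // -[X in '[X, _]]/((adj (DN (n k b)) \o DP z \o DN (n k b')) _).
  rewrite DN_DP_DN // M_inv /= ?adjl //; apply: NNM => //; exact: PN.
rewrite /mO; transitivity (\sum_k \sum_b \sum_b' '[z (n k b' xi), n k b xi] *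
    '[adj (n c b') a, adj (n c b) a'] : C).
  apply: eq_bigr => k _; rewrite vslice2E !nx (lop_sum bD) dot_sumr.
  apply: eq_bigr => b _; rewrite dot_suml; apply: eq_bigr => b' _; exact: key.
rewrite exchange_big; apply: eq_bigr => b _ /=; rewrite exchange_big.
by apply: eq_bigr => b' _; rewrite /mE mulr_suml.
Qed.

(** At v b = n_cb^* a this is the quadratic form at a of the slice of DP z by [mO]; for positive z
    it is nonnegative at every tuple v. *)
Definition mPhi (v : 'I_d -> H) (z : K -> K) : C := \sum_b \sum_b' mE z b b' * '[v b', v b].

Lemma mPhi_pos v z : pos z -> 0 <= mPhi v z.
Proof.
move=> pz; have [bz _] := pz.
have -> : mPhi v z = \sum_k '[ampl z H (\sum_b n k b xi ⊗v v b),
    \sum_b n k b xi ⊗v v b].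
  rewrite /mPhi; under eq_bigr do under eq_bigr do rewrite /mE mulr_suml.
  under eq_bigr do rewrite exchange_big /=.
  rewrite exchange_big /=; apply: eq_bigr => k _.
  have bt : bd (ampl z H) by auto.
  rewrite (lop_sum bt) dot_sumr; apply: eq_bigr => b _.
  rewrite dot_suml; apply: eq_bigr => b' _.
  by rewrite tensorE ?pure_dot //; exact: bd_id.
by apply: sumr_ge0 => k _; exact: tensor_pos.
Qed.

Lemma mE_lin k x y b b' : mE (k *: x + y) b b' = k * mE x b b' + mE y b b'.
Proof.
rewrite /mE mulr_sumr -big_split; apply: eq_bigr => i _ /=.
by rewrite (lcombE x y) dotDl dotZl.
Qed.
Lemma mPhi_lin v k x y : mPhi v (k *: x + y) = k * mPhi v x + mPhi v y.
Proof.
rewrite /mPhi mulr_sumr -big_split; apply: eq_bigr => b _ /=.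
rewrite mulr_sumr -big_split; apply: eq_bigr => b' _ /=.
by rewrite mE_lin mulrDl mulrA.
Qed.
Lemma mE_1 b b' : mE idfun b b' = (b == b')%:R.
Proof.
transitivity ('[\sum_k adj (n k b) (n k b' xi), xi] : C).
  by rewrite dot_suml; apply: eq_bigr => k _; rewrite adjl.
by rewrite nU1 dotZl xi1 mulr1.
Qed.

Lemma mPhi_dom y : span [set x | Fin P f x] y -> exists2 z, Fin P f z &
  forall v, `|mPhi v y| <= mPhi v z.
Proof.
have mPhi0 v : mPhi v 0 = 0.
  rewrite /mPhi big1 // => b _; rewrite big1 // => b' _.
  by rewrite /mE big1 ?mul0r // => k _; exact: dot0l.
move: y; apply: span_ind.
  by exists 0 => [|v]; [have [] := Fin_0 Pvna hf|rewrite mPhi0 normr0].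
move=> k x y fx [z fz hz].
have [e k0] := Cx_real (normr_ge0 k).
have [h1 _] := Fin_scale Pvna hf k0 fx; have [h2 _] := Fin_add Pvna hf h1 fz.
exists (cplx (complex.Re `|k|) *: x + z) => // v.
rewrite !mPhi_lin -e; apply: le_trans (ler_normD _ _) _; rewrite lerD // normrM.
by rewrite (ger0_norm (mPhi_pos v (Fin_Qp fx).2)).
Qed.

Lemma Qp_slice z : Qp P z -> Qp P (slice1 mO (DP z)).
Proof.
move=> [Pz pz]; have [pO _ _] := mO_state; have bD := DP_b Pz.
have [by' hy'] := slice1_spec pO bD; split.
  have -> : slice1 mO (DP z) = \sum_k (1 : C) *: vslice1 (DP z) (n k c xi) (n k c xi).
    apply: op_ext => a b; rewrite hy' /mO fct_sumE dot_suml; apply: eq_bigr => k _.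
    by rewrite scale1r vslice2E vslice1E.
  apply: (subspace_sum (N := P)) => [|k]; first by case: Pvna.
  case: (ghDP G) => _ [h _ _] _ _ _.
  by apply: (vn_slice1 _ _ (Qb Pvna) (Qb Pvna)); [case: Pvna|case: Pvna|exact: h].
by split=> // v; rewrite mE_slice //; exact: (mPhi_pos (fun b => adj (n c b) v)).
Qed.

(** Only finitely many functionals [mE] are involved, so the identity can be approximated on all of
    them by a combination of finite elements, dominated by a finite z whose form [mPhi] is at least
    half the identity. Slicing DP z by the state [mO] preserves f and yields an operator above 1/2;
    so f(1) <= 2 f(z). *)
Lemma mat_fin1 : (f idfun < +oo)%E.
Proof.
have Q1 : Qp P idfun by split; [exact: Q1 Pvna|exact: pos_id].
have d0 : 0 < d%:R :> C by rewrite ltr0n; exact: leq_ltn_trans (ltn_ord c).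
(* The moduli of <v b', v b>, summed over all pairs, are at most d times the sum of the |v b|^2; an
   error 1/(2d) in every entry therefore costs at most half. *)
pose e : C := (2%:R * d%:R)^-1.
have e0 : 0 < e by rewrite invr_gt0 mulr_gt0 // ltr0n.
pose s := enum {: 'I_d * 'I_d}.
pose w i z := mE z (nth (c, c) s i).1 (nth (c, c) s i).2.
have pw (i : 'I_(size s)) : predual (w i) by exact: pd_finT.
have [_ hcl] := Fin_dense hf Q1.1.
have [y sy hy] := hcl _ (fun i : 'I_(size s) => w i) e pw e0.
have hE b b' : `|mE y b b' - (b == b')%:R| < e.
  have ks : (index (b, b') s < size s)%N by rewrite index_mem mem_enum.
  by have := hy (Ordinal ks); rewrite /w /= nth_index ?mem_enum //= mE_1.
have [z fz hz] := mPhi_dom sy.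
have low v : 2%:R^-1 * \sum_b '[v b, v b] <= mPhi v z :> C.
  have E : mPhi v y = \sum_b \sum_b' (mE y b b' - (b == b')%:R) * '[v b', v b] +
      \sum_b '[v b, v b].
    rewrite -big_split; apply: eq_bigr => b _ /=.
    under [in RHS]eq_bigr do rewrite mulrBl.
    rewrite sumrB; have -> : \sum_b' (b == b')%:R * '[v b', v b] = '[v b, v b].
      rewrite (bigD1 b) //= eqxx mul1r big1 ?addr0 // => b'.
      by rewrite eq_sym => /negPf ->; rewrite mul0r.
    by rewrite subrK.
  set D := \sum_b \sum_b' _ in E; set q := \sum_b '[v b, v b] in E *.
  have q0 : 0 <= q by apply: sumr_ge0.
  have hD : `|D| <= 2%:R^-1 * q.
    have -> : 2%:R^-1 * q = \sum_b \sum_b' e * (2%:R^-1 * ('[v b, v b] + '[v b', v b'])).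
      under eq_bigr do rewrite -mulr_sumr -mulr_sumr big_split /= sumr_const card_ord.
      rewrite -mulr_sumr -mulr_sumr big_split /= sumr_const card_ord -/q.
      rewrite sumrMnl -/q -(mulr_natr q) /e.
      by field; rewrite gt_eqF.
    apply: le_trans (ler_norm_sum _ _ _) _; apply: ler_sum => b _.
    apply: le_trans (ler_norm_sum _ _ _) _; apply: ler_sum => b' _.
    rewrite normrM; apply: ler_pM => //; first exact: ltW.
    apply: le_trans (dot_CS _ _) _; rewrite !hdot_norm.
    rewrite ler_pdivlMl ?ltr0n // -subr_ge0.
    rewrite (_ : _ - _ = (`|v b| - `|v b'|) ^+ 2); last by ring.
    by rewrite real_exprn_even_ge0 // rpredB // normr_real.
  apply: le_trans (hz v); rewrite E.
  have := lerB_normD q D; rewrite (ger0_norm q0) addrC [q + D]addrC => h.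
  apply: le_trans h; rewrite addrC lerBrDr; apply: le_trans (lerD (lexx _) hD) _.
  by rewrite -mulrDl -mulr2n -(mulr_natr (_^-1)) mulVf ?mul1r ?pnatr_eq0.
have [[Pz pz] fz'] := fz; have bD := DP_b Pz.
pose y' := slice1 mO (DP z).
have y'E a : '[y' a, a] = mPhi (fun b => adj (n c b) a) z :> C by rewrite mE_slice.
have Qy' : Qp P y' by exact: Qp_slice.
have fy' : Fin P f y' by split=> //; rewrite /y' hfl //; exact: mO_state.
have h0 : 0 <= 2%:R^-1 :> R by rewrite invr_ge0 ler0n.
have Qh := Qp_scale Pvna h0 Q1.
have le : op_le (cplx (2%:R^-1) *: idfun) y'.
  move=> v; rewrite y'E; apply: le_trans (low _).
  rewrite (_ : (cplx 2^-1 *: idfun) v = cplx 2^-1 *: v) // dotZl cplxV.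
  have -> : cplx (2%:R : R) = 2%:R :> C by rewrite /cplx rmorph_nat.
  rewrite ler_wpM2l ?invr_ge0 ?ler0n //.
  have -> : \sum_b '[adj (n c b) v, adj (n c b) v] = '[v, v]; last by [].
  transitivity ('[\sum_k n c k (adj (n c k) v), v] : C).
    by rewrite dot_suml; apply: eq_bigr => k _; rewrite [RHS]adjr.
  by rewrite nU2 eqxx scale1r.
have [_ fh] := Fin_le Pvna hf Qh fy' le.
move: fh; rewrite (f_scale hf h0 Q1); have := f_ge0 hf Q1.
by case: (f idfun) => [r _ _| |] //=; rewrite ?ltry // gt0_muley // lte_fin invr_gt0 ltr0n.
Qed.

Lemma wext_sum (I : finType) (a : I -> C) (x : I -> K -> K) : (forall i, wdom P f (x i)) ->
  wext P f (\sum_i a i *: x i) = \sum_i a i * wext P f (x i).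
Proof.
move=> hx; have [h0 F0] := Fin_0 Pvna hf.
suff [] : wdom P f (\sum_i a i *: x i) /\
  wext P f (\sum_i a i *: x i) = \sum_i a i * wext P f (x i) by [].
elim/big_rec2: _ => [|i y z _ [hz <-]].
  by split; [exact: (wdom_fin Pvna hf)|rewrite (wext_fin Pvna hf h0) F0].
split; first exact: (wdom_lin Pvna hf).
exact: (wext_lin Pvna hf).
Qed.

Lemma mat_fin : finite_weight P f. Proof. exact: finite_of_unit hf mat_fin1. Qed.

Lemma Fin1 : Fin P f idfun.
Proof. by split; [split; [exact: Q1 Pvna|exact: pos_id]|exact: mat_fin1]. Qed.
Lemma F1_gt0 : 0 < F f idfun.
Proof.
rewrite lt_neqAle (F_ge0 hf (Fin_Qp Fin1)) andbT eq_sym; apply/eqP => h.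
have e := F_faith hf Fin1 h; have := mE_1 c c; rewrite e eqxx /mE big1.
  by move/eqP; rewrite eq_sym oner_eq0.
by move=> k _; exact: dot0l.
Qed.

Definition ms b b' : C := wext P f (n c b \o adj (n c b')) / cplx (F f idfun).
(** This is f / f(1) as an explicit combination of vector functionals, hence normal: left invariance
    evaluates f(z) on the slice of DP z by [mO], which [mE_slice] expands in the products n_cb
    n_cb'^*. *)
Definition mw (z : K -> K) : C := \sum_b \sum_b' mE z b b' * ms b b'.

Lemma mw_pd : predual mw.
Proof.
have := pd_finT (fun p : 'I_d * 'I_d * 'I_d => n p.2 p.1.2 xi)
  (fun p : 'I_d * 'I_d * 'I_d => (ms p.1.1 p.1.2)^* *: n p.2 p.1.1 xi).
move=> h; apply: (pd_ext h) => z bz.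
rewrite -(pair_big xpredT xpredT (fun p k => '[z (n k p.2 xi), (ms p.1 p.2)^* *: n k p.1 xi])) /=.
rewrite -(pair_big xpredT xpredT (fun b b' => \sum_k '[z (n k b' xi), (ms b b')^* *: n k b xi])) /=.
apply: eq_bigr => b _; apply: eq_bigr => b' _; rewrite /mE mulr_suml.
by apply: eq_bigr => k _; rewrite dotZr conjCK mulrC.
Qed.

Lemma mw_pos x : Qp P x -> mw x = cplx (F f x / F f idfun).
Proof.
move=> Qx; have [Px px] := Qx; have fx : Fin P f x by split=> //; exact: mat_fin.
have Qy := Qp_slice Qx; have [_ fx'] := fx.
have e : f (slice1 mO (DP x)) = f x by apply: hfl => //; exact: mO_state.
have fy : Fin P f (slice1 mO (DP x)) by split=> //; rewrite e.
have := wext_fin Pvna hf fy; rewrite /F e -/(F f x) cplxM cplxV => <-.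
have -> : slice1 mO (DP x) = \sum_(p : 'I_d * 'I_d) mE x p.1 p.2 *: (n c p.1 \o adj (n c p.2)).
  apply: op_ext => a a'; rewrite mE_slice // fct_sumE dot_suml.
  rewrite pair_big /=; apply: eq_bigr => -[b b'] _ /=.
  by rewrite [in RHS]scombE dotZl /= [in RHS](adjr _ _ (bn c b)).
have nf b : Nf f (n c b) by split=> //; split; [exact: Qp_sq|apply: mat_fin; case: (Qp_sq (nN c b))].
rewrite wext_sum => [|p]; last exact: Nf_wdom.
by rewrite mulr_suml /mw pair_big /=; apply: eq_bigr => p _; rewrite /ms mulrA.
Qed.

Lemma mw_state : normal_state P mw.
Proof.
split; first exact: mw_pd.
  move=> x Px px; rewrite mw_pos // cplx_ge0 divr_ge0 ?(F_ge0 hf) //.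
  by case: Fin1.
by rewrite mw_pos ?divff ?gt_eqF ?F1_gt0 //; case: Fin1.
Qed.

(** Polarizing the product of x with the identity writes x as a combination of four squares in P. *)
Lemma P_pos_ind (Pr : (K -> K) -> Prop) : (forall x, Qp P x -> Pr x) ->
  (forall k x y, P x -> P y -> Pr x -> Pr y -> Pr (k *: x + y)) -> forall x, P x -> Pr x.
Proof.
move=> h1 h2 x Px; have bx := P_b Px; have v := Pvna.
have P1 : P idfun by exact: Q1 v.
have QS y : P y -> Qp P (sq y).
  by move=> Py; split; [apply: (Qmul v) => //; exact: Qadj|apply: pos_sq; exact: P_b].
have PS y : P y -> P (sq y) by move=> /QS[].
have rS y : P y -> Pr (sq y) by move=> /QS; exact: h1.
have PD k y z : P y -> P z -> P (k *: y + z) by exact: (Qlin v).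
have PB y z : P y -> P z -> P (y - z) by exact: (QB v).
have rB y z : P y -> P z -> Pr y -> Pr z -> Pr (y - z).
  by move=> *; rewrite addrC -scaleN1r; exact: h2.
have P0 : P 0 := Q0 v.
have r0 : Pr 0 by apply: h1; split=> //; exact: pos_0.
have -> : x = x \o adj idfun by rewrite adj_idfun.
have Pi : P ('i *: idfun) by exact: (QZ v).
rewrite (polar_op bx (bd_id K)) -[_ *: _]addr0.
have A1 : P (x + idfun) by exact: (QD v).
have A2 : P (x - idfun) by exact: PB.
have A3 : P (x + 'i *: idfun) by exact: (QD v).
have A4 : P (x - 'i *: idfun) by exact: PB.
have B1 := PB _ _ (PS _ A1) (PS _ A2); have B2 := PB _ _ (PS _ A3) (PS _ A4).
rewrite [sq _ - _ + _]addrC.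
apply: (h2) => //; first exact: (PD).
by apply: (h2) => //; apply: (rB); auto.
Qed.

Lemma DP_pos x : Qp P x -> pos (DP x).
Proof.
move=> [Px px]; split=> [|v]; first exact: DP_b.
by rewrite DPV //= adjr; [exact: tensor_pos|exact: bVt].
Qed.
Lemma Qp_vslice1 x b : Qp P x -> Qp P (vslice1 (DP x) b b).
Proof.
move=> Qx; have [Px _] := Qx; have [bD pD] := DP_pos Qx; split.
  case: (ghDP G) => _ [h _ _] _ _ _.
  by apply: (vn_slice1 _ _ (Qb Pvna) (Qb Pvna)); [case: Pvna|case: Pvna|exact: h].
by split=> [|v]; [exact: bd_vslice1|rewrite vslice1E].
Qed.
Lemma Qp_vslice2 x b : Qp P x -> Qp P (vslice2 (DP x) b b).
Proof.
move=> Qx; have [Px _] := Qx; have [bD pD] := DP_pos Qx; split.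
  case: (ghDP G) => _ [h _ _] _ _ _.
  by apply: (vn_slice2 _ _ (Qb Pvna) (Qb Pvna)); [case: Pvna|case: Pvna|exact: h].
by split=> [|v]; [exact: bd_vslice2|rewrite vslice2E].
Qed.

(** [sl] stands for the slice by w in one leg and [vs] for vector slices in the other, so that left
    and right invariance share one argument. *)
Lemma inv_slice (w : (K -> K) -> C) (sl : (K ⊗ K -> K ⊗ K) -> K -> K)
    (vs : (K ⊗ K -> K ⊗ K) -> K -> K -> K -> K) : predual w ->
  (forall X, bd X -> bd (sl X) /\ forall u v, '[sl X u, v] = w (vs X u v)) ->
  (forall X u v, bd X -> bd (vs X u v)) ->
  (forall k X Y u v, vs (k *: X + Y) u v = k *: vs X u v + vs Y u v) ->
  (forall X a b, bd X -> vs X (a *: b) (a *: b) = `|a| ^+ 2 *: vs X b b) ->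
  (forall x b, Qp P x -> '[b, b] = 1 -> w (vs (DP x) b b) = w x) ->
  forall x, P x -> sl (DP x) = w x *: idfun.
Proof.
move=> pw hsl bvs vsl vsq h; apply: P_pos_ind => [x Qx|k x y Px Py hx hy].
  have [Px _] := Qx; have bD := DP_b Px; have [bs hs] := hsl _ bD.
  apply: quad_ext; [exact: bs|exact: bd_scale (bd_id K)|] => u; rewrite hs.
  rewrite (_ : (w x *: idfun) u = w x *: u) // dotZl.
  move: u; apply: pure_norm_ext => [a b|a b|b b1].
  - by rewrite vsq // (pd_Z _ pw) //; exact: bvs.
  - by rewrite dotZl dotZr !mulrA normCK [X in X * _]mulrC [LHS]mulrC; ring.
  - by rewrite h // b1 mulr1.
have [bx by_] := (DP_b Px, DP_b Py); rewrite DP_lin //.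
apply: op_ext => u v; have [_ ->] := hsl _ (bd_add (bd_scale k bx) by_).
rewrite vsl (pd_lin pw); [|exact: bvs|exact: bvs].
have [_ <-] := hsl _ bx; have [_ <-] := hsl _ by_.
rewrite hx hy (pd_lin pw k (P_b Px) (P_b Py)).
by rewrite !scombE !dotZl mulrDl mulrA.
Qed.

Lemma inv_slice2 (w : (K -> K) -> C) : predual w ->
  (forall x b, Qp P x -> '[b, b] = 1 -> w (vslice1 (DP x) b b) = w x) ->
  forall x, P x -> slice2 w (DP x) = w x *: idfun.
Proof.
move=> pw; apply: (inv_slice pw) => [X bX|X u v bX|k X Y u v|X a b bX].
- exact: slice2_spec.
- exact: bd_vslice1.
- by apply: op_ext => s t; rewrite vslice1E !lcombE !dotDl !dotZl !vslice1E.
apply: op_ext => s t; rewrite vslice1E !pureZl (lopZ bX) dotZl dotZr mulrA -normCK.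
by rewrite (_ : (`|a| ^+ 2 *: vslice1 X b b) s = `|a| ^+ 2 *: vslice1 X b b s) // dotZl vslice1E.
Qed.

Lemma inv_slice1 (w : (K -> K) -> C) : predual w ->
  (forall x b, Qp P x -> '[b, b] = 1 -> w (vslice2 (DP x) b b) = w x) ->
  forall x, P x -> slice1 w (DP x) = w x *: idfun.
Proof.
move=> pw; apply: (inv_slice pw) => [X bX|X u v bX|k X Y u v|X a b bX].
- exact: slice1_spec.
- exact: bd_vslice2.
- by apply: op_ext => s t; rewrite vslice2E !lcombE !dotDl !dotZl !vslice2E.
apply: op_ext => s t; rewrite vslice2E !pureZr (lopZ bX) dotZl dotZr mulrA -normCK.
by rewrite (_ : (`|a| ^+ 2 *: vslice2 X b b) s = `|a| ^+ 2 *: vslice2 X b b s) // dotZl vslice2E.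
Qed.

(** Left invariance of f gives one half of the invariance of [mw]. That half and the right
    invariance of g show that g is finite and equals g(1) [mw]; so [mw] inherits right invariance as
    well. *)
Lemma mat_compact : compact_woronowicz P DP.
Proof.
split; first exact: (ghDP G).
exists mw; split; first exact: mw_state.
have Q1 := Fin_Qp Fin1.
have Fin_all h : finite_weight P h -> forall x, Qp P x -> Fin P h x.
  by move=> fh x Qx; split=> //; apply: fh; case: Qx.
have s2 : forall x, P x -> slice2 mw (DP x) = mw x *: idfun.
  apply: inv_slice2 mw_pd _ => x b Qx b1.
  have [Px px] := Qx; have fx := mat_fin Px px; have vs := vec_state P b1.
  have e := hfl vs Px px fx; rewrite (slice1_vec _ (DP_b Px)) in e.
  by rewrite !mw_pos //; [rewrite /F e|exact: Qp_vslice1].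
have hgf : finite_weight P g.
  apply: (state_finite hg mw_state) => x Px px gx.
  by rewrite -s2 //; apply: hgr => //; exact: mw_state.
have gE x : Qp P x -> cplx (F g x) = mw x * cplx (F g idfun).
  move=> Qx; have [Px px] := Qx.
  have e : g (mw x *: idfun) = g x.
    by rewrite -s2 //; apply: hgr => //; [exact: mw_state|exact: hgf].
  have a0 : 0 <= F f x / F f idfun by rewrite divr_ge0 ?(F_ge0 hf).
  have [_ h2] := Fin_scale Pvna hg a0 (Fin_all _ hgf _ Q1).
  by rewrite /F -e (mw_pos Qx) -/(F g _) h2 cplxM.
have G1 : cplx (F g idfun) != 0 :> C.
  apply/eqP; rewrite -cplx0 => /cplx_inj /(F_faith hg (Fin_all _ hgf _ Q1)) e.
  by have := F1_gt0; rewrite e; have [_ ->] := Fin_0 Pvna hf; rewrite ltxx.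
move=> x Px; split; last exact: s2.
move: x Px; apply: inv_slice1 mw_pd _ => x b Qx b1.
have [Px px] := Qx; have fx := hgf x Px px; have vs := vec_state P b1.
have e := hgr vs Px px fx; rewrite (slice2_vec _ (DP_b Px)) in e.
apply: (mulIf G1); rewrite -!gE //; last exact: Qp_vslice2.
by rewrite /F e.
Qed.

End MatrixCompact.

(** * Corepresentations: compactness from one, finite dimension of all *)

Section Irreducible.

Lemma K_neq0 : exists w : K, w != 0.
Proof.
apply: contrapT => h; have z (w : K) : w = 0.
  by apply: contrapT => /eqP w0; apply: h; exists w.
case: (ghN G) => _ _ [_ dS] _ _.
have : xi = 0.
  apply: (dense_span_ext0 dS) => _ [x [w [Nx ->]]].
  by rewrite (z w) (lop0 (bd_adj (Nb Nx))) dot0l.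
by move=> x0; have := xi1; rewrite x0 dot0l => /eqP; rewrite eq_sym oner_eq0.
Qed.
Lemma exists_block : exists r : gI G, True.
Proof.
apply: contrapT => h; have [w /eqP] := K_neq0; apply.
have e : (idfun : K -> K) = 0.
  by apply: pi_inj; [exact: Nhat_1|exact: Nhat_0|move=> r; case: h; exists r].
exact: (congr1 (@^~ w) e).
Qed.

Lemma Kr_sum r (I : finType) (a : I -> C) (u : I -> K) : (forall i, Kr r (u i)) ->
  Kr r (\sum_i a i *: u i).
Proof.
move=> hu; rewrite /Kr (lop_sum (f := ee r) (th_b _)); apply: eq_bigr => i _.
by rewrite (lopZ (f := ee r) (th_b _)) hu.
Qed.

(** A vector of [Kr] orthogonal to all kap (g i) is killed by [cc], hence is 0. So finite dimension
    passes from H_r to its multiplicity space. *)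
Lemma Kr_basis r : fin_basis (Hr r) -> exists d (u : 'I_d -> K),
  [/\ forall i j, '[u i, u j] = (i == j)%:R :> C, forall i, Kr r (u i) &
    forall v, Kr r v -> v = \sum_i '[v, u i] *: u i].
Proof.
move=> [d [g [go gs_]]].
pose a m := if insub m is Some i then kap (g i) else 0.
have K0 : Kr r 0 by rewrite /Kr; exact: (lop0 (f := ee r) (th_b _)).
have aK m : Kr r (a m) by rewrite /a; case: insubP => [i _ _|_] //; exact: kap_Kr.
have gK n : Kr r (gs a n).
  elim/ltn_ind: n => n IH; rewrite gsE /nlz -[_ *: _]addr0; apply: Kr_lin => //.
  rewrite addrC -scaleN1r; apply: Kr_lin => //.
  by apply: Kr_sum => i; exact: IH.
have [|d' [u [uo un uc]]] := nonzero_subfamily (n0 := d) (gs_orth a) (gs_unit a).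
  move=> n nd; rewrite gsE /a insubF ?ltnNge ?nd //= /nlz big1 ?subr0 ?scaler0 //.
  by move=> i _; rewrite dot0l scale0r.
have uK i : Kr r (u i) by have [n ->] := un i.
exists d', u; split=> // v kv.
have kv' : Kr r (v - \sum_i '[v, u i] *: u i).
  by rewrite addrC -scaleN1r; apply: Kr_lin => //; exact: Kr_sum.
apply/eqP; rewrite -subr_eq0; apply/eqP; apply: (cc_inj kv').
have h n : '[v - \sum_i '[v, u i] *: u i, gs a n] = 0.
  by apply: uc => i; rewrite dotBl orthonormal_sum // subrr.
have h2 m : '[v - \sum_i '[v, u i] *: u i, a m] = 0.
  have := gs_span a m; move: (a m); apply: span_ind; first exact: dot0r.
  by move=> k x z [i _ <-] hz; rewrite dotDr dotZr h mulr0 add0r.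
rewrite (gs_ (cc r _)) big1 // => i _; rewrite -kap_cc dotC.
by have := h2 i; rewrite /a valK => ->; rewrite conjC0 scale0r.
Qed.

Lemma fin_lsl r d (u : 'I_d -> K) (L : hilbert R) (X : K ⊗ L) : (forall i, Kr r (u i)) ->
  (forall v, Kr r v -> v = \sum_i '[v, u i] *: u i) ->
  ampl (ee r) L X = X -> X = \sum_k u k ⊗v lsl (u k) X.
Proof.
move=> uK uc hX; apply: tdot_ext => w b; rewrite dot_suml.
have be : bd (ee r) := th_b _.
have bt : bd (ampl (ee r) L) by auto.
rewrite -[in LHS]hX (adjr _ _ bt) (adj_tensor be (bd_id L)) adj_idfun ee_adj.
rewrite (tensorE _ _ be (bd_id L)) [in LHS](uc (ee r w)); last exact: ee_ee.
rewrite (_ : (\sum_i '[ee r w, u i] *: u i) ⊗v b = \sum_i '[ee r w, u i] *: (u i ⊗v b)); last first.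
  by rewrite pure_suml; apply: eq_bigr => i _; rewrite pureZl.
rewrite dot_sumr; apply: eq_bigr => i _; rewrite pure_dot dotZr -lslE -dotC.
by congr (_ * _); rewrite -[in RHS](uK i) (adjr _ _ be) ee_adj.
Qed.

Lemma qq_lsl v w a : qq v w a = lsl v (Vt (w ⊗v a)).
Proof. by []. Qed.
Lemma adj_qq_lsl v w b : adj (qq v w) b = lsl w (adj Vt (v ⊗v b)).
Proof.
apply: dot_ext => a; rewrite lslE adjl ?qqE; last exact: bd_qq.
rewrite adjl; last exact: bVt.
by rewrite dotC qqE -dotC.
Qed.

(** As [ee r] lies in the dual algebra, Vt maps Kr ⊗ H onto Kr ⊗ K; its slices along a finite basis
    of Kr are the unitary matrix required. *)
Lemma compact_of_finite f g : nsf_weight P f -> left_invariant P DP f ->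
  nsf_weight P g -> right_invariant P DP g -> finite_weight P g -> compact_woronowicz P DP.
Proof.
move=> hf hfl hg hgr gf; have [r _] := exists_block.
have [d [u [uo uK uc]]] := Kr_basis (finite_blocks r hg hgr gf).
have [c _] : exists c : 'I_d, True.
  apply: contrapT => h; have := uu1 r; rewrite (uc _ (Kr_uu r)) big1 ?dot0l.
    by move=> /eqP; rewrite eq_sym oner_eq0.
  by move=> i _; case: h; exists i.
have be : bd (ee r) := th_b _; have eN : Nhat (ee r) := th_N _.
have uV := unVt.
have eV l a : ampl (ee r) K (Vt (u l ⊗v a)) = Vt (u l ⊗v a).
  by rewrite (Nhat_Vt eN) (tensorE _ _ be (bd_id H)) uK.
have eV' l b : ampl (ee r) H (adj Vt (u l ⊗v b)) = adj Vt (u l ⊗v b).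
  rewrite -[LHS](unK uV) -(Nhat_Vt eN) (unVK uV).
  by rewrite (tensorE _ _ be (bd_id K)) uK.
have P1 (L : hilbert R) (X X' : K ⊗ L) : ampl (ee r) L X = X ->
    \sum_k '[lsl (u k) X, lsl (u k) X'] = '[X, X'].
  move=> hX; rewrite [in RHS](fin_lsl uK uc hX) dot_suml; apply: eq_bigr => k _.
  by rewrite [in LHS]dotC lslE -dotC.
apply: (mat_compact hf hfl hg hgr (n := fun k l => qq (u k) (u l)) c).
- by move=> i j; exact: N_qq.
- move=> l l' a; apply: dot_ext => a'; rewrite dot_suml dotZl.
  transitivity ('[Vt (u l' ⊗v a), Vt (u l ⊗v a')] : C).
    rewrite -P1 //; apply: eq_bigr => k _; rewrite adjl; last exact: bd_qq.
    by rewrite !qq_lsl.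
  by rewrite (un_dot uV) pure_dot uo eq_sym.
- move=> l l' b; apply: dot_ext => b'; rewrite dot_suml dotZl.
  transitivity ('[adj Vt (u l' ⊗v b), adj Vt (u l ⊗v b')] : C).
    rewrite -P1 //; apply: eq_bigr => k _; rewrite adjr; last exact: bd_qq.
    by rewrite !adj_qq_lsl.
  by rewrite (un_dotV uV) pure_dot uo eq_sym.
move=> k l a b; apply: tdot_ext => a' b'; rewrite DN_qq dot_suml.
have ks : Kr r (sg b b' (u l)).
  by have [_ h] := (NhatP _).1 eN; rewrite /Kr h uK.
rewrite (uc _ ks) (lop_sum (bd_sg _ _)) dot_suml; apply: eq_bigr => m _.
by rewrite (lopZ (bd_sg _ _)) dotZl pure_dot !qq_sg mulrC.
Qed.

Section Corep.
Variables (L : hilbert R) (g0 : H ⊗ L -> K ⊗ L).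
Hypothesis hg : corepresentation N DN g0.
Let ug : unitary_op g0. Proof. by case: hg. Qed.
Let bg : bd g0 := un_bd ug.
Local Notation mm w' w := (vslice2 g0 w w').
Local Notation gg a b := (vslice1 g0 a b).

Lemma mm_N w' w : N (mm w' w).
Proof.
case: hg => h _ _.
by apply: (vn_slice2 w w' (@Nb) _ (@Nsub) (@Ncl)) h.
Qed.
Lemma mm_gg w' w a b : '[mm w' w a, b] = '[gg a b w, w'].
Proof. by rewrite vslice2E vslice1E. Qed.

Lemma DN_mm w' w f1 f2 b1 b2 :
  '[DN (mm w' w) (f1 ⊗v f2), b1 ⊗v b2] = '[gg f1 b1 (gg f2 b2 w), w'].
Proof.
have [b3 h3] := map1_spec bVt bV (@Nb) (@DNV) bg (fun u v => mm_N v u).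
rewrite -h3 vslice2E; case: hg => _ _ ->.
pose A Y := leg13 (L := K) g0 (adj (@assoc _ _ H K L) (f1 ⊗v Y)).
have bA : bd A.
  have : bd (leg13 (L := K) g0 \o (adj (@assoc _ _ H K L) \o (fun Y : K ⊗ L => f1 ⊗v Y))).
    by apply: bd_comp; auto.
  exact.
have [B [bB BE]] : exists B : K ⊗ L -> L, bd B /\ forall Y, B Y = gg f1 b1 (lsl b2 Y).
  by exists (gg f1 b1 \o lsl b2); split=> //; apply: bd_comp; auto.
have e Y : '[A Y, (b1 ⊗v b2) ⊗v w'] = '[B Y, w'].
  rewrite (adjr _ _ bA) (adjr _ _ bB); have -> // : adj A ((b1 ⊗v b2) ⊗v w') = adj B w'.
  apply: tdot_ext => c v.
  rewrite (adjl _ _ bA) (adjl _ _ bB) dotC [RHS]dotC; congr (_^*).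
  rewrite /A adj_assocE leg13E // BE lsl_pure (lopZ (bd_vslice1 _ _ bg)) dotZl.
  by rewrite vslice1E.
have e2 : leg23 (L := H) g0 ((f1 ⊗v f2) ⊗v w) = adj (@assoc _ _ H K L) (f1 ⊗v g0 (f2 ⊗v w)).
  by rewrite /leg23 /= assocE tensorE.
transitivity ('[A (g0 (f2 ⊗v w)), (b1 ⊗v b2) ⊗v w'] : C); last by rewrite e BE.
by rewrite /A -e2.
Qed.

Lemma mm_slice2 w' w a b : vslice2 (DN (mm w' w)) a b = mm w' (gg a b w).
Proof. by apply: op_ext => x y; rewrite vslice2E DN_mm mm_gg. Qed.

Lemma corep_compact f g : nsf_weight P f -> left_invariant P DP f ->
  nsf_weight P g -> right_invariant P DP g -> fin_basis L -> (exists v : L, v != 0) ->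
  compact_woronowicz P DP.
Proof.
move=> hf hfl hg' hgr [d [e [eo ec]]] [v v0].
have [c _] : exists c : 'I_d, True.
  apply: contrapT => h; case/eqP: v0; rewrite (ec v) big1 // => i _; case: h; by exists i.
have P1 (K1 : hilbert R) (X X' : K1 ⊗ L) : \sum_k '[rsl (e k) X, rsl (e k) X'] = '[X, X'].
  have e1 : X = \sum_k rsl (e k) X ⊗v e k.
    apply: tdot_ext => a w; rewrite dot_suml {1}(ec w) pure_sumr dot_sumr.
    by apply: eq_bigr => k _; rewrite pureZr dotZr pure_dot -rslE -dotC mulrC.
  rewrite [in RHS]e1 dot_suml; apply: eq_bigr => k _.
  by rewrite [in LHS]dotC rslE -dotC.
have adjE k l b : adj (mm (e k) (e l)) b = rsl (e l) (adj g0 (b ⊗v e k)).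
  apply: dot_ext => a; rewrite rslE adjl; last exact: bd_vslice2.
  by rewrite adjl // dotC vslice2E -dotC.
apply: (mat_compact hf hfl hg' hgr (n := fun k l => mm (e k) (e l)) c).
- by move=> i j; exact: mm_N.
- move=> l l' a; apply: dot_ext => a'; rewrite dot_suml dotZl.
  transitivity ('[g0 (a ⊗v e l'), g0 (a' ⊗v e l)] : C).
    by rewrite -P1; apply: eq_bigr => k _; rewrite adjl //; exact: bd_vslice2.
  by rewrite (un_dot ug) pure_dot eo eq_sym mulrC.
- move=> l l' b; apply: dot_ext => b'; rewrite dot_suml dotZl.
  transitivity ('[adj g0 (b ⊗v e l'), adj g0 (b' ⊗v e l)] : C).
    by rewrite -P1; apply: eq_bigr => k _; rewrite adjr ?adjE //; exact: bd_vslice2.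
  by rewrite (un_dotV ug) pure_dot eo eq_sym mulrC.
move=> k l a b; apply: tdot_ext => a' b'; rewrite DN_mm dot_suml.
rewrite [in LHS](ec (gg b b' (e l))) (lop_sum (bd_vslice1 _ _ bg)) dot_suml.
apply: eq_bigr => m _.
by rewrite (lopZ (bd_vslice1 _ _ bg)) dotZl pure_dot !mm_gg mulrC.
Qed.

Let fg : L ⊗ H -> L ⊗ K := fun t => flip (g0 (flip t)).
Let ufg : unitary_op fg.
Proof.
have bfg : bd fg by exact: bd_comp (bd_flip _ _) (bd_comp bg (bd_flip _ _)).
apply: (un_intro (v := fun t => flip (adj g0 (flip t)))) => // [x y|y].
  by rewrite /fg (adjr _ _ (bd_flip _ _)) flip_adj flipK (un_dot ug) (adjr _ _ (bd_flip _ _)) flip_adj flipK.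
by rewrite /fg flipK (unVK ug) flipK.
Qed.

(** Applying coefficients to xi maps L into K and carries the slices of the corepresentation to the
    slices [sg] of Vt. The relation for the adjoint of j uses that both unitaries are invertible.
    Together they put j j^* into the dual algebra. *)
Lemma coef_intertwines v : exists j : L -> K, [/\ bd j,
  forall w, j w = mm v w xi,
  forall a c w, sg a c (j w) = j (gg a c w) &
  forall a c w, adj j (sg a c w) = gg a c (adj j w)].
Proof.
have [j [bj jE]] : exists j : L -> K, bd j /\ forall w, j w = mm v w xi.
  exists (rsl v \o g0 \o (fun w => xi ⊗v w)); split=> //.
  by apply: bd_comp; auto.
have bK := bd_id K; have bH := bd_id H.
have h1 a c w : sg a c (j w) = j (gg a c w).
  by rewrite !jE sg_xi ?mm_slice2 //; exact: mm_N.
have uV := unVt; have bV := bVt; have bf := un_bd ufg.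
have e : Vt \o ampl j H = ampl j K \o fg.
  have b1 : bd (ampl j H) by auto.
  have b2 : bd (ampl j K) by auto.
  apply: top_ext; [exact: bd_comp|exact: bd_comp|] => w a t c /=.
  rewrite (tensorE _ _ bj bH) -sgE h1 (adjr _ _ b2) (adj_tensor bj bK) adj_idfun.
  rewrite (tensorE _ _ (bd_adj bj) bK) /fg flipE (adjr _ _ bj) (adjr _ _ (bd_flip _ _)).
  by rewrite flip_adj flipE vslice1E.
have e' z : adj Vt (ampl j K z) = ampl j H (adj fg z).
  rewrite -[in LHS](unVK ufg z) -[tensor_op _ _ (fg _)]/((ampl j K \o fg) _) -e.
  exact: (unK uV).
exists j; split=> // a c w; apply: dot_ext => t.
rewrite (adjl _ _ bj) vslice1E.
have -> : '[g0 (a ⊗v adj j w), c ⊗v t] = '[adj j w ⊗v a, adj fg (t ⊗v c)].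
  by rewrite -(adjr _ _ bf) /fg flipE (adjr _ _ (bd_flip _ _)) flip_adj flipE.
have b1 : bd (ampl j H) by auto.
have -> : adj j w ⊗v a = adj (ampl j H) (w ⊗v a).
  by rewrite (adj_tensor bj bH) adj_idfun (tensorE _ _ (bd_adj bj) bH).
by rewrite (adjl _ _ b1) -e' (tensorE _ _ bj bK) -(adjr _ _ bV) sgE.
Qed.

End Corep.

Lemma corner_scalar r x : Nhat x -> (forall w, ee r (x w) = x w) -> (forall w, x (ee r w) = x w) ->
  exists k : C, forall w, x w = k *: ee r w.
Proof.
move=> Nx h1 h2; exists ('[pi r x (eps r), eps r]) => w.
have e : pi r x (eps r) = '[pi r x (eps r), eps r] *: eps r.
  have : ee r \o x = x by apply: funext.
  move/(congr1 (fun y => pi r y (eps r))); rewrite pir_mul //=; last exact: th_N.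
  by rewrite /ee th_pi /rk => <-; rewrite dotZl eps1 mulr1.
by rewrite -h2 /ee (x_th _ _ Nx) {1}e thZ.
Qed.

(** [kap] is conjugate linear, so only its values on an eigenbasis of T_r are kept; divided by the
    square roots of the eigenvalues they extend to a linear isometry, onto Kr by [cc_inj]. *)
Lemma Kr_iso_basis r (g : nat -> Hr r) (t : nat -> R) : is_onb g ->
  (forall n, gT r (g n) = cplx (t n) *: g n) -> (forall n, g n != 0 -> 0 < t n) ->
  exists i : Hr r -> K, [/\ bd i, forall x y, '[i x, i y] = '[x, y],
  forall h, Kr r (i h), forall v, Kr r v -> i (adj i v) = v &
  forall n, i (g n) = (cplx (Num.sqrt (t n)))^-1 *: kap (g n)].
Proof.
move=> [go gu gd] Tg tp.
have kE m n : '[kap (g m), kap (g n)] = cplx (t n) * '[g n, g m].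
  by rewrite kap_dot Tg dotZl.
have tpos n : '[g n, g n] = 1 -> 0 < t n.
  move=> g1; apply: tp; apply/eqP => g0; move: g1; rewrite g0 dot0l => /eqP.
  by rewrite eq_sym oner_eq0.
pose u n := (cplx (Num.sqrt (t n)))^-1 *: kap (g n).
have [i bi [iE iI]] : exists2 i : Hr r -> K, bd i &
    (forall n, i (g n) = u n) /\ forall x y, '[i x, i y] = '[x, y].
  apply: iso_ext gd => m n; rewrite /u dotZl dotZr kE.
  have [->|mn] := eqVneq m n; last by rewrite go // go ?mulr0 // eq_sym.
  case: (gu n) => g1; first by rewrite g1 !mulr0.
  have t0 := tpos _ g1.
  rewrite g1 mulr1 fmorphV /= cplx_conj mulrA -invfM -expr2 cplx_sqrt ?ltW //.
  by rewrite mulVf // gt_eqF // cplx_gt0.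
have iK h : Kr r (i h).
  have be : bd (ee r) := th_b _.
  have e : ee r \o i = i.
    apply: (op_ext_span _ _ gd) => [||_ [n _ <-] /=]; [exact: bd_comp|exact: bi|].
    by rewrite iE /u (lopZ be) [ee r _]kap_Kr.
  exact: (congr1 (@^~ h) e).
exists i; split=> // v kv; apply/eqP; rewrite -subr_eq0; apply/eqP; apply: (cc_inj (r := r)).
  by rewrite /Kr (lopB (f := ee r) (th_b _)) kv iK.
apply: (onb_ext gd) => n; rewrite -kap_cc.
have o : '[u n, i (adj i v) - v] = 0.
  by rewrite -iE dotBr iI (adjr _ _ bi) subrr.
case: (gu n) => g1.
  have -> : kap (g n) = 0 by apply: dot_eq0; rewrite kE g1 mulr0.
  by rewrite dot0l.
have s0 : cplx (Num.sqrt (t n)) != 0 by rewrite gt_eqF // cplx_gt0 sqrtr_gt0 tpos.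
by move/eqP: o; rewrite /u dotZl mulf_eq0 invr_eq0 (negPf s0) /= => /eqP.
Qed.

Lemma Kr_iso r : exists i : Hr r -> K, [/\ bd i, forall x y, '[i x, i y] = '[x, y],
  forall h, Kr r (i h) & forall v, Kr r v -> i (adj i v) = v].
Proof.
have [pT tT Ti _] := ghT r; have [bT posT] := pT.
have tr n : \sum_(i < n) '[gT r (onb (Hr r) i), onb (Hr r) i] <= cplx (fine (trace_pos (gT (g := G) r))).
  have pe m : (0%:E <= (complex.Re ('[gT r (onb (Hr r) m), onb (Hr r) m] : C))%:E :> \bar R)%E.
    by rewrite lee_fin; have [] := Cx_real (posT (onb (Hr r) m)).
  have tfin : trace_pos (gT (g := G) r) \is a fin_num.
    by rewrite ge0_fin_numE // /trace_pos; apply: nneseries_ge0.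
  have -> : \sum_(i < n) '[gT r (onb (Hr r) i), onb (Hr r) i] =
     cplx (\sum_(i < n) complex.Re ('[gT r (onb (Hr r) i), onb (Hr r) i] : C)).
    by rewrite cplx_sum; apply: eq_bigr => i _; have [] := Cx_real (posT (onb (Hr r) i)).
  rewrite cplx_le -lee_fin fineK // -sumEFin.
  have := @nneseries_lim_ge R (fun i => (complex.Re ('[gT r (onb (Hr r) i), onb (Hr r) i] : C))%:E) xpredT 0 n.
  by rewrite big_mkord; apply=> i _ _; exact: pe.
have hB x : (idfun : Hr r -> Hr r) (gT r x) = gT r (idfun x) by [].
have [g [[go gu gd] [t [b hg]]]] := eigenbasis pT Ti tr (pos_id (Hr r)) hB.
have Tg n := (hg n).1.
have [|i [h1 h2 h3 h4 _]] := Kr_iso_basis (And3 go gu gd) Tg; last by exists i.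
move=> n g0; have g1 : '[g n, g n] = 1 by case: (gu n) => // /dot_eq0 e; rewrite e eqxx in g0.
rewrite -cplx_gt0 lt_neqAle; apply/andP; split.
  by apply/eqP => t0; case/eqP: g0; apply: (Ti); rewrite Tg -t0 scale0r (lop0 bT).
by have := posT (g n); rewrite Tg dotZl g1 mulr1.
Qed.

Lemma amp_isometry (L1 L2 L3 : hilbert R) (j : L2 -> L3) : bd j -> (forall x y, '[j x, j y] = '[x, y]) ->
  exists J : L1 ⊗ L2 -> L1 ⊗ L3, [/\ bd J, J = ampr L1 j, forall z, adj J (J z) = z &
    forall z, J (adj J z) = ampr L1 (j \o adj j) z].
Proof.
move=> bj Ij; have baj := bd_adj bj; have b1 := bd_id L1; exists (ampr L1 j).
split=> [||z|z] //; first exact: bd_tensor.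
  rewrite (adj_tensor b1 bj) adj_idfun; have e : ampr L1 (adj j) \o ampr L1 j = (fun z => z).
    rewrite (tensor_comp b1 baj b1 bj) (_ : adj j \o j = idfun); first exact: tensor_id.
    by apply: funext => x; exact: iso_adjK.
  exact: (congr1 (@^~ z) e).
rewrite (adj_tensor b1 bj) adj_idfun.
exact: (congr1 (@^~ z) (tensor_comp b1 bj b1 baj)).
Qed.

(** For some h the operator S = (th h)^* j is nonzero. S S^* lies in the corner of the dual algebra
    under the minimal projection [ee r], so it is a positive multiple of it; normalised, S^* is an
    isometry of Kr, identified with H_r, into L. Its range reduces the corepresentation and is
    therefore all of L. *)
Lemma irreducible_dim (L : hilbert R) (g0 : H ⊗ L -> K ⊗ L) :
  (forall r, fin_basis (Hr r)) -> irreducible_corep N DN g0 -> finite_dim L.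
Proof.
move=> hfin [hc [w0 w00] irr]; have [gt ug gD] := hc; have bg := un_bd ug.
have [v [w jv]] : exists v w, vslice2 g0 w v xi <> 0.
  apply: contrapT => h; case/eqP: w00; apply: dot_eq0.
  have z v w : vslice2 g0 w v = 0.
    apply: Nsep; first exact: mm_N hc _ _.
    by apply: contrapT => h'; apply: h; exists v, w.
  have e : g0 (xi ⊗v w0) = 0.
    apply: tdot_ext => a b; rewrite -vslice2E z zfunE.
    by rewrite !dot0l.
  have := un_dot ug (xi ⊗v w0) (xi ⊗v w0); rewrite e dot0l pure_dot xi1 mul1r.
  by move=> <-.
have [j [bj jE h1 h2]] := coef_intertwines hc v.
have jw : j w <> 0 by rewrite jE.
have sgj (x : K -> K) : Nhat x -> forall a c w, x (sg a c w) = sg a c (x w) by move=> /NhatP[].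
have Njj : Nhat (j \o adj j).
  by apply/NhatP; split=> [|a c x /=]; [auto|rewrite h2 h1].
have [r [h hS]] : exists r (h : Hr r), adj (th h) \o j <> 0.
  apply: contrapT => hn; apply: jw.
  have z r (h : Hr r) x : adj (th h) (j x) = 0.
    apply: contrapT => hx; apply: hn; exists r, h => e; apply: hx.
    exact: (congr1 (@^~ x) e).
  have e0 : j \o adj j = 0.
    apply: (pi_inj Njj Nhat_0) => r; rewrite pi_0.
    apply: funext => x; apply: dot_ext => y; rewrite dot0l.
    have e : adj (th y) \o (j \o adj j) = 0 by apply: funext => t /=; exact: z.
    have := congr1 (fun y : K -> K => pi r y x) e; rewrite pir_mul //; last exact: Nhat_adj.
    rewrite pi_0 pi_adj // th_pi /rk adj_rank1 /= => /(congr1 (fun t => '[t, eps r] : C)).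
    by rewrite dotZl eps1 mulr1 dot0l.
  have aj x : adj j x = 0.
    apply: dot_eq0; rewrite (adjl _ _ bj) -[j _]/((j \o adj j) x) e0.
    by rewrite zfunE dot0r.
  by apply: dot_eq0; rewrite (adjr _ _ bj) aj dot0r.
pose S := adj (th h) \o j; have bth := th_b h; have bth' := bd_adj bth.
have bS : bd S by exact: bd_comp.
have aS : adj S = adj j \o th h by rewrite /S adj_comp // adjK.
have Nth := th_N h; have Nth' := Nhat_adj Nth.
have S1 a c x : S (vslice1 g0 a c x) = sg a c (S x).
  by rewrite /S /= -h1 (sgj _ Nth').
have S2 a c x : adj S (sg a c x) = vslice1 g0 a c (adj S x).
  by rewrite aS /= (sgj _ Nth) h2.
have NSS : Nhat (S \o adj S).
  have -> : S \o adj S = adj (th h) \o (j \o adj j) \o th h by rewrite aS.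
  by apply: Nhat_comp => //; exact: Nhat_comp.
have [|x|k hk] := corner_scalar (r := r) NSS.
- by move=> x; exact: adj_th_ee.
- by rewrite aS /= th_ee.
have kE : k = '[adj S (uu r), adj S (uu r)].
  rewrite -(adjr _ _ bS) -[S _]/((S \o adj S) _) hk ee_uu dotZl uu1.
  by rewrite mulr1.
have k0 : 0 < k.
  rewrite lt_neqAle kE dot_ge0 andbT -kE eq_sym; apply/eqP => k0; apply: hS.
  have z x : adj S x = 0.
    apply: dot_eq0; rewrite (adjl _ _ bS) -[S _]/((S \o adj S) x) hk k0 scale0r.
    exact: dot0r.
  have z2 x : S x = 0 by apply: dot_eq0; rewrite (adjr _ _ bS) z dot0r.
  exact: (funext z2).
have [l l0 el] := Cx_gt0 k0.
have [i [bi iI iK iV]] := Kr_iso r.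
pose s := (cplx (Num.sqrt l))^-1; pose j' := s *: (adj S \o i).
have bj' : bd j' by apply: bd_scale; apply: bd_comp; auto.
have ss1 : s * s * k = 1.
  rewrite el -[cplx l]cplx_sqrt ?ltW // /s -invfM -expr2 mulVf // gt_eqF // exprn_gt0 //.
  by rewrite cplx_gt0 sqrtr_gt0.
have sc : s^* = s by rewrite /s fmorphV /= cplx_conj.
have j'E x : j' x = s *: adj S (i x) by [].
have j'I x y : '[j' x, j' y] = '[x, y].
  rewrite !j'E dotZl dotZr sc mulrA -(adjr _ _ bS) -[S _]/((S \o adj S) _) hk.
  by rewrite (iK x) dotZl iI mulrA ss1 mul1r.
have aj'E x : adj j' x = s *: adj i (S x).
  by apply: dot_ext => y; rewrite (adjl _ _ bj') j'E dotZr dotZl sc (adjl _ _ bi) -(adjr _ _ bS).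
pose p x := j' (adj j' x).
have KS x : Kr r (S x) by exact: adj_th_ee.
have pE x : p x = s * s *: adj S (S x).
  rewrite /p j'E aj'E (lopZ bi) iV ?(lopZ (bd_adj bS)) ?scalerA //.
have bp : bd p by exact: bd_comp bj' (bd_adj bj').
have pg a c x : p (vslice1 g0 a c x) = vslice1 g0 a c (p x).
  by rewrite !pE S1 S2 (lopZ (bd_vslice1 _ _ bg)).
have psa : adj p = p.
  have -> : p = j' \o adj j' by [].
  by rewrite adj_comp ?adjK //; exact: bd_adj.
have pj x : p (j' x) = j' x by rewrite /p iso_adjK.
have bHi := bd_id H; have bKi := bd_id K.
have G1 z : ampr K p (g0 z) = g0 (ampr H p z).
  have b1 : bd (ampr K p) by exact: bd_tensor.
  have b2 : bd (ampr H p) by exact: bd_tensor.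
  have e : ampr K p \o g0 = g0 \o ampr H p.
    apply: top_ext; [exact: bd_comp|exact: bd_comp|] => a x c y /=.
    rewrite (adjr _ _ b1) (adj_tensor bKi bp) adj_idfun psa !tensorE //.
    by rewrite -!vslice1E -pg [RHS](adjr _ _ bp) psa.
  exact: (congr1 (@^~ z) e).
have [jH [bjH jHE jHK pH]] := amp_isometry H bj' j'I.
have [jK [bjK jKE jKK pK]] := amp_isometry K bj' j'I.
have G2 z : jK (adj jK (g0 z)) = g0 (jH (adj jH z)) by rewrite pK pH G1.
pose G' := adj jK \o g0 \o jH.
have bG' : bd G' by do 2![apply: bd_comp => //]; exact: bd_adj.
have int : jK \o G' = g0 \o jH.
  by apply: funext => z; rewrite /G' /= G2 jHK.
have uG' : unitary_op G'.
  have aG' : adj G' = adj jH \o adj g0 \o jK.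
    by rewrite /G' adj_comp3 ?adjK //; exact: bd_adj.
  split=> //; apply: funext => z; rewrite aG' /=.
    by rewrite -[jK _]/((jK \o G') z) int /= (unK ug) jHK.
  by rewrite /G' /= -G2 (unVK ug) jKK jKK.
have tG' : vn_tensor N (@bounded_op _ (Hr r) (Hr r)) G'.
  apply: (sw_conj bjH bjK _ gt) => y [n [c [x [hx ->]]]].
  rewrite adj_sum_comp //; exists n, c, (fun i => adj jK \o x i \o jH); split=> // i0.
  have [a [b [Na bb ->]]] := hx i0; exists a, (adj j' \o b \o j'); split=> //.
    exact: bd_comp (bd_comp (bd_adj bj') bb) bj'.
  have ba := Nb Na; have baj := bd_adj bj'.
  rewrite jHE jKE (adj_tensor bKi bj') adj_idfun.
  rewrite (tensor_comp bKi baj ba bb) (tensor_comp ba (bd_comp baj bb) bHi bj').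
  by [].
have isoj : isometry_op j' by split.
have := irr _ j' G' isoj uG' tG'; rewrite -jHE -jKE int => /(_ erefl)[e0|eT].
  have [x x0] := Hr_neq0 r; case/eqP: x0; apply: dot_eq0; rewrite -j'I.
  have : range j' (j' x) by exists x.
  by rewrite e0 => ->; rewrite dot0l.
have [d [g [_ hg]]] := hfin r; exists d, (fun i => j' (g i)).
apply/seteqP; split=> // y _; have : range j' y by rewrite eT.
move=> [x _ <-]; exists d, (fun i => '[x, g i]), (fun i => j' (g i)); split.
  by move=> i0; exists i0.
rewrite {1}(hg x) (lop_sum bj'); apply: eq_bigr => i0 _; exact: (lopZ bj').
Qed.

End Irreducible.

(** * The dual algebra as a von Neumann algebra, and resolvents affiliated with it *)

Section DualAlgebra.

Lemma Nhat_vna : is_vna Nhat.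
Proof.
split.
- by split; [exact: Nhat_b|exact: Nhat_1].
- by split; [exact: Nhat_0|exact: Nhat_lin].
- exact: Nhat_comp.
- exact: Nhat_adj.
move=> x hx; have bx := sw_bd hx; apply/NhatP; split=> // a c w; apply: dot_ext => v.
apply: contrapT => h; set E := '[x (sg a c w), v] in h; set E' := '[_, v] in h.
have d0 : 0 < `|E - E'| / 2%:R by rewrite divr_gt0 ?ltr0n // normr_gt0 subr_eq0; apply/eqP.
pose w1 (y : K -> K) : C := '[y (sg a c w), v]; pose w2 (y : K -> K) : C := '[y w, adj (sg a c) v].
have p1 : predual w1 by exact: pd_vec.
have p2 : predual w2 by exact: pd_vec.
have [y [hy /(_ ord0) h1 h2]] := sw_close_two (n := 1) hx (fun _ => p1) p2 d0.
have e1 : w1 y = w2 y.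
  by rewrite /w1 /w2 -adjr //; have [_ ->] := (NhatP y).1 hy.
have e2 : w2 x = E' by rewrite /w2 -adjr.
have : `|E - E'| < `|E - E'|; last by rewrite ltxx.
rewrite [X in _ < X]splitr -{1}e2 (_ : E - w2 x = (w1 x - w1 y) + (w2 y - w2 x)); last first.
  by rewrite e1 addrA subrK.
by apply: le_lt_trans (ler_normD _ _) _; apply: ltrD; rewrite // distrC.
Qed.

Lemma Nhat_adj_sg x a c w : Nhat x -> x (adj (sg a c) w) = adj (sg a c) (x w).
Proof.
move=> hx; have bx := Nhat_b hx; apply: dot_ext => v.
have [_ h] := (NhatP _).1 (Nhat_adj hx).
by rewrite (adjr _ _ bx) adjl // -h adjl // (adjr _ _ bx).
Qed.

(** The projection onto the closed span commutes with the slices [sg], so it lies in the dual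
    algebra; it acts as the identity in every block. *)
Lemma th_total : dense (span [set v | exists r (h : Hr r) w, v = th h w]).
Proof.
set S := span _.
have hS : lin_closed S.
  split=> [|c x y Sx Sy]; first exact: span0.
  by apply: spanD => //; exact: spanZ.
have [p bp [ps po pz pd]] := projection hS; apply: pd => x.
have s1 a c s : S s -> S (sg a c s).
  move=> Ss; apply: (span_ind (Q := fun s => S (sg a c s)) _ _ Ss) => [|k _ y [r [h [w ->]]] hy].
    by rewrite (lop0 (bd_sg _ _)); exact: span0.
  rewrite (lopP (bd_sg _ _)); apply: hS.2 => //; apply: span_gen; exists r, h, (sg a c w).
  by have [_ ->] := (NhatP _).1 (th_N h).
have s2 a c s : S s -> S (adj (sg a c) s).
  have ba : bd (adj (sg a c)) by exact: bd_adj.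
  move=> Ss; apply: (span_ind (Q := fun s => S (adj (sg a c) s)) _ _ Ss) => [|k _ y [r [h [w ->]]] hy].
    by rewrite (lop0 ba); exact: span0.
  rewrite (lopP ba); apply: hS.2 => //; apply: span_gen; exists r, h, (adj (sg a c) w).
  by rewrite Nhat_adj_sg.
have pK y : (forall z, (forall s, S s -> '[s, z] = 0) -> '[y, z] = 0) -> p y = y.
  move=> hy; apply/eqP; rewrite eq_sym -subr_eq0; apply/eqP; apply: dot_eq0.
  have hz s : S s -> '[s, y - p y] = 0.
    by move=> Ss; rewrite dotC dotBl po // subrr conjC0.
  by rewrite dotBl hy // pz // subrr.
have p0 y : (forall s, S s -> '[s, y] = 0) -> p y = 0.
  move=> hy; apply: dot_eq0; apply: pz => s Ss.
  by rewrite dotC po // -dotC hy.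
have pN : Nhat p.
  apply/NhatP; split=> // a c w.
  have e : sg a c w = sg a c (p w) + sg a c (w - p w).
    by rewrite -(lopD (bd_sg _ _)) addrC subrK.
  rewrite {1}e (lopD bp) pK; last first.
    move=> z hz; rewrite adjr //; apply: pz => s Ss; rewrite -adjr //.
    by apply: hz; exact: s1.
  rewrite (p0 (sg a c (w - p w))) ?addr0 // => s Ss.
  rewrite -adjl // dotC dotBl po ?subrr ?conjC0 //.
  exact: s2.
have E : p = idfun.
  apply: (pi_inj pN Nhat_1) => r; rewrite pi_1; apply: funext => h /=.
  have h1 : p (th h (uu r)) = th h (uu r) by apply: ps; apply: span_gen; exists r, h, (uu r).
  move: h1; rewrite x_th // => h1.
  apply/eqP; rewrite -subr_eq0; apply/eqP; apply: dot_eq0.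
  rewrite -[LHS]mulr1 -(uu1 r) -th_dot; last exact: Kr_uu.
  have -> : th (pi r p h - h) (uu r) = 0.
    by rewrite addrC -scaleN1r th_lin h1 scaleN1r addNr.
  by rewrite dot0l.
by rewrite E.
Qed.

(** Affiliation speaks of unitaries in the commutant only. [commute_of_unitaries] passes from them
    to the self-adjoint and skew parts of each [sg], and commuting with these is membership in the
    dual algebra. *)
Lemma affiliated_resolvent (delta : uop K) (e : R) : positive_selfadjoint delta ->
  affiliated Nhat delta -> 0 < e -> Nhat (shift_inv delta e).
Proof.
move=> pd ad e0; have bX := bd_shift_inv pd e0; set X := shift_inv delta e in bX *.
have com (a : K -> K) : bd a -> adj a = a ->
    (forall x, Nhat x -> forall v, x (a v) = a (x v)) -> forall v, X (a v) = a (X v).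
  move=> ba sa ha; apply: (commute_of_unitaries ba sa bX) => u uu cu v.
  have [dx ex] := shift_invP pd e0 v; have bu := un_bd uu.
  have [|d1 d2] := ad u uu _ _ dx.
    by move=> x hx; apply: funext => w /=; rewrite (cu x (Nhat_b hx) (ha x hx)).
  by rewrite -[in LHS]ex (lopD bu) (lopZ bu) -d2 /X shift_invK.
apply/NhatP; split=> // a c v.
have bs := bd_sg a c : bd (sg a c); have bs' := bd_adj bs.
have hs x : Nhat x -> forall v, x (sg a c v) = sg a c (x v).
  by move=> hx; have [_ h] := (NhatP _).1 hx.
have h1 := com (sg a c + adj (sg a c)) (bd_add bs bs').
have h2 := com ('i *: (sg a c - adj (sg a c))) (bd_scale _ (bd_sub bs bs')).
have {}h1 : X (sg a c v + adj (sg a c) v) = sg a c (X v) + adj (sg a c) (X v).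
  apply: h1 => [|x hx w]; first by rewrite adj_add // adjK // addrC.
  by rewrite -[(_ + _) w]/(_ w + _ w) (lopD (Nhat_b hx)) hs // Nhat_adj_sg.
have {}h2 : X ('i *: (sg a c v - adj (sg a c) v)) = 'i *: (sg a c (X v) - adj (sg a c) (X v)).
  apply: h2 => [|x hx w].
    by rewrite adj_scale ?adj_sub // ?adjK //; [rewrite conjCi scaleNr -scalerN opprB|exact: bd_sub].
  rewrite scombE (lopZ (Nhat_b hx)) -[(_ - _) w]/(_ w - _ w) (lopB (Nhat_b hx)) hs //.
  by rewrite Nhat_adj_sg.
have i0 : ('i : C) != 0 by exact: neq0Ci.
move: h2; rewrite (lopZ bX) => /(scalerI i0); rewrite (lopB bX); move: h1; rewrite (lopD bX).
have f2 : (2%:R : C) != 0 by rewrite pnatr_eq0.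
move=> h1 h2; apply: (scalerI f2).
rewrite !scaler_nat !mulr2n.
transitivity ((X (sg a c v) + X (adj (sg a c) v)) + (X (sg a c v) - X (adj (sg a c) v))).
  by rewrite addrACA subrr addr0.
by rewrite h1 h2 addrACA subrr addr0.
Qed.

(** The hypotheses describe delta through its resolvent at 1, while [derived_weight] needs the
    bounded parts for all e > 0. *)
Lemma resolvent_shift (delta : uop K) (e : R) v : positive_selfadjoint delta -> 0 < e ->
  shift_inv delta e (cplx (1 - e) *: shift_inv delta 1 v + cplx e *: v) = shift_inv delta 1 v.
Proof.
move=> pd e0; have [dx ex] := shift_invP pd ltr01 v; set x := shift_inv delta 1 v in dx ex *.
rewrite -[RHS](shift_invK pd e0 dx); congr shift_inv; rewrite -[in LHS]ex cplx1 scale1r.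
by rewrite scalerDr addrA -scalerDl -cplxD subrK cplx1 scale1r.
Qed.

End DualAlgebra.

(** * Joint eigenvalues of T_r and A_r *)

Section BlockEigen.

Lemma T_trace r : exists c : C, forall n, \sum_(i < n) '[T r (onb (Hr r) i), onb (Hr r) i] <= c.
Proof.
have [pT tT _ _] := ghT r; have [bT posT] := pT.
exists (cplx (fine (trace_pos (T r)))) => n.
have tfin : trace_pos (T r) \is a fin_num.
  rewrite ge0_fin_numE //; apply: le_trans (trace_pos_partial 0 pT).
  by rewrite big_ord0.
have := trace_pos_partial n pT; rewrite -[X in (_ <= X)%E](fineK tfin) lee_fin -cplx_le cplx_sum.
rewrite (eq_bigr (fun i : 'I_n => '[T r (onb (Hr r) i), onb (Hr r) i] : C)) // => i _.
by have [] := Cx_real (posT (onb (Hr r) i)).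
Qed.

(** The resolvent B is injective and A is nonsingular, so eigenvalues of B lie strictly between 0
    and 1 and have the form 1 / (1 + a) with a > 0. At the zero vectors padding the basis, t and a
    are set to 1. *)
Lemma eigen_data (r : gI G) (B : Hr r -> Hr r) (A : uop (Hr r)) : positive_selfadjoint A ->
  nonsingular A -> B = shift_inv A 1 -> B \o T r = T r \o B ->
  exists (g : nat -> Hr r) (t a : nat -> R), is_onb g /\ forall n, [/\ 0 < t n, 0 < a n,
    T r (g n) = cplx (t n) *: g n & B (g n) = cplx (1 + a n)^-1 *: g n].
Proof.
move=> pA nA BE BT; have [[d0 dL] aL _ _ _] := pA.
have pB : pos B by rewrite BE; exact: pos_shift_inv.
have [c tr] := T_trace r.
have [g [hg [t [b hb]]]] := eigenbasis (T_pos r) (T_inj (r := r)) tr pB (fun x => congr1 (@^~ x) BT).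
have [go gu gd] := hg.
have pos n : g n != 0 -> 0 < t n /\ 0 < b n < 1.
  move=> g0; have g1 : '[g n, g n] = 1.
    by case: (gu n) => // /dot_eq0 e; rewrite e eqxx in g0.
  have [Tg Bg] := hb n; split.
    rewrite -cplx_gt0 lt_neqAle; apply/andP; split; last first.
      by have := (T_pos r).2 (g n); rewrite Tg dotZl g1 mulr1.
    apply/eqP => t0; case/eqP: g0; apply: (T_inj (r := r)).
    by rewrite Tg -t0 scale0r (lop0 (T_b r)).
  have [dx ex] := shift_invP pA ltr01 (g n); rewrite -BE Bg cplx1 scale1r in dx ex.
  have a0 : uact A 0 = 0.
    by have := aL 1 0 0 d0 d0; rewrite !scale1r addr0 => /eqP; rewrite -subr_eq0 opprD addrA subrr sub0r oppr_eq0 => /eqP.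
  have b0 : 0 <= b n by rewrite -(@cplx_ge0 R); have := pB.2 (g n); rewrite Bg dotZl g1 mulr1.
  have b1 : b n <= 1.
    have := (pos_bounded_part pA ltr01).2 (g n).
    rewrite -[bounded_part _ _ _]scale1r -cplx1 bounded_partE // -BE Bg dotBl dotZl g1 mulr1.
    by rewrite -cplx1 -cplxB cplx_ge0 subr_ge0.
  apply/andP; split; rewrite lt_neqAle ?b0 ?b1 andbT; apply/eqP => e.
    by case/eqP: g0; rewrite -ex -e cplx0 scale0r a0 addr0.
  rewrite e cplx1 scale1r in dx ex.
  by case/eqP: g0; apply: (nA) => //; apply: (addrI (g n)); rewrite addr0.
exists g, (fun n => if g n == 0 then 1 else t n), (fun n => if g n == 0 then 1 else (b n)^-1 - 1).
split=> // n; case: eqP => [g0|/eqP g0].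
  by rewrite ltr01 g0 !scaler0 (lop0 (T_b r)) (lop0 (pos_bd pB)).
have [t0 /andP[b0 b1]] := pos n g0; have [Tg Bg] := hb n.
by split=> //; rewrite ?subr_gt0 ?invf_gt1 // addrC subrK invrK.
Qed.

End BlockEigen.

(** * Values of psi: exact on rank one elements, bounded below in general *)

Section PsiValues.

Variables (g : forall r, nat -> Hr r) (t a : gI G -> nat -> R).
Hypotheses (hg : forall r, is_onb (g r)) (t0 : forall r n, 0 < t r n) (a0 : forall r n, 0 < a r n).
Hypothesis Tg : forall r n, T r (g r n) = cplx (t r n) *: g r n.

Lemma block_op (d : gI G -> nat -> R) (c : R) : (forall r n, 0 <= d r n <= c) ->
  exists z : K -> K, [/\ Nhat z, adj z = z, forall r n, pi r z (g r n) = cplx (d r n) *: g r n &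
    forall r n w, z (th (g r n) w) = cplx (d r n) *: th (g r n) w].
Proof.
move=> hd; have [_ _ _ ex _] := ghpi G.
pose P r (x : Hr r -> Hr r) := [/\ pos x, forall n, x (g r n) = cplx (d r n) *: g r n &
  forall v, `|x v| <= cplx c * `|v|].
pose y r := xget 0 [set x | P r x].
have yP r : P r (y r).
  have [x px [h1 h2]] := diag_op (hg r) (hd r).
  by rewrite /y; case: xgetP => [z -> //|/(_ x)[]].
have [|z Nz zE] := ex y.
  by exists (cplx c) => r; have [p1 p2 p3] := yP r; split; [exact: pos_bd|].
have E r n : pi r z (g r n) = cplx (d r n) *: g r n by rewrite zE; have [_ ->] := yP r.
exists z; split=> // [|r n w].
  apply: (pi_inj (Nhat_adj Nz) Nz) => r; rewrite pi_adj // (_ : pi r z = y r); last exact: zE.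
  by have [p1 _ _] := yP r; exact: pos_adj.
by rewrite x_th // E thZ.
Qed.

Lemma bd_th_l r w : bd (fun h : Hr r => th h w).
Proof.
have be : Kr r (ee r w) by exact: ee_ee.
apply: (@bd_intro _ _ _ _ `|ee r w|) => [c x y|h]; first exact: th_lin.
apply: sqr_le; rewrite ?mulr_ge0 // -hdot_norm -th_ee th_dot // exprMn -!hdot_norm mulrC.
exact: lexx.
Qed.

Lemma th_basis_ext (L : hilbert R) (x y : K -> L) : bd x -> bd y ->
  (forall r n w, x (th (g r n) w) = y (th (g r n) w)) -> x = y.
Proof.
move=> bx by_ h; apply: (op_ext_span bx by_ th_total) => _ [r [k [w ->]]].
have [_ _ gd] := hg r; have bl := bd_th_l r w.
have E : x \o (fun h : Hr r => th h w) = y \o (fun h : Hr r => th h w).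
  by apply: (op_ext_span (bd_comp bx bl) (bd_comp by_ bl) gd) => _ [n _ <-] /=.
exact: (congr1 (@^~ k) E).
Qed.

(** The bounded part of T_r^-1 at e is (T_r + e)^-1, so this is (T_r + e)^(-1/2). *)
Definition sT (r : gI G) (e : R) := sqrt_op (bounded_part (uop_inv (T r)) e).
Arguments sT : clear implicits.

Lemma sTP r e : 0 < e -> pos (sT r e) /\
  forall n, sT r e (g r n) = cplx (Num.sqrt (t r n + e)^-1) *: g r n.
Proof.
move=> e0; have bT := T_b r; have te n : 0 < t r n + e by rewrite addr_gt0.
have hd n : 0 <= (t r n + e)^-1 <= e^-1.
  by rewrite invr_ge0 ltW //= lef_pV2 ?posrE // lerDr ltW.
have [b0 pb0 [b0g _]] := diag_op (hg r) hd; have bb0 := pos_bd pb0.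
have [_ _ gd] := hg r.
have E1 : T r \o b0 + cplx e *: b0 = idfun.
  apply: (op_ext_span _ (bd_id _) gd) => [|_ [n _ <-]].
    by apply: bd_add; [exact: bd_comp|exact: bd_scale].
  rewrite -[LHS]/(T r (b0 (g r n)) + cplx e *: b0 (g r n)) b0g (lopZ bT) Tg !scalerA -scalerDl.
  by rewrite -!cplxM -cplxD [e * _]mulrC -mulrDr mulVf ?gt_eqF // cplx1 scale1r.
have E v : T r (b0 v) + cplx e *: b0 v = v by exact: (congr1 (@^~ v) E1).
have ux s : uact (uop_inv (T r)) (T r s) = s.
  rewrite /=; case: xgetP => [y _ /(T_inj (r := r)) //|/(_ s)[]//].
have bE : bounded_part (uop_inv (T r)) e = b0.
  apply: funext => v; rewrite -[LHS]/(uact (uop_inv (T r)) (shift_inv (uop_inv (T r)) e v)).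
  have hx : let x := shift_inv (uop_inv (T r)) e v in
      udom (uop_inv (T r)) x /\ x + cplx e *: uact (uop_inv (T r)) x = v.
    rewrite /shift_inv; case: xgetP => [x -> //|/(_ (T r (b0 v)))[]].
    by split; [exists (b0 v)|rewrite ux].
  move: hx => /= [[s _ <-]]; rewrite -[xget _ _]/(uact (uop_inv (T r)) (T r s)) ux => h.
  apply/eqP; rewrite -subr_eq0; apply/eqP; set d := _ - _.
  have : T r d + cplx e *: d = 0.
    by rewrite /d (lopB bT) scalerBr addrACA -opprD h E subrr.
  move=> hd0; apply: dot_eq0; apply: le_anti; rewrite dot_ge0 andbT.
  have ce : 0 < cplx e :> C by rewrite cplx_gt0.
  rewrite -(pmulr_rle0 _ ce) -dotZl -[_ *: d](addKr (T r d)) hd0 addr0 dotNl oppr_le0.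
  exact: (T_pos r).2.
rewrite /sT bE; exact: (sqrt_op_diag (hg r) bb0 hd).
Qed.

Variable delta : uop K.
Hypotheses (pd : positive_selfadjoint delta) (ad : affiliated Nhat delta).
Hypothesis Sg : forall r n, pi r (shift_inv delta 1) (g r n) = cplx (1 + a r n)^-1 *: g r n.

Definition yD (e : R) := sqrt_op (bounded_part delta e).

Lemma Nhat_affine (k l : C) x : Nhat x -> Nhat (k *: x + l *: idfun).
Proof. by move=> Nx; apply: Nhat_lin => //; apply: (QZ Nhat_vna); exact: Nhat_1. Qed.

Lemma pi_affine r (k l : C) x v : Nhat x -> pi r (k *: x + l *: idfun) v = k *: pi r x v + l *: v.
Proof.
move=> Nx; rewrite pi_lin //; last by apply: (QZ Nhat_vna); exact: Nhat_1.
rewrite -[l *: idfun]addr0 pi_lin; [|exact: Nhat_1|exact: Nhat_0].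
by rewrite pi_1 pi_0 addr0.
Qed.

(** The square root is identified by comparison with a diagonal competitor z \o z on the total set
    of the th (g r n) w. Here z is a diagonal fourth root, which makes z \o z visibly positive. *)
Lemma yDP e : 0 < e -> [/\ Nhat (yD e), pos (yD e) &
  forall r n, pi r (yD e) (g r n) = cplx (Num.sqrt (a r n / (1 + e * a r n))) *: g r n].
Proof.
move=> e0; pose Re := shift_inv delta e.
have NS : Nhat (shift_inv delta 1) by exact: affiliated_resolvent.
have NR : Nhat Re by exact: affiliated_resolvent.
have p1 r n : 0 < 1 + a r n by rewrite addr_gt0.
have pe r n : 0 < 1 + e * a r n by rewrite addr_gt0 // mulr_gt0.
have Rg r n : pi r Re (g r n) = cplx (1 + e * a r n)^-1 *: g r n.
  have E : Re \o (cplx (1 - e) *: shift_inv delta 1 + cplx e *: idfun) = shift_inv delta 1.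
    by apply: funext => v; exact: resolvent_shift.
  have := congr1 (fun x => pi r x (g r n)) E; rewrite pir_mul //; last exact: Nhat_affine.
  rewrite /= pi_affine // Sg scalerA -scalerDl (lopZ (pi_b r NR)) -cplxM -cplxD.
  have -> : (1 - e) / (1 + a r n) + e = (1 + e * a r n) / (1 + a r n).
    by field; rewrite gt_eqF.
  move=> h; have c0 : cplx ((1 + e * a r n) / (1 + a r n)) != 0 :> C.
    by rewrite gt_eqF // cplx_gt0 divr_gt0.
  apply: (scalerI c0); rewrite h scalerA -cplxM; congr (cplx _ *: _).
  by field; rewrite !gt_eqF.
have bE : bounded_part delta e = (- cplx e^-1) *: Re + cplx e^-1 *: idfun.
  apply: funext => v; rewrite -[RHS]/((- cplx e^-1) *: Re v + cplx e^-1 *: v).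
  rewrite scaleNr addrC -scalerBr -(bounded_partE pd e0).
  by rewrite scalerA -cplxM mulVf ?cplx1 ?scale1r // gt_eqF.
have Nb : Nhat (bounded_part delta e) by rewrite bE; exact: Nhat_affine.
have bg r n : pi r (bounded_part delta e) (g r n) = cplx (a r n / (1 + e * a r n)) *: g r n.
  rewrite bE pi_affine // Rg scalerA -scalerDl mulNr -cplxM addrC -cplxB; congr (cplx _ *: _).
  by field; rewrite !gt_eqF.
have [z [Nz sz zg zt]] : exists z : K -> K, [/\ Nhat z, adj z = z,
    forall r n, pi r z (g r n) = cplx (Num.sqrt (Num.sqrt (a r n / (1 + e * a r n)))) *: g r n &
    forall r n w, z (th (g r n) w) = cplx (Num.sqrt (Num.sqrt (a r n / (1 + e * a r n)))) *: th (g r n) w].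
  apply: (block_op (c := Num.sqrt (Num.sqrt e^-1))) => r n; rewrite sqrtr_ge0 /= !ler_wsqrtr //.
  rewrite ler_pdivrMr // mulrDr mulr1 mulrA mulVf ?gt_eqF // mul1r lerDr invr_ge0 ltW //.
have q0 r n : 0 <= a r n / (1 + e * a r n) by rewrite divr_ge0 // ltW.
have bz := Nhat_b Nz.
have py : pos (z \o z).
  by split=> [|v]; [exact: bd_comp|rewrite /= -{1}sz adjl].
have yt r n w : (z \o z) (th (g r n) w) = cplx (Num.sqrt (a r n / (1 + e * a r n))) *: th (g r n) w.
  by rewrite /= zt (lopZ bz) zt scalerA -cplxM -expr2 sqr_sqrtr // sqrtr_ge0.
have bth r n w : bounded_part delta e (th (g r n) w) = cplx (a r n / (1 + e * a r n)) *: th (g r n) w.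
  by rewrite x_th // bg thZ.
have [pS SS] : pos (yD e) /\ yD e \o yD e = bounded_part delta e.
  rewrite /yD /sqrt_op; case: xgetP => [y -> //|/(_ (z \o z))[]]; split=> //.
  have by_ := pos_bd py; apply: th_basis_ext (bd_comp by_ by_) (Nhat_b Nb) _ => r n w.
  rewrite -[LHS]/((z \o z) ((z \o z) (th (g r n) w))) yt (lopZ by_) yt scalerA -cplxM -expr2 sqr_sqrtr //.
have yE : yD e = z \o z.
  apply: th_basis_ext (pos_bd pS) (pos_bd py) _ => r n w; rewrite yt.
  apply: (sqrt_eigen pS); first exact: sqrtr_ge0.
  by rewrite -[LHS]/((yD e \o yD e) _) SS bth sqr_sqrtr.
rewrite yE; split=> //; first exact: Nhat_comp.
move=> r n; rewrite pir_mul //= zg (lopZ (pi_b r Nz)) zg scalerA -cplxM -expr2 sqr_sqrtr //.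
Qed.

Variable psi : (K -> K) -> \bar R.
Hypothesis psiE : forall x, Nhat x -> pos x ->
  psi x = derived_weight (dual_weight pi T) delta x.

Lemma nrm2Z (L : hilbert R) (c : R) (v : L) : nrm2 (cplx c *: v) = c ^+ 2 * nrm2 v.
Proof.
by apply: (@cplx_inj R); rewrite cplxM !nrm2E dotZl dotZr cplx_conj mulrA -cplxM expr2.
Qed.

Lemma conj_rk (L : hilbert R) (s : L -> L) (h : L) : pos s ->
  s \o rk h h \o s = rk (s h) (s h).
Proof.
move=> ps; apply: funext => v /=; rewrite /rk (lopZ (pos_bd ps)).
by rewrite (pos_sa _ _ ps).
Qed.

Lemma Nhat_sq_th r (h : Hr r) : Nhat (sq (th h)).
Proof. by apply: Nhat_comp => //; exact: Nhat_adj. Qed.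

Lemma pi_sq_th r (h : Hr r) : pi r (sq (th h)) = rk h h.
Proof.
rewrite /sq pir_mul //; last exact: Nhat_adj.
rewrite pi_adj // th_pi; apply: funext => v /=.
have -> : adj (rk h (eps r)) = rk (eps r) h by exact: adj_rank1.
by rewrite /rk dotZl eps1 mulr1.
Qed.

Lemma pi_sq_th0 r (h : Hr r) s : s != r -> pi s (sq (th h)) = 0.
Proof.
move=> sr; rewrite /sq pir_mul //; last exact: Nhat_adj.
have [_ _ ->] := rhoP (bd_rk h (eps r)); last exact: sr.
by apply: funext.
Qed.

Lemma pi_conj s (x y : K -> K) : Nhat x -> Nhat y ->
  pi s (y \o x \o y) = pi s y \o pi s x \o pi s y.
Proof.
move=> hx hy; have h := pir_mul s (Nhat_comp hy hx) hy; have h2 := pir_mul s hy hx.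
by rewrite h h2.
Qed.

(** The element is a rank one operator in block r: the other blocks contribute 0, and the trace of a
    rank one operator is a squared norm. *)
Lemma psi_sq_th r (h : Hr r) : psi (sq (th h)) =
  ereal_sup [set ereal_sup [set (nrm2 (sT r e' (pi r (yD e) h)))%:E | e' in [set e' : R | 0 < e']]
    | e in [set e : R | 0 < e]].
Proof.
rewrite psiE; [|exact: Nhat_sq_th|by apply: pos_sq].
rewrite /derived_weight; congr ereal_sup; apply: eq_imagel => e e0.
have [Ny py yg] := yDP e0; rewrite -[sqrt_op (bounded_part delta e)]/(yD e).
have Nx := Nhat_sq_th h.
pose X s := pi s (yD e \o sq (th h) \o yD e).
have XE s : X s = pi s (yD e) \o pi s (sq (th h)) \o pi s (yD e).
  exact: pi_conj.
pose dw s := ereal_sup [set trace_pos (sT s e' \o X s \o sT s e') | e' in [set e' : R | 0 < e']].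
have pY s : pos (pi s (yD e)).
  split=> [|v]; first exact: pi_b.
  have := py.2 (th v (uu s)); rewrite x_th // th_dot ?uu1 ?mulr1 //; exact: Kr_uu.
have dwr : dw r = ereal_sup [set (nrm2 (sT r e' (pi r (yD e) h)))%:E | e' in [set e' : R | 0 < e']].
  congr ereal_sup; apply: eq_imagel => e' e0'; have [ps _] := sTP r e0'.
  by rewrite XE pi_sq_th conj_rk // conj_rk // trace_pos_rk.
have dw0 s : s != r -> dw s = 0%E.
  move=> sr; rewrite /dw (_ : [set _ | _ in _] = [set 0%E]) ?ereal_sup1 //.
  have E e' : 0 < e' -> trace_pos (sT s e' \o X s \o sT s e') = 0%E.
    move=> e0'; have [ps _] := sTP s e0'.
    have -> : sT s e' \o X s \o sT s e' = rk 0 0.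
      rewrite XE pi_sq_th0 //; apply: funext => v /=.
      rewrite -[(0 : Hr s -> Hr s) _]/(0 : Hr s).
      by rewrite (lop0 (pi_b s Ny)) (lop0 (pos_bd ps)) /rk scaler0.
    by rewrite trace_pos_rk; congr EFin; apply: (@cplx_inj R); rewrite nrm2E dot0l.
  by apply/seteqP; split=> [_ [e' /E <- <-] //|_ ->]; exists 1; [exact: ltr01|exact: E].
have dwp : (0 <= dw r)%E.
  rewrite dwr; apply: (@le_trans _ _ (nrm2 (sT r 1 (pi r (yD e) h)))%:E); first by rewrite lee_fin nrm2_ge0.
  by apply: ereal_sup_ubound; exists 1; [exact: ltr01|].
rewrite -dwr -(esum_set1 (T := gI G) (t := r) (a := dw)) // esum_mkcond /dual_weight.
apply: eq_esum => s _; rewrite -[LHS]/(dw s).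
have [->|sr] := eqVneq s r; first by rewrite mem_set.
by rewrite memNset ?dw0 // => e1; rewrite e1 eqxx in sr.
Qed.

Lemma sT_yD e e' r n : 0 < e -> 0 < e' -> sT r e' (pi r (yD e) (g r n)) =
  cplx (Num.sqrt (a r n / (1 + e * a r n)) * Num.sqrt (t r n + e')^-1) *: g r n.
Proof.
move=> e0 e0'; have [ps sg'] := sTP r e0'; have [_ _ yg] := yDP e0.
by rewrite yg (lopZ (pos_bd ps)) sg' scalerA -cplxM.
Qed.

Lemma nrm2_g r n : nrm2 (g r n) <= 1.
Proof.
have [_ gu _] := hg r; rewrite -cplx_le nrm2E cplx1.
by case: (gu n) => ->; rewrite ?ler01 ?lexx.
Qed.

Lemma coefE e e' r n : 0 < e -> 0 < e' ->
  (Num.sqrt (a r n / (1 + e * a r n)) * Num.sqrt (t r n + e')^-1) ^+ 2 =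
  a r n / (1 + e * a r n) / (t r n + e').
Proof.
move=> e0 e0'; rewrite exprMn !sqr_sqrtr //.
  by rewrite invr_ge0 ltW // addr_gt0.
by rewrite divr_ge0 // ltW // addr_gt0 // mulr_gt0.
Qed.

Lemma psi_th_le r n : (psi (sq (th (g r n))) <= (a r n / t r n)%:E)%E.
Proof.
rewrite psi_sq_th; apply: ge_ereal_sup => _ [e e0 <-]; apply: ge_ereal_sup => _ [e' e0' <-].
rewrite lee_fin sT_yD // nrm2Z coefE //.
have h0 : 0 <= a r n / t r n by rewrite divr_ge0 // ltW.
have pe : 0 < 1 + e * a r n by rewrite addr_gt0 // mulr_gt0.
have pt : 0 < t r n + e' by rewrite addr_gt0.
apply: (@le_trans _ _ (a r n / (1 + e * a r n) / (t r n + e'))).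
  by rewrite -[leRHS]mulr1 ler_wpM2l ?nrm2_g // !divr_ge0 // ltW.
have h1 : a r n / (1 + e * a r n) <= a r n.
  by rewrite ler_pdivrMr // mulrDr mulr1 lerDl !mulr_ge0 // ltW.
have h2 : (t r n + e')^-1 <= (t r n)^-1 by rewrite lef_pV2 ?posrE // lerDl ltW.
have p1 : 0 <= a r n / (1 + e * a r n) by rewrite divr_ge0 // ltW.
have p2 : 0 <= (t r n + e')^-1 by rewrite invr_ge0 ltW.
exact: (ler_pM p1 p2 h1 h2).
Qed.

(** Everything is diagonal in g, so only |c| matters. By polarization, psi then vanishes on
    off-diagonal matrix units, as used in [EE_th]. *)
Lemma psi_th_phase r n m (c : C) : n != m -> c * c^* = 1 ->
  psi (sq (th (c *: g r m + g r n))) = psi (sq (th (1 *: g r m + g r n))).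
Proof.
move=> nm c1; rewrite !psi_sq_th; congr ereal_sup; apply: eq_imagel => e e0.
congr ereal_sup; apply: eq_imagel => e' e0'; congr EFin; apply: (@cplx_inj R).
have [Ny _ _] := yDP e0; have bY := pi_b r Ny; have [ps _] := sTP r e0'; have bs := pos_bd ps.
have [go _ _] := hg r; rewrite !nrm2E !(lopP bY) !(lopP bs) !sT_yD //.
set x := cplx _; set y := cplx _.
have g1 : '[g r m, g r n] = 0 by apply: go; rewrite eq_sym.
have g2 : '[g r n, g r m] = 0 by apply: go.
rewrite !dotDl !dotDr !dotZl !dotZr g1 g2.
rewrite !mulr0 !addr0 !add0r conjC1 !mul1r; congr (_ + _).
transitivity (c * c^* * (x * (x^* * '[g r m, g r m]))); first by ring.
by rewrite c1 mul1r.
Qed.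

Lemma psi_ge_step (L : hilbert R) (c : K -> L) (v e : R) (rs : seq (gI G)) m : bd c ->
  Nhat (adj c \o c) -> (psi (adj c \o c) <= v%:E)%E -> uniq rs -> 0 < e ->
  \sum_(r <- rs) \sum_(j < m) a r j / (1 + e * a r j) / (t r j + e) * nrm2 (c (th (g r j) (uu r))) <= v.
Proof.
move=> bc Nx hv urs e0; have [Ny py yg] := yDP e0.
have px : pos (adj c \o c) by split=> [|w]; [exact: Nhat_b|rewrite /= adjl].
set x := adj c \o c in Nx hv px.
rewrite -lee_fin -sumEFin; apply: le_trans hv; rewrite psiE //.
apply: (@le_trans _ _ (dual_weight pi T (yD e \o x \o yD e))); last first.
  by apply: ereal_sup_ubound; exists e.
apply: esum_ge; exists [set` rs]; first by split; [exact: finite_seq|].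
rewrite -fsbigop.fsbig_seq //; apply: lee_sum => r _.
apply: (@le_trans _ _ (trace_pos (sT r e \o pi r (yD e \o x \o yD e) \o sT r e))); last first.
  by apply: ereal_sup_ubound; exists e.
have [ps sg'] := sTP r e0; have bs := pos_bd ps; have bY := pi_b r Ny.
have pY : pos (pi r (yD e)).
  split=> [|w]; first exact: pi_b.
  have := py.2 (th w (uu r)); rewrite x_th // th_dot ?uu1 ?mulr1 //; exact: Kr_uu.
pose c1 (h : Hr r) := c (th h (uu r)).
have bc1 : bd c1 by apply: (bd_comp bc); exact: bd_th_l.
pose c2 := c1 \o (pi r (yD e) \o sT r e).
have bc2 : bd c2 by apply: (bd_comp bc1); exact: bd_comp.
have -> : sT r e \o pi r (yD e \o x \o yD e) \o sT r e = adj c2 \o c2.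
  rewrite (pi_conj r Nx Ny).
  apply: op_ext => u w; rewrite /= adjl // (pos_sa _ _ ps) (pos_sa _ _ pY).
  rewrite -[LHS]mulr1 -(uu1 r) -th_dot; last exact: Kr_uu.
  by rewrite -x_th // /x /= adjl.
case tr: (trace_pos _) => [s| |]; last 2 first.
- by rewrite leey.
- have p2 : pos (adj c2 \o c2) by split=> [|w]; [apply: bd_comp => //; exact: bd_adj|rewrite /= adjl].
  by have := trace_pos_partial 0 p2; rewrite tr big_ord0 leNgt ltNy0.
rewrite lee_fin -cplx_le.
have [go gu _] := hg r.
apply: le_trans (@trace_pos_family _ _ _ c2 (g r) m s bc2 go gu _); last by rewrite tr.
rewrite cplx_sum; apply: ler_sum => j _.
rewrite /c2 /= sg' (lopZ bY) yg scalerA -cplxM (lopZ bc1) -nrm2E nrm2Z mulrC.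
by rewrite (mulrC (Num.sqrt _)) coefE // mulrC.
Qed.

(** Only finitely many terms are kept, so the factors (1 + e a)(1 + e / t) of [psi_ge_step] are
    below 1 + e M0 for one constant M0, and e can tend to 0. *)
Lemma psi_ge (L : hilbert R) (c : K -> L) (v : R) (rs : seq (gI G)) m : bd c ->
  Nhat (adj c \o c) -> (psi (adj c \o c) <= v%:E)%E -> uniq rs ->
  \sum_(r <- rs) \sum_(j < m) a r j / t r j * nrm2 (c (th (g r j) (uu r))) <= v.
Proof.
move=> bc Nx hv urs; have h e := psi_ge_step m bc Nx hv urs (e := e).
pose k r j := a r j + (t r j)^-1 + a r j / t r j.
have k0 r j : 0 <= k r j by rewrite /k !addr_ge0 // ?divr_ge0 ?invr_ge0 // ltW.
pose M0 : R := \sum_(r <- rs) \sum_(j < m) k r j.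
have M00 : 0 <= M0 by apply: sumr_ge0 => r _; exact: sumr_ge0.
have kM r (j : 'I_m) : r \in rs -> k r j <= M0.
  move=> hr; rewrite /M0 (big_rem r) //= (bigD1 j) //= -addrA lerDl addr_ge0 //.
    exact: sumr_ge0.
  by apply: sumr_ge0 => s _; exact: sumr_ge0.
set S := \sum_(r <- rs) _.
have v0 : 0 <= v.
  apply: le_trans (h 1 ltr01); apply: sumr_ge0 => r _; apply: sumr_ge0 => j _.
  have [ta tt] := (ltW (a0 r j), ltW (t0 r j)).
  apply: mulr_ge0; last exact: nrm2_ge0.
  by apply: divr_ge0; [apply: divr_ge0 => //; apply: addr_ge0; rewrite ?mulr_ge0|apply: addr_ge0].
have step e : 0 < e -> e <= 1 -> S <= v * (1 + e * M0).
  move=> e0 e1; have pM : 0 < 1 + e * M0 by rewrite ltr_wpDr // mulr_ge0 // ltW.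
  rewrite -ler_pdivrMr //; apply: le_trans (h e e0); rewrite /S mulr_suml.
  rewrite big_seq [leRHS]big_seq; apply: ler_sum => r hr; rewrite mulr_suml; apply: ler_sum => j _.
  rewrite [leLHS]mulrAC; apply: ler_wpM2r; first exact: nrm2_ge0.
  have [ta tt] := (a0 r j, t0 r j).
  have -> : a r j / (1 + e * a r j) / (t r j + e) = a r j / t r j / ((1 + e * a r j) * (1 + e / t r j)).
    by field; rewrite !gt_eqF ?addr_gt0 ?mulr_gt0 ?divr_gt0.
  apply: ler_wpM2l; first by rewrite divr_ge0 // ltW.
  have p2 : 0 < (1 + e * a r j) * (1 + e / t r j) by apply: mulr_gt0; apply: addr_gt0 => //; [exact: mulr_gt0|exact: divr_gt0].
  rewrite lef_pV2 ?posrE //.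
  apply: (@le_trans _ _ (1 + e * k r j)); last by rewrite lerD2l ler_wpM2l ?kM // ltW.
  have -> : (1 + e * a r j) * (1 + e / t r j) = 1 + e * (a r j + (t r j)^-1 + e * (a r j / t r j)) by ring.
  rewrite lerD2l; apply: ler_wpM2l; first exact: ltW.
  rewrite /k lerD2l; apply: ler_piMl => //; rewrite divr_ge0 // ltW //.
apply/ler_addgt0Pr => d d0.
have q0 : 0 < v * M0 + 1 by rewrite ltr_wpDl // mulr_ge0.
have e0 : 0 < Num.min 1 (d / (v * M0 + 1)) by rewrite lt_min ltr01 divr_gt0.
apply: le_trans (step _ e0 _) _; first by rewrite ge_min lexx.
rewrite mulrDr mulr1 lerD2l mulrCA.
apply: (@le_trans _ _ (d / (v * M0 + 1) * (v * M0))).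
  by rewrite ler_wpM2r ?mulr_ge0 // ge_min lexx orbT.
by rewrite mulrAC ler_pdivrMr // mulrDr mulr1 lerDl ltW.
Qed.

End PsiValues.

(** * Invariance as a transfer of slices across the form S *)

Section Transfer.

Variables (f : (K -> K) -> \bar R) (hf : nsf_weight P f).
Local Notation S x y := (@wext _ _ P f (x \o adj y)).
Local Notation Nf := (Nf f).

Lemma Nf_lin1 (c : C) x y : Nf x -> Nf y -> Nf (c *: x + y).
Proof. exact: Nf_lin. Qed.

Lemma S_0l y : Nf y -> S 0 y = 0.
Proof.
move=> hy; have h0 := Nf_0 hf; have := S_linl hf (-1) h0 h0 hy.
by rewrite scaler0 addr0 mulN1r addNr.
Qed.
Lemma S_0r y : Nf y -> S y 0 = 0.
Proof. by move=> hy; rewrite (S_conj hf (Nf_0 hf) hy) S_0l // conjC0. Qed.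
Lemma S_Zl c x y : Nf x -> Nf y -> S (c *: x) y = c * S x y.
Proof. by move=> hx hy; have := S_linl hf c hx (Nf_0 hf) hy; rewrite addr0 S_0l // addr0. Qed.
Lemma S_Zr c x y : Nf x -> Nf y -> S y (c *: x) = c^* * S y x.
Proof. by move=> hx hy; have := S_linr hf c hx (Nf_0 hf) hy; rewrite addr0 S_0r // addr0. Qed.

(* The two one-sided invariance properties of a weight are instances of this pattern, with
   [sl] a slice of [DN] and [n] the corresponding matrix coefficients. *)
Variables (U : H ⊗ K -> K ⊗ K) (sl : (H -> K) -> H -> K -> (H -> K)) (n : K -> (H -> K)) (c : C).
Hypothesis hU : unitary_op U.
Hypothesis slN : forall z a b, Nf z -> Nf (sl z a b) /\ S (sl z a b) (sl z a b) <= '[a, a] * '[b, b] * S z z.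
Hypothesis slz : forall k z z' a b, Nf z -> Nf z' -> sl (k *: z + z') a b = k *: sl z a b + sl z' a b.
Hypothesis sla : forall k z a a' b, Nf z -> sl z (k *: a + a') b = k *: sl z a b + sl z a' b.
Hypothesis slb : forall k z a b b', Nf z -> sl z a (k *: b + b') = k^* *: sl z a b + sl z a b'.
Hypothesis slS : forall z b, Nf z -> '[b, b] = 1 ->
  series (fun k => S (sl z (onb H k) b) (sl z (onb H k) b)) @ \oo --> S z z.
Hypothesis c0 : 0 <= c.
Hypothesis nL : forall k x y, n (k *: x + y) = k^* *: n x + n y.
Hypothesis nB : forall w, Nf (n w) /\ S (n w) (n w) <= c * '[w, w].
Hypothesis nS : forall a b w, sl (n w) a b = n (lsl a (adj U (b ⊗v w))).

Let slF z a b (hz : Nf z) : Nf (sl z a b). Proof. by have [] := slN a b hz. Qed.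
Let nF w : Nf (n w). Proof. by have [] := nB w. Qed.

Lemma transfer_series z z' b : Nf z -> Nf z' -> '[b, b] = 1 ->
  series (fun k => S (sl z (onb H k) b) (sl z' (onb H k) b)) @ \oo --> S z z'.
Proof.
move=> hz hz' b1.
apply: (polar_series (D := Nf) Nf_lin1 (Bk := fun k x y => S (sl x (onb H k) b) (sl y (onb H k) b))
  (B := fun x y => S x y)) => //.
- move=> k; split=> d x y v hx hy hv; first by rewrite slz // S_linl //; exact: slF.
  by rewrite slz // S_linr //; exact: slF.
- by split=> d x y v hx hy hv; [exact: S_linl|exact: S_linr].
- by move=> x hx; exact: slS.
Qed.

Let sl0b z a : Nf z -> sl z a 0 = 0.
Proof.
move=> hz; have := slb (-1) a 0 0 hz; rewrite scaler0 addr0 => e.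
by rewrite e rmorphN /= conjC1 scaleN1r addNr.
Qed.
Let slZb z a k b : Nf z -> sl z a (k *: b) = k^* *: sl z a b.
Proof. by move=> hz; rewrite -[k *: b]addr0 slb // sl0b // addr0. Qed.

Lemma transfer_series2 z z' b b' : Nf z -> Nf z' ->
  series (fun k => S (sl z (onb H k) b) (sl z' (onb H k) b')) @ \oo --> '[b', b] * S z z'.
Proof.
move=> hz hz'.
apply: (polar_series (D := [set: K]) _ (Bk := fun k x y => S (sl z (onb H k) y) (sl z' (onb H k) x))
  (B := fun x y => '[x, y] * S z z') _ _ _ (x := b') (y := b)) => //.
- move=> k; split=> d x y v _ _ _; first by rewrite slb // S_linr ?conjCK //; exact: slF.
  by rewrite slb // S_linl //; exact: slF.
- by split=> d x y v _ _ _; rewrite ?(dotDl, dotDr) ?(dotZl, dotZr) mulrDl mulrA.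
move=> x _; have [x0|x0] := eqVneq x 0.
  rewrite x0 dot0l mul0r; apply: cvgC_ex => e e0; exists 0%N => m _.
  rewrite seriesEord /= big1 ?subrr ?normr0 // => k _.
  by rewrite !sl0b // S_0l //; exact: Nf_0.
have [x1 [k [h1 ->]]] : exists x1 k, '[x1, x1] = 1 /\ x = k *: x1.
  exists (nlz x), `|x|; rewrite nlzK; split=> //; case: (nlz_dot x) => // /dot_eq0 h.
  by move: (nlzK x); rewrite h scaler0 => e; rewrite -e eqxx in x0.
rewrite dotZl dotZr h1 mulr1.
have -> : series (fun i => S (sl z (onb H i) (k *: x1)) (sl z' (onb H i) (k *: x1))) =
  (fun m => (k * k^*) * series (fun i => S (sl z (onb H i) x1) (sl z' (onb H i) x1)) m).
  apply: funext => m; rewrite !seriesEord /= mulr_sumr; apply: eq_bigr => i _.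
  have h2 := slF (onb H i) x1 hz; have h3 := slF (onb H i) x1 hz'.
  rewrite !slZb // S_Zl // ?S_Zr ?conjCK //; last exact: Nf_scale.
  by rewrite mulrA [k^* * _]mulrC.
by apply: cvgMr; exact: transfer_series.
Qed.

Lemma transfer_vector z : Nf z ->
  exists2 a : K, (forall w, S z (n w) = '[w, a]) & '[a, a] <= c * S z z.
Proof.
move=> hz; have zz0 : 0 <= S z z := S_ge0 hf hz.
have A0 : 0 <= S z z * c by rewrite mulr_ge0.
have hb w : `|S z (n w)| ^+ 2 <= S z z * c * '[w, w].
  by apply: le_trans (S_CS hf hz (nF w)) _; rewrite -mulrA ler_wpM2l //; have [] := nB w.
have [|k x y|w|a ha] := @riesz R K (fun w => S z (n w)) (S z z * c + 1).
- by rewrite addr_ge0.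
- by rewrite nL S_linr // conjCK.
- apply: sqr_le; rewrite ?mulr_ge0 ?addr_ge0 //; apply: le_trans (hb w) _.
  by rewrite exprMn -hdot_norm ler_wpM2r //; exact: le_sqr_succ.
exists a => //; have := hb a; rewrite ha ger0_norm // expr2 => h.
have [->|a0] := eqVneq ('[a, a] : C) 0; first by rewrite mulr_ge0.
have p : 0 < '[a, a] :> C by rewrite lt_neqAle eq_sym a0 dot_ge0.
by move: h; rewrite ler_pM2r // mulrC.
Qed.

(** Let y represent w |-> S z (n w) and A_k represent the same functional for the slice of z at e_k
    and b. The polarised invariance identifies Σ e_k ⊗ A_k with U^* (b ⊗ y), and reading off its
    components gives the claim. *)
Lemma transfer z a b w : Nf z -> S (sl z a b) (n w) = S z (n (lsl b (U (a ⊗v w)))).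
Proof.
move=> hz; have [y hy _] := transfer_vector hz; have bU := un_bd hU; have baU := bd_adj bU.
have /choice[A hA] k : exists v : K, (forall w', S (sl z (onb H k) b) (n w') = '[w', v]) /\
    '[v, v] <= c * S (sl z (onb H k) b) (sl z (onb H k) b).
  by have [v h1 h2] := transfer_vector (slF (onb H k) b hz); exists v.
have [eo eu ed] := onbP H.
have hc := transfer_series2 (b := b) (b' := b) hz hz.
have [l hl] : exists l : H ⊗ K, series (fun k => onb H k ⊗v A k) @ \oo --> l.
  apply: (orth_series (c := c * ('[b, b] * S z z))) => [i j ij|m].
    by rewrite pure_dot eo // mul0r.
  apply: (@le_trans _ _ (\sum_(i < m) c * S (sl z (onb H i) b) (sl z (onb H i) b))).
    apply: ler_sum => i _; apply: le_trans (hA i).2; rewrite -hdot_norm pure_dot.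
    by case: (eu i) => ->; rewrite ?mul0r ?mul1r.
  rewrite -mulr_sumr ler_wpM2l //.
  by apply: (partial_le_lim (u := fun k => S (sl z (onb H k) b) (sl z (onb H k) b)) m _ hc) => k; apply: S_ge0 => //; exact: slF.
have lE : l = adj U (b ⊗v y).
  rewrite -[l](unK hU); congr (adj U _); apply: tdot_ext => b' w'.
  rewrite pure_dot dotC (dotC b) (dotC y) -rmorphM; congr (_^*).
  have -> : '[b' ⊗v w', U l] = '[adj U (b' ⊗v w'), l] by rewrite adjl.
  have h1 := cvg_dotr (y := adj U (b' ⊗v w')) hl.
  have h2 := transfer_series2 (b := b) (b' := b') hz (nF w'); rewrite hy in h2.
  apply: (cvg_uniq h1).
  rewrite (_ : (fun m => '[adj U (b' ⊗v w'), series (fun k => onb H k ⊗v A k) m] : C) =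
    series (fun k => S (sl z (onb H k) b) (sl (n w') (onb H k) b'))); first exact: h2.
  apply: funext => m; rewrite !seriesEord /= dot_sumr.
  by apply: eq_bigr => k _; rewrite nS (hA k).1 lslE.
have E k : S (sl z (onb H k) b) (n w) = '[onb H k ⊗v w, l].
  rewrite (hA k).1; apply: (cvg_uniq (u := fun _ : nat => '[w, A k] : C)).
    by apply: cvgC_ex => e e0; exists 0%N => m _; rewrite subrr normr0.
  have := cvg_dotr (y := onb H k ⊗v w) hl; apply: cvg_trans; apply: near_eq_cvg.
  exists k.+1 => // m /= km; rewrite seriesEord /= dot_sumr (bigD1 (Ordinal km)) //= big1 ?addr0.
    rewrite pure_dot; case: (eu k) => e1; last by rewrite e1 mul1r.
    have k0 : onb H k = 0 by exact: dot_eq0.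
    rewrite e1 mul0r -(hA k).1 k0; have -> : sl z 0 b = 0.
      by have := sla (-1) 0 0 b hz; rewrite scaler0 addr0 scaleN1r addNr.
    by rewrite S_0l.
  by move=> i ni; rewrite pure_dot eo ?mul0r // eq_sym.
have -> : S (sl z a b) (n w) = '[a ⊗v w, l].
  have cc0 : 0 <= '[b, b] * S z z * S (n w) (n w) by rewrite !mulr_ge0 // S_ge0.
  have [|k x x'|x|p hp] := @riesz R H (fun x => S (sl z x b) (n w)) ('[b, b] * S z z * S (n w) (n w) + 1).
  - by rewrite addr_ge0.
  - by rewrite sla // S_linl //; exact: slF.
  - apply: sqr_le; rewrite ?mulr_ge0 ?addr_ge0 //.
    apply: le_trans (S_CS hf (slF x b hz) (nF w)) _.
    apply: (@le_trans _ _ ('[b, b] * S z z * S (n w) (n w) * '[x, x])).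
      have [_ h] := slN x b hz.
      have n0 : 0 <= S (n w) (n w) by exact: S_ge0.
      by rewrite [leRHS]mulrAC; apply: ler_wpM2r => //; apply: le_trans h _; rewrite -mulrA [leLHS]mulrC.
    by rewrite exprMn -hdot_norm ler_wpM2r //; exact: le_sqr_succ.
  rewrite hp; have -> : p = rsl w l; last by rewrite dotC rslE -dotC.
  apply/eqP; rewrite -subr_eq0; apply/eqP; apply: (onb_ext ed) => k.
  rewrite dotBl dotC -hp E rslE -dotC; exact: subrr.
by rewrite lE -(adjr _ _ bU) hy lslE.
Qed.

End Transfer.

(** * Left and right transfer for a weight with both invariance properties *)

Section Modular.

Variables (f : (K -> K) -> \bar R) (hf : nsf_weight P f).
Hypotheses (hl : left_invariant P DP f) (hr : vector_invariant f).
Local Notation Fn := (@Fin _ _ P f).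
Local Notation FF := (@F _ _ f).
Local Notation S x y := (@wext _ _ P f (x \o adj y)).
Local Notation Nf := (Nf f).

Lemma left_slice z b : Fn z -> '[b, b] = 1 ->
  Fn (vslice1 (DP z) b b) /\ FF (vslice1 (DP z) b b) = FF z.
Proof.
move=> hz b1; have [[Pz pz] fz] := hz; have fe := hl (vec_state P b1) Pz pz fz.
rewrite (slice1_vec _ (DP_b Pz)) in fe.
by split; [split; [exact: Qp_vslice1|rewrite fe]|rewrite /F fe].
Qed.

Lemma right_slice z b : Fn z -> '[b, b] = 1 ->
  Fn (vslice2 (DP z) b b) /\ FF (vslice2 (DP z) b b) = FF z.
Proof.
move=> hz b1; have [[Pz pz] fz] := hz; have fe := hr b1 Pz pz fz.
by split; [split; [exact: Qp_vslice2|rewrite fe]|rewrite /F fe].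
Qed.

Lemma Nf_dom x z (k : R) : N x -> Fn z -> 0 <= k -> op_le (sq x) (cplx k *: z) ->
  Nf x /\ S x x <= cplx (k * FF z).
Proof.
move=> Nx hz k0 h; have [hk Fk] := Fin_scale Pvna hf k0 hz; have Qx := Qp_sq Nx.
have fx := Fin_le Pvna hf Qx hk h; have hx : Nf x := conj Nx fx.
have le := F_le Pvna hf Qx hk h.
by split=> //; rewrite (S_sq hf hx) cplx_le -Fk.
Qed.

Lemma unit_multiple (L : hilbert R) (x : L) : x != 0 ->
  exists x1 (k : C), '[x1, x1] = 1 /\ x = k *: x1.
Proof.
move=> x0; exists (nlz x), `|x|; rewrite nlzK; split=> //; case: (nlz_dot x) => // /dot_eq0 h.
by move: (nlzK x); rewrite h scaler0 => e; rewrite -e eqxx in x0.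
Qed.

(* Slices in the second variable being conjugate linear, it suffices to bound them at unit vectors. *)
Lemma slice_dom (sl : (H -> K) -> H -> K -> (H -> K)) z a b :
  (forall k b, Nf z -> sl z a (k *: b) = k^* *: sl z a b) -> Nf z ->
  (forall b, '[b, b] = 1 -> Nf (sl z a b) /\ S (sl z a b) (sl z a b) <= '[a, a] * S z z) ->
  Nf (sl z a b) /\ S (sl z a b) (sl z a b) <= '[a, a] * '[b, b] * S z z.
Proof.
move=> slZ hz h1; have zz0 := S_ge0 hf hz.
have [b0|/unit_multiple[b1 [k [hb ->]]]] := eqVneq b 0.
  have -> : sl z a b = 0 by rewrite b0 -[0 : K](scale0r 0) slZ // conjC0 scale0r.
  have h0 := Nf_0 hf; split=> //; rewrite (S_0l hf h0).
  by rewrite !mulr_ge0.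
have [h2 h3] := h1 b1 hb; rewrite slZ //.
have h4 := Nf_scale hf k^* h2; split=> //.
rewrite S_Zl // S_Zr // conjCK dotZl dotZr hb mulr1.
rewrite mulrA [k^* * k]mulrC [leRHS]mulrAC mulrC [leRHS]mulrC.
apply: le_trans (_ : k * k^* * ('[a, a] * S z z) <= _); last by apply: le_of_eq; ring.
by rewrite mulrC ler_wpM2l // mul_conjC_ge0.
Qed.

Lemma lsl_norm (L1 L2 : hilbert R) (a : L1) (z : L1 ⊗ L2) :
  '[lsl a z, lsl a z] <= '[a, a] * '[z, z] :> C.
Proof.
have [e0|e0] := eqVneq ('[lsl a z, lsl a z] : C) 0; first by rewrite e0 mulr_ge0.
have p : 0 < '[lsl a z, lsl a z] :> C by rewrite lt_neqAle eq_sym e0 dot_ge0.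
rewrite -(ler_pM2r p).
have := dot_CS2 z (a ⊗v lsl a z); rewrite -lslE ger0_norm // pure_dot expr2 => h.
by apply: le_trans h _; apply: le_of_eq; ring.
Qed.

Lemma rsl_norm (L1 L2 : hilbert R) (a : L2) (z : L1 ⊗ L2) :
  '[rsl a z, rsl a z] <= '[a, a] * '[z, z] :> C.
Proof.
rewrite rsl_flip; apply: le_trans (lsl_norm _ _) _; rewrite -flip_adj adjl // flip_adj flipK; exact: lexx.
Qed.

(** For |b| = 1 the slice m of DN z satisfies m m^* <= |a|^2 times the slice of DP (z z^* ) at b,
    whose weight is that of z z^* by invariance. *)
Lemma dom_slice2 z a b : Nf z ->
  Nf (vslice2 (DN z) a b) /\ S (vslice2 (DN z) a b) (vslice2 (DN z) a b) <= '[a, a] * '[b, b] * S z z.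
Proof.
move=> hz; have [Nz fz] := hz; have bD := DN_b Nz.
apply: (slice_dom (sl := fun z a b => vslice2 (DN z) a b)) => // [k b' _|b' b1].
  have h0 : vslice2 (DN z) a 0 = 0.
    have := vslice2_linr (-1) a 0 0 bD; rewrite scaler0 addr0 => e.
    by rewrite e rmorphN /= conjC1 scaleN1r addNr.
  by rewrite -[k *: b']addr0 vslice2_linr // h0 addr0.
have [h1 h2] := right_slice fz b1.
have -> : '[a, a] * S z z = cplx (nrm2 a * FF (vslice2 (DP (sq z)) b' b')).
  by rewrite h2 cplxM nrm2E (S_sq hf hz).
apply: Nf_dom => // [|v]; first exact: DN_slice2.
have bm : bd (vslice2 (DN z) a b') by exact: bd_vslice2.
rewrite sq_form // scombE dotZl nrm2E vslice2E ghDPN //= (adjr _ _ bD).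
have -> : adj (vslice2 (DN z) a b') v = rsl a (adj (DN z) (v ⊗v b')).
  by apply: dot_ext => x; rewrite rslE adjl // adjl // dotC [RHS]dotC vslice2E.
exact: rsl_norm.
Qed.

Lemma dom_slice1 z a b : Nf z ->
  Nf (vslice1 (DN z) a b) /\ S (vslice1 (DN z) a b) (vslice1 (DN z) a b) <= '[a, a] * '[b, b] * S z z.
Proof.
move=> hz; have [Nz fz] := hz; have bD := DN_b Nz.
apply: (slice_dom (sl := fun z a b => vslice1 (DN z) a b)) => // [k b' _|b' b1].
  have h0 : vslice1 (DN z) a 0 = 0.
    have := vslice1_linr (-1) a 0 0 bD; rewrite scaler0 addr0 => e.
    by rewrite e rmorphN /= conjC1 scaleN1r addNr.
  by rewrite -[k *: b']addr0 vslice1_linr // h0 addr0.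
have [h1 h2] := left_slice fz b1.
have -> : '[a, a] * S z z = cplx (nrm2 a * FF (vslice1 (DP (sq z)) b' b')).
  by rewrite h2 cplxM nrm2E (S_sq hf hz).
apply: Nf_dom => // [|v]; first exact: DN_slice1.
have bm : bd (vslice1 (DN z) a b') by exact: bd_vslice1.
rewrite sq_form // scombE dotZl nrm2E vslice1E ghDPN //= (adjr _ _ bD).
have -> : adj (vslice1 (DN z) a b') v = lsl a (adj (DN z) (b' ⊗v v)).
  by apply: dot_ext => x; rewrite lslE adjl // adjl // dotC [RHS]dotC vslice1E.
exact: lsl_norm.
Qed.

Lemma right_transfer (w0 : K) (c : C) z a b w : 0 <= c ->
  (forall w, Nf (nn w w0) /\ S (nn w w0) (nn w w0) <= c * '[w, w]) -> Nf z ->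
  S (vslice2 (DN z) a b) (nn w w0) = S z (nn (ss a b w) w0).
Proof.
move=> c0 hn hz.
have -> : ss a b w = lsl b (Z (a ⊗v w)) by apply: dot_ext => v; rewrite [RHS]lslE ssE.
apply: (transfer hf (U := Z) (sl := fun z a b => vslice2 (DN z) a b) (n := fun w => nn w w0) (c := c) unZ) => //.
- by move=> x a' b' hx; exact: dom_slice2.
- move=> k x x' a' b' hx hx'; have [Nx Nx'] := (Nf_N hx, Nf_N hx').
  rewrite DN_lin //; apply: op_ext => u v; rewrite vslice2E !lcombE dotDl dotZl.
  by rewrite dotDl dotZl !vslice2E.
- by move=> k x a' a2 b' hx; apply: vslice2_linl; exact: DN_b (Nf_N hx).
- by move=> k x a' b' b2 hx; apply: vslice2_linr; exact: DN_b (Nf_N hx).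
- move=> x b' hx b1; have [h1 h2] := right_inv_series hf hr hx b1.
  rewrite (S_sq hf hx).
  rewrite (_ : (fun k => S (vslice2 (DN x) (onb H k) b') (vslice2 (DN x) (onb H k) b')) =
    fun k => cplx (FF (sq (vslice2 (DN x) (onb H k) b')))); first exact: h2.
  by apply: funext => k; exact: S_sq.
- by move=> k x y; exact: nn_linl.
- by move=> a' b' v; rewrite nn_slice2 ss_adj_lsl.
Qed.

Lemma left_transfer (w0 : K) (c : C) z a b w : 0 <= c ->
  (forall w, Nf (qq w w0) /\ S (qq w w0) (qq w w0) <= c * '[w, w]) -> Nf z ->
  S (vslice1 (DN z) a b) (qq w w0) = S z (qq (sg a b w) w0).
Proof.
move=> c0 hn hz.
(* Vt with its legs exchanged fits the common pattern of [transfer]. *)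
have [U [bU hU UE UV]] : exists U : H ⊗ K -> K ⊗ K, [/\ bd U, unitary_op U,
    forall a w, U (a ⊗v w) = flip (Vt (w ⊗v a)) &
    forall b w, adj U (b ⊗v w) = flip (adj Vt (w ⊗v b))].
  pose U : H ⊗ K -> K ⊗ K := fun t => flip (Vt (flip t)).
  have bU : bd U by apply: bd_comp (bd_flip _ _) (bd_comp bVt (bd_flip _ _)).
  have aU t : adj U t = flip (adj Vt (flip t)).
    apply: dot_ext => s; rewrite adjl // /U -[in RHS]flip_adj adjl // adjl; last exact: bVt.
    by rewrite -[flip (Vt _)]/(flip _) -[in LHS]flip_adj -adjr // .
  exists U; split=> //.
  - split=> //; apply: funext => t /=; rewrite aU /U flipK ?(unK unVt) ?(unVK unVt) flipK //.
  - by move=> a' w'; rewrite /U flipE.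
  - by move=> b' w'; rewrite aU flipE.
have -> : sg a b w = lsl b (U (a ⊗v w)).
  by apply: dot_ext => v; rewrite lslE UE sgE -flip_adj adjl // flipE.
apply: (transfer hf (U := U) (sl := fun z a b => vslice1 (DN z) a b) (n := fun w => qq w w0) (c := c) hU) => //.
- by move=> x a' b' hx; exact: dom_slice1.
- move=> k x x' a' b' hx hx'; have [Nx Nx'] := (Nf_N hx, Nf_N hx').
  rewrite DN_lin //; apply: op_ext => u v; rewrite vslice1E !lcombE dotDl dotZl.
  by rewrite dotDl dotZl !vslice1E.
- by move=> k x a' a2 b' hx; apply: vslice1_linl; exact: DN_b (Nf_N hx).
- by move=> k x a' b' b2 hx; apply: vslice1_linr; exact: DN_b (Nf_N hx).
- move=> x b' hx b1; have [h1 h2] := left_inv_series hf hl hx b1.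
  rewrite (S_sq hf hx).
  rewrite (_ : (fun k => S (vslice1 (DN x) (onb H k) b') (vslice1 (DN x) (onb H k) b')) =
    fun k => cplx (FF (sq (vslice1 (DN x) (onb H k) b')))); first exact: h2.
  by apply: funext => k; exact: S_sq.
- by move=> k x y; exact: qq_linl.
- move=> a' b' v; rewrite qq_slice1 sg_adj_rsl UV; congr (qq _ _).
  exact: rsl_flip.
Qed.

End Modular.

(** * The weight on matrix coefficients expressed by the Haar state *)

Section KMS.

Lemma qq_Nhat x v w : Nhat x -> qq v (x w) = qq (adj x v) w.
Proof.
move=> Nx; have bx := Nhat_b Nx; have bax := bd_adj bx; apply: op_ext => a b; rewrite !qqE.
rewrite -(tensorE _ _ bx (bd_id H)) -(Nhat_Vt Nx) (adjr _ _ (bd_tensor bx (bd_id K))).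
by rewrite (adj_tensor bx (bd_id K)) adj_idfun (tensorE _ _ bax (bd_id K)).
Qed.


Lemma sg_kap r (g : Hr r) u u' : Kr r u -> Kr r u' -> sg xi (th g u') u = '[u, u'] *: kap g.
Proof.
move=> ku ku'; apply: dot_ext => w; rewrite sgE -ZVxi -nnE -[X in nn _ X](th_eps ku).
by rewrite (nn_th _ _ _ _ _ ku) dotZl kap_cc mulrC.
Qed.

Lemma cc_kap r (g : Hr r) : cc r (kap g) = T r g.
Proof. by apply: dot_ext => h; rewrite -kap_cc kap_dot. Qed.

Lemma ss_th_uu r (g : Hr r) (v : K) : Kr r v -> ss xi (th g v) (uu r) = '[eps r, g] *: th (cc r v) (uu r).
Proof. by move=> kv; rewrite -{1}(th_eps (Kr_uu r)) x_th // pi_ss_th // thZ. Qed.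

Variables (f : (K -> K) -> \bar R) (hf : nsf_weight P f).
Hypotheses (hl : left_invariant P DP f) (hr : vector_invariant f).
Local Notation Fn := (@Fin _ _ P f).
Local Notation FF := (@F _ _ f).
Local Notation S x y := (@wext _ _ P f (x \o adj y)).
Local Notation Nf := (Nf f).
Variable r : gI G.
Local Notation u := (uu r).
Let ku : Kr r u. Proof. exact: Kr_uu. Qed.

(** DP z is Vt (z ⊗ 1) Vt^*, so Cauchy-Schwarz for z ⊗ 1 bounds the square of qq b (z k0) by <z k0,
    k0> times the slice of DP z at b. This is how finite elements of P produce elements of N with
    finite square. *)
Lemma qq_dom (z : K -> K) (k0 b : K) : Fn z ->
  Nf (qq b (z k0)) /\ S (qq b (z k0)) (qq b (z k0)) <= '[z k0, k0] * '[b, b] * cplx (FF z).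
Proof.
move=> hz; have [[Pz pz] fz] := hz; have [bz posz] := pz.
have Fz : 0 <= FF z by exact: (F_ge0 hf).
have [b0|/unit_multiple[b1 [k [hb ->]]]] := eqVneq b 0.
  have -> : qq b (z k0) = 0.
    apply: funext => a; apply/eqP; rewrite -normr_le0; apply: le_trans (qq_norm _ _ _) _.
    by rewrite b0 normr0 !mul0r.
  have h0 := Nf_0 hf; split=> //; rewrite (S_0l hf h0).
  by rewrite !mulr_ge0 ?cplx_ge0.
have hk : qq (k *: b1) (z k0) = k^* *: qq b1 (z k0).
  have h0 : qq 0 (z k0) = 0.
    apply: funext => a; apply/eqP; rewrite -normr_le0; apply: le_trans (qq_norm _ _ _) _.
    by rewrite normr0 !mul0r.
  by rewrite -[k *: b1]addr0 qq_linl h0 addr0.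
have [h1 h2] := left_slice hl hz hb.
have [zr zr0] := Cx_real (posz k0).
have [h3 h4] : Nf (qq b1 (z k0)) /\ S (qq b1 (z k0)) (qq b1 (z k0)) <=
    cplx (complex.Re ('[z k0, k0] : C) * FF (vslice1 (DP z) b1 b1)).
  apply: (Nf_dom hf (N_qq _ _) h1 zr0) => v.
  have bV := bVt; have bq : bd (qq b1 (z k0)) by [].
  rewrite sq_form // scombE dotZl -zr vslice1E DPV //= (adjr _ _ bV).
  have -> : adj (qq b1 (z k0)) v = lsl (z k0) (adj Vt (b1 ⊗v v)).
    exact: adj_qq_lsl.
  set t := adj Vt (b1 ⊗v v); set y := lsl _ _.
  have pt : pos (ampl z H).
    by split=> [|x]; [exact: bd_tensor|exact: tensor_pos].
  have e1 : '[ampl z H t, k0 ⊗v y] = '[y, y].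
    rewrite (pos_sa _ _ pt) (tensorE _ _ bz (bd_id H)) /y lslE //.
  have := pos_CS t (k0 ⊗v y) pt; rewrite e1 (tensorE _ _ bz (bd_id H)) pure_dot.
  have [->|y0] := eqVneq ('[y, y] : C) 0; first by rewrite mulr_ge0 // tensor_pos.
  have p : 0 < '[y, y] :> C by rewrite lt_neqAle eq_sym y0 dot_ge0.
  rewrite ger0_norm // expr2 mulrA (ler_pM2r p) => h; apply: le_trans h _.
  by rewrite mulrC.
rewrite hk; have h5 := Nf_scale hf k^* h3; split=> //.
rewrite S_Zl // S_Zr // conjCK dotZl dotZr hb mulr1 mulrA [k^* * k]mulrC.
rewrite [leRHS]mulrAC [leRHS]mulrC ler_wpM2l ?mul_conjC_ge0 //.
by move: h4; rewrite h2 cplxM -zr.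
Qed.

(** By density of the finite elements some finite z has ee (z k0) <> 0; moving [ee] across [qq]
    preserves the bound of [qq_dom]. *)
Lemma qq_seed : exists (v0 : K) (c : C), [/\ v0 != 0, Kr r v0, 0 <= c &
  forall v, Nf (qq v v0) /\ S (qq v v0) (qq v v0) <= c * '[v, v]].
Proof.
have be : bd (ee r) by exact: th_b.
have [z [k0 [hz ez]]] : exists z k0, Fn z /\ ee r (z k0) != 0.
  apply: contrapT => h; have P1 : P idfun by exact: Q1 Pvna.
  have pd : predual (fun x : K -> K => '[x u, u]) by exact: pd_vec.
  have [_ hd] := Fin_dense hf P1.
  have [y hy hy2] := hd 1%N (fun _ => fun x : K -> K => '[x u, u]) 1 (fun _ => pd) ltr01.
  have e0 : '[y u, u] = 0.
    apply: (span_ind (Q := fun y : K -> K => '[y u, u] = 0) _ _ hy) => [|c x x' hx hx'].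
      by rewrite zfunE dot0l.
    rewrite lcombE dotDl dotZl hx' addr0 -[X in '[_, X]](ee_uu r).
    have -> : '[x u, ee r u] = '[ee r (x u), u] by rewrite (adjr _ _ be) ee_adj.
    have -> : ee r (x u) = 0.
      by apply/eqP; apply: contrapT => /negP e; apply: h; exists x, u.
    by rewrite dot0l mulr0.
  by have := hy2 ord0; rewrite e0 uu1 sub0r normrN normr1 ltxx.
have [d d0 hd] := bdP be; have [_ posz] := hz.1.2.
have Fz : 0 <= FF z by apply: (F_ge0 hf); exact: Fin_Qp hz.
exists (ee r (z k0)), ('[z k0, k0] * (d ^+ 2) * cplx (FF z)); split=> //; first exact: ee_ee.
  by rewrite !mulr_ge0 ?exprn_ge0 ?cplx_ge0.
move=> v; rewrite (qq_Nhat _ _ (th_N _)) -/(ee r) (ee_adj r).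
have [h1 h2] := qq_dom k0 (ee r v) hz; split=> //; apply: le_trans h2 _.
rewrite -!mulrA; apply: ler_wpM2l => //; rewrite mulrA [leRHS]mulrA [leRHS]mulrAC; apply: ler_wpM2r; rewrite ?cplx_ge0 //.
by rewrite !hdot_norm -expr2 -exprMn lerXn2r ?nnegrE ?mulr_ge0.
Qed.

(** Slicing DN (qq v v0) at xi and th g v0 gives <v0, v0> qq v (kap g), so the single seed v0
    reaches every kap g. *)
Lemma kap_bound : exists2 c : C, 0 <= c & forall v (g : Hr r), Nf (qq v (kap g)) /\
  S (qq v (kap g)) (qq v (kap g)) <= c * '[v, v] * '[g, g].
Proof.
have [v0 [c [v00 kv c0 hc]]] := qq_seed.
have p : 0 < '[v0, v0] :> C.
  by rewrite lt_neqAle eq_sym dot_ge0 andbT; apply/eqP => /dot_eq0 e; rewrite e eqxx in v00.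
exists (c / '[v0, v0]) => [|v g]; first by rewrite divr_ge0 // ltW.
have [h1 h2] := hc v; have [h3 h4] := dom_slice2 hf hr xi (th g v0) h1.
have ek : kap g = '[v0, v0]^-1 *: sg xi (th g v0) v0.
  by rewrite sg_kap // scalerA mulVf ?scale1r // gt_eqF.
have eq : qq v (kap g) = '[v0, v0]^-1 *: vslice2 (DN (qq v v0)) xi (th g v0).
  have q0 : qq v 0 = 0 by apply: funext => a; apply/eqP; rewrite -normr_le0; apply: le_trans (qq_norm _ _ _) _; rewrite normr0 mulr0 mul0r.
  apply: funext => a; rewrite qq_slice2 ek -[_ *: sg _ _ _]addr0 qq_lin q0.
  by rewrite zfunE ?addr0.
rewrite eq; have h5 := Nf_scale hf ('[v0, v0]^-1) h3; split=> //.
rewrite S_Zl // S_Zr // fmorphV /= -dotC mulrA.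
have th1 : '[th g v0, th g v0] = '[g, g] * '[v0, v0] by exact: th_dot.
rewrite th1 xi1 mul1r in h4.
have p2 : 0 <= ('[v0, v0])^-1 * ('[v0, v0])^-1 :> C by rewrite mulr_ge0 // invr_ge0 ltW.
apply: le_trans (ler_wpM2l p2 h4) _.
have p3 : 0 <= '[v0, v0]^-1 * '[g, g] :> C by rewrite mulr_ge0 // invr_ge0 ltW.
apply: le_trans (_ : ('[v0, v0]^-1 * '[g, g]) * (c * '[v, v]) <= _).
  apply: le_trans (ler_wpM2l p3 h2); apply: le_of_eq; field.
  by rewrite gt_eqF.
by apply: le_of_eq; ring.
Qed.

Let w0 := th (cc r u) u.
Lemma nn_th_cc (g v : Hr r) : nn (th g u) (th (cc r (kap v)) u) = qq (kap v) (kap g).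
Proof.
have -> : th (cc r (kap v)) u = ss xi (kap v) u.
  by rewrite /cc -(x_th _ _ (Nhat_ss _ _)) (th_eps ku).
by rewrite nn_ss_qq.
Qed.
Let nn_w0 (g : Hr r) : nn (th g u) w0 = qq u (kap g).
Proof.
have -> : w0 = ss xi u u by rewrite /w0 /cc -(x_th _ _ (Nhat_ss _ _)) (th_eps ku).
by rewrite nn_ss_qq.
Qed.

Lemma nn_compress : exists2 t : K -> Hr r, bd t &
  forall w (h : Hr r), nn w (th h u) = nn (th (t w) u) (th h u).
Proof.
have bl := bd_th_l r u; exists (adj (fun h : Hr r => th h u)); first exact: bd_adj.
move=> w h; apply: op_ext => a b; rewrite !nn_ss x_th // th_dot // uu1 mulr1.
by rewrite -adjr.
Qed.

Lemma nn_bound_w0 : exists2 c : C, 0 <= c & forall w, Nf (nn w w0) /\ S (nn w w0) (nn w w0) <= c * '[w, w].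
Proof.
have [c c0 hc] := kap_bound; have [t bt ht] := nn_compress; have [d d0 hd] := bdP bt.
exists (c * d ^+ 2) => [|w]; first by rewrite mulr_ge0 ?exprn_ge0.
rewrite /w0 ht -/w0 nn_w0; have [h1 h2] := hc u (t w); split=> //; apply: le_trans h2 _.
rewrite uu1 mulr1 -mulrA ler_wpM2l // !hdot_norm -exprMn lerXn2r ?nnegrE ?mulr_ge0 //.
Qed.

Definition chi : C := S (qq u (kap (eps r))) (qq u (kap (eps r))).

Lemma Nf_nn_T (g1 g2 : Hr r) : Nf (nn (th (T r g2) u) (th (T r g1) u)).
Proof. by have [c c0 hc] := kap_bound; rewrite -(cc_kap g1) nn_th_cc; have [] := hc (kap g1) (T r g2). Qed.

(** The coefficient is qq (kap g1) (kap (T g2)). Left transfer moves the slice producing kap g1 onto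
    z and replaces z by qq u v with v = (th g1)^* (z xi); right transfer then moves the slice
    producing kap (T g2), leaving the factor <v, kap g2> in front of chi. *)
Lemma kms z (g1 g2 : Hr r) : Nf z ->
  S z (nn (th (T r g2) u) (th (T r g1) u)) = chi * '[z xi, nn (th g2 u) (th g1 u) xi].
Proof.
move=> hz; have Nz := Nf_N hz; have [c c0 hc] := kap_bound; have [c' c0' hc'] := nn_bound_w0.
have kk := kap_Kr g1.
have -> : nn (th (T r g2) u) (th (T r g1) u) = qq (kap g1) (kap (T r g2)).
  by rewrite -(cc_kap g1) nn_th_cc.
have e1 : kap g1 = sg xi (th g1 u) u by rewrite sg_kap // uu1 scale1r.
rewrite [X in qq X _]e1 -(@left_transfer f hf hl (kap (T r g2)) (c * '[T r g2, T r g2])) //; first last.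
- by move=> w; have [h1 h2] := hc w (T r g2); split=> //; apply: le_trans h2 _; rewrite mulrAC.
- by rewrite mulr_ge0.
have hz' := (dom_slice1 hf hl xi (th g1 u) hz).1.
pose v := adj (th g1) (z xi); have kv : Kr r v by exact: adj_th_ee.
have e2 : vslice1 (DN z) xi (th g1 u) = qq u v.
  rewrite -qq_xi // /v; have := qq_Nhat u (z xi) (Nhat_adj (th_N g1)).
  by rewrite adjK // => ->.
rewrite e2 in hz' *.
pose b := th (eps r) (kap g2).
have := right_transfer hf hr xi b u c0' hc' hz'.
have -> : vslice2 (DN (qq u v)) xi b = '[v, kap g2] *: qq u (kap (eps r)).
  have q0 : qq u 0 = 0 by apply: funext => a; apply/eqP; rewrite -normr_le0; apply: le_trans (qq_norm _ _ _) _; rewrite normr0 mulr0 mul0r.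
  rewrite qq_slice2 sg_kap //; last exact: kap_Kr.
  apply: funext => a; rewrite -[_ *: kap _]addr0 qq_lin q0 zfunE.
  by rewrite addr0.
have -> : nn u w0 = qq u (kap (eps r)) by rewrite -{1}(th_eps ku) nn_w0.
have -> : nn (ss xi b u) w0 = qq u (kap (T r g2)).
  by rewrite /b ss_th_uu ?eps1 ?scale1r ?cc_kap ?nn_w0 //; exact: kap_Kr.
have ne : Nf (qq u (kap (eps r))) by have [] := hc u (eps r).
rewrite S_Zl // -/chi => <-; rewrite mulrC; congr (_ * _).
by rewrite -th_kap /v adjl.
Qed.

Lemma chi_gt0 : 0 < chi.
Proof.
have [c c0 hc] := kap_bound; have ne : Nf (qq u (kap (eps r))) by have [] := hc u (eps r).
rewrite lt_neqAle eq_sym S_ge0 // andbT; apply/eqP => e.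
pose h := T r (eps r); have hn := Nf_nn_T (eps r) (eps r).
have := kms (eps r) (eps r) hn; rewrite e mul0r (S_sq hf hn) -cplx0 => /cplx_inj /(S_eq0 hf hn) n0.
have : th h (kap h) = 0 by rewrite th_kap n0.
move=> t0; have : '[h, h] * '[kap h, kap h] = 0.
  by rewrite -th_dot ?t0 ?dot0l //; exact: kap_Kr.
have hz : h <> 0.
  move=> h0; have e0 : eps r = 0 by apply: (T_inj (r := r)); rewrite -/h h0 (lop0 (T_b r)).
  by have := eps1 r; rewrite e0 dot0l => /eqP; rewrite eq_sym oner_eq0.
move/eqP; rewrite mulf_eq0 => /orP[/eqP /dot_eq0 //|/eqP /dot_eq0 k0].
apply: hz; apply: (T_inj (r := r)); rewrite (lop0 (T_b r)); apply: dot_ext0 => g'.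
by rewrite -kap_dot k0 dot0r.
Qed.

End KMS.

(** * Eigenvectors of the modular group of the Haar state and its conjugation *)

Section Homogeneous.

Variables (f : (K -> K) -> \bar R) (hf : nsf_weight P f).
Hypotheses (hl : left_invariant P DP f) (hr : vector_invariant f).
Local Notation S x y := (@wext _ _ P f (x \o adj y)).
Local Notation Nf := (Nf f).
Variables (g : forall r, nat -> Hr r) (t : gI G -> nat -> R).
Hypotheses (t0 : forall r n, 0 < t r n) (Tg : forall r n, T r (g r n) = cplx (t r n) *: g r n).

Lemma Nf_M n m : Nf n -> M m -> Nf (n \o m).
Proof.
move=> hn Mm; have [Nn fn] := hn; have bm := Mb Mm; have bn := Nb Nn.
have [d d0 hd] := bdP bm.
have d2 : 0 <= d ^+ 2 by rewrite exprn_ge0.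
have [dE dr] := Cx_real d2.
apply: (Nf_dom hf (NM Nn Mm) fn dr _).1 => v; rewrite sq_form; last exact: bd_comp.
rewrite scombE dotZl -dE sq_form // adj_comp //= !hdot_norm -exprMn lerXn2r ?nnegrE ?mulr_ge0 //.
exact: adj_bound.
Qed.

Definition nkl r k l : H -> K := nn (th (g r k) (uu r)) (th (g r l) (uu r)).
Definition lam r k l : R := complex.Re (chi f r) / (t r k * t r l).

Lemma chiE r : chi f r = cplx (complex.Re (chi f r)) /\ 0 < complex.Re (chi f r).
Proof.
have c0 := chi_gt0 hf hl hr r; have [e _] := Cx_real (ltW c0).
by split=> //; rewrite -cplx_gt0 -e.
Qed.

Lemma lam_gt0 r k l : 0 < lam r k l.
Proof. by have [_ c0] := chiE r; rewrite /lam divr_gt0 ?mulr_gt0. Qed.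

Lemma nkl_T r k l : nn (th (T r (g r k)) (uu r)) (th (T r (g r l)) (uu r)) =
  cplx (t r k * t r l) *: nkl r k l.
Proof.
rewrite !Tg !thZ; apply: op_ext => a b.
rewrite scombE dotZl /nkl !nn_ss (lopZ (bd_ss _ _)) dotZl dotZr cplx_conj cplxM.
by rewrite mulrA [cplx (t r l) * _]mulrC.
Qed.

Lemma Nf_nkl r k l : Nf (nkl r k l).
Proof.
have h := Nf_nn_T hf hl hr (g r l) (g r k); rewrite nkl_T in h.
have -> : nkl r k l = cplx (t r k * t r l)^-1 *: (cplx (t r k * t r l) *: nkl r k l).
  by rewrite scalerA -cplxM mulVf ?cplx1 ?scale1r // gt_eqF // mulr_gt0.
exact: Nf_scale.
Qed.

Lemma kms_nkl r k l z : Nf z -> S z (nkl r k l) = cplx (lam r k l) * '[z xi, nkl r k l xi].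
Proof.
move=> hz; have := kms hf hl hr (g r l) (g r k) hz; rewrite nkl_T S_Zr //; last exact: Nf_nkl.
have tt0 : cplx (t r k * t r l) != 0 :> C by rewrite gt_eqF // cplx_gt0 mulr_gt0.
rewrite cplx_conj => h; apply: (mulfI tt0); rewrite h mulrA -cplxM; congr (_ * _).
have e : t r k * t r l * lam r k l = complex.Re (chi f r).
  by rewrite /lam mulrC divfK // gt_eqF // mulr_gt0.
by rewrite e; exact: (chiE r).1.
Qed.

(** The form S of nkl r i j \o m and nkl s k l is evaluated by [kms_nkl] in either argument. The
    factors [lam] differ, and their ratio measures how far the Haar state is from a trace. *)
Lemma nkl_modular r s i j k l m : M m ->
  '[nkl r i j (m xi), nkl s k l xi] =
  cplx (lam r i j / lam s k l) * '[nkl r i j xi, nkl s k l (adj m xi)] :> C.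
Proof.
move=> Mm; have bm := Mb Mm; have Mam := Madj Mm.
have [h1 h2] := (Nf_nkl r i j, Nf_nkl s k l).
have b2 : bd (nkl s k l) by exact: bd_nn.
have e1 := kms_nkl s k l (Nf_M h1 Mm).
have e2 := kms_nkl r i j (Nf_M h2 Mam).
have e3 : S (nkl r i j \o m) (nkl s k l) = (S (nkl s k l \o adj m) (nkl r i j))^*.
  rewrite -(S_conj hf (Nf_M h2 Mam) h1) adj_comp // ?adjK //; exact: bd_adj.
have l0 : cplx (lam s k l) != 0 :> C by rewrite gt_eqF // cplx_gt0 lam_gt0.
apply: (mulfI l0); rewrite -[LHS]e1 e3 e2 rmorphM /= cplx_conj -dotC mulrA -cplxM.
have e : lam s k l * (lam r i j / lam s k l) = lam r i j.
  by rewrite mulrC divfK // gt_eqF // lam_gt0.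
by rewrite e.
Qed.

(** m is an eigenvector of the modular automorphism of the Haar state phi: phi(m x) = q phi(x m). *)
Definition homog (m : H -> H) (q : R) := [/\ M m, 0 < q &
  forall x, M x -> '[m (x xi), xi] = cplx q * '[x (m xi), xi]].

Lemma homog_nkl r s i j k l (c : C) :
  homog (c *: (adj (nkl s k l) \o nkl r i j)) (lam r i j / lam s k l).
Proof.
have [N1 N2] := (N_nn (th (g r i) (uu r)) (th (g r j) (uu r)), N_nn (th (g s k) (uu s)) (th (g s l) (uu s))).
have M1' : M (adj (nkl s k l) \o nkl r i j) by exact: NNM.
split.
- by rewrite -[_ *: _]addr0; apply: Msub.2 => //; exact: Msub.1.
- by rewrite divr_gt0 ?lam_gt0.
move=> x Mx; have bx := Mb Mx; have b2 : bd (nkl s k l) by exact: bd_nn.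
rewrite !scombE (lopZ bx) !dotZl mulrCA; congr (_ * _) => /=.
by rewrite adjl // nkl_modular // (adjr _ _ bx) adjl.
Qed.

Lemma homog_scale m q (c : C) : homog m q -> homog (c *: m) q.
Proof.
move=> [Mm q0 h]; split=> //.
  by rewrite -[_ *: _]addr0; apply: Msub.2 => //; exact: Msub.1.
by move=> x Mx; rewrite !scombE (lopZ (Mb Mx)) !dotZl h // mulrCA.
Qed.

(** The modular conjugation J applied to m xi, in closed form for homogeneous m; [hvec_dot] is the
    antiunitarity of J. *)
Definition hvec m (q : R) : H := cplx (Num.sqrt q)^-1 *: adj m xi.

(** Computed with either homogeneity, <m^* xi, m'^* xi> is both q and q' times <m' xi, m xi>; so
    that number is 0 or q = q'. *)
Lemma hvec_dot m q m' q' : homog m q -> homog m' q' ->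
  '[hvec m q, hvec m' q'] = '[m' xi, m xi].
Proof.
move=> [Mm q0 h] [Mm' q0' h'].
have [bm bm'] := (Mb Mm, Mb Mm').
have e1 : '[adj m xi, adj m' xi] = cplx q' * '[m' xi, m xi].
  by rewrite -adjr // h' ?adjl //; exact: Madj.
have e2 : '[adj m xi, adj m' xi] = cplx q * '[m' xi, m xi].
  rewrite adjl // dotC h; last exact: Madj.
  by rewrite rmorphM /= cplx_conj adjl // -dotC.
rewrite /hvec dotZl dotZr cplx_conj e1.
have [->|z0] := eqVneq ('[m' xi, m xi] : C) 0; first by rewrite !mulr0.
have qq : q = q'.
  by apply: (@cplx_inj R); apply: (mulIf z0); rewrite -e1 -e2.
have s0 : 0 < Num.sqrt q' by rewrite sqrtr_gt0.
rewrite qq !mulrA -!cplxM -{3}(sqr_sqrtr (ltW q0')) expr2.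
by rewrite mulrA mulfVK ?gt_eqF // mulVf ?gt_eqF // cplx1 mul1r.
Qed.

(** Either both sides vanish, or q is inverse to the ratio of the [lam], which turns the ratio in
    [nkl_modular] into its square root. *)
Lemma hvec_nkl m q r s i j k l : homog m q ->
  '[nkl r i j (m xi), nkl s k l xi] =
  cplx (Num.sqrt (lam r i j / lam s k l)) * '[nkl r i j xi, nkl s k l (hvec m q)] :> C.
Proof.
move=> [Mm q0 h]; have b2 : bd (nkl s k l) by exact: bd_nn.
have b1 : bd (nkl r i j) by exact: bd_nn.
have [N1 N2] := (N_nn (th (g r i) (uu r)) (th (g r j) (uu r)), N_nn (th (g s k) (uu s)) (th (g s l) (uu s))).
have M1' : M (adj (nkl s k l) \o nkl r i j) by exact: NNM.
rewrite nkl_modular // /hvec (lopZ b2) dotZr cplx_conj.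
set A := '[nkl r i j xi, _]; set ka := lam r i j / lam s k l.
have k0 : 0 < ka by rewrite divr_gt0 ?lam_gt0.
have e : A = cplx q * (cplx ka * A).
  rewrite -nkl_modular //; have := h _ M1'; rewrite /= adjl // => e.
  by rewrite -e (adjr _ _ (Mb Mm)) adjl.
have [->|A0] := eqVneq A 0; first by rewrite !mulr0.
have kq : q * ka = 1.
  by apply: (@cplx_inj R); apply: (mulIf A0); rewrite cplx1 mul1r cplxM -mulrA -e.
have s0 : 0 < Num.sqrt q by rewrite sqrtr_gt0.
have sk : Num.sqrt ka = (Num.sqrt q)^-1.
  have sn : Num.sqrt q != 0 by rewrite gt_eqF.
  apply: (mulfI sn); rewrite mulfV //.
  by rewrite -sqrtrM ?kq ?sqrtr1 // ltW.
rewrite mulrA -cplxM; congr (cplx _ * _).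
by rewrite -{1}(sqr_sqrtr (ltW k0)) sk expr2.
Qed.

End Homogeneous.

(** * The invariant weight psi on slices of the dual coaction *)

Section PsiForm.

Variables (psi : (K -> K) -> \bar R).
Hypotheses (hpsi : nsf_weight Nhat psi) (hinv : coaction_invariant Wt Nhat (dual_algebra V) psi).
Local Notation Nv := Nhat_vna.
Local Notation wg := (wgraph Nhat psi).

Lemma Z_sg v a c w : Z (v ⊗v sg a c w) = ampr K (sg a c) (Z (v ⊗v w)).
Proof.
have bs : bd (sg a c) by [].
apply: tdot_ext => b w'; rewrite -ssE ss_sg (adjr _ _ bs) ssE.
rewrite (adjr _ _ (bd_tensor (bd_id K) bs)) (adj_tensor (bd_id K) bs) adj_idfun.
by rewrite (tensorE _ _ (bd_id K) (bd_adj bs)).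
Qed.

Lemma Z_adj_sg v a c w : Z (v ⊗v adj (sg a c) w) = ampr K (adj (sg a c)) (Z (v ⊗v w)).
Proof.
have bs : bd (adj (sg a c)) by exact: bd_adj.
apply: tdot_ext => b w'; rewrite -ssE Nhat_adj_sg // (adjr _ _ bs) ssE.
rewrite (adjr _ _ (bd_tensor (bd_id K) bs)) (adj_tensor (bd_id K) bs) adj_idfun.
by rewrite (tensorE _ _ (bd_id K) (bd_adj bs)).
Qed.

Lemma bd_Zl v : bd (fun w : K => Z (v ⊗v w)).
Proof. exact: bd_comp bZ (bd_pr _ _). Qed.

(** The slice at v, v' of Z^* (x ⊗ 1) Z, which is the dual coaction up to flips. The hypothesis on
    psi covers v = v' of norm 1. *)
Definition EE (x : K -> K) (v v' : H) : K -> K :=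
  adj (fun w : K => Z (v' ⊗v w)) \o (ampl x K \o (fun w : K => Z (v ⊗v w))).

Lemma EE_form x v v' w w' : bd x ->
  '[EE x v v' w, w'] = '[ampl x K (Z (v ⊗v w)), Z (v' ⊗v w')].
Proof. by move=> bx; rewrite /EE /= adjl //; exact: bd_Zl. Qed.

Lemma bd_EE x v v' : bd x -> bd (EE x v v').
Proof.
move=> bx; apply: bd_comp; first by apply: bd_adj; exact: bd_Zl.
by apply: bd_comp; [exact: bd_tensor|exact: bd_Zl].
Qed.

Lemma EE_N x v v' : bd x -> Nhat (EE x v v').
Proof.
move=> bx; apply/NhatP; split=> [|a c w]; first exact: bd_EE.
have bs : bd (sg a c) by []; have bt : bd (ampl x K) by exact: bd_tensor.
apply: dot_ext => w'; rewrite EE_form // Z_sg (adjr _ _ bs) EE_form // Z_adj_sg.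
have -> : ampl x K (ampr K (sg a c) (Z (v ⊗v w))) =
  ampr K (sg a c) (ampl x K (Z (v ⊗v w))).
  transitivity (tensor_op x (sg a c) (Z (v ⊗v w))).
    exact: (congr1 (@^~ _) (tensor_comp bx (bd_id K) (bd_id K) bs)).
  exact: (congr1 (@^~ _) (esym (tensor_comp (bd_id K) bs bx (bd_id K)))).
by rewrite (adjr _ _ (bd_tensor (bd_id K) bs)) (adj_tensor (bd_id K) bs) adj_idfun.
Qed.

Lemma EE_lin k x y v v' : bd x -> bd y ->
  EE (k *: x + y) v v' = k *: EE x v v' + EE y v v'.
Proof.
move=> bx by_; have bxy : bd (k *: x + y) by apply: bd_add => //; exact: bd_scale.
by apply: op_ext => w w'; rewrite lcombE dotDl dotZl !EE_form // tensor_linl // lcombE dotDl dotZl.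
Qed.

Lemma EE_Z k x v v' : bd x -> EE (k *: x) v v' = k *: EE x v v'.
Proof.
move=> bx; have := EE_lin (-1) v v' (bd_0 K K) (bd_0 K K); rewrite scaler0 addr0 scaleN1r addNr => e0.
by have := EE_lin k v v' bx (bd_0 K K); rewrite addr0 e0 addr0.
Qed.

Lemma EE_D x y v v' : bd x -> bd y -> EE (x + y) v v' = EE x v v' + EE y v v'.
Proof. by move=> bx by_; have := EE_lin 1 v v' bx by_; rewrite !scale1r. Qed.

Lemma EE_sesq x w w' : bd x -> sesq_on (U := H) [set: H] (fun v v' => '[EE x v v' w, w'] : C).
Proof.
move=> bx; have bt : bd (ampl x K) by exact: bd_tensor.
have b_Z := bZ.
split=> k v1 v2 v3 _ _ _; rewrite !EE_form // pureDl pureZl (lopP b_Z).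
  by rewrite (lopP bt) dotDl dotZl.
by rewrite dotDr dotZr.
Qed.

Lemma EE_psi x v : Fin Nhat psi x -> '[v, v] = 1 -> wg (EE x v v) (cplx (F psi x)).
Proof.
move=> hx v1; have [[Nx px] fx] := hx; have bx := Nhat_b Nx.
have bt : bd (ampl x K) by exact: bd_tensor.
have [uW b_W] : unitary_op Wt /\ bd Wt by have [h _] := hWt; split=> //; exact: un_bd h.
have bD : bd (dual_coaction Wt x).
  by apply: bd_comp (bd_comp (bd_comp (bd_comp (bd_flip _ _) b_W) bt) (bd_adj b_W)) (bd_flip _ _).
have E : EE x v v = slice2 (vector_functional v) (dual_coaction Wt x).
  rewrite slice2_vec //; apply: op_ext => w w'.
  rewrite EE_form // vslice2E /dual_coaction /= flipE -flip_adj adjl // flipE.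
  by rewrite (adjr _ _ b_W).
have pE : pos (EE x v v).
  by split=> [|w]; [exact: bd_EE|rewrite EE_form //; exact: tensor_pos].
have fE : psi (EE x v v) = psi x by rewrite E; apply: hinv => //; exact: vec_state.
rewrite -[F psi x]/(fine (psi x)) -fE; apply: (wgraph_fin Nv hpsi).
by split; [split=> //; exact: EE_N|rewrite fE].
Qed.

Lemma EE_graph x v v' : Fin Nhat psi x -> wg (EE x v v') ('[v, v'] * cplx (F psi x)).
Proof.
move=> hx; have bx := Nhat_b (Fin_Qp hx).1.
have sE w w' := EE_sesq w w' bx.
have dg w : wg (EE x w w) ('[w, w] * cplx (F psi x)).
  have [->|/unit_multiple[w1 [k [h1 ->]]]] := eqVneq w 0.
    have -> : EE x 0 0 = 0.
      apply: op_ext => y y'; have b_Z := bZ; rewrite EE_form // !pure0l (lop0 b_Z) dot0r.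
      by rewrite zfunE dot0l.
    by rewrite dot0l mul0r; exact: (wgraph_0 Nv hpsi).
  have -> : EE x (k *: w1) (k *: w1) = (k * k^*) *: EE x w1 w1.
    apply: op_ext => y y'; have b_Z := bZ; have bt : bd (ampl x K) by exact: bd_tensor.
    rewrite scombE dotZl !EE_form // !pureZl !(lopZ b_Z) (lopZ bt) dotZl dotZr mulrA.
    by [].
  rewrite dotZl dotZr h1 mulr1; apply: (wgraph_Z Nv hpsi); exact: EE_psi.
have sI : sesq_on (U := H) [set: H] (fun v v' => '[v, v'] * cplx (F psi x) : C).
  by split=> d a b c _ _ _; rewrite ?(dotDl, dotDr) ?(dotZl, dotZr) mulrDl mulrA.
pose p c := c *: v' + v.
have -> : EE x v v' = 4%:R^-1 *: ((EE x (p 1) (p 1) - EE x (p (-1)) (p (-1))) +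
    'i *: (EE x (p 'i) (p 'i) - EE x (p (- 'i)) (p (- 'i)))).
  apply: op_ext => w w'; rewrite (polar_sesq (D := [set: H]) _ (sE w w')) //.
  rewrite scombE dotZl -[(_ + _) w]/((EE x (p 1) (p 1) w - EE x (p (-1)) (p (-1)) w) +
    'i *: (EE x (p 'i) (p 'i) w - EE x (p (- 'i)) (p (- 'i)) w)).
  by rewrite dotDl dotZl !dotBl.
rewrite (polar_sesq (D := [set: H]) _ sI) //.
by apply: (wgraph_polar Nv hpsi); exact: dg.
Qed.

Variables (g : forall r, nat -> Hr r) (t a : gI G -> nat -> R).
Hypotheses (hg : forall r, is_onb (g r)) (t0 : forall r n, 0 < t r n) (a0 : forall r n, 0 < a r n).
Hypothesis Tg : forall r n, @gT _ _ G r (g r n) = cplx (t r n) *: g r n.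
Variable delta : uop K.
Hypotheses (pd : positive_selfadjoint delta) (ad : affiliated Nhat delta).
Hypothesis Sg : forall r n, pi r (shift_inv delta 1) (g r n) = cplx (1 + a r n)^-1 *: g r n.
Hypothesis psiE : forall x, Nhat x -> pos x ->
  psi x = derived_weight (dual_weight pi (@gT _ _ G)) delta x.

Lemma Qp_sq_th r (h : Hr r) : Qp Nhat (sq (th h)).
Proof. by split; [exact: Nhat_sq_th|exact: pos_sq]. Qed.

Lemma Fin_sq_th r n : Fin Nhat psi (sq (th (g r n))).
Proof.
split; first exact: Qp_sq_th.
by apply: le_lt_trans (psi_th_le hg t0 a0 Tg pd ad Sg psiE r n) _; rewrite ltry.
Qed.

(** The upper bound is [psi_th_le]; the lower one is [psi_ge] for the adjoint of th (g r n), with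
    all terms but one dropped. *)
Lemma F_sq_th r n : cplx (F psi (sq (th (g r n)))) = '[g r n, g r n] * cplx (a r n / t r n) :> C.
Proof.
have hF := Fin_sq_th r n; have [_ gu _] := hg r.
have p0 : 0 <= a r n / t r n by rewrite divr_ge0 // ltW.
have [e|e] := gu n.
  rewrite e mul0r (dot_eq0 e); have -> : sq (th (0 : Hr r)) = 0.
    apply: funext => w; rewrite /sq /= -[0 : Hr r](scale0r 0) thZ scale0r.
    by [].
  by have [_ ->] := Fin_0 Nv hpsi; rewrite cplx0.
rewrite e mul1r; congr cplx; apply: le_anti; apply/andP; split.
  by rewrite -lee_fin -(Fin_fE hpsi hF); exact: (psi_th_le hg t0 a0 Tg pd ad Sg psiE).
have b1 := bd_adj (th_b (g r n)).
have E : adj (adj (th (g r n))) \o adj (th (g r n)) = sq (th (g r n)) by rewrite adjK.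
have := @psi_ge g t a hg t0 a0 Tg delta pd ad Sg psi psiE K (adj (th (g r n)))
  (F psi (sq (th (g r n)))) [:: r] n.+1 b1.
rewrite E (Fin_fE hpsi hF) => /(_ hF.1.1 (lexx _) isT); rewrite big_seq1 => h.
apply: le_trans h; rewrite (bigD1 ord_max) //=.
have -> : nrm2 (adj (th (g r n)) (th (g r n) (uu r))) = 1.
  apply: (@cplx_inj R); rewrite nrm2E adj_th_th e scale1r ee_uu cplx1; exact: uu1.
rewrite mulr1 lerDl; apply: sumr_ge0 => j _; apply: mulr_ge0; last exact: nrm2_ge0.
by rewrite divr_ge0 // ltW.
Qed.

Lemma Fin_sq_add r (h k : Hr r) : Fin Nhat psi (sq (th h)) -> Fin Nhat psi (sq (th k)) ->
  Fin Nhat psi (sq (th (h + k))).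
Proof.
move=> hh hk; have [h1 _] := Fin_add Nv hpsi hh hk.
have [h2 _] := Fin_scale Nv hpsi (ler0n R 2) h1.
apply: (Fin_le Nv hpsi (Qp_sq_th _) h2) => v.
have e : adj (th (h + k)) v = adj (th h) v + adj (th k) v.
  have -> : th (h + k) = th h + th k.
    by apply: funext => w; rewrite -[h]scale1r th_lin !scale1r.
  by rewrite adj_add.
set x := adj (th h) v in e *; set y := adj (th k) v in e *.
have -> : '[sq (th (h + k)) v, v] = '[x + y, x + y] by rewrite sq_form // e.
have -> : '[(cplx 2 *: (sq (th h) + sq (th k))) v, v] = cplx 2 * ('[x, x] + '[y, y]) :> C.
  by rewrite scombE dotZl -[(_ + _) v]/(sq (th h) v + sq (th k) v) dotDl !sq_form.
have e2 : cplx 2 = 2%:R :> C by rewrite /cplx rmorph_nat.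
have := dot_ge0 (x - y); rewrite !dotBl !dotBr !dotDl !dotDr e2 => hxy.
rewrite -subr_ge0; apply: le_trans hxy _; apply: le_of_eq; ring.
Qed.

(** For l <> m polarization writes the matrix unit through four squares on which psi agrees by
    [psi_th_phase], so the alternating sum cancels. *)
Lemma EE_th r l m v v' : wg (EE (th (g r l) \o adj (th (g r m))) v v')
  ('[v, v'] * ('[g r l, g r m] * cplx (a r l / t r l))).
Proof.
have [->|lm] := eqVneq l m.
  by rewrite -F_sq_th; apply: EE_graph; exact: Fin_sq_th.
have [go _ _] := hg r; rewrite go // mul0r mulr0.
have bl := th_b (g r l); have bm := th_b (g r m).
pose x c := sq (th (c *: g r m + g r l)).
have xE c : x c = sq (th (g r l) + c *: th (g r m)).
  rewrite /x; congr sq; apply: funext => w; rewrite th_lin addrC.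
  by [].
have fx c : c * c^* = 1 -> Fin Nhat psi (x c) /\ F psi (x c) = F psi (x 1).
  move=> c1; split; last by rewrite /F (psi_th_phase hg t0 a0 Tg pd ad Sg psiE r lm c1).
  apply: Fin_sq_add; last exact: Fin_sq_th.
  have -> : sq (th (c *: g r m)) = sq (th (g r m)); last exact: Fin_sq_th.
  apply: quad_ext => [||w]; [by exact: (Nhat_b (Qp_sq_th _).1)|by exact: (Nhat_b (Qp_sq_th _).1)|].
  have -> : th (c *: g r m) = c *: th (g r m) by apply: funext => w'; rewrite thZ.
  rewrite !sq_form //; last exact: bd_scale.
  rewrite adj_scale // scombE dotZl dotZr conjCK mulrA [c^* * c]mulrC c1 mul1r.
  by [].
have i1 : ('i : C) * 'i^* = 1 by rewrite conjCi mulrN -expr2 sqrCi opprK.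
have n1 : (-1 : C) * (-1)^* = 1 by rewrite rmorphN /= conjC1 mulrNN mulr1.
have n2 : (- 'i : C) * (- 'i)^* = 1 by rewrite rmorphN /= mulrNN.
have o1 : (1 : C) * 1^* = 1 by rewrite conjC1 mulr1.
have -> : EE (th (g r l) \o adj (th (g r m))) v v' =
    4%:R^-1 *: ((EE (x 1) v v' - EE (x (-1)) v v') + 'i *: (EE (x 'i) v v' - EE (x (- 'i)) v v')).
  have bx c : bd (x c) by exact: (Nhat_b (Qp_sq_th _).1).
  have bxy (y z : K -> K) : bd y -> bd z -> EE (y - z) v v' = EE y v v' - EE z v v'.
    move=> b1 b2; have e := EE_lin (-1) v v' b2 b1; rewrite !scaleN1r in e.
    by rewrite addrC e addrC.
  rewrite (polar_op bl bm).
  have -> : sq (th (g r l) + th (g r m)) = x 1 by rewrite xE scale1r.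
  have -> : sq (th (g r l) - th (g r m)) = x (-1) by rewrite xE scaleN1r.
  have -> : sq (th (g r l) + 'i *: th (g r m)) = x 'i by rewrite xE.
  have -> : sq (th (g r l) - 'i *: th (g r m)) = x (- 'i) by rewrite xE scaleNr.
  have b1 := bd_sub (bx 1) (bx (-1)); have b2 := bd_sub (bx 'i) (bx (- 'i)).
  rewrite EE_Z; last by apply: bd_add => //; exact: bd_scale.
  rewrite EE_D //; last exact: bd_scale.
  by rewrite EE_Z // !bxy.
have gx c (c1 : c * c^* = 1) : wg (EE (x c) v v') ('[v, v'] * cplx (F psi (x 1))).
  by have [h1 <-] := fx c c1; exact: EE_graph.
have := wgraph_polar Nv hpsi (gx 1 o1) (gx (-1) n1) (gx 'i i1) (gx (- 'i) n2).
by rewrite !subrr mulr0 addr0 mulr0.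
Qed.

End PsiForm.

(** * Bases of the multiplicity spaces and the legs of Z at block vectors *)

Section Multiplicity.

Definition ub (s : gI G) (k : nat) : K := gs (fun n => ee s (onb K n)) k.

Lemma ub_Kr s k : Kr s (ub s k).
Proof.
rewrite /ub; elim/ltn_ind: k => k IH; have be : bd (ee s) by exact: th_b.
rewrite /Kr gsE /nlz (lopZ be) (lopB be) ee_ee (lop_sum be); congr (_ *: (_ - _)).
by apply: eq_bigr => i _; rewrite (lopZ be) IH.
Qed.

Lemma ub_orth s k k' : k != k' -> '[ub s k, ub s k'] = 0.
Proof. exact: gs_orth. Qed.

Lemma ub_unit s k : '[ub s k, ub s k] = 0 \/ '[ub s k, ub s k] = 1.
Proof. exact: gs_unit. Qed.

Lemma ub_total s v : Kr s v -> (forall k, '[v, ub s k] = 0) -> v = 0.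
Proof.
move=> kv h; have be : bd (ee s) by exact: th_b.
have [_ _ ed] := onbP K; apply: (onb_ext ed) => n.
have -> : '[v, onb K n] = '[v, ee s (onb K n)] by rewrite -{1}kv (adjr _ _ be) ee_adj.
apply: (span_ind (Q := fun x => '[v, x] = 0) _ _ (gs_span (fun n => ee s (onb K n)) n)).
  by rewrite dot0r.
by move=> c x y [k _ <-] hy; rewrite dotDr dotZr hy (h k) mulr0 addr0.
Qed.

Lemma block_orth s s' (h : Hr s) (h' : Hr s') u u' : s != s' -> '[th h u, th h' u'] = 0.
Proof.
move=> ss'; have b' := th_b h'; rewrite dotC (adjr _ _ b').
have E : adj (th h') \o th h = 0.
  have Na := Nhat_adj (th_N h').
  apply: (pi_inj (Nhat_comp Na (th_N h)) Nhat_0) => r.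
  rewrite pir_mul // pi_adj // pi_0.
  have [rs|rs] := eqVneq r s.
    have -> : pi r (th h') = 0.
      by have [_ _ ->] := rhoP (bd_rk h' (eps s')); rewrite ?rs.
    have az : adj (0 : Hr r -> Hr r) = 0.
      by apply: adj_uniq => [|x y]; [exact: bd_0|rewrite zfunE zfunE dot0l dot0r].
    by apply: funext => x /=; rewrite az.
  have -> : pi r (th h) = 0 by have [_ _ ->] := rhoP (bd_rk h (eps s)).
  have ba : bd (adj (pi r (th h'))) by apply: bd_adj; exact: pi_b.
  by apply: funext => x /=; exact: lop0 ba.
have -> : adj (th h') (th h u) = 0 by exact: (congr1 (@^~ u) E).
by rewrite dot0r conjC0.
Qed.

Lemma ub_block s s' k k' : s != s' -> '[ub s k, ub s' k'] = 0.
Proof.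
move=> h; rewrite -(th_eps (ub_Kr s k)) -(th_eps (ub_Kr s' k')).
exact: block_orth.
Qed.

Lemma ub_idx s s' k k' : (s, k) != (s', k') -> '[ub s k, ub s' k'] = 0.
Proof.
move=> ne; have [e|e] := eqVneq s s'; last exact: ub_block.
subst s'; apply: ub_orth; apply: contraNN ne => /eqP ->.
by rewrite eqxx.
Qed.

Lemma th_idx s s' k k' (h : Hr s) (h' : Hr s') : (s, k) != (s', k') ->
  '[th h (ub s k), th h' (ub s' k')] = 0.
Proof.
move=> ne; have [e|e] := eqVneq s s'; last exact: block_orth.
subst s'; rewrite th_dot; last exact: ub_Kr.
by rewrite ub_idx // mulr0.
Qed.

Section SecondLeg.
Variables (r : gI G) (u : K).
Hypotheses (ku : Kr r u) (u01 : '[u, u] = 0 \/ '[u, u] = 1).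
Let J (h : Hr r) : K := th h u.
Let bJ : bd J. Proof. exact: bd_th_l. Qed.
Let JJ (h : Hr r) : J (adj J (J h)) = J h.
Proof.
have e : adj J (J h) = '[u, u] *: h.
  by apply: dot_ext => k; rewrite adjl // dotZl /J th_dot // mulrC.
rewrite e (lopZ bJ); case: u01 => c; last by rewrite c scale1r.
by rewrite c scale0r /J (dot_eq0 c) (lop0 (th_b h)).
Qed.

Lemma second_leg v (h : Hr r) : ampr K (J \o adj J) (Z (v ⊗v th h u)) = Z (v ⊗v th h u).
Proof.
have bb : bd (J \o adj J) by apply: bd_comp => //; exact: bd_adj.
apply: tdot_ext => b c; have bt := bd_tensor (bd_id K) bb.
have e x : '[x, b ⊗v c] = '[lsl b x, c] by rewrite lslE.
rewrite !e lsl_tensor //.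
have -> : lsl b (Z (v ⊗v th h u)) = J (pi r (ss v b) h).
  by apply: dot_ext => w; rewrite lslE -ssE x_th.
by rewrite /= JJ.
Qed.

(** The first leg of X lies in Kr s, the range of i; the second lies in the range of J, because
    slices of Z act on th h u through h alone. So X comes from a vector of H_s ⊗ H_r. *)
Lemma leg_form s (i : Hr s -> K) (k : Hr s) v (h : Hr r) : bd i ->
  (forall w, Kr s w -> i (adj i w) = w) ->
  let X := ampl (adj (th k)) K (Z (v ⊗v th h u)) in
  X = tensor_op i J (tensor_op (adj i) (adj J) X).
Proof.
move=> bi ii X; have bai := bd_adj bi; have baJ := bd_adj bJ; have bk : bd (adj (th k)) by exact: bd_adj.
have bII : bd (i \o adj i) by exact: bd_comp.
have bJJ : bd (J \o adj J) by exact: bd_comp.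
have -> : tensor_op i J (tensor_op (adj i) (adj J) X) = tensor_op (i \o adj i) (J \o adj J) X.
  exact: (congr1 (@^~ X) (tensor_comp bi bJ bai baJ)).
rewrite /X -[in LHS]second_leg.
transitivity (tensor_op (adj (th k)) (J \o adj J) (Z (v ⊗v th h u))).
  exact: (congr1 (@^~ _) (tensor_comp bk (bd_id K) (bd_id K) bJJ)).
transitivity (tensor_op ((i \o adj i) \o adj (th k)) ((J \o adj J) \o idfun) (Z (v ⊗v th h u))).
  congr (tensor_op _ _ _); apply: funext => w /=; rewrite ii //.
  exact: adj_th_ee.
exact: (congr1 (@^~ _) (esym (tensor_comp bII bJJ bk (bd_id K)))).
Qed.

End SecondLeg.

Lemma leg_dot (L1 L2 L3 : hilbert R) (i : L1 -> K) (j : L2 -> K) (j' : L3 -> K) (x : L1 ⊗ L2) (x' : L1 ⊗ L3) :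
  bd i -> bd j -> bd j' -> (forall h h', '[j h, j' h'] = 0) ->
  '[tensor_op i j x, tensor_op i j' x'] = 0.
Proof.
move=> bi bj bj' h0.
have bt : bd (tensor_op i j) by exact: bd_tensor.
rewrite (adjr _ _ bt) (adj_tensor bi bj); have ba := bd_adj bi; have baj := bd_adj bj.
have E : tensor_op (adj i) (adj j) \o tensor_op i j' = 0.
  apply: tens_ext => [||y z]; [by apply: bd_comp => //; exact: bd_tensor|exact: bd_0|].
  rewrite /= tensorE // tensorE //; have -> : adj j (j' z) = 0.
    by apply: dot_ext0 => w; rewrite adjl // dotC h0 conjC0.
  by rewrite pure0r.
by rewrite -[tensor_op (adj i) _ _]/((tensor_op (adj i) (adj j) \o tensor_op i j') x') E dot0r.
Qed.

Lemma leg_iso (L1 L2 : hilbert R) (i : L1 -> K) (j : L2 -> K) (x x' : L1 ⊗ L2) :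
  bd i -> bd j -> (forall h h', '[i h, i h'] = '[h, h']) ->
  (forall h h', '[j h, j h'] = '[h, h']) ->
  '[tensor_op i j x, tensor_op i j x'] = '[x, x'].
Proof.
move=> bi bj hi hj.
have bt : bd (tensor_op i j) by exact: bd_tensor.
rewrite (adjr _ _ bt) (adj_tensor bi bj); have ba := bd_adj bi; have baj := bd_adj bj.
have E : tensor_op (adj i) (adj j) \o tensor_op i j = idfun.
  rewrite tensor_comp //.
  have -> : adj i \o i = idfun by apply: funext => y; exact: iso_adjK.
  have -> : adj j \o j = idfun by apply: funext => y; exact: iso_adjK.
  exact: tensor_id.
by rewrite -[tensor_op (adj i) _ _]/((tensor_op (adj i) (adj j) \o tensor_op i j) x') E.
Qed.

End Multiplicity.

(** * Finite truncations of diagonal operators *)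

Section FiniteParts.

Variable (g : forall r, nat -> Hr r).
Hypothesis hg : forall r, is_onb (g r).

Lemma th_orth_total (u : gI G -> nat -> K) z :
  (forall s v, Kr s v -> (forall k, '[v, u s k] = 0) -> v = 0) ->
  (forall s l k, '[th (g s l) (u s k), z] = 0) -> z = 0.
Proof.
move=> hu hz; apply: (dense_span_ext0 th_total) => _ [s [h [w ->]]].
have bl := bd_th_l s w; have [_ _ gd] := hg s.
rewrite (adjr h z bl); have -> : adj (fun h : Hr s => th h w) z = 0; last by rewrite dot0r.
apply: (dense_span_ext0 gd) => _ [l _ <-].
rewrite -(adjr _ _ bl) (adjr _ _ (th_b _)).
have -> : adj (th (g s l)) z = 0; last by rewrite dot0r.
apply: (hu s) => [|k]; first exact: adj_th_ee.
by rewrite adjl // dotC hz conjC0.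
Qed.

(** A finite truncation of the diagonal operator with eigenvalue c r j at th (g r j) w; that
    operator itself may be unbounded. *)
Definition SJ (c : gI G -> nat -> R) rs n : K -> K :=
  \sum_(r <- rs) \sum_(j < n) cplx (c r j) *: (th (g r j) \o adj (th (g r j))).

Lemma bd_SJ c rs n : bd (SJ c rs n).
Proof.
apply: bd_sum => r _; apply: bd_sum => j _; apply: bd_scale; apply: bd_comp => //; exact: bd_adj.
Qed.

Lemma SJ_form c rs n (z : K ⊗ K) : '[ampl (SJ c rs n) K z, z] =
  \sum_(r <- rs) \sum_(j < n) cplx (c r j) *
    '[ampl (adj (th (g r j))) K z, ampl (adj (th (g r j))) K z] :> C.
Proof.
have b r j : bd (th (g r j) \o adj (th (g r j))) by apply: bd_comp => //; exact: bd_adj.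
have lin I r (P : pred I) (F : I -> K -> K) : (forall i, bd (F i)) ->
    '[ampl (\sum_(i <- r | P i) F i) K z, z] =
    \sum_(i <- r | P i) '[ampl (F i) K z, z] :> C.
  move=> bF; elim: r => [|i r IH].
    by rewrite !big_nil (_ : tensor_op 0 idfun = 0) ?dot0l // -(scale0r (idfun : K -> K)) tensorZl // scale0r.
  rewrite !big_cons; case: (P i) => //; rewrite -IH -dotDl -[F i]scale1r.
  by rewrite tensor_linl // ?scale1r //; exact: bd_sum.
rewrite lin => [|r]; last by apply: bd_sum => j _; exact: bd_scale.
apply: eq_bigr => r _; rewrite lin => [|j]; last exact: bd_scale.
apply: eq_bigr => j _; rewrite tensorZl // dotZl; congr (_ * _).
have ba : bd (adj (th (g r j))) by exact: bd_adj.
have -> : ampl (th (g r j) \o adj (th (g r j))) K =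
    ampl (th (g r j)) K \o ampl (adj (th (g r j))) K.
  by rewrite tensor_comp.
by rewrite /= (adjr _ _ (bd_tensor (th_b _) (bd_id K))) (adj_tensor (th_b _) (bd_id K)) adj_idfun.
Qed.

Lemma pos_SJ c rs n : (forall r j, 0 <= c r j) -> pos (ampl (SJ c rs n) K).
Proof.
move=> c0; split; first by apply: bd_tensor => //; exact: bd_SJ.
move=> z; rewrite SJ_form; apply: sumr_ge0 => r _; apply: sumr_ge0 => j _.
by rewrite mulr_ge0 // cplx_ge0.
Qed.

Lemma SJE c rs n w : SJ c rs n w =
  \sum_(r <- rs) \sum_(j < n) cplx (c r j) *: th (g r j) (adj (th (g r j)) w).
Proof.
by rewrite /SJ fct_sumE; apply: eq_bigr => r _; rewrite fct_sumE; apply: eq_bigr => j _.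
Qed.

Lemma SJ_th c rs n r j w : uniq rs -> r \in rs -> (j < n)%N ->
  SJ c rs n (th (g r j) w) = cplx (c r j) *: th (g r j) w.
Proof.
move=> urs rr jn; have [go gu _] := hg r.
rewrite SJE (bigD1_seq r) //= [X in _ + X]big1_seq => [|s /andP[sr _]]; last first.
  rewrite big1 // => i _; have -> : adj (th (g s i)) (th (g r j) w) = 0.
    by apply: dot_ext0 => v; rewrite adjl // block_orth // eq_sym.
  by rewrite (lop0 (th_b _)) scaler0.
rewrite addr0 (bigD1 (Ordinal jn)) //= big1 => [|i ij].
  rewrite addr0 adj_th_th (lopZ (th_b _)) th_ee; case: (gu j) => e; last by rewrite e scale1r.
  by rewrite e scale0r (dot_eq0 e) (_ : th 0 w = 0) ?scaler0 //; exact: (lop0 (bd_th_l r w)).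
rewrite adj_th_th go ?scale0r ?(lop0 (th_b _)) ?scaler0 //.
by apply: contraNN ij => /eqP e; apply/eqP; apply: val_inj.
Qed.

Lemma SJ_bessel rs n (z : K ⊗ K) : uniq rs ->
  '[ampl (SJ (fun _ _ => 1) rs n) K z, z] <= '[z, z] :> C.
Proof.
move=> urs; set E := SJ _ rs n; have bE : bd E by exact: bd_SJ.
have EE : E \o E = E.
  apply: funext => w /=; rewrite {2}/E SJE (lop_sum bE) [in RHS]/E SJE.
  apply: eq_big_seq => r rr; rewrite (lop_sum bE); apply: eq_bigr => j _.
  by rewrite (lopZ bE) /E SJ_th ?ltn_ord // cplx1 !scale1r.
have pE : pos (ampl E K) by exact: pos_SJ.
have bt := pos_bd pE.
have tE : ampl E K \o ampl E K = ampl E K.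
  by rewrite tensor_comp // EE.
have e1 : '[ampl E K z, ampl E K z] =
    '[ampl E K z, z] :> C.
  have tz : ampl E K (ampl E K z) = ampl E K z.
    exact: (congr1 (@^~ z) tE).
  by rewrite (adjr z _ bt) (pos_adj pE) tz (adjr z _ bt) (pos_adj pE).
have := dot_ge0 (z - ampl E K z).
rewrite dotBl !dotBr e1 (adjr _ _ bt) (pos_adj pE).
have -> : '[z, ampl E K z] = '[ampl E K z, z].
  by rewrite (adjr _ _ bt) (pos_adj pE).
by rewrite subrr subr0 subr_ge0.
Qed.

Lemma SJ_reach c (x : K -> K) (L : hilbert R) (z : K ⊗ L) : bd x ->
  (forall r j w, x (th (g r j) w) = cplx (c r j) *: th (g r j) w) ->
  span [set z | exists r j w b, z = th (g r j) w ⊗v b] z -> exists rs n, uniq rs /\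
  ampl (SJ c rs n) L z = ampl x L z.
Proof.
move=> bx hx hz; have bS rs n := bd_SJ c rs n.
(* Agreement is asked for all larger truncations, so that the ones found for two summands can be
   merged. *)
have : exists (rs : seq (gI G)) n, forall rs' n', uniq rs' -> {subset rs <= rs'} -> (n <= n')%N ->
    ampl (SJ c rs' n') L z = ampl x L z.
  apply: (span_ind (Q := fun z => exists (rs : seq (gI G)) n, forall rs' n', uniq rs' -> {subset rs <= rs'} -> (n <= n')%N ->
    ampl (SJ c rs' n') L z = ampl x L z) _ _ hz).
    by exists [::], 0%N => rs' n' _ _ _; rewrite !lop0 //; exact: bd_tensor.
  move=> k _ y [r [j [w [b ->]]]] [rs [n h]]; exists (r :: rs), (maxn j.+1 n) => rs' n' u sub le.
  have b1 : bd (ampl (SJ c rs' n') L) by exact: bd_tensor.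
  have b2 : bd (ampl x L) by exact: bd_tensor.
  rewrite (lopP b1) (lopP b2) h //; first last.
  - by rewrite (leq_trans _ le) // leq_maxr.
  - by move=> s hs; apply: sub; rewrite in_cons hs orbT.
  rewrite !tensorE // hx SJ_th //; first by apply: sub; rewrite mem_head.
  by rewrite (leq_trans _ le) // leq_maxl.
move=> [rs [n h]]; exists (undup rs), n; split; first exact: undup_uniq.
by apply: h => //; [exact: undup_uniq|move=> r; rewrite mem_undup].
Qed.
End FiniteParts.

(** * The inequality for R is an equality *)

Section Equality.

(** Y is the adjoint of the unitary W of M. Invariance of the Haar state makes it an isometry;
    [DN_YY] takes the place of surjectivity. *)
Lemma Y_ex : exists2 Y : H ⊗ H -> H ⊗ H, bd Y &
  (forall a m, M m -> Y (a ⊗v m xi) = DM m (a ⊗v xi)) /\ forall x y, '[Y x, Y y] = '[x, y].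
Proof.
have [Y bY [h1 h2]] : exists2 u : H ⊗ H -> H ⊗ H, bd u &
    (forall i : H * {m : H -> H | M m}, u (i.1 ⊗v (sval i.2) xi) = DM (sval i.2) (i.1 ⊗v xi)) /\
    forall x y, '[u x, u y] = '[x, y].
  apply: (@iso_ext _ _ _ (H * {m : H -> H | M m}) (fun i => i.1 ⊗v (sval i.2) xi)
    (fun i => DM (sval i.2) (i.1 ⊗v xi))) => [[v [m hm]] [v' [m' hm']]|].
    rewrite /= pure_dot.
    have ba : bd (adj m') by apply: bd_adj; exact: Mb.
    have bDm := DM_b hm; have bDm' := DM_b hm'.
    have Mc : M (adj m' \o m) by apply: Mmul => //; exact: Madj.
    have := M_inv2 v v' Mc; rewrite DM_mul //; last exact: Madj.
    have -> : DM (adj m') = adj (DM m') by have [[_ _ [_ h _] _ _] _ _ _] := hM; exact: h.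
    rewrite /= adjl // adjl; last exact: Mb.
    by move=> ->; rewrite mulrC.
  apply: dense_sub (@dense_pure R tens H H [set: H] [set v | exists2 x, M x & v = x xi] _ _) => [z|z hz|z hz].
  - apply: (span_ind (Q := span _)) => [|c _ u [x [y [_ [m hm ->] ->]]] hu]; first exact: span0.
    by apply: spanD => //; apply: spanZ; apply: span_gen; exists (x, exist _ m hm).
  - by apply: dot_eq0; exact: hz.
  - exact: (dense_orth0 (@Mxi_dense) hz).
exists Y => //; split=> // v m hm; exact: (h1 (v, exist _ m hm)).
Qed.

Section WithY.
Variable Y : H ⊗ H -> H ⊗ H.
Hypotheses (bY : bd Y) (YE : forall a m, M m -> Y (a ⊗v m xi) = DM m (a ⊗v xi))
  (Yd : forall x y, '[Y x, Y y] = '[x, y]).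

Lemma Z_DN_Y n z : N n -> Z (ampr H n z) = DN n (Y z).
Proof.
move=> Nn; have bn := Nb Nn; have bD := DN_b Nn.
have bt : bd (ampr H n) by exact: bd_tensor.
have E : Z \o ampr H n = DN n \o Y.
  apply: (@op_ext_span _ _ _ _ _ [set z | exists x y, [/\ [set: H] x, [set v | exists2 x, M x & v = x xi] y & z = x ⊗v y]]).
  - exact: (bd_comp bZ bt).
  - exact: bd_comp.
  - apply: dense_pure => z' hz'; first by apply: dot_eq0; exact: hz'.
    exact: (dense_orth0 (@Mxi_dense) hz').
  move=> _ [v [_ [_ [m hm ->] ->]]]; have bm := Mb hm.
  have e : ampr H n (v ⊗v m xi) = v ⊗v (n \o m) xi by rewrite tensorE.
  by rewrite /= e (ZE _ (NM Nn hm)) YE // DNM.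
exact: (congr1 (@^~ z) E).
Qed.

(** (DN x)^* Z sends v ⊗ y xi to Y (v ⊗ x^* y xi), so the range of the adjoint of DN x lies in that
    of Y. *)
Lemma DN_YY x z : N x -> DN x (Y (adj Y z)) = DN x z.
Proof.
move=> Nx; have bD := DN_b Nx; apply: dot_ext => w; rewrite -(unK (un_adj unZ) w).
set w' := adj (adj _) w; have bZ' := bZ.
rewrite adjK //; set u := (w' : H ⊗ K).
have h : adj (DN x) \o Z = Y \o adj Y \o (adj (DN x) \o Z).
  have bl : bd (adj (DN x) \o Z) by apply: bd_comp => //; exact: bd_adj.
  apply: (@op_ext_span _ _ _ _ _ [set z | exists x y, [/\ [set: H] x, [set v | exists2 x, N x & v = x xi] y & z = x ⊗v y]]) => //.
  - by apply: bd_comp => //; apply: bd_comp => //; exact: bd_adj.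
  - apply: dense_pure => z' hz'; first by apply: dot_eq0; exact: hz'.
    exact: (dense_orth0 (@Nxi_dense) hz').
  move=> _ [v [_ [_ [y hy ->] ->]]]; have Mxy := NNM Nx hy.
  have e : (adj (DN x) \o Z) (v ⊗v y xi) = Y (v ⊗v (adj x \o y) xi).
    by rewrite YE // -DNN //= ZE.
  by rewrite [RHS]/= -/((adj (DN x) \o Z) (v ⊗v y xi)) e iso_adjK.
rewrite !(adjr _ _ bD); have e1 := congr1 (@^~ u) h; rewrite /= in e1; rewrite [in RHS]e1.
by rewrite (adjr _ _ bY) -(adjl _ _ bY).
Qed.

Lemma vslice_YM z w : M (vslice2 Y z w).
Proof.
have [_ _ _ _ Mcl] : is_vna M by have [[]] := hM.
have [c c0 hc] := vslice2_bound bY; apply: (Mcl); apply: (sw_norm_closed (@Mb)) => [|e e0]; first exact: bd_vslice2.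
have k0 : 0 < c * `|w| + 1 by rewrite ltr_wpDl // mulr_ge0.
have [_ [m Mm ->] hm] := (denseP _).1 (@Mxi_dense) z _ (divr_gt0 e0 k0).
exists (vslice2 Y (m xi) w) => [|v].
  have -> : vslice2 Y (m xi) w = vslice2 (DM m) xi w.
    by apply: op_ext => a b; rewrite !vslice2E ?YE //; exact: DM_b.
  have [[_ [h _ _] _ _ _] _ _ _] := hM.
  by apply: vn_slice2 (h _ Mm); [exact: Mb|exact: Mb|exact: Msub|exact: Mcl].
have -> : vslice2 Y z w v - vslice2 Y (m xi) w v = vslice2 Y (z - m xi) w v.
  apply: dot_ext => b; rewrite dotBl !vslice2E // -dotBl -(lopB bY); congr '[Y _, _].
  exact/esym/(lopB (bd_pr H v)).
apply: le_trans (hc _ _ _) _; rewrite ler_wpM2r //.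
rewrite ltr_pdivlMr // mulrC in hm; apply: le_trans (ltW hm).
by rewrite mulrDl mul1r mulrAC lerDl.
Qed.

(** For such z each slice [vslice2 Y z w] is an element of M whose adjoint kills xi, hence is 0
    because xi is separating. So Y (a ⊗ z) = 0 for all a, and Y is isometric. *)
Lemma slices_total z : (forall f v, '[lsl f (adj Y (xi ⊗v v)), z] = 0) -> z = 0.
Proof.
move=> h; suff Y0 a : Y (a ⊗v z) = 0.
  have := Yd (xi ⊗v z) (xi ⊗v z); rewrite Y0 dot0l pure_dot xi1 mul1r => e.
  by apply: dot_eq0.
apply: tdot_ext => b w; rewrite dot0l -vslice2E //.
have -> : vslice2 Y z w = 0; last by rewrite zfunE dot0l.
have Mx := vslice_YM z w; have bx := Mb Mx.
have -> : vslice2 Y z w = adj (adj (vslice2 Y z w)) by rewrite adjK.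
have -> : adj (vslice2 Y z w) = 0.
  apply: (Msep (Madj Mx)); apply: dot_ext0 => f.
  rewrite adjl // dotC vslice2E; have := h f w; rewrite lslE adjl // => e.
  by rewrite -dotC.
by apply: adj_uniq => [|x y]; [exact: bd_0|rewrite zfunE zfunE dot0l dot0r].
Qed.

Variable y : K -> K.
Hypotheses (yN : Nhat y) (ya : adj y = y).
Hypothesis hle : forall z, '[ampl (y \o y) K (Z z), Z z] <=
  '[ampr H (y \o y) z, z] :> C.
Let by_ : bd y. Proof. exact: Nhat_b. Qed.
Let bR : bd (y \o y). Proof. exact: bd_comp. Qed.

Definition Adiff : H ⊗ K -> H ⊗ K := ampr H (y \o y) -
  (adj (Z : H ⊗ K -> K ⊗ K) \o (ampl (y \o y) K \o Z)).

Lemma Adiff_form z : '[Adiff z, z] = '[ampr H (y \o y) z, z] -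
  '[ampl (y \o y) K (Z z), Z z] :> C.
Proof. by rewrite /Adiff dotBl; congr (_ - _); exact: (adjl _ _ bZ). Qed.

Lemma pos_Adiff : pos Adiff.
Proof.
have bt : bd (ampl (y \o y) K) by exact: bd_tensor.
split=> [|z]; last by rewrite Adiff_form subr_ge0.
apply: bd_sub; first exact: bd_tensor.
exact: (bd_comp (bd_adj bZ) (bd_comp bt bZ)).
Qed.

Section Vectors.
Variables (v : H) (w : K).
Local Notation Zw := (fun a : H => Z (a ⊗v w)).
Let bZw : bd Zw.
Proof. exact: (bd_comp bZ (bd_pl H w)). Qed.

Let Dw : H -> H := '[y (y w), w] *: (idfun : H -> H) -
  (adj Zw \o (ampl (y \o y) K \o Zw)).

Lemma Dw_form a : '[Dw a, a] = '[y (y w), w] * '[a, a] -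
  '[ampl (y \o y) K (Z (a ⊗v w)), Z (a ⊗v w)] :> C.
Proof. by rewrite /Dw dotBl dotZl; congr (_ - _); exact: (adjl _ _ bZw). Qed.

Lemma pos_Dw : pos Dw.
Proof.
have bt : bd (ampl (y \o y) K) by exact: bd_tensor.
split=> [|a]; first by apply: bd_sub; [apply: bd_scale; exact: bd_id|exact: (bd_comp (bd_adj bZw) (bd_comp bt bZw))].
rewrite Dw_form subr_ge0 mulrC -pure_dot; have := hle (a ⊗v w).
by rewrite (tensorE a w (bd_id H) bR).
Qed.

Let z0 := adj Y (xi ⊗v v).
Let Xi : (H ⊗ K) ⊗ K := adj (@assoc _ _ H K K) (ampr H Zw z0).

Let rsl_Xi e : rsl e Xi = ampr H (nn e w) z0.
Proof.
apply: tdot_ext => a b; rewrite rslE (adjl _ _ (bd_assoc H K K)) assocE -lslE lsl_tensor //.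
by rewrite -nnE -(lsl_tensor a z0 (bd_nn e w)) lslE.
Qed.

Let Phi : (K ⊗ K) ⊗ K := ampl (Z : H ⊗ K -> K ⊗ K) K Xi.

Let Phi_form b1 b2 e : '[Phi, (b1 ⊗v b2) ⊗v e] = '[ss v b2 (ss xi b1 w), e].
Proof.
rewrite -rslE (rsl_tensor e Xi bZ) rsl_Xi Z_DN_Y; last exact: N_nn.
by rewrite DN_YY ?DN_nn //; exact: N_nn.
Qed.

Let Zv : K -> K ⊗ K := fun x => Z (v ⊗v x).
Let bZv : bd Zv. Proof. exact: bd_Zl. Qed.

Let Phi_y : ampl (ampl y K) K Phi =
  adj (@assoc _ _ K K K) (ampr K Zv (Z (xi ⊗v y w))).
Proof.
have bt : bd (ampl y K) by exact: bd_tensor.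
have btt : bd (ampl (ampl y K) K) by exact: bd_tensor.
apply: tdot_ext => b e; rewrite -!rslE; congr '[_, _]; apply: tdot_ext => b1 b2; rewrite !rslE.
rewrite (adjr _ _ btt) (adj_tensor bt (bd_id K)) (adj_tensor by_ (bd_id K)) !adj_idfun ya.
rewrite (tensorE _ _ bt (bd_id K)) (tensorE _ _ by_ (bd_id K)) Phi_form.
rewrite (adjl _ _ (bd_assoc K K K)) assocE -lslE lsl_tensor //.
rewrite -[RHS]ssE; congr '[ss v b2 _, e]; apply: dot_ext => c.
by rewrite lslE -ssE !ss_xi_qq qq_Nhat // ya.
Qed.

Let Phi_norm : '[ampl (ampl (y \o y) K) K Phi, Phi] =
  '[v, v] * '[y (y w), w] :> C.
Proof.
have bt : bd (ampl y K) by exact: bd_tensor.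
have btt : bd (ampl (ampl y K) K) by exact: bd_tensor.
have -> : ampl (ampl (y \o y) K) K =
    ampl (ampl y K) K \o
    ampl (ampl y K) K.
  by rewrite tensor_comp // tensor_comp.
rewrite /= (adjr _ _ btt) (adj_tensor bt (bd_id K)) (adj_tensor by_ (bd_id K)) !adj_idfun ya Phi_y.
rewrite adj_assoc_dot (adjr _ _ (bd_tensor (bd_id K) bZv)) (adj_tensor (bd_id K) bZv) adj_idfun.
have e : adj Zv \o Zv = '[v, v] *: idfun.
  apply: op_ext => a b; rewrite /= (adjl _ _ bZv) (un_dot unZ) pure_dot.
  by rewrite (_ : ('[v, v] *: (idfun : K -> K)) a = '[v, v] *: a) // dotZl.
have -> : ampr K (adj Zv) (ampr K Zv (Z (xi ⊗v y w))) =
    '[v, v] *: Z (xi ⊗v y w).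
  apply: tdot_ext => a b; rewrite -lslE (lsl_tensor a _ (bd_adj bZv)) (lsl_tensor a _ bZv).
  have := congr1 (@^~ (lsl a (Z (xi ⊗v y w)))) e; rewrite /= => ->.
  by rewrite (_ : ('[v, v] *: (idfun : K -> K)) _ = '[v, v] *: lsl a (Z (xi ⊗v y w))) // !dotZl lslE.
rewrite dotZr -dotC (un_dot unZ) pure_dot xi1 mul1r; congr (_ * _).
by rewrite [RHS](adjr _ _ by_) ya.
Qed.

(** [Phi] is Z_12 Z_23 Y_12^* at xi ⊗ v ⊗ w. By [DN_nn] it is Z (xi ⊗ w) with Z (v ⊗ -) applied to
    its second leg, and y passes to w because Z (xi ⊗ w) = Vt (w ⊗ xi); so R on its first leg has
    form |v|^2 <R w, w>. The assumed inequality at [Xi] bounds this by the form of 1 ⊗ R ⊗ 1, and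
    |z0| <= |v| leaves nothing for the positive form of [Dw] at z0. *)
Lemma slice_null f : Dw (lsl f z0) = 0.
Proof.
have pA := (pos_amp_l H pos_Dw).2 z0; have bD := pos_bd pos_Dw.
have bt : bd (ampl (y \o y) K) by exact: bd_tensor.
rewrite -(lsl_tensor f z0 bD); suff -> : ampr H Dw z0 = 0 by apply: lop0; exact: bd_lsl.
apply: pos_zero; first exact: (pos_amp_l H pos_Dw).
apply: le_anti; rewrite pA andbT.
have b1 : bd (ampr H (y \o y)) by exact: bd_tensor.
have b2 : bd (adj (Z : H ⊗ K -> K ⊗ K) \o (ampl (y \o y) K \o Z)).
  exact: (bd_comp (bd_adj bZ) (bd_comp bt bZ)).
have b3 : bd (adj Zw \o (ampl (y \o y) K \o Zw)).
  exact: (bd_comp (bd_adj bZw) (bd_comp bt bZw)).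
have b4 : bd ('[y (y w), w] *: (idfun : H -> H)) by exact: bd_scale.
have := (pos_amp_r K pos_Adiff).2 Xi.
rewrite /Adiff (tensor_subl _ b1 b2) dotBl (form_conj_l _ bZ bt) -/Phi Phi_norm.
rewrite /Xi (assoc_mid _ bR) adj_assoc_dot -(form_conj_r _ bZw bt) subr_ge0 => le.
rewrite /Dw (tensor_subr _ b4 b3) dotBl subr_le0; apply: le_trans le.
have -> : ampr H ('[y (y w), w] *: (idfun : H -> H)) z0 = '[y (y w), w] *: z0.
  apply: tdot_ext => a b; rewrite -lslE lsl_tensor //.
  by rewrite (_ : ('[y (y w), w] *: (idfun : H -> H)) (lsl a z0) = '[y (y w), w] *: lsl a z0) // !dotZl lslE.
rewrite dotZl mulrC ler_wpM2r //; first by rewrite (adjr _ _ by_) ya.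
have := dot_ge0 (xi ⊗v v - Y z0); rewrite dotBl !dotBr Yd.
have -> : '[Y z0, xi ⊗v v] = '[z0, z0] by rewrite (adjr _ _ bY).
have -> : '[xi ⊗v v, Y z0] = '[z0, z0] by rewrite -(adjl _ _ bY).
by rewrite subrr subr0 subr_ge0 pure_dot xi1 mul1r.
Qed.

End Vectors.
Lemma equality_case a w : '[ampl (y \o y) K (Z (a ⊗v w)), Z (a ⊗v w)] =
  '[y (y w), w] * '[a, a] :> C.
Proof.
pose D : H -> H := '[y (y w), w] *: (idfun : H -> H) - (adj (fun a : H => Z (a ⊗v w)) \o
  (ampl (y \o y) K \o (fun a : H => Z (a ⊗v w)))).
have nul v f : D (lsl f (adj Y (xi ⊗v v))) = 0 by exact: slice_null.
have pD : pos D by exact: pos_Dw.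
have Da : D a = 0.
  apply: slices_total => f v; have := adjr (lsl f (adj Y (xi ⊗v v))) a (pos_bd pD).
  by rewrite (pos_adj pD) nul dot0l => <-.
have := Dw_form w a; rewrite -/D Da dot0l => /esym/eqP; rewrite subr_eq0 => /eqP <-.
by [].
Qed.

End WithY.

Lemma intertwine (y : K -> K) z : Nhat y -> adj y = y ->
  (forall z, '[ampl (y \o y) K (Z z), Z z] <=
    '[ampr H (y \o y) z, z] :> C) ->
  ampl (y \o y) K (Z z) = Z (ampr H (y \o y) z).
Proof.
move=> yN ya hle; have [Y bY [YE Yd]] := Y_ex; have by_ := Nhat_b yN.
have bR : bd (y \o y) by exact: bd_comp.
have bt : bd (ampl (y \o y) K) by exact: bd_tensor.
have b1 : bd (ampr H (y \o y)) by exact: bd_tensor.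
have pA := pos_Adiff yN hle.
have A0 : Adiff y = 0.
  apply: tens_ext => [||a w]; [exact: pos_bd|exact: bd_0|].
  apply: (pos_zero pA); rewrite Adiff_form (equality_case bY YE Yd yN ya hle).
  by rewrite (tensorE a w (bd_id H) bR) pure_dot mulrC subrr.
have e := congr1 (@^~ z) A0; rewrite /Adiff in e.
have {}e : adj (Z : H ⊗ K -> K ⊗ K) (ampl (y \o y) K (Z z)) =
    ampr H (y \o y) z.
  by apply/eqP; rewrite eq_sym -subr_eq0; apply/eqP.
by rewrite -e (unVK unZ).
Qed.

End Equality.

(** * The inequality from psi, its bounded version, and its consequence in a block *)

Section Star.

Variables (f : (K -> K) -> \bar R) (hf : nsf_weight P f).
Hypotheses (hl : left_invariant P DP f) (hr : vector_invariant f).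
Variables (psi : (K -> K) -> \bar R).
Hypotheses (hpsi : nsf_weight Nhat psi) (hinv : coaction_invariant Wt Nhat (dual_algebra V) psi).
Local Notation Nv := Nhat_vna.
Local Notation wg := (wgraph Nhat psi).
Variables (g : forall r, nat -> Hr r) (t a : gI G -> nat -> R).
Hypotheses (hg : forall r, is_onb (g r)) (t0 : forall r n, 0 < t r n) (a0 : forall r n, 0 < a r n).
Hypothesis Tg : forall r n, T r (g r n) = cplx (t r n) *: g r n.
Variable delta : uop K.
Hypotheses (pd : positive_selfadjoint delta) (ad : affiliated Nhat delta).
Hypothesis Sg : forall r n, pi r (shift_inv delta 1) (g r n) = cplx (1 + a r n)^-1 *: g r n.
Hypothesis psiE : forall x, Nhat x -> pos x ->
  psi x = derived_weight (dual_weight pi (@gT _ _ G)) delta x.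
Local Notation nkl := (nkl g).
Local Notation lam := (lam f t).
Local Notation homog := homog.

Definition Ch (r : gI G) : R := complex.Re (chi f r).
Lemma Ch_gt0 r : 0 < Ch r. Proof. by have [] := chiE hf hl hr r. Qed.
(** Chosen so that the square roots left by the modular relation combine in [gam_sqrt] to Ch r / t r
    j, which does not involve s and l. *)
Definition gam s l : R := Num.sqrt (Ch s / t s l).
(** The eigenvalue at g r j of Ch r times A_r T_r^-2; the third claim amounts to its being constant
    in j at the nonzero g r j. *)
Definition Fq r j : R := Ch r * a r j / t r j ^+ 2.
Lemma Fq_gt0 r j : 0 < Fq r j.
Proof. by rewrite /Fq divr_gt0 ?mulr_gt0 ?exprn_gt0 ?Ch_gt0. Qed.

(** [XX] and [YY] are exchanged by the modular relation: one has m xi and block s in the first leg,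
    the other has J (m xi) and block r there. *)
Definition XX r j s l (m : H -> H) : K ⊗ K :=
  ampl (adj (th (g s l))) K (Z (m xi ⊗v th (g r j) (uu r))).
Definition YY r j s k l (m : H -> H) (q : R) : K ⊗ K :=
  ampl (adj (th (g r j))) K (Z (hvec m q ⊗v th (g s l) (ub s k))).

Lemma sqrt_lam r s i j k l : Num.sqrt (lam r i j / lam s k l) * (Num.sqrt (t s k))^-1 * Num.sqrt (t r i) =
  Num.sqrt (Ch r * t s l / (Ch s * t r j)).
Proof.
have [c1 c2] := (Ch_gt0 r, Ch_gt0 s).
have -> : lam r i j / lam s k l = Ch r * t s l / (Ch s * t r j) * (t s k / t r i).
  by rewrite /lam -/(Ch r) -/(Ch s); field; rewrite !gt_eqF.
have p1 : 0 <= Ch r * t s l / (Ch s * t r j) by rewrite divr_ge0 // mulr_ge0 // ltW.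
rewrite (sqrtrM _ p1) (sqrtrM _ (ltW (t0 s k))) (sqrtrV (ltW (t0 r i))).
have s1 : Num.sqrt (t s k) != 0 by rewrite gt_eqF // sqrtr_gt0.
have s2 : Num.sqrt (t r i) != 0 by rewrite gt_eqF // sqrtr_gt0.
by field; rewrite s1 s2.
Qed.

Lemma XX_coef r j s l m k i (ir : Hr s -> K) :
  (forall n, ir (g s n) = (cplx (Num.sqrt (t s n)))^-1 *: kap (g s n)) ->
  '[XX r j s l m, ir (g s k) ⊗v th (g r i) (uu r)] =
  (cplx (Num.sqrt (t s k)))^-1 * '[nkl r i j (m xi), nkl s k l xi] :> C.
Proof.
move=> hi; have bk : bd (adj (th (g s l))) by exact: bd_adj.
rewrite hi pureZl dotZr fmorphV /= cplx_conj; congr (_ * _).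
rewrite /XX (adjr _ _ (bd_tensor bk (bd_id K))) (adj_tensor bk (bd_id K)) adj_idfun adjK //.
by rewrite (tensorE _ _ (th_b _) (bd_id K)) th_kap -nnE.
Qed.

Lemma YY_coef r j s kk l m q k i (ir : Hr r -> K) :
  (forall n, ir (g r n) = (cplx (Num.sqrt (t r n)))^-1 *: kap (g r n)) ->
  '[YY r j s kk l m q, ir (g r i) ⊗v th (g s k) (ub s kk)] =
  (cplx (Num.sqrt (t r i)))^-1 * ('[ub s kk, ub s kk] * '[nkl s k l (hvec m q), nkl r i j xi]) :> C.
Proof.
move=> hi; have bk : bd (adj (th (g r j))) by exact: bd_adj.
rewrite hi pureZl dotZr fmorphV /= cplx_conj; congr (_ * _).
rewrite /YY (adjr _ _ (bd_tensor bk (bd_id K))) (adj_tensor bk (bd_id K)) adj_idfun adjK //.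
rewrite (tensorE _ _ (th_b _) (bd_id K)) th_kap -nnE.
by rewrite (nn_th _ _ _ _ _ (ub_Kr s kk)) (nn_th _ _ _ _ _ (Kr_uu s)) uu1 mulr1 mulrC.
Qed.

Lemma kap_iso r : exists i : Hr r -> K, [/\ bd i, forall x y, '[i x, i y] = '[x, y],
  forall v, Kr r v -> i (adj i v) = v &
  forall n, i (g r n) = (cplx (Num.sqrt (t r n)))^-1 *: kap (g r n)].
Proof.
by have [i [h1 h2 h3 h4 h5]] := Kr_iso_basis (hg r) (Tg r) (fun n _ => t0 r n); exists i.
Qed.

(** By [leg_form] the vectors come from H_s ⊗ H_r and H_r ⊗ H_s. Their coefficients in the
    eigenbases are conjugate by [hvec_nkl], up to a factor that [sqrt_lam] shows to be independent
    of the basis indices; [conj_pair] then compares inner products. *)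
Lemma pairing_eq r j s l k m q l' m' q' : homog m q -> homog m' q' -> '[ub s k, ub s k] = 1 ->
  '[XX r j s l m, XX r j s l' m'] = cplx (Num.sqrt (Ch r * t s l / (Ch s * t r j)) *
    Num.sqrt (Ch r * t s l' / (Ch s * t r j))) * '[YY r j s k l' m' q', YY r j s k l m q] :> C.
Proof.
move=> hm hm' u1; have [i [bi Ii ii ig]] := kap_iso r; have [i' [bi' Ii' ii' ig']] := kap_iso s.
have uk := ub_Kr s k; have ku := Kr_uu r; have uu11 := uu1 r.
pose J := fun h : Hr r => th h (uu r); pose J' := fun h : Hr s => th h (ub s k).
have bJ : bd J by exact: bd_th_l.
have bJ' : bd J' by exact: bd_th_l.
have IJ h h' : '[J h, J h'] = '[h, h'] by rewrite /J th_dot // uu11 mulr1.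
have IJ' h h' : '[J' h, J' h'] = '[h, h'] by rewrite /J' th_dot // u1 mulr1.
have EX l0 m0 : XX r j s l0 m0 = tensor_op i' J (tensor_op (adj i') (adj J) (XX r j s l0 m0)).
  have := @leg_form r (uu r) ku (or_intror uu11) s i' (g s l0) (m0 xi) (g r j) bi' ii'.
  exact.
have EY l0 m0 q0 : YY r j s k l0 m0 q0 = tensor_op i J' (tensor_op (adj i) (adj J') (YY r j s k l0 m0 q0)).
  have := @leg_form s (ub s k) uk (or_intror u1) r i (g r j) (hvec m0 q0) (g s l0) bi ii.
  exact.
have co l0 m0 q0 k0 i0 : homog m0 q0 ->
    '[tensor_op (adj i') (adj J) (XX r j s l0 m0), g s k0 ⊗v g r i0] =
    cplx (Num.sqrt (Ch r * t s l0 / (Ch s * t r j))) *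
    ('[tensor_op (adj i) (adj J') (YY r j s k l0 m0 q0), g r i0 ⊗v g s k0])^* :> C.
  move=> h0; rewrite -(adj_tensor bi' bJ) -(adj_tensor bi bJ').
  rewrite (adjl _ _ (bd_tensor bi' bJ)) (adjl _ _ (bd_tensor bi bJ')) !tensorE //.
  rewrite (XX_coef _ _ _ _ _ _ ig') (YY_coef _ _ _ _ _ _ _ _ ig) u1 mul1r (hvec_nkl hf hl hr t0 Tg _ _ _ _ _ _ h0).
  rewrite rmorphM fmorphV /= cplx_conj -dotC -(sqrt_lam r s i0 j k0 l0) !cplxM !cplxV.
  have p : cplx (Num.sqrt (t r i0)) != 0 :> C by rewrite gt_eqF // cplx_gt0 sqrtr_gt0.
  by field; rewrite p gt_eqF // cplx_gt0 sqrtr_gt0.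
have DX := leg_iso (tensor_op (adj i') (adj J) (XX r j s l m))
  (tensor_op (adj i') (adj J) (XX r j s l' m')) bi' bJ Ii' IJ.
have DY := leg_iso (tensor_op (adj i) (adj J') (YY r j s k l' m' q'))
  (tensor_op (adj i) (adj J') (YY r j s k l m q)) bi bJ' Ii IJ'.
rewrite -!EX in DX; rewrite -!EY in DY; rewrite DX DY.
rewrite (conj_pair (hg s) (hg r) (fun k0 i0 => co l m q k0 i0 hm) (fun k0 i0 => co l' m' q' k0 i0 hm')).
by rewrite cplx_conj -dotC cplxM.
Qed.

Lemma gam_sqrt r j s l l' : gam s l * gam s l' * (Num.sqrt (Ch r * t s l / (Ch s * t r j)) *
    Num.sqrt (Ch r * t s l' / (Ch s * t r j))) = Ch r / t r j.
Proof.
have [c1 c2] := (Ch_gt0 r, Ch_gt0 s).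
have h l0 : gam s l0 * Num.sqrt (Ch r * t s l0 / (Ch s * t r j)) = Num.sqrt (Ch r / t r j).
  rewrite /gam -sqrtrM ?divr_ge0 // ?ltW //; congr Num.sqrt.
  by field; rewrite !gt_eqF.
rewrite mulrACA !h -expr2 sqr_sqrtr // divr_ge0 // ltW //.
Qed.

Lemma YY_orth r j s k l m q s' k' l' m' q' : (s, k) != (s', k') ->
  '[YY r j s' k' l' m' q', YY r j s k l m q] = 0.
Proof.
move=> ne; have [i [bi Ii ii ig]] := kap_iso r; have uk := ub_Kr s k; have uk' := ub_Kr s' k'.
pose J := fun h : Hr s => th h (ub s k); pose J' := fun h : Hr s' => th h (ub s' k').
have bJ : bd J by exact: bd_th_l.
have bJ' : bd J' by exact: bd_th_l.
have E1 := @leg_form s (ub s k) uk (ub_unit s k) r i (g r j) (hvec m q) (g s l) bi ii.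
have E2 := @leg_form s' (ub s' k') uk' (ub_unit s' k') r i (g r j) (hvec m' q') (g s' l') bi ii.
rewrite /YY E1 E2; apply: leg_dot => // h h'; rewrite dotC th_idx ?conjC0 //.
Qed.

Lemma pairing r j s l k m q s' k' l' m' q' : homog m q -> homog m' q' ->
  cplx (gam s l * gam s' l') * '[ub s k, ub s' k'] * '[XX r j s l m, XX r j s' l' m'] =
  cplx (Ch r / t r j) * '[YY r j s' k' l' m' q', YY r j s k l m q] :> C.
Proof.
move=> hm hm'; have [e|ne] := eqVneq (s, k) (s', k'); last first.
  by rewrite (ub_idx ne) mulr0 mul0r YY_orth // mulr0.
case: e => es ek; subst s' k'; have [u0|u1] := ub_unit s k.
  rewrite u0 mulr0 mul0r; suff -> : YY r j s k l m q = 0 by rewrite dot0r mulr0.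
  rewrite /YY (dot_eq0 u0) (lop0 (th_b _)) pure0r (lop0 bZ).
  by apply: lop0; apply: bd_tensor => //; exact: bd_adj.
by rewrite u1 mulr1 (pairing_eq _ _ _ _ hm hm' u1) mulrA -cplxM gam_sqrt.
Qed.

Lemma wg_term s k l m q s' k' l' m' q' : homog m q -> homog m' q' ->
  wg ((cplx (gam s l * gam s' l') * '[ub s k, ub s' k']) *:
      EE (th (g s' l') \o adj (th (g s l))) (m xi) (m' xi))
    (cplx (Fq s' l') * ('[hvec m' q', hvec m q] * '[th (g s' l') (ub s' k'), th (g s l) (ub s k)])).
Proof.
move=> hm hm'; have [e|ne] := eqVneq (s, k) (s', k'); last first.
  rewrite (ub_idx ne) mulr0 scale0r th_idx; last by rewrite eq_sym.
  by rewrite !mulr0; exact: (wgraph_0 Nv hpsi).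
case: e => es ek; subst s' k'.
have := wgraph_Z Nv hpsi (cplx (gam s l * gam s l') * '[ub s k, ub s k])
  (EE_th hpsi hinv hg t0 a0 Tg pd ad Sg psiE s l' l (m xi) (m' xi)).
congr (wgraph _ _ _ _); rewrite (hvec_dot hm' hm) th_dot; last exact: ub_Kr.
have [e|ne] := eqVneq l' l; last by have [o _ _] := hg s; rewrite o // !(mul0r, mulr0).
subst l'; have -> : Fq s l = gam s l * gam s l * (a s l / t s l).
  have p : 0 <= Ch s / t s l by rewrite divr_ge0 // ltW // Ch_gt0.
  by rewrite -expr2 /gam sqr_sqrtr // /Fq; field; rewrite gt_eqF.
rewrite !cplxM; ring.
Qed.

Section Family.
Variables (d : nat) (s : 'I_d -> gI G) (k l : 'I_d -> nat) (m : 'I_d -> (H -> H)) (q : 'I_d -> R).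
Hypothesis hm : forall p, homog (m p) (q p).
Let el p : H ⊗ K := hvec (m p) (q p) ⊗v th (g (s p) (l p)) (ub (s p) (k p)).

Let Bp p : K -> K ⊗ K := fun w => ampl (adj (th (g (s p) (l p)))) K (Z (m p xi ⊗v w)).
Let bB p : bd (Bp p).
Proof.
have bt : bd (ampl (adj (th (g (s p) (l p)))) K).
  by apply: bd_tensor => //; exact: bd_adj.
exact: (bd_comp bt (bd_Zl (m p xi))).
Qed.

Let Cop : K -> K ⊗ (K ⊗ K) := fun w => \sum_p cplx (gam (s p) (l p)) *: (ub (s p) (k p) ⊗v Bp p w).
Let bC : bd Cop.
Proof.
have -> : Cop = \sum_p cplx (gam (s p) (l p)) *: ((fun x : K ⊗ K => ub (s p) (k p) ⊗v x) \o Bp p).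
  by apply: funext => w; rewrite /Cop fct_sumE.
by apply: bd_sum => p _; apply: bd_scale; apply: bd_comp => //; exact: bd_pr.
Qed.

Let Cdot w w' : '[Cop w, Cop w'] = \sum_p \sum_p' cplx (gam (s p) (l p) * gam (s p') (l p')) *
  '[ub (s p) (k p), ub (s p') (k p')] * '[Bp p w, Bp p' w'] :> C.
Proof.
rewrite dot_suml; apply: eq_bigr => p _; rewrite dot_sumr; apply: eq_bigr => p' _.
by rewrite dotZl dotZr cplx_conj pure_dot cplxM; ring.
Qed.

Let CC : adj Cop \o Cop = \sum_p \sum_p' (cplx (gam (s p) (l p) * gam (s p') (l p')) *
    '[ub (s p) (k p), ub (s p') (k p')]) *:
  EE (th (g (s p') (l p')) \o adj (th (g (s p) (l p)))) (m p xi) (m p' xi).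
Proof.
apply: op_ext => w w'; rewrite /= adjl // Cdot fct_sumE dot_suml; apply: eq_bigr => p _.
rewrite fct_sumE dot_suml; apply: eq_bigr => p' _; rewrite [RHS]dotZl; congr (_ * _).
have bx : bd (th (g (s p') (l p')) \o adj (th (g (s p) (l p)))) by apply: bd_comp => //; exact: bd_adj.
have ba : bd (adj (th (g (s p) (l p)))) by exact: bd_adj.
have ba' : bd (adj (th (g (s p') (l p')))) by exact: bd_adj.
rewrite EE_form // /Bp.
have -> : ampl (th (g (s p') (l p')) \o adj (th (g (s p) (l p)))) K =
    ampl (th (g (s p') (l p'))) K \o ampl (adj (th (g (s p) (l p)))) K.
  by rewrite tensor_comp.
rewrite /= (adjr _ _ (bd_tensor (th_b _) (bd_id K))) (adj_tensor (th_b _) (bd_id K)) adj_idfun.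
by [].
Qed.

(** The value of psi at Cop^* Cop is computed exactly by [EE_th] and is the right-hand side;
    [psi_ge] bounds it below by a sum that [pairing] turns into the left-hand side. In effect Z^* (F
    ⊗ 1) Z <= 1 ⊗ F on finite sums, F being diagonal with eigenvalues [Fq]. *)
Lemma star rs n : uniq rs ->
  \sum_(r <- rs) \sum_(j < n) cplx (Fq r j) *
     '[ampl (adj (th (g r j))) K (Z (\sum_p el p)),
       ampl (adj (th (g r j))) K (Z (\sum_p el p))] <=
  '[\sum_p cplx (Fq (s p) (l p)) *: el p, \sum_p el p] :> C.
Proof.
move=> urs; have Nx : Nhat (adj Cop \o Cop).
  rewrite CC; apply: (@big_ind _ (fun x : K -> K => Nhat x)) => [|x y hx hy|p _]; first exact: Nhat_0.
    exact: (QD Nv hx hy).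
  apply: (@big_ind _ (fun x : K -> K => Nhat x)) => [|x y hx hy|p' _]; first exact: Nhat_0.
    exact: (QD Nv hx hy).
  apply: (QZ Nv); apply: EE_N; apply: bd_comp => //; exact: bd_adj.
have Px : pos (adj Cop \o Cop).
  split; first by apply: bd_comp => //; exact: bd_adj.
  by move=> w /=; rewrite adjl // dot_ge0.
have W : wg (adj Cop \o Cop) '[\sum_p cplx (Fq (s p) (l p)) *: el p, \sum_p el p].
  rewrite CC dot_suml exchange_big /=.
  have -> : \sum_p '[cplx (Fq (s p) (l p)) *: el p, \sum_p0 el p0] =
    \sum_p \sum_p' cplx (Fq (s p) (l p)) * ('[hvec (m p) (q p), hvec (m p') (q p')] *
      '[th (g (s p) (l p)) (ub (s p) (k p)), th (g (s p') (l p')) (ub (s p') (k p'))]) :> C.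
    by apply: eq_bigr => p _; rewrite dot_sumr; apply: eq_bigr => p' _; rewrite dotZl pure_dot.
  apply: (wgraph_sum Nv hpsi) => p _; apply: (wgraph_sum Nv hpsi) => p' _.
  exact: wg_term.
have [Fx ->] := wgraph_pos Nv hpsi (conj Nx Px) W.
have le1 : (psi (adj Cop \o Cop) <= (F psi (adj Cop \o Cop))%:E)%E by rewrite (Fin_fE hpsi Fx).
have := @psi_ge g t a hg t0 a0 Tg delta pd ad Sg psi psiE _ Cop _ rs n bC Nx le1 urs.
rewrite -cplx_le; apply: le_trans; rewrite le_eqVlt; apply/orP; left; apply/eqP.
rewrite cplx_sum; apply: eq_bigr => r _; rewrite cplx_sum; apply: eq_bigr => j _.
have bk : bd (adj (th (g r j))) by exact: bd_adj.
have bt : bd (ampl (adj (th (g r j))) K) by exact: bd_tensor.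
have e1 : ampl (adj (th (g r j))) K (Z (\sum_p el p)) =
    \sum_p YY r j (s p) (k p) (l p) (m p) (q p).
  by rewrite (lop_sum bZ) (lop_sum bt).
rewrite cplxM nrm2E Cdot e1 dot_sumr.
have -> : Fq r j = a r j / t r j * (Ch r / t r j) by rewrite /Fq; field; rewrite gt_eqF.
rewrite cplxM -mulrA; congr (_ * _); rewrite mulr_sumr; apply: eq_bigr => p _.
rewrite dot_suml mulr_sumr; apply: eq_bigr => p' _.
exact/esym/pairing.
Qed.

End Family.

Local Notation Rq r j := (Fq r j / (1 + Fq r j)).

Let Fq0 r j : 0 < Fq r j. Proof. exact: Fq_gt0. Qed.

Lemma hvecZ (c : R) m q : M m -> hvec (cplx c *: m) q = cplx c *: hvec m q.
Proof.
move=> Mm; have bm := Mb Mm; rewrite /hvec adj_scale // cplx_conj.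
by rewrite (_ : (cplx c *: adj m) xi = cplx c *: adj m xi) // !scalerA mulrC.
Qed.

Lemma kap_total r v : Kr r v -> (forall k, '[v, kap (g r k)] = 0) -> v = 0.
Proof.
move=> kv h; have [i [bi Ii ii ig]] := kap_iso r; have [_ _ gd] := hg r.
rewrite -(ii v kv); suff -> : adj i v = 0 by exact: lop0.
apply: (dense_span_ext0 gd) => _ [n _ <-].
by rewrite -(adjr _ _ bi) ig dotZl dotC h conjC0 mulr0.
Qed.

Lemma nkl_inj z : (forall r i j, nkl r i j z = 0) -> z = 0.
Proof.
move=> h; have [r _] := exists_block; have [v v0] := Hr_neq0 r.
have [go gu gd] := hg r; have [j gj] : exists j, g r j != 0.
  apply: contrapT => n; move/eqP: v0; apply; apply: (dense_span_ext0 gd) => _ [j _ <-].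
  by have [->|e] := eqVneq (g r j) 0; [rewrite dot0l|case: n; exists j].
have Z0 : Z (z ⊗v th (g r j) (uu r)) = 0.
  apply: tdot_ext => b w; rewrite dot0l -ssE x_th //.
  have -> : pi r (ss z b) (g r j) = 0; last by rewrite (lop0 (bd_th_l r (uu r))) dot0l.
  apply: (dense_span_ext0 gd) => _ [i _ <-]; rewrite dotC.
  by have := nn_th (g r i) (g r j) (uu r) z b (Kr_uu r); rewrite uu1 mulr1 => <-; rewrite -/(nkl r i j) h dot0l conjC0.
have := un_dot unZ (z ⊗v th (g r j) (uu r)) (z ⊗v th (g r j) (uu r)).
rewrite Z0 dot0l pure_dot th_dot ?uu1 ?mulr1; last exact: Kr_uu.
move/esym/eqP; rewrite mulf_eq0 => /orP[/eqP/dot_eq0//|/eqP/dot_eq0 e].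
by rewrite e eqxx in gj.
Qed.

(** Such a z is orthogonal to n^* n' xi for all coefficients n, n' of the form [nkl], whose
    quotients are homogeneous. The vectors n' xi are total, so n z = 0 for every n, and unitarity of
    Z gives z = 0. *)
Lemma hvec_total z : (forall m q, homog m q -> '[hvec m q, z] = 0) -> z = 0.
Proof.
move=> h; apply: nkl_inj => r i j; apply: (th_orth_total hg (u := fun s k => kap (g s k))) => [s v kv hv|s l k].
  exact: (kap_total kv).
rewrite th_kap -/(nkl s k l) (adjr _ _ (bd_nn _ _)).
have := h _ _ (homog_nkl hf hl hr t0 Tg r s i j k l 1).
rewrite /hvec scale1r dotZl => /eqP; rewrite mulf_eq0 gt_eqF ?cplx_gt0 ?invr_gt0 ?sqrtr_gt0 ?lam_gt0 //=; last first.
  by apply: divr_gt0; apply: lam_gt0.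
move/eqP; rewrite adjl //; last by apply: bd_comp; [apply: bd_adj|]; exact: bd_nn.
Qed.

Lemma el_total : dense (span [set z : H ⊗ K | exists s k l m q,
  homog m q /\ z = hvec m q ⊗v th (g s l) (ub s k)]).
Proof.
have := @dense_pure R tens H K [set x | exists m q, homog m q /\ x = hvec m q]
  [set x | exists s k l, x = th (g s l) (ub s k)].
move=> D; apply: dense_sub (D _ _) => [z|z hz|z hz].
- apply: (span_ind (Q := span _)) => [|c _ u [x [y [[m [q [hm ->]]] [s [k [l ->]]] ->]]] hu]; first exact: span0.
  by apply: spanD => //; apply: spanZ; apply: span_gen; exists s, k, l, m, q.
- by apply: hvec_total => m q hm; apply: hz; exists m, q.
apply: (th_orth_total hg (u := @ub)) => [s v kv hv|s l k]; first exact: ub_total kv hv.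
by apply: hz; exists s, k, l.
Qed.

(** The difference of the two sides is |F x - y|^2 / (1 + F). *)
Lemma weighted_parallelogram (L : hilbert R) (x y : L) (F : R) : 0 < F ->
  cplx (F / (1 + F)) * '[x + y, x + y] <= cplx F * '[x, x] + cplx 1 * '[y, y] :> C.
Proof.
move=> F0; have p : 0 < 1 + F by rewrite addr_gt0.
have p' : 1 + cplx F != 0 :> C by rewrite -cplx1 -cplxD gt_eqF // cplx_gt0.
rewrite -subr_ge0.
have -> : cplx F * '[x, x] + cplx 1 * '[y, y] - cplx (F / (1 + F)) * '[x + y, x + y] =
    cplx (1 + F)^-1 * '[cplx F *: x - y, cplx F *: x - y] :> C.
  rewrite !dotDl !dotDr !dotNl !dotNr !dotZl !dotZr cplx_conj cplxM cplxV cplxD cplx1.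
  by field.
by rewrite mulr_ge0 // cplx_ge0 invr_ge0 ltW.
Qed.

Section SquareRoot.
Variable y : K -> K.
Hypotheses (yN : Nhat y) (ya : adj y = y)
  (yth : forall r j w, y (th (g r j) w) = cplx (Num.sqrt (Rq r j)) *: th (g r j) w).
Local Notation Rop := (y \o y).

Let Rq_ge0 r j : 0 <= Rq r j.
Proof. by have F0 := Fq_gt0 r j; rewrite divr_ge0 // ?addr_ge0 // ltW. Qed.

Let by_ : bd y. Proof. exact: Nhat_b. Qed.
Let bR : bd Rop. Proof. exact: bd_comp. Qed.

Lemma Rop_th r j w : Rop (th (g r j) w) = cplx (Rq r j) *: th (g r j) w.
Proof. by rewrite /= yth (lopZ by_) yth scalerA -cplxM -expr2 sqr_sqrtr. Qed.

Lemma pos_Rop_l (L : hilbert R) : pos (ampl Rop L).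
Proof.
have e : ampl Rop L = ampl y L \o ampl y L.
  by rewrite tensor_comp.
have bt : bd (ampl y L) by exact: bd_tensor.
split=> [|z]; first exact: bd_tensor.
by rewrite e /= (adjr _ _ bt) adj_tensor // ya adj_idfun.
Qed.

Lemma pos_Rop_r (L : hilbert R) : pos (ampr L Rop).
Proof.
have e : ampr L Rop = ampr L y \o ampr L y.
  by rewrite tensor_comp.
have bt : bd (ampr L y) by exact: bd_tensor.
split=> [|z]; first exact: bd_tensor.
by rewrite e /= (adjr _ _ bt) adj_tensor // ya adj_idfun.
Qed.

(** Split z = z1 + z2 with z1 = (1 + F)^-1 z and z2 = R z. [star] at z1 and Bessel's inequality at
    z2 add up to <R z, z> on the right, and on the left [weighted_parallelogram] recovers the form
    of R in every component. *)
Lemma ineq_finite rs n z : uniq rs ->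
  span [set z : H ⊗ K | exists s k l m q, homog m q /\ z = hvec m q ⊗v th (g s l) (ub s k)] z ->
  '[ampl (SJ g (fun r j => Rq r j) rs n) K (Z z), Z z] <=
  '[ampr H Rop z, z] :> C.
Proof.
move=> urs hz; have [d [s [k [l [m [q [hm ->]]]]]]] : exists d (s : 'I_d -> gI G) (k l : 'I_d -> nat) m q,
    (forall p, homog (m p) (q p)) /\ z = \sum_p hvec (m p) (q p) ⊗v th (g (s p) (l p)) (ub (s p) (k p)).
  have [d [c [v [hv ->]]]] := hz.
  have /choice[s /choice[k /choice[l /choice[m /choice[q hq]]]]] := hv.
  (* [hvec] is conjugate linear in m, so coefficients are absorbed conjugated. *)
  exists d, s, k, l, (fun p => (c p)^* *: m p), q; split=> [p|].
    by have [hm _] := hq p; exact: homog_scale.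
  apply: eq_bigr => p _; have [[Mm _ _] ->] := hq p; rewrite -pureZl; congr (_ ⊗v _).
  rewrite /hvec adj_scale ?conjCK; last exact: Mb.
  by rewrite (_ : (c p *: adj (m p)) xi = c p *: adj (m p) xi) // !scalerA mulrC.
have F0 p : 0 < Fq (s p) (l p) by exact: Fq_gt0.
have F1 p : 1 + Fq (s p) (l p) != 0 by rewrite gt_eqF // addr_gt0.
pose m1 p := cplx (1 + Fq (s p) (l p))^-1 *: m p.
have hm1 p : homog (m1 p) (q p) by exact: homog_scale.
have st := star s k l hm1 n urs.
have e1 p : hvec (m1 p) (q p) = cplx (1 + Fq (s p) (l p))^-1 *: hvec (m p) (q p).
  by have [Mm _ _] := hm p; exact: hvecZ.
have e2 p (w : K) : hvec (m1 p) (q p) ⊗v w = cplx (1 + Fq (s p) (l p))^-1 *: (hvec (m p) (q p) ⊗v w).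
  by rewrite e1; exact: pureZl.
have bT : bd (ampr H Rop) by exact: bd_tensor.
set z0 := \sum_p _; set z1 := \sum_p hvec (m1 p) (q p) ⊗v th (g (s p) (l p)) (ub (s p) (k p)).
set z2 := tensor_op _ _ z0.
have z2E : z2 = \sum_p cplx (Rq (s p) (l p)) *: (hvec (m p) (q p) ⊗v th (g (s p) (l p)) (ub (s p) (k p))).
  rewrite /z2 (lop_sum bT); apply: eq_bigr => p _; rewrite tensorE //.
  have -> : Rop (th (g (s p) (l p)) (ub (s p) (k p))) = cplx (Rq (s p) (l p)) *: th (g (s p) (l p)) (ub (s p) (k p)).
    exact: Rop_th.
  by rewrite pureZr.
have zE : z0 = z1 + z2.
  rewrite z2E -big_split /=; apply: eq_bigr => p _; rewrite e2 -scalerDl -cplxD.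
  by rewrite (_ : (1 + Fq (s p) (l p))^-1 + Rq (s p) (l p) = 1) ?cplx1 ?scale1r //; field.
have FE : \sum_p cplx (Fq (s p) (l p)) *: (hvec (m1 p) (q p) ⊗v th (g (s p) (l p)) (ub (s p) (k p))) = z2.
  by rewrite z2E; apply: eq_bigr => p _; rewrite e2 scalerA -cplxM.
have st1 : '[ampl (SJ g (fun r j => Fq r j) rs n) K (Z z1), Z z1] <= '[z2, z1] :> C.
  by rewrite SJ_form -FE; exact: st.
have st2 : '[ampl (SJ g (fun _ _ => 1) rs n) K (Z z2), Z z2] <= '[z2, z2] :> C.
  by rewrite -(un_dot unZ z2 z2); exact: SJ_bessel.
have -> : '[z2, z0] = '[z2, z1] + '[z2, z2] by rewrite -dotDr -zE.
apply: le_trans (lerD st1 st2).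
rewrite !SJ_form -big_split /=; apply: ler_sum => r _; rewrite -big_split /=; apply: ler_sum => j _.
have bt : bd (ampl (adj (th (g r j))) K) by apply: bd_tensor => //; exact: bd_adj.
rewrite {1 2}zE (lopD bZ) (lopD bt); apply: weighted_parallelogram.
exact: Fq_gt0.
Qed.

Lemma dense_th_pure : dense (span [set z : K ⊗ K | exists r j w b, z = th (g r j) w ⊗v b]).
Proof.
have := @dense_pure R tens K K [set x | exists r j w, x = th (g r j) w] [set: K].
move=> D; apply: dense_sub (D _ _) => [z|z hz|z hz].
- apply: (span_ind (Q := span _)) => [|c _ u [x [b [[r [j [w ->]]] _ ->]]] hu]; first exact: span0.
  by apply: spanD => //; apply: spanZ; apply: span_gen; exists r, j, w, b.
- apply: (th_orth_total hg (u := @ub)) => [s v kv hv|s l k]; first exact: ub_total kv hv.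
  by apply: hz; exists s, l, (ub s k).
- by apply: dot_eq0; exact: hz.
Qed.

(** For a fixed truncation the inequality extends to all z by continuity; [form_le_approx] then
    removes the truncation, which is exact on suitable vectors of a dense subspace. *)
Lemma ineq z : '[ampl Rop K (Z z), Z z] <= '[ampr H Rop z, z] :> C.
Proof.
have bSJ rs n : bd (ampl (SJ g (fun r j => Rq r j) rs n) K).
  by apply: bd_tensor => //; exact: bd_SJ.
have pT := pos_Rop_r H; have bT := pos_bd pT.
have step rs n : uniq rs -> '[ampl (SJ g (fun r j => Rq r j) rs n) K (Z z), Z z] <=
    '[ampr H Rop z, z] :> C.
  move=> urs; set S := tensor_op (SJ _ _ _ _) _; pose A := adj (Z : H ⊗ K -> K ⊗ K) \o S \o Z.
  have bA : bd A by exact: (bd_comp (bd_comp (bd_adj bZ) (bSJ rs n)) bZ).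
  have AE u : '[A u, u] = '[S (Z u), Z u].
    by rewrite /A /=; exact: (adjl _ _ bZ).
  pose B := ampr H Rop - A; have bB : bd B by exact: bd_sub.
  have BE u : '[B u, u] = '[ampr H Rop u, u] - '[S (Z u), Z u].
    by rewrite -AE -dotBl.
  suff : 0 <= '[B z, z] by rewrite BE subr_ge0.
  apply: (form_ge0_dense bB el_total) => u hu; rewrite BE subr_ge0; exact: ineq_finite.
apply: (form_le_approx (pos_Rop_l K) dense_th_pure) => x hx.
have [rs [n [urs e]]] := SJ_reach hg bR Rop_th hx.
exists (ampl (SJ g (fun r j => Rq r j) rs n) K); split=> //.
  by apply: pos_SJ => r j; exact: Rq_ge0.
exact: step.
Qed.
End SquareRoot.

Lemma commuting_op : exists2 x : K -> K, bd x &
  [/\ forall r j w, x (th (g r j) w) = cplx (Rq r j) *: th (g r j) w, adj x = x &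
  forall z, ampl x K (Z z) = Z (ampr H x z)].
Proof.
have b r j : 0 <= Num.sqrt (Rq r j) <= 1.
  rewrite sqrtr_ge0 -sqrtr1 ler_wsqrtr // ler_pdivrMr ?addr_gt0 // mul1r lerDr //.
have [y [yN ya _ yth]] := block_op hg b; have by_ := Nhat_b yN.
exists (y \o y); first exact: bd_comp.
split=> [r j w||z]; last 1 first.
- apply: intertwine => // z'; exact: (ineq yN ya yth z').
- exact: (Rop_th yN yth).
- by rewrite adj_comp // ya.
Qed.

Lemma nkl_neq0 r l : g r l != 0 -> nkl r l l != 0.
Proof.
move=> gl; apply/eqP => e; have [_ gu _] := hg r.
have g1 : '[g r l, g r l] = 1 by case: (gu l) => // /dot_eq0 h; rewrite h eqxx in gl.
have : '[nkl r l l xi, nkl r l l xi] = cplx (t r l).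
  have -> : nkl r l l xi = th (g r l) (kap (g r l)) by rewrite th_kap.
  rewrite th_dot; last exact: kap_Kr.
  by rewrite kap_dot Tg dotZl g1 mul1r mulr1.
rewrite e zfunE dot0l => /esym/eqP.
by rewrite gt_eqF // cplx_gt0.
Qed.

(** If the eigenvalues differed, commutation of R with Z would kill the slices of Z between the two
    eigenvectors, hence all slices of DN (nkl r l l) at the unit vector th (g r l') uu. Left
    invariance would then give the square of the nonzero element nkl r l l weight 0. *)
Lemma Fq_block r l l' : g r l != 0 -> g r l' != 0 -> Fq r l = Fq r l'.
Proof.
move=> gl gl'; apply: contrapT => ne; have [x bx [xth xa xZ]] := commuting_op.
have Rne : Rq r l != Rq r l'.
  apply/eqP => e; apply: ne; have p s j : 1 + Fq s j != 0 by rewrite gt_eqF // addr_gt0.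
  move/eqP: e; rewrite eqr_div ?p // => /eqP e.
  by apply: (addrI (Fq r l * Fq r l')); move: e; rewrite !mulrDr !mulr1 addrC [X in _ = X]addrC [X in _ = X + _]mulrC.
have [_ gu _] := hg r.
have u1 : '[th (g r l') (uu r), th (g r l') (uu r)] = 1.
  rewrite th_dot; last exact: Kr_uu.
  by rewrite uu1 mulr1; case: (gu l') => // /dot_eq0 h; rewrite h eqxx in gl'.
have z0 k : vslice1 (DN (nkl r l l)) (onb H k) (th (g r l') (uu r)) = 0.
  rewrite nn_slice1; have -> : ss (onb H k) (th (g r l') (uu r)) (th (g r l) (uu r)) = 0.
    apply: dot_ext0 => w'; rewrite ssE; set q := '[_, _]; apply/eqP.
    have : cplx (Rq r l) * q = cplx (Rq r l') * q.
      rewrite /q -[RHS]mulr1; have bt : bd (ampl x K) by exact: bd_tensor.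
      have e1 : ampl x K (Z (onb H k ⊗v th (g r l) (uu r))) =
          cplx (Rq r l) *: Z (onb H k ⊗v th (g r l) (uu r)).
        by rewrite xZ (tensorE _ _ (bd_id H) bx) xth pureZr (lopZ bZ).
      rewrite -dotZl -e1 (adjr _ _ bt) (adj_tensor bx (bd_id K)) adj_idfun xa.
      by rewrite (tensorE _ _ bx (bd_id K)) xth pureZl dotZr cplx_conj mulr1.
    move/eqP; rewrite -subr_eq0 -mulrBl mulf_eq0 -cplxB => /orP[/eqP e|//].
    by move: Rne; rewrite -subr_eq0 => /eqP; case; apply: cplx_inj; rewrite e cplx0.
  by apply: op_ext => v v'; rewrite nnE pure0r (lop0 bZ) zfunE !dot0l.
have Nn := Nf_nkl hf hl hr t0 Tg r l l.
have [_ cv] := left_inv_series hf hl Nn u1.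
have F0 : F f (sq (nkl r l l)) = 0.
  apply: cplx_inj; apply: cvg_uniq cv _.
  have -> : (fun k => cplx (F f (sq (vslice1 (DN (nkl r l l)) (onb H k) (th (g r l') (uu r))))) : C) = fun=> 0.
    apply: funext => k; rewrite z0 (_ : sq (0 : H -> K) = 0) ?(Fin_0 Pvna hf).2 ?cplx0 //.
  have -> : series (fun=> 0 : C) = fun=> cplx 0.
    by apply: funext => n; rewrite seriesEord /= big1 // cplx0.
  exact: cvg_cst.
by have /eqP := nkl_neq0 gl; apply; exact: (S_eq0 hf Nn F0).
Qed.

(** With a = d^2 t^2 the resolvent of A is a left inverse of the bounded operator 1 + d^2 T^2. Every
    vector is thus in the range of the resolvent, which is the domain of A, and the value of A can
    be read off. *)
Lemma component_square r (A : uop (Hr r)) : positive_selfadjoint A ->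
  pi r (shift_inv delta 1) = shift_inv A 1 ->
  exists2 d : R, 0 < d & udom A = setT /\ uact A = cplx (d ^+ 2) *: (T r \o T r).
Proof.
move=> pA hA; have [go gu gd] := hg r; have bT := T_b r.
have [j0 gj0] : exists j, g r j != 0.
  have [v v0] := Hr_neq0 r.
  apply: contrapT => n; move/eqP: v0; apply; apply: (dense_span_ext0 gd) => _ [j _ <-].
  by have [->|e] := eqVneq (g r j) 0; [rewrite dot0l|case: n; exists j].
have C0 := Ch_gt0 r.
pose d := Num.sqrt (Fq r j0 / Ch r); have d2 : d ^+ 2 = Fq r j0 / Ch r.
  by rewrite /d sqr_sqrtr // divr_ge0 // ltW.
exists d; first by rewrite sqrtr_gt0 divr_gt0.
have aE n : g r n != 0 -> a r n = d ^+ 2 * t r n ^+ 2.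
  move=> gn; rewrite d2 (Fq_block gj0 gn) (_ : Fq r n = Ch r * a r n / t r n ^+ 2) //; field.
  by rewrite !gt_eqF.
pose X := (idfun : Hr r -> Hr r) + cplx (d ^+ 2) *: (T r \o T r).
have bX : bd X by apply: bd_add => //; apply: bd_scale; exact: bd_comp.
have bB : bd (shift_inv A 1) by apply: bd_shift_inv.
have XE v : X v = v + cplx (d ^+ 2) *: T r (T r v) by [].
have BX : shift_inv A 1 \o X = (fun v => v).
  apply: (op_ext_span (bd_comp bB bX) (bd_id _) gd) => _ [n _ <-].
  rewrite /= XE Tg (lopZ bT) Tg !scalerA -hA.
  have [->|gn] := eqVneq (g r n) 0; first by rewrite scaler0 addr0 hA lop0.
  rewrite -[X in X + _]scale1r -scalerDl hA (lopZ bB) -hA Sg (aE n gn) scalerA -!cplxM -cplx1 -cplxD -cplxM.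
  have -> : (1 + d ^+ 2 * t r n * t r n) / (1 + d ^+ 2 * t r n ^+ 2) = 1.
    have p : 0 < 1 + d ^+ 2 * t r n ^+ 2 by apply: ltr_wpDr => //; rewrite -exprMn; exact: sqr_ge0.
    by rewrite -[d ^+ 2 * t r n * t r n]mulrA -expr2 divff // gt_eqF.
  by rewrite cplx1 scale1r.
have key v : udom A v /\ uact A v = cplx (d ^+ 2) *: T r (T r v).
  have [u e] := shift_invP pA ltr01 (X v); have Bv : shift_inv A 1 (X v) = v := congr1 (@^~ v) BX.
  rewrite Bv in u e; split=> //; move: e; rewrite XE cplx1 scale1r; exact: addrI.
split; first by apply/seteqP; split=> // v _; have [] := key v.
by apply: funext => v; have [] := key v.
Qed.

End Star.

(** * The unimodular case assembled *)

Section Unimodular.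

(** Right invariance of g is stated at elements of finite weight, and c > 0 makes g finite wherever
    f is. *)
Lemma vector_invariant_multiple (f g : (K -> K) -> \bar R) (c : R) : 0 < c ->
  nsf_weight P f -> nsf_weight P g -> right_invariant P DP g ->
  (forall x, P x -> pos x -> f x = (c%:E * g x)%E) -> vector_invariant f.
Proof.
move=> c0 hf hg hr fg b x b1 Px px fx; have [Py py] : Qp P (vslice2 (DP x) b b) by exact: Qp_vslice2.
rewrite !fg //; congr (_ * _)%E; apply: (right_vector_invariant hr) => //.
have := fx; rewrite fg // => fx'; rewrite ltey; apply/eqP => e.
by move: fx'; rewrite e gt0_muley ?lte_fin // ltxx.
Qed.

Lemma unimodular_components (f psi : (K -> K) -> \bar R) (delta : uop K) (A : forall r, uop (Hr r)) :
  nsf_weight P f -> left_invariant P DP f -> vector_invariant f ->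
  nsf_weight Nhat psi -> coaction_invariant Wt Nhat (dual_algebra V) psi ->
  is_RN_derivative Nhat pi T psi delta -> block_components pi delta A ->
  exists d : gI G -> R, (forall r, 0 < d r) /\
    forall r, udom (A r) = setT /\ uact (A r) = cplx (d r ^+ 2) *: (T r \o T r).
Proof.
move=> hf hl hr hpsi hinv [pd _ ad cT psiE] hA.
have E r : exists gta : (nat -> Hr r) * (nat -> R) * (nat -> R), is_onb gta.1.1 /\
    forall n, [/\ 0 < gta.1.2 n, 0 < gta.2 n, T r (gta.1.1 n) = cplx (gta.1.2 n) *: gta.1.1 n &
      pi r (shift_inv delta 1) (gta.1.1 n) = cplx (1 + gta.2 n)^-1 *: gta.1.1 n].
  have [pA nA eA] := hA r; have [g [t [a [hg h]]]] := eigen_data pA nA eA (cT r).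
  by exists (g, t, a).
pose g r := (projT1 (cid (E r))).1.1; pose t r := (projT1 (cid (E r))).1.2.
pose a r := (projT1 (cid (E r))).2.
have hg r : is_onb (g r) by have [] := projT2 (cid (E r)).
have h r n : [/\ 0 < t r n, 0 < a r n, T r (g r n) = cplx (t r n) *: g r n &
    pi r (shift_inv delta 1) (g r n) = cplx (1 + a r n)^-1 *: g r n].
  by have [_ h] := projT2 (cid (E r)); exact: h.
have t0 r n : 0 < t r n by have [] := h r n.
have a0 r n : 0 < a r n by have [] := h r n.
have Tg r n : T r (g r n) = cplx (t r n) *: g r n by have [] := h r n.
have Sg r n : pi r (shift_inv delta 1) (g r n) = cplx (1 + a r n)^-1 *: g r n by have [] := h r n.
have D r : exists d : R, 0 < d /\ (udom (A r) = setT /\ uact (A r) = cplx (d ^+ 2) *: (T r \o T r)).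
  have [pA _ eA] := hA r.
  have [d d0 h'] := component_square hf hl hr hpsi hinv hg t0 a0 Tg pd ad Sg psiE pA eA.
  by exists d.
by have [d hd] := choice D; exists d; split=> r; have [] := hd r.
Qed.

End Unimodular.

End Galois.

Theorem proposition4p3 (R : realType) (tens : tensor_model R)
    (* the compact Woronowicz algebra (M, DM) on its GNS space *)
    (L2M : hilbert R) (M : set (L2M -> L2M))
    (DM : (L2M -> L2M) -> (L2M ⊗ L2M -> L2M ⊗ L2M)) (xi : L2M)
    (hM : compact_woronowicz_gns M DM xi)
    (* the right Galois co-object (N, DN) *)
    (L2N : hilbert R) (N : set (L2M -> L2N))
    (DN : (L2M -> L2N) -> (L2M ⊗ L2M -> L2N ⊗ L2N))
    (hN : right_galois_coobject M DM N DN)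
    (* the reflected von Neumann bialgebra (P, DP) and its invariant weights *)
    (P : set (L2N -> L2N)) (DP : (L2N -> L2N) -> (L2N ⊗ L2N -> L2N ⊗ L2N))
    (hP : P = vna_generated [set z | exists x y, [/\ N x, N y & z = x \o adj y]])
    (hDP : vn_bialgebra P DP)
    (hDPN : forall x y, N x -> N y -> DP (x \o adj y) = DN x \o adj (DN y))
    (phiP psiP : (L2N -> L2N) -> \bar R)
    (hphiP : nsf_weight P phiP) (hphiPinv : left_invariant P DP phiP)
    (hpsiP : nsf_weight P psiP) (hpsiPinv : right_invariant P DP psiP)
    (* the unitary V of (M, DM), and V~ and W~ of (N, DN) *)
    (V : L2M ⊗ L2M -> L2M ⊗ L2M) (hV : is_mult_unitaryV M DM xi V)
    (Vt : L2N ⊗ L2M -> L2N ⊗ L2N) (hVt : is_mult_unitaryV N DN xi Vt)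
    (Wt : L2N ⊗ L2N -> L2M ⊗ L2N) (hWt : is_mult_unitaryW N DN xi Wt)
    (* the blocks of N^ *)
    (I : choiceType) (Hr : I -> hilbert R)
    (pi : forall r, (L2N -> L2N) -> (Hr r -> Hr r)) (p : I -> (L2N -> L2N))
    (hpi : block_decomposition (dual_algebra Vt) pi p)
    (T : forall r, Hr r -> Hr r)
    (hT : state_densities xi Wt (dual_algebra Vt) pi p T)
    (* the invariant weight of N^, its Radon-Nikodym derivative, and A_r *)
    (psi : (L2N -> L2N) -> \bar R)
    (hpsi : nsf_weight (dual_algebra Vt) psi)
    (hpsiinv : coaction_invariant Wt (dual_algebra Vt) (dual_algebra V) psi)
    (delta : uop L2N)
    (hdelta : is_RN_derivative (dual_algebra Vt) pi T psi delta)
    (A : forall r, uop (Hr r)) (hA : block_components pi delta A) :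
  [/\ (* "compact" means that both invariant weights are finite *)
      compact_woronowicz P DP <-> (finite_weight P phiP /\ finite_weight P psiP),
      compact_woronowicz P DP ->
        (forall r, finite_dim (Hr r)) /\
        (forall (H : hilbert R) (G : L2M ⊗ H -> L2N ⊗ H),
           irreducible_corep N DN G -> finite_dim H),
      (exists (H : hilbert R) (G : L2M ⊗ H -> L2N ⊗ H),
         irreducible_corep N DN G /\ finite_dim H) ->
        (forall (H : hilbert R) (G : L2M ⊗ H -> L2N ⊗ H),
           irreducible_corep N DN G -> finite_dim H) /\
        compact_woronowicz P DP &
      (exists c : R, 0 < c /\
         forall x, P x -> positive_op x -> phiP x = (c%:E * psiP x)%E) ->
        exists d : I -> R, (forall r, 0 < d r) /\
          forall r, udom (A r) = setT /\
            uact (A r) = cplx (d r ^+ 2) *: (T r \o T r)].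
Proof.
pose G := GaloisData hM hN hP hDP hDPN hV hVt hWt hpi hT.
have blocks : compact_woronowicz P DP -> forall r, fin_basis (Hr r).
  move=> hc r; have fr := @compact_finite_right _ _ G _ hpsiP hpsiPinv hc.
  exact: (@finite_blocks _ _ G psiP r hpsiP hpsiPinv fr).
have irr : compact_woronowicz P DP -> forall (H : hilbert R) (g : L2M ⊗ H -> L2N ⊗ H),
    irreducible_corep N DN g -> finite_dim H.
  by move=> hc H g; apply: (@irreducible_dim _ _ G); exact: blocks.
split.
- split=> [hc|[fl fr]].
    split; [exact: (@compact_finite_left _ _ G)|exact: (@compact_finite_right _ _ G)].
  exact: (@compact_of_finite _ _ G phiP psiP).
- by move=> hc; split=> [r|]; [exact/fin_basis_dim/blocks|exact: irr].
- move=> [L [g [[cg nz _] fd]]].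
  have hc : compact_woronowicz P DP.
    apply: (@corep_compact _ _ G L g cg phiP psiP) => //; exact: finite_dim_basis.
  by split=> //; exact: irr.
move=> [c [c0 hc]].
(* Unimodularity enters only here: one weight, [phiP], now has both invariance properties. *)
have hv := @vector_invariant_multiple _ _ G phiP psiP c c0 hphiP hpsiP hpsiPinv hc.
exact: (@unimodular_components _ _ G phiP psi delta A hphiP hphiPinv hv hpsi hpsiinv hdelta hA).
Qed.
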